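(* Let $t_0\in I$, $(t_0,x_0)\in D$, and consider in $\mathcal T_n'(I)$ the initial value problem $$\dot x=f(t,x)+g(t,x)v,\qquad x(t_0-)=x_0,\qquad v=\dot u,\qquad( * )$$ under the assumptions on $D,f,g,u$ given in the context. Then there is a constant $h>0$ such that, with $I_h=(t_0-h,t_0+h)\subset I$, there exists a solution $x\in s\mathbb{BV}_n(I_h)$ of $( * )$ on $I_h$, which (i) is unique in the sense that it coincides with any other solution of $( * )$ on the common interval of definition in $I_h$, and (ii) depends continuously on $u|_{I_h}\in s\mathbb{BV}_n(I_h)$: if $u_k\to u|_{I_h}$ in $s\mathbb{BV}_n(I_h)$ and $x_k\in s\mathbb{BV}_n(I_h)$ is the solution on $I_h$ of $( * )$ with $u$ replaced by $u_k$, then $x_k\to x$ in $s\mathbb{BV}_n(I_h)$.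
   Context: Basic notation. $I=(a,b)$, $-\infty\le a<b\le\infty$, $J=[-\frac12,\frac12]$; $|\cdot|$ is the max-norm on $\mathbb R^n$ and $\mathbb R^{n\times n}$; $(\cdot,\cdot)$ is the inner product and $\langle\cdot,\cdot\rangle$ the componentwise product in $\mathbb R^n$. $\mathbb G(I)$: bounded functions $g:I\to\mathbb R$ having one-sided limits at every point (including $g(a+)$, $g(b-)$), functions with the same one-sided limits being identified; $\mathbb{BV}(I)\subset\mathbb G(I)$: those with $\mathrm{var}_I(g)=\sup\sum_k|g(\tau_{k+1}-)-g(\tau_k+)|<\infty$ (sup over finite partitions $a<\tau_1<\dots<\tau_m<b$); $\mathbb{CBV}(I)$: continuous elements of $\mathbb{BV}(I)$; $g_c$ is the continuous part of $g\in\mathbb{BV}$ (that is, $g$ minus its jump part); $\mathbb{AC}$, $\mathbb L$: absolutely continuous and Lebesgue summable functions; $\mathrm{loc}$ denotes local versions (the restriction to $(c,d)$ is in the space for each $[c,d]\subset I$); subscript $n$ denotes vector-valued versions, all operations componentwise. The same definitions are used on $J$ and on open subintervals of $I$. Dynamic functions. A dynamic function is a map $f$ assigning to each $t\in I$ a function $f(t)(\cdot):J\to\mathbb R$ (its dynamic value at $t$). If $f(t)(\cdot)$ is constant it is called an ordinary value, denoted $f(t)$; ordinary functions are dynamic functions with all values ordinary. $f(\tau+)=c$ means: for each $\varepsilon>0$ there is $\eta>0$ with $\sup_{t\in(\tau,\tau+\eta)}\sup_{s\in J}|f(t)(s)-c|\le\varepsilon$; similarly $f(\tau-)$. $f$ is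 continuous at $\tau$ if $f(\tau)(\cdot)$ is an ordinary value and $f(\tau)=f(\tau+)=f(\tau-)$; $T(f)$ is the set of points of discontinuity; $\sigma_\tau(f)=f(\tau+)-f(\tau-)$. $f\ge0$ means $f(t)(s)\ge 0$ for all $t,s$. $\mathrm{supp}(f)$ is the closure of the set of $t$ where $f(t)(\cdot)$ is not identically $0$. $d\mathbb G(I)$: dynamic functions $g$ with $g(t)(\cdot)\in\mathbb G(J)$ for all $t$ and with one-sided limits at all $t\in I$ and at $a+,b-$, with norm $\|g\|=\sup_{t,s}|g(t)(s)|$; such $g$ has at most countable $T(g)$, and its ordinary part $\hat g=\mathrm{ord}(g)\in\mathbb G(I)$ is $\hat g(t)=g(t)$ at points where the value is ordinary. $s\mathbb G(I)$: those $g\in d\mathbb G(I)$ with $g(t)(\cdot)\in\mathbb{AC}(J)$, $g(t)(-1/2)=g(t-)$, $g(t)(1/2)=g(t+)$ for all $t$. $s\mathbb{BV}(I)$: those $g\in s\mathbb G(I)$ with $\mathrm{ord}(g)\in\mathbb{BV}(I)$ and $\sum_{t\in T(g)}\mathrm{var}_{s\in J}(g(t)(s))<\infty$, with norm $\|g\|_{s\mathbb{BV}}=|g(a+)|+\|g_c\|_{\mathbb{CBV}}+\sum_{t\in T(g)}\mathrm{var}_{s\in J}(g(t)(s))$, where $g_c$ is the continuous part of $\mathrm{ord}(g)$ and $\|h\|_{\mathbb{CBV}}=|h(a+)|+\mathrm{var}_I(h)$. Distributions. $\mathcal T(I)$: elements $\varphi\in d\mathbb G(I)$ with compact support in $I$;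 $\varphi_k\to\varphi$ in $\mathcal T$ if $\varphi_k\to\varphi$ in $d\mathbb G$ and all supports lie in one compact subset of $I$. $\mathcal T'(I)$: continuous linear functionals on $\mathcal T(I)$; $\mathcal T_n'(I)$: vectors of such. Product with a dynamic function $g$ (locally in $d\mathbb G$): $(gf,\varphi)=(f,g\varphi)$. $f\in\mathbb L^{\mathrm{loc}}$ defines the regular distribution $(f,\varphi)=\int_I f\hat\varphi\,dt$, $\hat\varphi=\mathrm{ord}(\varphi)$. Delta-function with shape $\alpha\in\mathbb L(J)$, $\int_J\alpha=1$: $(\delta_\tau^\alpha,\varphi)=\int_J\alpha(s)\varphi(\tau)(s)\,ds$; for $\alpha=(\alpha^i)\in\mathbb L_n(J)$ with each $\int_J\alpha^i=1$, $\delta_\tau^\alpha=(\delta_\tau^{\alpha^i})_{i=1}^n$. Derivative of $g\in s\mathbb{BV}^{\mathrm{loc}}$: $(\dot g,\varphi)=\int_I\hat\varphi\,dg_c+\sum_{\tau\in T(g)}\int_J\varphi(\tau)(s)\frac{d}{ds}\bigl(g(\tau)(s)\bigr)ds$. Equation. $D\subset I\times\mathbb R^n$ is open. $f:D\to\mathbb R^n$ is Carathéodory (in the usual sense of ODE theory: measurable in $t$, continuous in $x$, bounded on compact sets by a summable function of $t$) and Lipschitz in $x$ with constant $K_f>0$ in $D$. $g$ is $\mathbb R^{n\times n}$-valued, its entries belong to $s\mathbb G$ in $t$ for fixed $x$ (so at each $(t,x)\in D$ it has a dynamic value $g(t,x)(s)$, $s\in J$), and it is Lipschitz in $x$ with constant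 $K_g>0$ in $D$; $\hat g(t,x)$ is its ordinary part in $t$. $v=\dot u$ with $u\in s\mathbb{BV}_n^{\mathrm{loc}}(I)$ such that $\sigma_\tau(u)\ne0$ for $\tau\in T(u)$, so that $v=\dot u_c+\sum_{\tau\in T(u)}\langle\sigma_\tau(u),\delta_\tau^{\alpha_\tau}\rangle$ with shapes $\alpha_\tau\in\mathbb L_n(J)$, $\langle\sigma_\tau(u),\alpha_\tau(s)\rangle=\frac{d}{ds}u(\tau)(s)$. For a dynamic function $x$, $f(t,x)$ is the regular distribution of $t\mapsto f(t,\hat x(t))$, and $g(t,x)$ is the dynamic function with dynamic values $s\mapsto g(t,x(t)(s))(s)$. A solution on an open interval $\Omega\subset I$ (with $t_0\in\Omega$) is $x\in s\mathbb{BV}_n^{\mathrm{loc}}(\Omega)$ with $(t,x(t)(s))\in D$ for $t\in\Omega$, $s\in J$, satisfying the equation in $\mathcal T_n'(\Omega)$ and the initial condition.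
   Formalization: Added: if u jumps at t_0, the fast-time problem dξ/ds = g(t_0,ξ)(s) d/ds u(t_0)(s), ξ(-1/2)=x_0, has an absolutely continuous solution on J inside D. Any solution forces this; without it existence fails, e.g. D=R×(-1,1), f=0, g=1, x_0=0, u jumping by 10 at t_0=0. *)

(* Defs.v *)
From HB Require Import structures.
From mathcomp Require Import all_boot all_order all_algebra.
From mathcomp Require Import all_classical all_reals all_analysis.

Set Implicit Arguments.
Unset Strict Implicit.
Unset Printing Implicit Defensive.

Import Order.TTheory GRing.Theory Num.Theory.
Import numFieldNormedType.Exports.

Local Open Scope classical_set_scope.
Local Open Scope ring_scope.

(* Intervals (a, b) have endpoints in \bar R.  A function on (a, b) is a total
   function on R and a dynamic function on (a, b) is a total function of
   (t, s); only the values at t in (a, b), s in J are ever used, so that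
   restricting to a subinterval is just changing the endpoints. *)

Section Defs.
Context {R : realType}.
Implicit Types (a b : \bar R) (h : R -> R) (A : set R) (F : set_system R).

Definition dyn : Type := R -> R -> R.
Implicit Types (g phi psi : dyn).

Definition oitv a b : set R := [set t | (a < t%:E)%E /\ (t%:E < b)%E].

Definition J : set R := `[- 2^-1, 2^-1].

(** Ordinary functions *)

(* t --> a+ and t --> b-, also for infinite endpoints. *)
Definition at_lb a : set_system R :=
  match a with r%:E => r^'+ | _ => ninfty_nbhs R end.
Definition at_ub b : set_system R :=
  match b with r%:E => r^'- | _ => pinfty_nbhs R end.

Definition rlim h (t : R) : R := lim (h x @[x --> t^'+]).
Definition llim h (t : R) : R := lim (h x @[x --> t^'-]).
Definition jump h (t : R) : R := rlim h t - llim h t.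

(* The identification of functions with the same one-sided limits is not
   built in; everything below that involves such functions depends on their
   one-sided limits only. *)
Definition regulated a b h : Prop :=
  [/\ exists M : R, forall t, oitv a b t -> `|h t| <= M,
      forall t, oitv a b t -> cvg (h x @[x --> t^'+]),
      forall t, oitv a b t -> cvg (h x @[x --> t^'-]),
      cvg (h x @[x --> at_lb a]) &
      cvg (h x @[x --> at_ub b])].

Definition var a b h : \bar R := ereal_sup
  [set (\sum_(k < (size p).-1) `|llim h p`_k.+1 - rlim h p`_k|)%:E
   | p in [set p : seq R |
             sorted <%R p /\ forall t, t \in p -> oitv a b t]].

Definition BV a b h : Prop := regulated a b h /\ (var a b h < +oo)%E.

(* Sum of an absolutely summable family. *)
Definition ssum A h : R :=
  fine (\esum_(t in A) (h^\+ t)%:E) - fine (\esum_(t in A) (h^\- t)%:E).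

(* Continuous part: h minus its jump part t |-> sum of the jumps in (a, t),
   in the representative that is continuous everywhere. *)
Definition cpart a h (t : R) : R := llim h t - ssum (oitv a t%:E) (jump h).

Definition CBV_norm a b h : \bar R :=
  (`|lim (h x @[x --> at_lb a])|%:E + var a b h)%E.

(* G(J) and variations over J: one-sided limits at the points of J only see
   the interior of J. *)
Definition regulatedJ h : Prop := regulated (- 2^-1)%:E (2^-1)%:E h.
Definition varJ h : \bar R := var (- 2^-1)%:E (2^-1)%:E h.

Definition ACJ h : Prop :=
  forall e : R, 0 < e -> exists2 d : R, 0 < d &
    forall p : seq (R * R),
      (forall I, I \in p -> [/\ J I.1, J I.2 & I.1 <= I.2]) ->
      pairwise (fun I I' : R * R => I.2 <= I'.1) p ->
      \sum_(I <- p) (I.2 - I.1) < d ->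
      \sum_(I <- p) `|h I.2 - h I.1| < e.

(** Dynamic functions *)

(* Ordinary part.  At the (at most countably many) points t where g t is not
   an ordinary value, the value g t 0 is an arbitrary choice that nothing
   below depends on. *)
Definition ord g : R -> R := fun t => g t 0.

(* With F = t^'+, t^'-, at_lb a or at_ub b:
   g(t+) = c, g(t-) = c, g(a+) = c or g(b-) = c. *)
Definition dlim F g (c : R) : Prop :=
  forall e : R, 0 < e ->
    \forall t \near F, forall s, J s -> `|g t s - c| <= e.

Definition dcontinuous_at g (t : R) : Prop := exists c : R,
  [/\ forall s, J s -> g t s = c, dlim t^'+ g c & dlim t^'- g c].

Definition Tdisc a b g : set R :=
  [set t | oitv a b t /\ ~ dcontinuous_at g t].

Definition dG a b g : Prop :=
  [/\ forall t, oitv a b t -> regulatedJ (g t),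
      forall t, oitv a b t -> exists c, dlim t^'+ g c,
      forall t, oitv a b t -> exists c, dlim t^'- g c,
      exists c, dlim (at_lb a) g c &
      exists c, dlim (at_ub b) g c].

Definition sG a b g : Prop :=
  [/\ dG a b g,
      forall t, oitv a b t -> ACJ (g t),
      forall t, oitv a b t -> dlim t^'- g (g t (- 2^-1)) &
      forall t, oitv a b t -> dlim t^'+ g (g t 2^-1)].

Definition sBV a b g : Prop :=
  [/\ sG a b g, BV a b (ord g) &
      (\esum_(t in Tdisc a b g) varJ (g t) < +oo)%E].

Definition sBVloc a b g : Prop :=
  forall c d : R, c < d -> `[c, d] `<=` oitv a b -> sBV c%:E d%:E g.

Definition sBV_norm a b g : \bar R :=
  (`|lim (ord g x @[x --> at_lb a])|%:E
   + CBV_norm a b (cpart a (ord g))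
   + \esum_(t in Tdisc a b g) varJ (g t))%E.

(** Test functions and distributions *)

Definition dsupp a b phi : set R :=
  closure [set t | oitv a b t /\ exists2 s, J s & phi t s != 0].

Definition test a b phi : Prop :=
  [/\ dG a b phi, compact (dsupp a b phi) & dsupp a b phi `<=` oitv a b].

Definition test_cvg a b (phi_ : nat -> dyn) phi : Prop :=
  [/\ forall k, test a b (phi_ k), test a b phi,
      forall e : R, 0 < e -> \forall k \near \oo,
        forall t s, oitv a b t -> J s -> `|phi_ k t s - phi t s| <= e &
      exists K : set R, [/\ compact K, K `<=` oitv a b &
        forall k, dsupp a b (phi_ k) `<=` K]].

Definition functional : Type := dyn -> R.

Definition distribution a b (L : functional) : Prop :=
  (forall (k : R) phi psi, test a b phi -> test a b psi ->
     L (fun t s => k * phi t s + psi t s) = k * L phi + L psi) /\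
  (forall (phi_ : nat -> dyn) phi, test_cvg a b phi_ phi ->
     L (phi_ k) @[k --> \oo] --> L phi).

Definition distribution_eq a b (L M : functional) : Prop :=
  [/\ distribution a b L, distribution a b M &
      forall phi, test a b phi -> L phi = M phi].

Definition dmul g (L : functional) : functional :=
  fun phi => L (fun t s => g t s * phi t s).

Definition regular a b (f : R -> R) : functional := fun phi =>
  \int[@completed_lebesgue_measure R]_(t in oitv a b) (f t * ord phi t).

(* Lebesgue-Stieltjes integral of ord phi with respect to the continuous part
   of ord g.  On an interval (c, d) around the support of phi, with [c, d]
   inside (a, b), the continuous part (based at c) is written as a difference
   of nondecreasing functions; v depends neither on (c, d) nor on p, q. *)
Definition is_cpart_integral a b g phi (v : R) : Prop :=
  exists (c d : R) (p q : cumulative R R),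
  [/\ c < d /\ `[c, d] `<=` oitv a b,
      dsupp a b phi `<=` `]c, d[,
      forall t : R, c < t < d -> cpart c%:E (ord g) t = p t - q t &
      v = \int[lebesgue_stieltjes_measure p]_(t in `]c, d[) ord phi t
        - \int[lebesgue_stieltjes_measure q]_(t in `]c, d[) ord phi t].

Definition cpart_integral a b g phi : R := xget 0 (is_cpart_integral a b g phi).

Definition ddot a b g : functional := fun phi =>
  cpart_integral a b g phi
  + ssum (Tdisc a b g)
      (fun t => \int[@lebesgue_measure R]_(s in J) (phi t s * derive1 (g t) s)).

(** Vector-valued versions *)

Section Vector.
Context {n : nat}.
Implicit Types (x u : R -> R -> 'cV[R]_n) (D : set (R * 'cV[R]_n)).
Implicit Types (f : R -> 'cV[R]_n -> 'cV[R]_n).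
(* g t y s is the dynamic value g(t, y)(s). *)
Implicit Types (G : R -> 'cV[R]_n -> R -> 'M[R]_n).

Definition coord x (i : 'I_n) : dyn := fun t s => x t s i 0.

Definition sBVn a b x : Prop := forall i, sBV a b (coord x i).
Definition sBVn_loc a b x : Prop := forall i, sBVloc a b (coord x i).

Definition sBVn_cvg a b (x_ : nat -> R -> R -> 'cV[R]_n) x : Prop :=
  forall i, sBV_norm a b (fun t s => coord (x_ k) i t s - coord x i t s)
    @[k --> \oo] --> 0%E.

Definition Tdiscn a b x : set R := [set t | exists i, Tdisc a b (coord x i) t].

Definition sigma x (t : R) : 'cV[R]_n := \col_i jump (ord (coord x i)) t.

(* caratheodory_type (wlength idfun)^* carries the sigma-algebra of Lebesgue
   measurable sets, on which completed_lebesgue_measure is defined. *)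
Definition caratheodory D f : Prop :=
  [/\ forall (y : 'cV[R]_n) i,
        measurable_fun
          ([set t | D (t, y)] : set (caratheodory_type (@wlength R idfun)^*%mu))
          (fun t => f t y i 0),
      forall t, {within [set y | D (t, y)], continuous (f t)} &
      forall K : set (R * 'cV[R]_n), compact K -> K `<=` D ->
        exists m : R -> R,
          (@completed_lebesgue_measure R).-integrable setT (EFin \o m) /\
          {ae @lebesgue_measure R, forall t y, K (t, y) -> `|f t y| <= m t}].

Definition rhs a b f G u x (i : 'I_n) : functional := fun phi =>
  regular a b (fun t => f t (x t 0) i 0) phi
  + \sum_j dmul (fun t s => G t (x t s) s i j) (ddot a b (coord u j)) phi.

Definition solution a b (t0 : R) (x0 : 'cV[R]_n) D f G u x : Prop :=
  [/\ oitv a b t0,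
      sBVn_loc a b x,
      forall t s, oitv a b t -> J s -> D (t, x t s),
      forall i, distribution_eq a b (ddot a b (coord x i)) (rhs a b f G u x i) &
      forall i, dlim t0^'- (coord x i) (x0 i 0)].

(* The jump of the state at t0 caused by u can be carried out inside D: the
   fast-time problem dxi/ds = G(t0, xi)(s) d/ds u(t0)(s), xi(-1/2) = x0, has
   an absolutely continuous solution on all of J.  For any solution x one
   necessarily has xi = x(t0). *)
Definition jump_in_domain (t0 : R) (x0 : 'cV[R]_n) D G u : Prop :=
  exists xi : R -> 'cV[R]_n,
    [/\ forall i, ACJ (fun s => xi s i 0),
        xi (- 2^-1) = x0,
        forall s, J s -> D (t0, xi s) &
        {ae @lebesgue_measure R, forall s, J s -> forall i,
           derive1 (fun r => xi r i 0) s =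
           \sum_j G t0 (xi s) s i j * derive1 (coord u j t0) s}].

End Vector.
End Defs.

(* Main.v *)
From HB Require Import structures.
Require Import Defs.
From mathcomp Require Import all_boot all_order all_algebra.
From mathcomp Require Import all_classical all_reals all_analysis.
From mathcomp Require Import measurable_realfun ring lra.
Set Implicit Arguments.
Unset Strict Implicit.
Unset Printing Implicit Defensive.
Import Order.TTheory GRing.Theory Num.Theory.
Import numFieldNormedType.Exports.
Local Open Scope classical_set_scope.
Local Open Scope ring_scope.

(**
A point of the state space of the problem is a pair (t, s): the time t and the
fast time s in J inside the jump at t.  Ordered lexicographically these pairs
form a line, and along this line every object of the statement becomes
continuous in the way that its classical counterpart is: an element of sBV is
a function whose increments are dominated by those of a nondecreasing
function w, its control ([control], with [sBV_control] and [sBV_of_control]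
for the two directions).  The proof is the Caratheodory existence argument
carried out on this line instead of on the time axis.

From distributions to an integral equation.  A test function times the
indicator of a lexicographic interval [P, Q) is again a test function, and
every test function is a uniform limit of combinations of such indicators and
of indicators of points (this is the compactness argument [approx_ldG]).  A
distribution that vanishes on points is therefore determined by its values
on the indicators of intervals ([distr_eq_test]), and if these are bounded by
the increments of w then it is a measure bounded by w ([distr_bound]).  The
derivative of g takes the value g Q - g P on the indicator of [P, Q)
([ddot_ind]); this needs the fundamental theorem of calculus for absolutely
continuous functions ([ACJ_density]) on the fibres and the theory of
Lebesgue-Stieltjes measures for the continuous part.  Both sides of the
equation vanish on points.  So x is a solution iff x Q - x P equals the right
hand side applied to the indicator of [P, Q), for all P <= Q
([solution_integral] and [integral_solution_solution]).

Estimates.  If x and z are two solutions, driven by u and v, and |z - x| <= B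
on [P, Q), then ([rhs_int_diff]) the increment of z - x over [P, Q) is at
most Kf B |Q - P| + Kg B (w Q - w P) + (M + Kg B) (nu Q - nu P), where w
controls u, nu controls v - u and M bounds g along x.  Where
Kf |Q - P| + Kg (w Q - w P) is at most 1/4 the bound B reproduces itself with
a factor 1/2 up to a multiple of the mass of nu ([halving]), hence it can be
dropped.  The jump of u at t0 may be large, but on the fibre over t0 the
control is continuous, so that the fibre is cut into finitely many pieces on
which it is small ([perturbed_fibre]); h is chosen so that nothing else is
large ([small_interval]).  The outcome [stability] gives uniqueness when v = u
and a Lipschitz estimate in general.  Inserted once more into the bound for the
increments it yields a control of z - x of small mass, which bounds the norm
of z - x in sBV ([solution_diff_norm]).

Existence.  At t0 the jump of the solution is given: it is the constant x0 if
u does not jump there and the curve provided by [jump_in_domain] if it does.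
Extended by constants to both sides ([jump_curve]) it has a compact graph,
around which there is a tube inside D ([compact_tube]).  On the interval found
by [small_interval] Picard's iteration stays in this tube, keeps its value on
the fibre over t0, and contracts by 1/2 in the sup norm
([picard_contraction]); all iterates share one control, and the limit
inherits it, so that the limit lies in sBV ([picard_solution]).
*)

(** * The lexicographic line *)

Section RealInduction.
Context {R : realType}.

(** Compactness of [c, d] in the form of an induction principle: an additive
property of intervals that holds for all short intervals on either side of
each point holds for [c, d]. *)
Lemma cousin (c d : R) (E : R -> R -> Prop) :
  c <= d ->
  (forall x y z, c <= x -> x <= y -> y <= z -> z <= d -> E x y -> E y z -> E x z) ->
  (forall x, c <= x <= d -> E x x) ->
  (forall x, c <= x < d -> exists2 e, 0 < e & forall y, x < y < x + e -> y <= d -> E x y) ->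
  (forall x, c < x <= d -> exists2 e, 0 < e & forall y, x - e < y < x -> c <= y -> E y x) ->
  E c d.
Proof.
move=> cd Ecat E0 Er El.
pose S := [set x | c <= x <= d /\ E c x].
have Sc : S c by split; [rewrite lexx cd | apply: E0; rewrite lexx cd].
have hS : has_sup S by split; [exists c | exists d => x [/andP[]]].
have cs : c <= sup S by apply: ub_le_sup => //; exact: hS.2.
have sd : sup S <= d by apply: ge_sup; [exists c | move=> x [/andP[]]].
have Ss : E c (sup S).
  have [->|nes] := eqVneq (sup S) c; first by apply: E0; rewrite lexx cd.
  have lcs : c < sup S by rewrite lt_neqAle eq_sym nes.
  have [e e0 He] : exists2 e, 0 < e & forall y, sup S - e < y < sup S -> c <= y -> E y (sup S).
    by apply: El; rewrite lcs sd.
  have [y [/andP[cy yd] Ey] ys] := sup_adherent e0 hS.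
  have := ub_le_sup hS.2 (conj (introT andP (conj cy yd)) Ey).
  rewrite le_eqVlt => /predU1P[<-//|ylt].
  apply: (Ecat _ y) => //; first exact: ltW.
  by apply: He; rewrite ?ys.
have [<-//|nsd] := eqVneq (sup S) d.
have lsd : sup S < d by rewrite lt_neqAle nsd.
have [e e0 He] := Er (sup S) (introT andP (conj cs lsd)).
pose y := Num.min (sup S + e / 2) d.
have sy : sup S < y by rewrite /y lt_min lsd andbT ltrDl divr_gt0.
have yd : y <= d by rewrite /y ge_min lexx orbT.
have Sy : S y.
  split; first by rewrite yd (le_trans cs (ltW sy)).
  apply: (Ecat _ (sup S)) => //; first exact: ltW.
  apply: He => //; rewrite sy /= /y gt_min; apply/orP; left.
  by rewrite ltrD2l; rewrite ltr_pdivrMr// ltr_pMr// ltr1n.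
by have := ub_le_sup hS.2 Sy; rewrite leNgt sy.
Qed.

End RealInduction.

Section Lexicographic.
Context {R : realType}.
Local Notation pt := (R *lexi[ring_display] R)%type.
Implicit Types (P Q S : pt) (phi psi : @dyn R).

Lemma ltptE P Q : (P < Q) = (P.1 < Q.1) || ((P.1 == Q.1) && (P.2 < Q.2)).
Proof.
by rewrite Order.ProdLexiOrder.ltEprodlexi; case: (ltgtP P.1 Q.1).
Qed.

Lemma leptE P Q : (P <= Q) = (P.1 < Q.1) || ((P.1 == Q.1) && (P.2 <= Q.2)).
Proof.
by rewrite Order.ProdLexiOrder.leEprodlexi; case: (ltgtP P.1 Q.1).
Qed.

Lemma lept1 P Q : P <= Q -> P.1 <= Q.1.
Proof. by rewrite leptE => /orP[/ltW//|/andP[/eqP->]]. Qed.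

(** The half-line below Q; indicators of lexicographic intervals are differences
of half-lines, which makes them additive in their end points without any
order hypothesis. *)
Definition below (Q : pt) : dyn := fun t s => (((t, s) : pt) < Q)%R%:R.

Definition ind (P Q : pt) : @dyn R := fun t s => below Q t s - below P t s.

Definition sing (P : pt) : @dyn R := fun t s => (((t, s) : pt) == P)%:R.

Lemma indE P Q t s : P <= Q -> ind P Q t s = (P <= ((t, s) : pt) < Q)%R%:R.
Proof.
move=> PQ; rewrite /ind /below leNgt.
case: ltP => [tQ|Qt]; case: ltP => [tP|Pt] /=; rewrite ?subr0 ?subrr//.
by have := lt_le_trans tP (le_trans PQ Qt); rewrite ltxx.
Qed.

Lemma ind_anti P Q t s : ind P Q t s = - ind Q P t s.
Proof. by rewrite /ind; ring. Qed.

Lemma norm_ind P Q t s : `|ind P Q t s| <= 1.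
Proof.
rewrite /ind /below; case: ltP => _; case: ltP => _;
  by rewrite ?subr0 ?sub0r ?subrr ?normrN ?normr1 ?normr0.
Qed.

Lemma ind0 P Q t s : t < P.1 \/ Q.1 < t -> P <= Q -> ind P Q t s = 0.
Proof.
move=> h PQ; rewrite indE//; case: h => h.
  by rewrite leptE /= ltNge (ltW h) /= gt_eqF.
by rewrite [X in _ && X]ltptE /= ltNge (ltW h) /= gt_eqF //= andbF.
Qed.

Lemma JE s : @J R s = (- 2^-1 <= s <= 2^-1).
Proof. by rewrite /J /= in_itv. Qed.

Lemma Jl : J (- 2^-1 : R). Proof. by rewrite JE lexx /=; lra. Qed.
Lemma Jr : J (2^-1 : R). Proof. by rewrite JE lexx andbT; lra. Qed.
Lemma J0 : J (0 : R). Proof. by rewrite JE; lra. Qed.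

(** The local version of [dG]: [test] asks for limits at the ends of the interval
too, but those are automatic for a function with compact support. *)
Definition ldG (a b : \bar R) phi :=
  [/\ forall t, oitv a b t -> regulatedJ (phi t),
      forall t, oitv a b t -> exists c, dlim t^'+ phi c &
      forall t, oitv a b t -> exists c, dlim t^'- phi c].

Lemma near_right_ex (t : R) (A : R -> Prop) : (\forall x \near t^'+, A x) ->
  exists2 e, 0 < e & forall x, t < x < t + e -> A x.
Proof.
move=> [e /= e0 He]; exists e => // x /andP[tx xe]; apply: He => //=.
by rewrite ltr0_norm ?subr_lt0// opprB ltrBlDl.
Qed.

Lemma near_left_ex (t : R) (A : R -> Prop) : (\forall x \near t^'-, A x) ->
  exists2 e, 0 < e & forall x, t - e < x < t -> A x.
Proof.
move=> [e /= e0 He]; exists e => // x /andP[tx xe]; apply: He => //=.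
by rewrite gtr0_norm ?subr_gt0// ltrBlDr -ltrBlDl.
Qed.

Lemma ex_near_right (t : R) (A : R -> Prop) e : 0 < e ->
  (forall x, t < x < t + e -> A x) -> (\forall x \near t^'+, A x).
Proof.
move=> e0 He; exists e => //= x /= xt tx; apply: He; rewrite tx /=.
by move: xt; rewrite ltr0_norm ?subr_lt0// opprB ltrBlDl.
Qed.

Lemma ex_near_left (t : R) (A : R -> Prop) e : 0 < e ->
  (forall x, t - e < x < t -> A x) -> (\forall x \near t^'-, A x).
Proof.
move=> e0 He; exists e => //= x /= xt tx; apply: He; rewrite tx andbT.
by move: xt; rewrite gtr0_norm ?subr_gt0// ltrBlDr -ltrBlDl.
Qed.

(** Step functions on the lexicographic line.  The value at the left end of a cell
is independent of the value inside, because a regulated function may have an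
isolated value anywhere. *)
Inductive lexstep (V : R -> Prop) : pt -> pt -> @dyn R -> Prop :=
| lexcell P Q c d : P < Q -> J P.2 -> J Q.2 -> V c -> V d ->
    lexstep V P Q (fun t s => c * ind P Q t s + (d - c) * sing P t s)
| lexcat P Q S psi1 psi2 : lexstep V P Q psi1 -> lexstep V Q S psi2 ->
    lexstep V P S (fun t s => psi1 t s + psi2 t s).

Lemma lexstep_lt V P Q psi : lexstep V P Q psi -> [/\ P < Q, J P.2 & J Q.2].
Proof.
elim=> // {}P {}Q S psi1 psi2 _ [PQ JP _] _ [QS _ JS]; split => //.
exact: lt_trans QS.
Qed.

Lemma lexstep0 V P Q psi t s : lexstep V P Q psi ->
  ~~ (P <= ((t, s) : pt) < Q) -> psi t s = 0.
Proof.
elim=> [{}P {}Q c d PQ _ _ _ _|{}P {}Q S psi1 psi2 s1 IH1 s2 IH2] nPQ.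
  rewrite (indE _ _ (ltW PQ)) (negbTE nPQ) mulr0 add0r /sing; case: eqP => [E|_]; last by rewrite mulr0.
  by move: nPQ; rewrite E lexx PQ.
have [PQ _ _] := lexstep_lt s1; have [QS _ _] := lexstep_lt s2.
rewrite IH1 ?IH2 ?addr0//.
  apply: contra nPQ => /andP[h1 ->]; rewrite andbT; exact: le_trans (ltW PQ) h1.
apply: contra nPQ => /andP[-> h1] /=; exact: lt_trans h1 QS.
Qed.

Definition approximable (V : R -> Prop) phi (e : R) P Q := P < Q ->
  exists2 psi, lexstep V P Q psi & forall t s, J s -> P <= ((t, s) : pt) < Q ->
    `|phi t s - psi t s| <= e.

Lemma approx_cat V phi e P Q S : P <= Q -> Q <= S ->
  approximable V phi e P Q -> approximable V phi e Q S -> approximable V phi e P S.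
Proof.
rewrite le_eqVlt => /predU1P[<-//|PQ]; rewrite le_eqVlt => /predU1P[<-//|QS].
move=> /(_ PQ)[psi1 s1 h1] /(_ QS)[psi2 s2 h2] PS.
exists (fun t s => psi1 t s + psi2 t s); first exact: lexcat s1 s2.
move=> t s Js /andP[Pts tsS]; case: (ltP ((t, s) : pt) Q) => hQ.
  rewrite (lexstep0 s2) ?addr0 ?h1 ?Pts//; by rewrite leNgt hQ.
rewrite (lexstep0 s1) ?add0r ?h2 ?hQ//; by rewrite ltNge hQ andbF.
Qed.

(** One cell suffices for a function that oscillates little on the open interval
(P, Q): its value at P is represented exactly, by the indicator of a point. *)
Lemma approx_cell V phi (e : R) P Q : J P.2 -> J Q.2 ->
  (forall t s, J s -> P <= ((t, s) : pt) < Q -> V (phi t s)) ->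
  (forall t s t' s', J s -> J s' -> P < ((t, s) : pt) < Q -> P < ((t', s') : pt) < Q ->
     `|phi t s - phi t' s'| <= e) -> 0 <= e ->
  approximable V phi e P Q.
Proof.
move=> JP JQ HV osc e0 PQ.
have [[t0 s0] /= J0' /andP[Pm mQ]] : exists2 M : pt, J M.2 & P < M < Q.
  move: PQ; rewrite ltptE => /orP[PQ|/andP[/eqP E PQ]].
    exists ((P.1 + Q.1) / 2, 0) => /=; first exact: J0.
    by rewrite !ltptE /=; apply/andP; split; apply/orP; left; lra.
  exists (P.1, (P.2 + Q.2) / 2) => /=.
    by move: JP JQ; rewrite !JE; lra.
  by rewrite !ltptE /= E ltxx eqxx /=; apply/andP; split; lra.
exists (fun t s => phi t0 s0 * ind P Q t s + (phi P.1 P.2 - phi t0 s0) * sing P t s).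
  apply: lexcell => //; apply: HV => //; rewrite ?mQ ?(ltW Pm)//.
  by case: (P) PQ => ? ? ->; rewrite lexx.
move=> t s Js /andP[Pts tsQ]; rewrite (indE _ _ (ltW PQ)) Pts tsQ mulr1 /sing.
case: eqP => [E|/eqP nE].
  by rewrite -E /= mulr1 (addrC (phi t0 s0)) subrK subrr normr0.
rewrite mulr0 addr0; apply: osc => //; rewrite ?Pm ?mQ// tsQ andbT.
by rewrite lt_neqAle eq_sym nE.
Qed.

Lemma regJ_right h s : @regulatedJ R h -> - 2^-1 <= s < 2^-1 ->
  cvg (h x @[x --> s^'+]).
Proof.
move=> [_ hr _ hl _] /andP[]; rewrite le_eqVlt => /predU1P[<-//|s1 s2].
by apply: hr; split; rewrite lte_fin.
Qed.

Lemma regJ_left h s : @regulatedJ R h -> - 2^-1 < s <= 2^-1 ->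
  cvg (h x @[x --> s^'-]).
Proof.
move=> [_ _ hr _ hl] /andP[s1]; rewrite le_eqVlt => /predU1P[->//|s2].
by apply: hr; split; rewrite lte_fin.
Qed.

Lemma between_fibre t s s' (M : pt) :
  ((t, s) : pt) < M -> M < ((t, s') : pt) -> M.1 = t /\ s < M.2 < s'.
Proof.
rewrite !ltptE /= => /orP[h1|/andP[/eqP <- h1]]; move=> /orP[h2|/andP[/eqP h2 h3]].
- by have := lt_trans h1 h2; rewrite ltxx.
- by move: h1; rewrite h2 ltxx.
- by move: h2; rewrite ltxx.
- by rewrite h1 h3.
Qed.

Lemma approx_fibre (V : R -> Prop) phi (e : R) t s s' :
  regulatedJ (phi t) -> 0 < e -> J s -> J s' -> s <= s' ->
  (forall r, J r -> s <= r < s' -> V (phi t r)) ->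
  approximable V phi e (t, s) (t, s').
Proof.
move=> rt e0 Js Js' ss' HV.
have ltt x y : (((t, x) : pt) < ((t, y) : pt)) = (x < y) by rewrite ltptE /= ltxx eqxx.
have lett x y : (((t, x) : pt) <= ((t, y) : pt)) = (x <= y) by rewrite leptE /= ltxx eqxx.
have e2 : 0 < e / 2 by rewrite divr_gt0.
have incl x y r q : s <= x -> y <= s' -> J r ->
    ((t, x) : pt) <= ((q, r) : pt) < ((t, y) : pt) -> V (phi q r).
  move=> sx ys Jr' /andP[h1 h2]; have [E|ne] := eqVneq ((q, r) : pt) (t, x).
    move: h1 h2; rewrite E ltt => _; case: E Jr' => -> -> Jr' xy.
    by apply: HV => //; rewrite sx (lt_le_trans xy ys).
  have h1' : ((t, x) : pt) < (q, r) by rewrite lt_neqAle eq_sym ne.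
  have [/= -> /andP[xr ry]] := between_fibre h1' h2.
  by apply: HV => //; rewrite (le_trans sx (ltW xr)) (lt_le_trans ry ys).
apply: (@cousin R s s' (fun x y => approximable V phi e (t, x) (t, y))) => //.
- move=> x y z _ xy yz _; apply: approx_cat; by rewrite lett.
- by move=> x _; rewrite /approximable ltxx.
- move=> x /andP[sx xs'].
  have /(regJ_right rt) /cvgrPdist_le/(_ _ e2)/near_right_ex[d d0 Hd] : - 2^-1 <= x < 2^-1.
    by move: Js Js'; rewrite !JE; lra.
  exists d => // y /andP[xy yd] ys'; apply: approx_cell => //=.
  + by move: Js Js'; rewrite !JE; lra.
  + by move: Js Js'; rewrite !JE; lra.
  + by move=> q r Jr' h; apply: incl h.
  + move=> q r q' r' _ _ /andP[h1 h2] /andP[h3 h4].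
    have [/= -> hr] := between_fibre h1 h2; have [/= -> hr'] := between_fibre h3 h4.
    have := Hd r; have := Hd r'; set l := lim _; move=> A1 A2.
    have {A1} : `|l - phi t r'| <= e / 2 by apply: A1; lra.
    have {A2} : `|l - phi t r| <= e / 2 by apply: A2; lra.
    rewrite !ler_norml; lra.
  + exact: ltW.
- move=> x /andP[sx xs'].
  have /(regJ_left rt) /cvgrPdist_le/(_ _ e2)/near_left_ex[d d0 Hd] : - 2^-1 < x <= 2^-1.
    by move: Js Js'; rewrite !JE; lra.
  exists d => // y /andP[xy yd] ys'; apply: approx_cell => //=.
  + by move: Js Js'; rewrite !JE; lra.
  + by move: Js Js'; rewrite !JE; lra.
  + by move=> q r Jr' h; apply: incl h.
  + move=> q r q' r' _ _ /andP[h1 h2] /andP[h3 h4].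
    have [/= -> hr] := between_fibre h1 h2; have [/= -> hr'] := between_fibre h3 h4.
    have := Hd r; have := Hd r'; set l := lim _; move=> A1 A2.
    have {A1} : `|l - phi t r'| <= e / 2 by apply: A1; lra.
    have {A2} : `|l - phi t r| <= e / 2 by apply: A2; lra.
    rewrite !ler_norml; lra.
  + exact: ltW.
Qed.

Lemma oitv_le (a b : \bar R) t t' t'' : oitv a b t -> oitv a b t'' ->
  t <= t' <= t'' -> oitv a b t'.
Proof.
move=> [h1 _] [_ h2] /andP[h3 h4]; split.
  by apply: lt_le_trans h1 _; rewrite lee_fin.
by apply: le_lt_trans h2; rewrite lee_fin.
Qed.

Lemma between_cols t t' (M : pt) : J M.2 ->
  ((t, 2^-1) : pt) < M -> M < ((t', - 2^-1) : pt) -> t < M.1 < t'.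
Proof.
rewrite JE !ltptE /= => /andP[J1 J2] /orP[-> /=|/andP[_ h1]]; last by move: h1; lra.
by move=> /orP[-> //|/andP[_ h1]]; move: h1; lra.
Qed.

(** The existence of one-sided limits along a fibre and of the limits at t+ and
t- says precisely that short intervals on either side of each point of the
lexicographic line are single cells; [cousin] is applied first in the fibres
over the two end points, then in time. *)
Lemma approx_ldG (a b : \bar R) (V : R -> Prop) phi (e : R) P Q :
  ldG a b phi -> 0 < e -> J P.2 -> J Q.2 -> oitv a b P.1 -> oitv a b Q.1 -> P <= Q ->
  (forall t s, J s -> P <= ((t, s) : pt) < Q -> V (phi t s)) ->
  approximable V phi e P Q.
Proof.
case: P Q => [t1 s1] [t2 s2] /= [r1 r2 r3] e0 J1 J2 o1 o2 PQ HV.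
have e2 : 0 < e / 2 by rewrite divr_gt0.
have := lept1 PQ; rewrite le_eqVlt /= => /predU1P[E|t12].
  move: PQ HV; rewrite -{t2 o2}E => PQ HV; apply: approx_fibre => //; first exact: r1.
    by move: PQ; rewrite leptE /= ltxx eqxx.
  move=> r Jr' h; apply: HV => //.
  by rewrite leptE ltptE /= ltxx eqxx.
have colle t x y : (((t, x) : pt) <= (t, y)) = (x <= y) by rewrite leptE /= ltxx eqxx.
have diagle t t' x y : t < t' -> ((t, x) : pt) <= (t', y) by rewrite leptE /= => ->.
have tops (t s : R) : J s -> ((t, s) : pt) <= (t, 2^-1) by rewrite colle JE => /andP[].
have bots (t s : R) : J s -> ((t, - 2^-1) : pt) <= (t, s) by rewrite colle JE => /andP[].
apply: (@approx_cat _ _ _ _ (t1, 2^-1)); [exact: tops|exact: diagle| |].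
  apply: approx_fibre => //; [exact: r1|exact: Jr|by move: J1; rewrite JE => /andP[]|].
  move=> r Jr' /andP[h1 h2]; apply: HV => //; rewrite colle h1 /=.
  by rewrite ltptE /= t12.
apply: (@approx_cat _ _ _ _ (t2, -2^-1)); [exact: diagle|exact: bots| |]; last first.
  apply: approx_fibre => //; [exact: r1|exact: Jl|by move: J2; rewrite JE => /andP[]|].
  move=> r Jr' /andP[h1 h2]; apply: HV => //; rewrite ltptE /= ltxx eqxx h2 /= andbT.
  exact: diagle.
have HV' t s : J s -> ((t1, 2^-1) : pt) <= ((t, s) : pt) < (t2, -2^-1) -> V (phi t s).
  move=> Js /andP[h1 h2]; apply: HV => //.
  by rewrite (le_trans _ h1) ?tops//= (lt_le_trans h2) ?bots.
have cell t t' l : t1 <= t -> t' <= t2 -> t < t' ->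
    (forall x s, J s -> t < x < t' -> `|phi x s - l| <= e / 2) ->
    approximable V phi e (t, 2^-1) (t', - 2^-1).
  move=> h1 h2 tt' H; apply: approx_cell => /=; [exact: Jr|exact: Jl| | |exact: ltW].
    move=> q r Jr' /andP[h3 h4]; apply: HV' => //.
    apply/andP; split.
      by apply: le_trans h3; move: h1; rewrite le_eqVlt => /predU1P[->|/diagle].
    by apply: (lt_le_trans h4); move: h2; rewrite le_eqVlt => /predU1P[->|/diagle].
  move=> q r q' r' Jr1 Jr2 /andP[h3 h4] /andP[h5 h6].
  have := H _ _ Jr1 (@between_cols t t' (q, r) Jr1 h3 h4); have := H _ _ Jr2 (@between_cols t t' (q', r') Jr2 h5 h6).
  rewrite !ler_norml; lra.
pose E x y := x < y -> approximable V phi e (x, 2^-1) (y, - 2^-1).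
suff : E t1 t2 by apply.
apply: cousin; first exact: ltW.
- move=> x y z t1x xy yz zt2 Exy Eyz xz.
  move: xy yz; rewrite le_eqVlt => /predU1P[xy|xy]; first by rewrite xy in xz *; move=> _; apply: Eyz.
  rewrite le_eqVlt => /predU1P[yz|yz]; first by rewrite -yz; apply: Exy.
  have Jlr : ((y, -2^-1) : pt) <= (y, 2^-1) by rewrite colle; lra.
  apply: (@approx_cat _ _ _ _ (y, - 2^-1)); [exact: diagle|exact: diagle|exact: Exy|].
  apply: (@approx_cat _ _ _ _ (y, 2^-1)); [exact: Jlr|exact: diagle| |exact: Eyz].
  apply: approx_fibre => //; [|exact: Jl|exact: Jr| lra|].
    by apply: r1; apply: oitv_le o1 o2 _; rewrite (ltW (le_lt_trans t1x xy)) (ltW (lt_le_trans yz zt2)).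
  move=> r Jr' _; apply: HV' => //; rewrite leptE ltptE /=.
  by rewrite (le_lt_trans t1x xy) (lt_le_trans yz zt2).
- by move=> x _; rewrite /E ltxx.
- move=> x /andP[h1 h2].
  have [|l /(_ _ e2) /near_right_ex[d d0 Hd]] := r2 x.
    by apply: oitv_le o1 o2 _; rewrite h1 ltW.
  exists d => // y /andP[xy yd] yt2 _; apply: (cell _ _ l) => // q r Jr' /andP[h3 h4].
  by apply: Hd => //; rewrite h3 (lt_trans h4).
- move=> x /andP[h1 h2].
  have [|l /(_ _ e2) /near_left_ex[d d0 Hd]] := r3 x.
    by apply: oitv_le o1 o2 _; rewrite h2 ltW.
  exists d => // y /andP[xy yd] yt2 _; apply: (cell _ _ l) => // q r Jr' /andP[h3 h4].
  by apply: Hd => //; rewrite h4 (lt_trans xy).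
Qed.

Lemma dlim_cst (F : set_system R) {FF : Filter F} (c : R) : dlim F (fun _ _ => c) c.
Proof. by move=> e e0; apply: nearW => t s _; rewrite subrr normr0 ltW. Qed.

Lemma dlimD (F : set_system R) {FF : Filter F} phi psi c d :
  dlim F phi c -> dlim F psi d -> dlim F (fun t s => phi t s + psi t s) (c + d).
Proof.
move=> h1 h2 e e0; have e2 : 0 < e / 2 by rewrite divr_gt0.
have A1 := h1 _ e2; have A2 := h2 _ e2; near=> t => s Js.
have : `|phi t s - c| <= e / 2 by move: s Js; near: t.
have : `|psi t s - d| <= e / 2 by move: s Js; near: t.
by rewrite !ler_norml; lra.
Unshelve. all: by end_near. Qed.

Lemma dlimM (F : set_system R) {FF : Filter F} phi psi c d :
  dlim F phi c -> dlim F psi d -> dlim F (fun t s => phi t s * psi t s) (c * d).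
Proof.
move=> h1 h2 e e0; pose e' := Num.min 1 (e / (`|c| + `|d| + 1)).
have k0 : 0 < `|c| + `|d| + 1 by rewrite ltr_wpDl// addr_ge0.
have e'0 : 0 < e' by rewrite lt_min ltr01 divr_gt0.
have e'1 : e' <= 1 by rewrite ge_min lexx.
have e'e : e' * (`|c| + `|d| + 1) <= e.
  by rewrite -ler_pdivlMr// ge_min lexx orbT.
have A1 := h1 _ e'0; have A2 := h2 _ e'0; near=> t => s Js.
have B1 : `|phi t s - c| <= e' by move: s Js; near: t.
have B2 : `|psi t s - d| <= e' by move: {B1} s Js; near: t.
have -> : phi t s * psi t s - c * d
   = (phi t s - c) * (psi t s - d) + (phi t s - c) * d + c * (psi t s - d) by ring.
apply: le_trans (ler_normD _ _) _; apply: le_trans (lerD (ler_normD _ _) (lexx _)) _.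
rewrite !normrM; apply: le_trans e'e.
have h3 : `|phi t s - c| * `|psi t s - d| <= e' * 1.
  by apply: ler_pM => //; exact: le_trans B2 e'1.
have h4 : `|phi t s - c| * `|d| <= e' * `|d| by apply: ler_wpM2r.
have h5 : `|c| * `|psi t s - d| <= `|c| * e' by apply: ler_wpM2l.
by lra.
Unshelve. all: by end_near. Qed.

Lemma dlim_eq (F : set_system R) {FF : Filter F} phi psi c :
  dlim F phi c -> (\forall t \near F, forall s, J s -> phi t s = psi t s) -> dlim F psi c.
Proof.
move=> h1 h2 e e0; have A := h1 _ e0; near=> t => s Js.
rewrite (_ : psi t s = phi t s); last by apply/esym; move: s Js; near: t.
by move: s Js; near: t.
Unshelve. all: by end_near. Qed.

#[local] Instance at_lb_filter (a : \bar R) : ProperFilter (at_lb a).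
Proof. by case: a => [r| |] /=; apply: _. Qed.

#[local] Instance at_ub_filter (a : \bar R) : ProperFilter (at_ub a).
Proof. by case: a => [r| |] /=; apply: _. Qed.

Lemma regJ_cst (c : R) : regulatedJ (fun _ => c).
Proof.
split.
- by exists `|c|.
- by move=> t _; exact: is_cvg_cst.
- by move=> t _; exact: is_cvg_cst.
- exact: is_cvg_cst.
- exact: is_cvg_cst.
Qed.

Lemma regulatedD a b (h k : R -> R) : regulated a b h -> regulated a b k ->
  regulated a b (fun s => h s + k s).
Proof.
move=> [[M HM] h1 h2 h3 h4] [[N HN] k1 k2 k3 k4]; split.
- by exists (M + N) => t ot; rewrite (le_trans (ler_normD _ _))// lerD ?HM ?HN.
- by move=> t ot; apply: is_cvgD; [exact: h1|exact: k1].
- by move=> t ot; apply: is_cvgD; [exact: h2|exact: k2].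
- exact: is_cvgD.
- exact: is_cvgD.
Qed.

Lemma regulatedM a b (h k : R -> R) : regulated a b h -> regulated a b k ->
  regulated a b (fun s => h s * k s).
Proof.
move=> [[M HM] h1 h2 h3 h4] [[N HN] k1 k2 k3 k4]; split.
- by exists (M * N) => t ot; rewrite normrM ler_pM ?HM ?HN.
- by move=> t ot; apply: is_cvgM; [exact: h1|exact: k1].
- by move=> t ot; apply: is_cvgM; [exact: h2|exact: k2].
- exact: is_cvgM.
- exact: is_cvgM.
Qed.

Lemma regJD (h k : R -> R) : regulatedJ h -> regulatedJ k ->
  regulatedJ (fun s => h s + k s).
Proof. exact: regulatedD. Qed.

Lemma regJM (h k : R -> R) : regulatedJ h -> regulatedJ k ->
  regulatedJ (fun s => h s * k s).
Proof. exact: regulatedM. Qed.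

Lemma regJ_eq (h k : R -> R) : regulatedJ h ->
  (forall s, J s -> h s = k s) -> regulatedJ k.
Proof.
move=> [[M HM] h1 h2 h3 h4] hk.
have oJ (s : R) : - 2^-1 < s -> s < 2^-1 -> J s by rewrite JE; lra.
have E (F : set_system R) (l : R) : h x @[x --> F] --> l -> Filter F -> (\forall x \near F, J x) -> cvg (k x @[x --> F]).
  move=> hl FF nJ; apply/cvg_ex; exists l; apply: cvg_trans hl.
  by apply: near_eq_cvg; near=> x; apply: hk; near: x.
have nr (s : R) : - 2^-1 <= s < 2^-1 -> \forall x \near s^'+, J x.
  move=> s1; apply: (@ex_near_right _ _ (2^-1 - s)); first by lra.
  by move=> x ?; apply: oJ; lra.
have nl (s : R) : - 2^-1 < s <= 2^-1 -> \forall x \near s^'-, J x.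
  move=> s1; apply: (@ex_near_left _ _ (s + 2^-1)); first by lra.
  by move=> x ?; apply: oJ; lra.
split.
- by exists M; move=> t ot; rewrite -hk ?HM//; case: ot => o1 o2; apply: oJ.
- by move=> t [p1 p2]; apply: E (h1 t (conj p1 p2)) _ _; apply: nr; move: p1 p2; rewrite !lte_fin; lra.
- by move=> t [p1 p2]; apply: E (h2 t (conj p1 p2)) _ _; apply: nl; move: p1 p2; rewrite !lte_fin; lra.
- by apply: E h3 _ _; apply: nr; lra.
- by apply: E h4 _ _; apply: nl; lra.
Unshelve. all: by end_near. Qed.

(** Local one-sided constancy replaces the computation of one-sided limits for
functions that take finitely many values. *)
Lemma regJ_pc (h : R -> R) (M : R) : (forall s, `|h s| <= M) ->
  (forall s : R, exists c e : R, 0 < e /\ forall x, s < x < s + e -> h x = c) ->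
  (forall s : R, exists c e : R, 0 < e /\ forall x, s - e < x < s -> h x = c) ->
  regulatedJ h.
Proof.
move=> HM Hr Hl.
have A (s : R) : cvg (h x @[x --> s^'+]).
  have [c [e [e0 He]]] := Hr s; apply/cvg_ex; exists c; apply: cvg_near_cst.
  exact: ex_near_right e0 He.
have B (s : R) : cvg (h x @[x --> s^'-]).
  have [c [e [e0 He]]] := Hl s; apply/cvg_ex; exists c; apply: cvg_near_cst.
  exact: ex_near_left e0 He.
split; [by exists M|by move=> *; exact: A|by move=> *; exact: B|exact: A|exact: B].
Qed.

Lemma ldG_cst a b c : ldG a b (fun _ _ => c).
Proof.
split; first by move=> *; exact: regJ_cst.
  by move=> t _; exists c; apply: dlim_cst.
by move=> t _; exists c; apply: dlim_cst.
Qed.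

Lemma ldGD a b phi psi : ldG a b phi -> ldG a b psi ->
  ldG a b (fun t s => phi t s + psi t s).
Proof.
move=> [h1 h2 h3] [k1 k2 k3]; split => t ot.
- by apply: regJD; [exact: h1|exact: k1].
- by have [c Hc] := h2 t ot; have [d Hd] := k2 t ot; exists (c + d); apply: dlimD.
- by have [c Hc] := h3 t ot; have [d Hd] := k3 t ot; exists (c + d); apply: dlimD.
Qed.

Lemma ldGM a b phi psi : ldG a b phi -> ldG a b psi ->
  ldG a b (fun t s => phi t s * psi t s).
Proof.
move=> [h1 h2 h3] [k1 k2 k3]; split => t ot.
- by apply: regJM; [exact: h1|exact: k1].
- by have [c Hc] := h2 t ot; have [d Hd] := k2 t ot; exists (c * d); apply: dlimM.
- by have [c Hc] := h3 t ot; have [d Hd] := k3 t ot; exists (c * d); apply: dlimM.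
Qed.

Lemma ldGZ a b k phi : ldG a b phi -> ldG a b (fun t s => k * phi t s).
Proof. by move=> h; apply: ldGM h; exact: ldG_cst. Qed.

Lemma ldGB a b phi psi : ldG a b phi -> ldG a b psi ->
  ldG a b (fun t s => phi t s - psi t s).
Proof.
move=> h k; have /(ldGD h) := ldGZ (-1) k.
by under eq_fun do under eq_fun do rewrite mulN1r.
Qed.

Lemma ldG_pc a b phi M : (forall t s, `|phi t s| <= M) ->
  (forall t s : R, exists c e : R, 0 < e /\ forall x, s < x < s + e -> phi t x = c) ->
  (forall t s : R, exists c e : R, 0 < e /\ forall x, s - e < x < s -> phi t x = c) ->
  (forall t : R, exists c e : R, 0 < e /\ forall x s, t < x < t + e -> phi x s = c) ->
  (forall t : R, exists c e : R, 0 < e /\ forall x s, t - e < x < t -> phi x s = c) ->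
  ldG a b phi.
Proof.
move=> HM h1 h2 h3 h4; split => t _.
- by apply: (regJ_pc (M := M)).
- have [c [e [e0 He]]] := h3 t; exists c; apply: dlim_eq (dlim_cst _) _.
  by apply: ex_near_right e0 _ => x hx s _; rewrite He.
- have [c [e [e0 He]]] := h4 t; exists c; apply: dlim_eq (dlim_cst _) _.
  by apply: ex_near_left e0 _ => x hx s _; rewrite He.
Qed.

Lemma ldG_below a b P : ldG a b (below P).
Proof.
have E t s : below P t s = ((t < P.1)%R || ((t == P.1) && (s < P.2)%R))%:R.
  by rewrite /below ltptE.
apply: (@ldG_pc _ _ _ 1).
- by move=> t s; rewrite /below; case: (_ < _); rewrite ?normr1 ?normr0.
- move=> t s; have [sP|Ps] := ltP s P.2.
    exists (below P t s), (P.2 - s); rewrite subr_gt0; split => // x /andP[h1 h2].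
    by rewrite !E sP (_ : x < P.2)//; lra.
  exists (below P t s), 1; split => // x /andP[h1 h2].
  by rewrite !E !(ltNge _ P.2) Ps (_ : P.2 <= x)//; lra.
- move=> t s; have [sP|Ps] := leP s P.2.
    exists (t <= P.1)%R%:R, 1; split => // x /andP[h1 h2].
    by rewrite E (_ : x < P.2) ?andbT ?[t <= _]le_eqVlt 1?orbC//; lra.
  exists (t < P.1)%R%:R, (s - P.2); rewrite subr_gt0; split => // x /andP[h1 h2].
  by rewrite E (_ : x < P.2 = false) ?andbF ?orbF//; apply/negbTE; rewrite -leNgt; lra.
- move=> t; have [tP|Pt] := ltP t P.1.
    exists 1, (P.1 - t); rewrite subr_gt0; split => // x s /andP[h1 h2].
    by rewrite E (_ : x < P.1)//; lra.
  exists 0, 1; split => // x s /andP[h1 h2].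
  have h : P.1 < x by lra.
  by rewrite E ltNge (ltW h) gt_eqF.
- move=> t; have [tP|Pt] := leP t P.1.
    exists 1, 1; split => // x s /andP[h1 h2].
    by rewrite E (_ : x < P.1)//; lra.
  exists 0, (t - P.1); rewrite subr_gt0; split => // x s /andP[h1 h2].
  have h : P.1 < x by lra.
  by rewrite E ltNge (ltW h) gt_eqF.
Qed.

Lemma ldG_ind a b P Q : ldG a b (ind P Q).
Proof. by apply: ldGB; exact: ldG_below. Qed.

Lemma ldG_sing a b P : ldG a b (sing P).
Proof.
have E t s : sing P t s = ((t == P.1) && (s == P.2))%:R.
  by case: (P).
apply: (@ldG_pc _ _ _ 1).
- by move=> t s; rewrite /sing; case: (_ == _); rewrite ?normr1 ?normr0.
- move=> t s; have [sP|Ps] := ltP s P.2.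
    exists 0, (P.2 - s); rewrite subr_gt0; split => // x /andP[h1 h2].
    by rewrite E (_ : x == P.2 = false) ?andbF// lt_eqF//; lra.
  exists 0, 1; split => // x /andP[h1 h2].
  by rewrite E (_ : x == P.2 = false) ?andbF// gt_eqF//; lra.
- move=> t s; have [sP|Ps] := leP s P.2.
    exists 0, 1; split => // x /andP[h1 h2].
    by rewrite E (_ : x == P.2 = false) ?andbF// lt_eqF//; lra.
  exists 0, (s - P.2); rewrite subr_gt0; split => // x /andP[h1 h2].
  by rewrite E (_ : x == P.2 = false) ?andbF// gt_eqF//; lra.
- move=> t; have [tP|Pt] := ltP t P.1.
    exists 0, (P.1 - t); rewrite subr_gt0; split => // x s /andP[h1 h2].
    by rewrite E (_ : x == P.1 = false)// lt_eqF//; lra.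
  exists 0, 1; split => // x s /andP[h1 h2].
  by rewrite E (_ : x == P.1 = false)// gt_eqF//; lra.
- move=> t; have [tP|Pt] := leP t P.1.
    exists 0, 1; split => // x s /andP[h1 h2].
    by rewrite E (_ : x == P.1 = false)// lt_eqF//; lra.
  exists 0, (t - P.1); rewrite subr_gt0; split => // x s /andP[h1 h2].
  by rewrite E (_ : x == P.1 = false)// gt_eqF//; lra.
Qed.

Definition suppin (a b : \bar R) (c d : R) phi :=
  forall t s, oitv a b t -> J s -> ~~ (c <= t <= d) -> phi t s = 0.

Lemma dsupp_suppin a b c d phi :
  suppin a b c d phi -> dsupp a b phi `<=` `[c, d].
Proof.
move=> h; rewrite /dsupp; have /closure_id -> : closed `[c, d] by exact: interval_closed.
apply: closure_subset => t [ot [s Js]]; apply: contraNP.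
by rewrite /= in_itv /= => /negP nt; rewrite h.
Qed.

Lemma suppin_dsupp a b c d phi :
  dsupp a b phi `<=` `[c, d] -> suppin a b c d phi.
Proof.
move=> h t s ot Js; apply: contraNeq => nz.
suff : `[c, d]%classic t by rewrite /= in_itv.
by apply: h; apply: subset_closure; split => //; exists s.
Qed.

Lemma suppinS a b c d c' d' phi : c' <= c -> d <= d' ->
  suppin a b c d phi -> suppin a b c' d' phi.
Proof.
move=> c'c dd' h t s ot Js nt; apply: h => //; apply: contra nt => /andP[h1 h2].
by rewrite (le_trans c'c) ?(le_trans h2).
Qed.

Lemma segment_oitv (a b : \bar R) (c d : R) : oitv a b c -> oitv a b d ->
  `[c, d] `<=` oitv a b.
Proof. by move=> oc od t /=; rewrite in_itv /= => tcd; exact: oitv_le oc od tcd. Qed.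

(** Beyond the segment [c, d] the function vanishes, so the limits at a and b
exist and the support is compact. *)
Lemma mk_test a b c d phi : ldG a b phi -> oitv a b c -> oitv a b d ->
  suppin a b c d phi -> test a b phi.
Proof.
move=> [h1 h2 h3] oc od hs; have hd := dsupp_suppin hs; split; last first.
- exact: subset_trans hd (segment_oitv oc od).
- apply: subclosed_compact hd; [exact: closed_closure|exact: segment_compact].
have nl : \forall t \near at_lb a, forall s, J s -> phi t s = 0.
  have : \forall t \near at_lb a, oitv a b t /\ t < c.
    case: (a) oc => [r| |] [] //=.
    - rewrite lte_fin => rc cb; apply: (@ex_near_right _ _ (c - r)); first by lra.
      move=> x /andP[rx xc]; split; last by lra.
      by split; rewrite ?lte_fin//; apply: lt_trans cb; rewrite lte_fin; lra.
    - move=> _ cb; exists c; split; [exact: num_real|move=> x xc; split => //; split; first exact: ltNyr].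
      by apply: lt_trans cb; rewrite lte_fin.
  apply: filterS => t [ot tc] s Js; apply: hs => //.
  by rewrite negb_and -ltNge tc.
have nr : \forall t \near at_ub b, forall s, J s -> phi t s = 0.
  have : \forall t \near at_ub b, oitv a b t /\ d < t.
    case: (b) od => [r| |] [] //=.
    - rewrite lte_fin => ad dr; apply: (@ex_near_left _ _ (r - d)); first by lra.
      move=> x /andP[rx xc]; split; last by lra.
      by split; rewrite ?lte_fin//; apply: (lt_trans ad); rewrite lte_fin; lra.
    - move=> ad _; exists d; split; [exact: num_real|move=> x xc; split => //; split; last exact: ltry].
      by apply: (lt_trans ad); rewrite lte_fin.
  apply: filterS => t [ot tc] s Js; apply: hs => //.
  by rewrite negb_and -!ltNge tc orbT.
split => //; exists 0; apply: dlim_eq (dlim_cst 0) _.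
  by apply: filterS nl => t h s Js; rewrite h.
by apply: filterS nr => t h s Js; rewrite h.
Qed.

(** A compact subset of the line sits between two of its points; this turns
compact supports into supports inside a segment. *)
Lemma compact_segment (K : set R) : compact K -> K !=set0 ->
  exists c d, [/\ K c, K d & K `<=` `[c, d]].
Proof.
move=> cK K0.
have [|c] := @compact_EVT_min R R id K K0 cK; first by apply: continuous_subspaceT => ?; exact: cvg_id.
rewrite inE => Kc hc.
have [|d] := @compact_EVT_max R R id K K0 cK; first by apply: continuous_subspaceT => ?; exact: cvg_id.
rewrite inE => Kd hd; exists c, d; split => // t Kt; rewrite /= in_itv /=.
by rewrite hc ?inE// hd ?inE.
Qed.

Lemma compact_oitv (a b : \bar R) t0 (K : set R) : oitv a b t0 -> compact K -> K `<=` oitv a b ->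
  exists c d, [/\ oitv a b c, oitv a b d, c <= d & K `<=` `[c, d]].
Proof.
move=> o0 cK Kab; have [K0|nK] := pselect (K !=set0); last first.
  exists t0, t0; split => // t Kt; exfalso; apply: nK; by exists t.
have [c [d [Kc Kd Kcd]]] := compact_segment cK K0.
exists c, d; split; [exact: Kab|exact: Kab| |exact: Kcd].
by have := Kcd _ Kc; rewrite /= in_itv /= => /andP[].
Qed.

Lemma test_suppin a b t0 phi : oitv a b t0 -> test a b phi ->
  ldG a b phi /\ exists c d, [/\ oitv a b c, oitv a b d, c <= d & suppin a b c d phi].
Proof.
move=> o0 [[h1 h2 h3 _ _] cphi sphi]; split; first by split.
have [c [d [oc od cd h]]] := compact_oitv o0 cphi sphi.
by exists c, d; split => //; exact: suppin_dsupp.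
Qed.

Lemma suppin_ind a b P Q : suppin a b (Num.min P.1 Q.1) (Num.max P.1 Q.1) (ind P Q).
Proof.
wlog PQ : P Q / P <= Q.
  move=> H; have [|/ltW QP] := leP P Q; first exact: H.
  by move=> t s ot Js; rewrite minC maxC => h; rewrite ind_anti (H _ _ QP)// oppr0.
move=> t s _ _; rewrite (min_idPl (lept1 PQ)) (max_idPr (lept1 PQ)) negb_and -!ltNge => h.
by apply: ind0 PQ; case/orP: h; [left|right].
Qed.

Lemma suppinM a b c d phi psi : suppin a b c d psi ->
  suppin a b c d (fun t s => phi t s * psi t s).
Proof. by move=> h t s ot Js nt; rewrite h ?mulr0. Qed.

Lemma oitv_min (a b : \bar R) (x y : R) : oitv a b x -> oitv a b y -> oitv a b (Num.min x y).
Proof. by move=> h1 h2; rewrite minEle; case: ifP. Qed.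

Lemma oitv_max (a b : \bar R) (x y : R) : oitv a b x -> oitv a b y -> oitv a b (Num.max x y).
Proof. by move=> h1 h2; rewrite maxEle; case: ifP. Qed.

Lemma test_ind a b phi P Q : ldG a b phi -> oitv a b P.1 -> oitv a b Q.1 ->
  test a b (fun t s => phi t s * ind P Q t s).
Proof.
move=> hphi oP oQ; apply: (mk_test (ldGM hphi (ldG_ind _ _ P Q)) (oitv_min oP oQ) (oitv_max oP oQ)).
by apply: suppinM; exact: suppin_ind.
Qed.

Lemma test_ind1 a b P Q : oitv a b P.1 -> oitv a b Q.1 -> test a b (ind P Q).
Proof.
move=> oP oQ; apply: (mk_test (ldG_ind _ _ P Q) (oitv_min oP oQ) (oitv_max oP oQ)).
exact: suppin_ind.
Qed.

Lemma test_sing a b P : oitv a b P.1 -> test a b (sing P).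
Proof.
move=> oP; apply: (mk_test (ldG_sing _ _ P) oP oP) => t s _ _.
by rewrite /sing; case: eqP => [<-|//]; rewrite /= lexx.
Qed.

Lemma testZD a b k phi psi : test a b phi -> test a b psi ->
  test a b (fun t s => k * phi t s + psi t s).
Proof.
move=> t1 t2; have [[t0 o0]|no] := pselect (exists t, oitv a b t); last first.
  have Z : dsupp a b (fun t s => k * phi t s + psi t s) = dsupp a b psi.
    rewrite /dsupp; congr closure; apply/seteqP; split => t [ot]; exfalso; apply: no; by exists t.
  split; [|by rewrite Z; case: t2|by rewrite Z; case: t2].
  case: t1 => -[_ _ _ [c1 h1] [c2 h2]] _ _; case: t2 => -[_ _ _ [d1 k1] [d2 k2]] _ _.
  split; try by move=> t ot; exfalso; apply: no; exists t.
    by exists (k * c1 + d1); apply: dlimD => //; apply: dlimM => //; exact: dlim_cst.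
  by exists (k * c2 + d2); apply: dlimD => //; apply: dlimM => //; exact: dlim_cst.
have [l1 [c1 [d1 [oc1 od1 cd1 s1]]]] := test_suppin o0 t1.
have [l2 [c2 [d2 [oc2 od2 cd2 s2]]]] := test_suppin o0 t2.
apply: (mk_test (ldGD (ldGZ k l1) l2) (oitv_min oc1 oc2) (oitv_max od1 od2)).
move=> t s ot Js nt; rewrite s1// ?s2// ?mulr0 ?addr0//.
  by apply: contra nt => /andP[x1 x2]; rewrite ge_min le_max x1 x2 !orbT.
by apply: contra nt => /andP[x1 x2]; rewrite ge_min le_max x1 x2.
Qed.

Section Distribution.
Variables (a b : \bar R) (L : @functional R).

Hypothesis dL : Defs.distribution a b L.

Lemma distr_cvg (phi_ : nat -> @dyn R) phi (c d : R) :
  oitv a b c -> oitv a b d ->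
  (forall k, ldG a b (phi_ k)) -> ldG a b phi ->
  (forall k, suppin a b c d (phi_ k)) -> suppin a b c d phi ->
  (forall e : R, 0 < e -> exists N : nat, forall k, (N <= k)%N ->
      forall t s, oitv a b t -> J s -> `|phi_ k t s - phi t s| <= e) ->
  L (phi_ k) @[k --> \oo] --> L phi.
Proof.
move=> oc od rk r sk s H; apply: dL.2; split.
- by move=> k; apply: mk_test oc od (sk k).
- exact: mk_test oc od s.
- by move=> e /H [N HN]; exists N => // k /= Nk t s'; apply: HN.
- exists `[c, d]%classic; split; [exact: segment_compact|exact: segment_oitv|].
  by move=> k; exact: dsupp_suppin.
Qed.

Lemma distr_ext phi psi : test a b phi -> test a b psi ->
  (forall t s, oitv a b t -> J s -> phi t s = psi t s) -> L phi = L psi.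
Proof.
move=> t1 t2 E.
have H : L phi @[k --> \oo] --> L psi.
  apply: (dL.2 (fun _ => phi)); split => //.
    move=> e e0; apply: nearW => _ t s ot Js; rewrite E// subrr normr0; exact: ltW.
  by exists (dsupp a b phi); case: t1 => _ h1 h2; split => // ? ?.
apply: (@cvg_unique _ (@Rhausdorff R) _ _ _ _ _ H); exact: cvg_cst.
Qed.

Lemma distrD phi psi : test a b phi -> test a b psi ->
  L (fun t s => phi t s + psi t s) = L phi + L psi.
Proof.
move=> t1 t2; rewrite -[X in X + _]mul1r -dL.1//; congr L.
by apply/funext => t; apply/funext => s; rewrite mul1r.
Qed.

Lemma test0 : test a b (fun _ _ => 0 : R).
Proof.
split; first by split=> *; first exact: regJ_cst; exists 0; exact: dlim_cst.
  rewrite (_ : dsupp _ _ _ = set0); first exact: compact0.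
  rewrite /dsupp (_ : [set t | _] = set0) ?closure0//.
  by apply/seteqP; split => t // [_ [s _]]; rewrite eqxx.
rewrite (_ : dsupp _ _ _ = set0)//.
rewrite /dsupp (_ : [set t | _] = set0) ?closure0//.
by apply/seteqP; split => t // [_ [s _]]; rewrite eqxx.
Qed.

Lemma distr0 : L (fun _ _ => 0) = 0.
Proof.
have := distrD test0 test0; rewrite (_ : (fun _ _ => 0 + 0) = (fun _ _ => 0)); last first.
  by apply/funext => t; apply/funext => s; rewrite addr0.
by move/eqP; rewrite -subr_eq subrr eq_sym => /eqP.
Qed.

Lemma distrZ k phi : test a b phi -> L (fun t s => k * phi t s) = k * L phi.
Proof.
move=> t1; rewrite -[RHS]addr0 -distr0 -dL.1//; last exact: test0.
by congr L; apply/funext => t; apply/funext => s; rewrite addr0.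
Qed.

Lemma testZ k phi : test a b phi -> test a b (fun t s => k * phi t s).
Proof.
move=> t1; have := testZD k t1 test0.
by under eq_fun do under eq_fun do rewrite addr0.
Qed.

Lemma distrB phi psi : test a b phi -> test a b psi ->
  L (fun t s => phi t s - psi t s) = L phi - L psi.
Proof.
move=> t1 t2; rewrite [RHS]addrC -mulN1r -dL.1//; congr L.
by apply/funext => t; apply/funext => s; rewrite mulN1r addrC.
Qed.

End Distribution.

(** Sup-norm bounds on each segment are how the distributions of the equation
are recognized: convergence of test functions is uniform with supports in one
segment. *)
Lemma bounded_distribution (a b : \bar R) (L : @functional R) :
  (forall t, oitv a b t -> forall (k : R) phi psi, test a b phi -> test a b psi ->
     L (fun t s => k * phi t s + psi t s) = k * L phi + L psi) ->
  (forall c d, oitv a b c -> oitv a b d -> c <= d -> exists2 C : R, 0 <= C &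
     forall phi (e : R), ldG a b phi -> suppin a b c d phi -> 0 <= e ->
       (forall t s, oitv a b t -> J s -> `|phi t s| <= e) -> `|L phi| <= C * e) ->
  (exists t, oitv a b t) ->
  Defs.distribution a b L.
Proof.
move=> lin bd [t0 o0]; split; first exact: lin o0.
move=> phi_ phi [tk t u [K [cK Kab sK]]].
have [c1 [d1 [oc1 od1 cd1 s1]]] := compact_oitv o0 cK Kab.
have [l2 [c2 [d2 [oc2 od2 cd2 s2]]]] := test_suppin o0 t.
pose c := Num.min c1 c2; pose d := Num.max d1 d2.
have cd : c <= d by rewrite ge_min le_max cd1.
have [C C0 HC] := bd c d (oitv_min oc1 oc2) (oitv_max od1 od2) cd.
apply/cvgrPdist_le => e e0.
have e'0 : 0 < e / (C + 1) by rewrite divr_gt0// ltr_wpDl.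
have := u _ e'0; apply: filterS => k Hk.
have -> : L phi - L (phi_ k) = - L (fun t s => - 1 * phi t s + phi_ k t s).
  by rewrite (lin _ o0)//; ring.
rewrite normrN; apply: (@le_trans _ _ (C * (e / (C + 1)))); last first.
  rewrite mulrA ler_pdivrMr ?ltr_wpDl//; nra.
apply: HC.
- by apply: ldGD; [apply: ldGZ|case: (test_suppin o0 (tk k))].
- have s1k := suppin_dsupp (subset_trans (sK k) s1).
  move=> x s ox Js nx; rewrite s2// ?s1k ?mulr0 ?addr0//.
    by apply: contra nx => /andP[x1 x2]; rewrite ge_min le_max x1 x2.
  by apply: contra nx => /andP[x1 x2]; rewrite ge_min le_max x1 x2 !orbT.
- exact: ltW.
- by move=> x s ox Js; rewrite mulN1r addrC; exact: Hk.
Qed.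

Lemma lexstep_ldG a b V P Q psi : lexstep V P Q psi -> ldG a b psi.
Proof.
elim=> [{}P {}Q c d _ _ _ _ _|{}P {}Q S p1 p2 _ IH1 _ IH2]; last exact: ldGD.
by apply: ldGD; apply: ldGZ; [exact: ldG_ind|exact: ldG_sing].
Qed.

Lemma lexstep_suppin a b V P Q psi : lexstep V P Q psi -> suppin a b P.1 Q.1 psi.
Proof.
move=> st t s _ _ nt; rewrite (lexstep0 st)//; apply: contra nt => /andP[h1 /ltW h2].
by rewrite (lept1 h1) (lept1 h2).
Qed.

(** The values on points drop out, and the values on intervals add up to the
increment of w. *)
Lemma lexstep_bound a b (L : @functional R) (w : @dyn R) (M : R) P Q psi :
  Defs.distribution a b L -> (forall P, oitv a b P.1 -> J P.2 -> L (sing P) = 0) ->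
  oitv a b P.1 -> oitv a b Q.1 ->
  (forall S S' : pt, J S.2 -> J S'.2 -> P <= S -> S < S' -> S' <= Q ->
     `|L (ind S S')| <= w S'.1 S'.2 - w S.1 S.2) ->
  0 <= M -> lexstep (fun c => `|c| <= M) P Q psi ->
  `|L psi| <= M * (w Q.1 Q.2 - w P.1 P.2).
Proof.
move=> dL L0 + + + M0 st; elim: st => [{}P {}Q c d PQ JP JQ cM dM|{}P {}Q S p1 p2 st1 IH1 st2 IH2] oP oQ H.
  rewrite dL.1; [|exact: test_ind1|exact/(testZ)/test_sing].
  rewrite (distrZ dL); last exact: test_sing.
  rewrite L0// mulr0 addr0 normrM ler_pM//.
  by apply: H; rewrite ?lexx.
have [PQ JP JQ] := lexstep_lt st1; have [QS _ JS] := lexstep_lt st2.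
have oQ' : oitv a b Q.1 by apply: oitv_le oP oQ _; rewrite !lept1// ltW.
rewrite (distrD dL); last 2 first.
- exact: mk_test (lexstep_ldG _ _ st1) oP oQ' (lexstep_suppin st1).
- exact: mk_test (lexstep_ldG _ _ st2) oQ' oQ (lexstep_suppin st2).
apply: le_trans (ler_normD _ _) _.
have := IH1 oP oQ' (fun S1 S2 J1 J2 h1 h2 h3 => H S1 S2 J1 J2 h1 h2 (le_trans h3 (ltW QS))).
have := IH2 oQ' oQ (fun S1 S2 J1 J2 h1 h2 h3 => H S1 S2 J1 J2 (le_trans (ltW PQ) h1) h2 h3).
by lra.
Qed.

(** A step function that approximates phi uniformly can be taken bounded by the
same M; the bound for step functions passes to the limit by continuity. *)
Lemma distr_bound a b (L : @functional R) (w : @dyn R) phi (M : R) P Q :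
  Defs.distribution a b L -> (forall P, oitv a b P.1 -> J P.2 -> L (sing P) = 0) ->
  oitv a b P.1 -> oitv a b Q.1 -> J P.2 -> J Q.2 -> P <= Q ->
  (forall S S' : pt, J S.2 -> J S'.2 -> P <= S -> S < S' -> S' <= Q ->
     `|L (ind S S')| <= w S'.1 S'.2 - w S.1 S.2) ->
  ldG a b phi -> 0 <= M ->
  (forall t s, J s -> P <= ((t, s) : pt) < Q -> `|phi t s| <= M) ->
  `|L (fun t s => phi t s * ind P Q t s)| <= M * (w Q.1 Q.2 - w P.1 P.2).
Proof.
move=> dL L0 oP oQ JP JQ; rewrite le_eqVlt => /predU1P[<-{Q oQ JQ} H|PQ H] rphi M0 HM.
  rewrite subrr mulr0 (_ : (fun _ => _) = fun _ _ => 0) ?(distr0 dL) ?normr0//.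
  by apply/funext => t; apply/funext => s; rewrite /ind subrr mulr0.
have A (k : nat) : { psi | lexstep (fun c => `|c| <= M) P Q psi /\
    forall t s, J s -> P <= ((t, s) : pt) < Q -> `|phi t s - psi t s| <= k.+1%:R^-1 }.
  apply: cid; have [||psi h1 h2] := @approx_ldG a b (fun c => `|c| <= M) phi k.+1%:R^-1 P Q rphi _ JP JQ oP oQ (ltW PQ) HM => //.
  by exists psi.
pose psi k := sval (A k).
have st k : lexstep (fun c => `|c| <= M) P Q (psi k) by have [] := svalP (A k).
have dist k t s : J s -> P <= ((t, s) : pt) < Q -> `|phi t s - psi k t s| <= k.+1%:R^-1.
  by have [_] := svalP (A k); apply.
have C : L (psi k) @[k --> \oo] --> L (fun t s => phi t s * ind P Q t s).
  apply: (distr_cvg dL oP oQ).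
  - by move=> k; exact: lexstep_ldG (st k).
  - by apply: ldGM rphi (ldG_ind _ _ _ _).
  - by move=> k; exact: lexstep_suppin (st k).
  - apply: suppinM; have := @suppin_ind a b P Q.
    by rewrite (min_idPl (lept1 (ltW PQ))) (max_idPr (lept1 (ltW PQ))).
  - move=> e e0; have [N _ HN] := near_infty_natSinv_lt (PosNum e0).
    exists N => k Nk t s ot Js; rewrite (indE _ _ (ltW PQ)).
    case: (boolP (P <= _ < Q)) => h; last by rewrite (lexstep0 (st k) h) mulr0 subrr normr0 ltW.
    rewrite mulr1 distrC; apply: le_trans (dist k t s Js h) _.
    exact: ltW (HN k Nk).
apply/ler_addgt0Pr => e e0; move/cvgrPdist_le: C => /(_ e e0)[N _ /(_ N (leqnn N))].
have := lexstep_bound dL L0 oP oQ H M0 (st N).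
set B := M * _; set x := L _; set y := L _ => h1.
rewrite distrC => h2; have := ler_normB x (x - y); rewrite subKr => h3.
by lra.
Qed.

Lemma ldG_bounded a b phi P Q : ldG a b phi ->
  oitv a b P.1 -> oitv a b Q.1 -> J P.2 -> J Q.2 -> P <= Q ->
  exists2 M : R, 0 <= M & forall t s, J s -> P <= ((t, s) : pt) < Q -> `|phi t s| <= M.
Proof.
move=> rphi oP oQ JP JQ; rewrite le_eqVlt => /predU1P[<-|PQ].
  by exists 0 => // t s _ /andP[h1 /(le_lt_trans h1)]; rewrite ltxx.
have [//|psi st h] := @approx_ldG a b (fun _ => True) phi 1 P Q rphi ltr01 JP JQ oP oQ (ltW PQ) _ PQ.
suff [M HM] : exists M, forall t s, `|psi t s| <= M.
  exists (M + 1); first by have := HM 0 0; have := normr_ge0 (psi 0 0); lra.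
  move=> t s Js PtQ; rewrite -(subrK (psi t s) (phi t s)) addrC.
  by rewrite (le_trans (ler_normD _ _))// lerD// h.
elim: st => {h} [S S' c d _ _ _ _ _|S S1 S2 p1 p2 _ [M1 h1] _ [M2 h2]].
  exists (`|c| + `|d - c|) => t s; rewrite (le_trans (ler_normD _ _))// !normrM lerD//.
    by rewrite ler_piMr// norm_ind.
  by rewrite ler_piMr// /sing; case: eqP; rewrite ?normr1 ?normr0.
by exists (M1 + M2) => t s; rewrite (le_trans (ler_normD _ _))// lerD.
Qed.

(** The difference of the two distributions is bounded by the increments of 0. *)
Lemma distr_eq a b (L L' : @functional R) phi P Q :
  Defs.distribution a b L -> Defs.distribution a b L' ->
  (forall P, oitv a b P.1 -> J P.2 -> L (sing P) = L' (sing P)) ->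
  oitv a b P.1 -> oitv a b Q.1 -> J P.2 -> J Q.2 -> P <= Q ->
  (forall S S' : pt, J S.2 -> J S'.2 -> P <= S -> S < S' -> S' <= Q ->
     L (ind S S') = L' (ind S S')) ->
  ldG a b phi ->
  L (fun t s => phi t s * ind P Q t s) = L' (fun t s => phi t s * ind P Q t s).
Proof.
move=> dL dL' L0 oP oQ JP JQ PQ H rphi.
have tphi : test a b (fun t s => phi t s * ind P Q t s) by exact: test_ind.
have dB : Defs.distribution a b (fun f => L f - L' f).
  split; first by move=> k f g tf tg; rewrite dL.1// dL'.1//; ring.
  by move=> f_ f h; apply: cvgB; [exact: dL.2|exact: dL'.2].
have [M M0 HM] := ldG_bounded rphi oP oQ JP JQ PQ.
apply/eqP; rewrite -subr_eq0 -normr_le0.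
have := @distr_bound a b _ (fun _ _ => 0) phi M P Q dB _ oP oQ JP JQ PQ _ rphi M0.
rewrite subrr mulr0; apply.
- by move=> S oS JS; rewrite L0// subrr.
- by move=> S S' JS JS' h1 h2 h3; rewrite H// !subrr normr0.
- exact: HM.
Qed.

Lemma oitv_right (a b : \bar R) d : oitv a b d -> exists2 d', d < d' & oitv a b d'.
Proof.
case: b => [r| |] [h1 h2] //=; last by exists (d + 1); [lra|split; rewrite ?ltry//; apply: (lt_trans h1); rewrite lte_fin; lra].
move: h2; rewrite lte_fin => h2; exists ((d + r) / 2); first by lra.
by split; rewrite ?lte_fin; [apply: (lt_trans h1); rewrite lte_fin|]; lra.
Qed.

Lemma oitv_left (a b : \bar R) d : oitv a b d -> exists2 d', d' < d & oitv a b d'.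
Proof.
case: a => [r| |] [h1 h2] //=; last by exists (d - 1); [lra|split; rewrite ?ltNyr//; apply: lt_trans h2; rewrite lte_fin; lra].
move: h1; rewrite lte_fin => h1; exists ((d + r) / 2); first by lra.
by split; rewrite ?lte_fin; [|apply: lt_trans h2; rewrite lte_fin]; lra.
Qed.

(** Multiplication by an indicator loses nothing on a test function, so that the
results on products with indicators cover all test functions. *)
Lemma suppin_ind_eq a b c d d' phi t s : suppin a b c d phi -> d < d' -> c <= d ->
  oitv a b t -> J s ->
  phi t s = phi t s * ind (c, - 2^-1) (d', - 2^-1) t s.
Proof.
move=> hs dd' cd ot Js.
rewrite indE; last by rewrite leptE /= (le_lt_trans cd dd').
case: (boolP (c <= t <= d)) => [/andP[h1 h2]|h]; last by rewrite hs// mul0r.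
rewrite leptE ltptE /= (le_lt_trans h2 dd') andbT.
move: h1; rewrite le_eqVlt => /predU1P[->|->]; last by rewrite mulr1.
by move: Js; rewrite ltxx eqxx JE => /andP[-> _] /=; rewrite mulr1.
Qed.

Lemma distr_suppin a b c d d' phi (L : @functional R) :
  Defs.distribution a b L -> oitv a b c -> oitv a b d -> oitv a b d' ->
  ldG a b phi -> suppin a b c d phi -> d < d' -> c <= d ->
  L phi = L (fun t s => phi t s * ind (c, - 2^-1) (d', - 2^-1) t s).
Proof.
move=> dL oc od od' rphi hs dd' cd; apply: (distr_ext dL).
- exact: mk_test rphi oc od hs.
- exact: test_ind.
- by move=> t s ot Js; exact: (suppin_ind_eq hs).
Qed.

Lemma distr_eq_test a b t0 (L L' : @functional R) phi :
  Defs.distribution a b L -> Defs.distribution a b L' -> oitv a b t0 ->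
  (forall P, oitv a b P.1 -> J P.2 -> L (sing P) = L' (sing P)) ->
  (forall S S' : pt, J S.2 -> J S'.2 -> oitv a b S.1 -> oitv a b S'.1 -> S < S' ->
     L (ind S S') = L' (ind S S')) ->
  test a b phi -> L phi = L' phi.
Proof.
move=> dL dL' o0 hs hi tphi.
have [rphi [c [d [oc od cd sphi]]]] := test_suppin o0 tphi.
have [d' dd' od'] := oitv_right od.
rewrite (distr_suppin dL oc od od' rphi sphi dd' cd) (distr_suppin dL' oc od od' rphi sphi dd' cd).
have cd' : ((c, - 2^-1) : pt) <= (d', - 2^-1) by rewrite leptE /= (le_lt_trans cd dd').
apply: (@distr_eq _ _ _ _ phi (c, - 2^-1) (d', - 2^-1) dL dL') => //; [exact: Jl|exact: Jl|].
move=> S S' JS JS' h1 h2 h3; have := lept1 h1; have := lept1 h3; have := lept1 (ltW h2) => /= g1 g2 g3.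
by apply: hi => //; apply: oitv_le oc od' _; rewrite ?g3 ?g2 ?(le_trans g3 g1) ?(le_trans g1 g2).
Qed.

End Lexicographic.

(** * Absolutely continuous functions on J *)

Section AbsoluteContinuity.
Context {R : realType}.
Implicit Types (h : R -> R) (p q : seq (R * R)).
Local Notation TV := (@total_variation R).
Local Notation BVf := (@bounded_variation R).

Definition lenp p : R := \sum_(I <- p) (I.2 - I.1).
Definition osc h p : R := \sum_(I <- p) `|h I.2 - h I.1|.
Definition ordered p := pairwise (fun I I' : R * R => I.2 <= I'.1) p.

(** Total variation is defined by lists of points and absolute continuity by
lists of intervals. *)
Lemma partition_intervals h (a b : R) s : itv_partition a b s ->
  let p := zip (a :: s) s in
  [/\ forall I, I \in p -> [/\ a <= I.1, I.1 <= I.2 & I.2 <= b],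
      ordered p, lenp p = b - a & osc h p = variation a b h s].
Proof.
elim: s a => [|y s IH] a.
  move=> /itv_partition_nil ->; split => //; first by rewrite /lenp big_nil subrr.
  by rewrite /osc big_nil variation_nil.
move=> abs; have [ay] : a < y /\ itv_partition y b s.
  by case: abs => /= /andP[ay ys] l; split.
move=> ybs; have [H1 H2 H3 H4] := IH y ybs.
have yb := itv_partition_le ybs; have ab := itv_partition_le abs.
split => /=.
- move=> I; rewrite inE => /predU1P[->|/H1[h1 h2 h3]] /=; first by rewrite lexx (ltW ay).
  by rewrite (le_trans (ltW ay) h1).
- rewrite /ordered /= -/(ordered _) H2 andbT; apply/allP => I /H1[h1 _ _] //.
- by rewrite /lenp big_cons -/(lenp (zip (y :: s) s)) H3 /= addrC subrKA.
- rewrite /osc big_cons -/(osc h (zip (y :: s) s)) H4 /=.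
  rewrite -cat1s (@variation_cat _ y a b h [:: y] s (ltW ay) yb)//; last exact: itv_partition1.
  by congr (_ + _); rewrite /variation /= big_nat1.
Qed.

Lemma ACJ_TV_le h (e d x y : R) : 0 < e ->
  (forall p, (forall I, I \in p -> [/\ J I.1, J I.2 & I.1 <= I.2]) ->
      ordered p -> lenp p < d -> osc h p < e) ->
  J x -> J y -> x <= y -> y - x < d -> (TV x y h <= e%:E)%E.
Proof.
move=> e0 H; rewrite !JE => /andP[x1 x2] /andP[y1 y2] xy yxd.
apply: ge_ereal_sup => _ [_ [s xys <-] <-]; rewrite lee_fin.
have [H1 H2 H3 <-] := partition_intervals h xys.
apply/ltW/H => //; last by rewrite H3.
by move=> I /H1[h1 h2 h3]; split => //; rewrite JE; lra.
Qed.

Lemma TV_fin_BV h (x y : R) : x <= y -> (TV x y h < +oo)%E -> BVf x y h.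
Proof.
move=> xy H; apply/bounded_variationP => //.
by rewrite ge0_fin_numE// total_variation_ge0.
Qed.

(** Finitely many intervals of the length provided by absolute continuity with
error 1 cover J. *)
Lemma ACJ_BV h : ACJ h -> BVf (- 2^-1) (2^-1) h.
Proof.
move=> ach; have [d d0 Hd] := ach 1 ltr01.
have loc x y : J x -> J y -> x <= y -> y - x < d -> BVf x y h.
  move=> Jx Jy xy yxd; apply: TV_fin_BV => //.
  by apply: le_lt_trans (ACJ_TV_le ltr01 Hd Jx Jy xy yxd) _; rewrite ltry.
have Jm (x : R) : - 2^-1 <= x <= 2^-1 -> J x by rewrite JE.
apply: (@cousin R (- 2^-1) (2^-1) (fun x y => BVf x y h)); first by lra.
- move=> x y z x1 xy yz z1 /bounded_variationP-/(_ xy) B1 /bounded_variationP-/(_ yz) B2.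
  apply/bounded_variationP; first exact: le_trans yz.
  by rewrite (total_variationD _ xy yz) fin_numD B1 B2.
- by move=> x _; apply: bounded_variationxx.
- move=> x hx; exists d => // y hy y1; apply: loc; rewrite ?JE; lra.
- move=> x hx; exists d => // y hy y1; apply: loc; rewrite ?JE; lra.
Qed.

(** In each interval a partition that nearly realizes the variation is
chosen; together these form one admissible list of intervals. *)
Lemma ACJ_TV h : ACJ h -> forall e : R, 0 < e -> exists2 d : R, 0 < d & forall p,
  (forall I, I \in p -> [/\ J I.1, J I.2 & I.1 <= I.2]) -> ordered p -> lenp p < d ->
  \sum_(I <- p) fine (TV I.1 I.2 h) <= e.
Proof.
move=> ach e e0; have [d d0 Hd] := ach e e0; exists d => // p Jp op lp.
suff : forall q, (forall I, I \in q ++ p -> [/\ J I.1, J I.2 & I.1 <= I.2]) ->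
    ordered (q ++ p) -> lenp (q ++ p) < d -> osc h q + \sum_(I <- p) fine (TV I.1 I.2 h) <= e.
  by move=> /(_ [::] Jp op lp); rewrite /osc big_nil add0r.
elim: p {Jp op lp} => [|I p IH] q Jq oq lq.
  by rewrite big_nil addr0 ltW// Hd// -(cats0 q).
have [JI1 JI2 I12] := Jq I (ltac:(by rewrite mem_cat inE eqxx orbT)).
rewrite big_cons addrA addrAC -lerBrDl.
have fTV : (TV I.1 I.2 h <= (e - (osc h q + \sum_(j <- p) fine (TV j.1 j.2 h)))%:E)%E.
  apply: ge_ereal_sup => _ [_ [s xys <-] <-]; rewrite lee_fin.
  have [H1 H2 H3 H4] := partition_intervals h xys.
  rewrite lerBrDl -H4 addrAC -[X in X + _](_ : osc h (q ++ zip (I.1 :: s) s) = _); last first.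
    by rewrite /osc big_cat.
  apply: IH.
  - move=> K; rewrite !mem_cat => /orP[/orP[Kq|KI]|Kp].
    + by apply: Jq; rewrite mem_cat Kq.
    + have [h1 h2 h3] := H1 _ KI; move: JI1 JI2; rewrite !JE => h4 h5; split => //; rewrite ?JE; lra.
    + by apply: Jq; rewrite mem_cat inE Kp !orbT.
  - move: oq; rewrite /ordered -catA !pairwise_cat => /and3P[/allrelP r1 r2].
    rewrite pairwise_cons => /andP[/allP r3 r4]; move: H2; rewrite /ordered => ->; rewrite r2 r4 !andbT /=.
    apply/andP; split.
      apply/allrelP => K K' Kq; rewrite mem_cat => /orP[/H1[h1 h2 h3]|K'p].
        by apply: le_trans h1; apply: (r1 K I) => //; rewrite inE eqxx.
      by apply: r1 => //; rewrite inE K'p orbT.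
    apply/allrelP => K K' /H1[h1 h2 h3] /r3; exact: le_trans.
  - by move: lq; rewrite /lenp !big_cat /= big_cons -/(lenp (zip _ _)) H3 addrA.
rewrite -[leRHS]/(fine _%:E) fine_le//.
by rewrite ge0_fin_numE ?total_variation_ge0// (le_lt_trans fTV)// ltry.
Qed.

Lemma ACJ_cts h s : ACJ h -> J s -> forall e : R, 0 < e -> exists2 d : R, 0 < d &
  forall s', J s' -> `|s' - s| < d -> `|h s' - h s| < e.
Proof.
move=> ach Js e e0; have [d d0 Hd] := ach e e0; exists d => // s' Js'.
have [ss'|s's] := leP s s'.
  rewrite ger0_norm ?subr_ge0// => sd.
  have := Hd [:: (s, s')]; rewrite !big_seq1 /=; apply => //.
  by move=> I; rewrite inE => /eqP ->.
rewrite ltr0_norm ?subr_lt0// opprB distrC => sd.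
have := Hd [:: (s', s)]; rewrite !big_seq1 /=; apply => //.
by move=> I; rewrite inE => /eqP ->; split => //; exact: ltW.
Qed.

Lemma ACJ_within h : ACJ h -> {within `[- 2^-1, 2^-1], continuous h}.
Proof.
move=> ach; apply/continuous_within_itvP; first by lra.
have nr (s : R) : - 2^-1 <= s < 2^-1 -> h x @[x --> s^'+] --> h s.
  move=> hs; apply/cvgrPdist_lt => e e0.
  have [|d d0 Hd] := @ACJ_cts h s ach _ e e0; first by rewrite JE; lra.
  apply: (@ex_near_right _ _ _ (Num.min d (2^-1 - s))); first by rewrite lt_min d0; lra.
  move=> x /andP[sx]; rewrite -ltrBlDl lt_min => /andP[h1 h2]; rewrite distrC.
  apply: Hd; first by rewrite JE; lra.
  by rewrite gtr0_norm ?subr_gt0.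
have nl (s : R) : - 2^-1 < s <= 2^-1 -> h x @[x --> s^'-] --> h s.
  move=> hs; apply/cvgrPdist_lt => e e0.
  have [|d d0 Hd] := @ACJ_cts h s ach _ e e0; first by rewrite JE; lra.
  apply: (@ex_near_left _ _ _ (Num.min d (s + 2^-1))); first by rewrite lt_min d0; lra.
  move=> x /andP[+ xs]; rewrite ltrBlDl -ltrBlDr lt_min => /andP[h1 h2]; rewrite distrC.
  apply: Hd; first by rewrite JE; lra.
  by rewrite ltr0_norm ?subr_lt0// opprB.
split; [|by apply: nr; lra|by apply: nl; lra].
move=> s; rewrite in_itv /= => /andP[h1 h2]; apply/left_right_continuousP; split.
  by apply: nl; lra.
by apply: nr; lra.
Qed.

End AbsoluteContinuity.

Section MonotoneDensity.
Context {R : realType}.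
Implicit Types (H : R -> R) (p : seq (R * R)).
Local Notation leb := (@lebesgue_measure R).
Local Notation ls := (@lebesgue_stieltjes_measure R).

Definition mkcumulative H (nd : {homo H : x y / x <= y}) (rc : right_continuous H) :
  cumulative R R := HB.pack H (isCumulative.Build R _ R H nd rc).

Lemma ls_itvoc (f : cumulative R R) (a b : R) : a <= b ->
  ls f `]a, b]%classic = (f b - f a)%:E.
Proof.
move=> ab; rewrite /lebesgue_stieltjes_measure /measure_extension /=.
rewrite measurable_mu_extE /=; last exact: is_ocitv.
by rewrite wlength_itv_bnd.
Qed.

(** The connected components of an open set enter as abstract intervals; they are
turned into half-open intervals with the same end points, which is the form in
which Stieltjes measures are evaluated. *)
Lemma open_interval_bounds (I : set R) (a b : R) : open I -> is_interval I -> I !=set0 ->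
  I `<=` `]a, b[ -> [/\ a <= inf I, inf I < sup I & sup I <= b] /\
    [/\ I `<=` `]inf I, sup I], `]inf I, sup I[ `<=` I & leb I = (sup I - inf I)%:E].
Proof.
move=> oI iI I0 Iab.
have hl : has_lbound I by exists a => x /Iab /=; rewrite in_itv /= => /andP[/ltW].
have hu : has_ubound I by exists b => x /Iab /=; rewrite in_itv /= => /andP[_ /ltW].
have hull := iffLR (is_intervalP I) iI.
have sub : `]inf I, sup I[ `<=` I.
  move=> x /=; rewrite in_itv /= => /andP[h1 h2].
  have [y Iy yx] : exists2 y, I y & y < x.
    by have [y Iy] := inf_lt I0 h1; exists y.
  have [z Iz xz] : exists2 z, I z & x < z.
    by have [z Iz] := sup_gt I0 h2; exists z.
  by apply: (iI y z) => //; rewrite (ltW yx) (ltW xz).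
have opn x : I x -> inf I < x < sup I.
  move=> Ix; have /nbhs_ballP[e /= e0 He] := open_nbhs_nbhs (conj oI Ix).
  have h1 : I (x - e / 2) by apply: He; rewrite /ball /= opprB addrCA subrr addr0 gtr0_norm; lra.
  have h2 : I (x + e / 2) by apply: He; rewrite /ball /= opprD addrA subrr add0r normrN gtr0_norm; lra.
  have := inf_lbound hl h1; have := ub_le_sup hu h2; lra.
have IE : I = `]inf I, sup I[%classic.
  by apply/seteqP; split => // x /opn; rewrite /= in_itv.
have [x Ix] := I0; have xI := opn x Ix.
have lr : inf I < sup I by lra.
split; split => //.
- by apply: lb_le_inf => // y /Iab /=; rewrite in_itv /= => /andP[/ltW].
- by apply: ge_sup => // y /Iab /=; rewrite in_itv /= => /andP[_ /ltW].
- by move=> y /opn /andP[h1 h2]; rewrite /= in_itv /= h1 ltW.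
- by rewrite {1}IE lebesgue_measure_itv /= lte_fin lr.
Qed.

Lemma disjoint_intervals_le (I K : set R) (a b : R) : open I -> is_interval I -> I !=set0 ->
  open K -> is_interval K -> K !=set0 -> I `<=` `]a, b[ -> K `<=` `]a, b[ ->
  I `&` K = set0 -> inf I <= inf K -> sup I <= inf K.
Proof.
move=> oI iI I0 oK iK K0 Iab Kab IK0 lelr.
have [[_ lI _] [_ sI _]] := open_interval_bounds oI iI I0 Iab.
have [[_ lK _] [_ sK _]] := open_interval_bounds oK iK K0 Kab.
rewrite leNgt; apply/negP => ls.
have lm : inf K < Num.min (sup I) (sup K) by rewrite lt_min ls lK.
suff : (I `&` K) ((inf K + Num.min (sup I) (sup K)) / 2) by rewrite IK0.
have h1 : Num.min (sup I) (sup K) <= sup I by rewrite ge_min lexx.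
have h2 : Num.min (sup I) (sup K) <= sup K by rewrite ge_min lexx orbT.
by split; [apply: sI|apply: sK]; rewrite /= in_itv /=; lra.
Qed.

Lemma measure_bigcupT (nu : {measure set (measurableTypeR R) -> \bar R}) (I : nat -> set R) :
  (forall k, measurable (I k : set (measurableTypeR R))) -> trivIset setT I ->
  (nu (\bigcup_k I k) = \sum_(0 <= k <oo) nu (I k))%E.
Proof.
move=> mI tI; apply/esym/cvg_lim => //; apply: measure_semi_sigma_additive => //.
exact: bigcupT_measurable.
Qed.

(** A null set lies in an open set of small Lebesgue measure; any finitely many of
its components form a list of intervals of small total length, so that their
Stieltjes mass is at most e. *)
Lemma monotone_AC_null (H : cumulative R R) (A : set R) :
  (forall e : R, 0 < e -> exists2 d : R, 0 < d & forall p,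
    (forall I, I \in p -> [/\ J I.1, J I.2 & I.1 <= I.2]) -> ordered p -> lenp p < d ->
    \sum_(I <- p) (H I.2 - H I.1) <= e) ->
  measurable A -> leb A = 0%E -> A `<=` `]- 2^-1, 2^-1[ -> ls H A = 0%E.
Proof.
move=> ac mA A0 AJ; apply/eqP; rewrite eq_le measure_ge0 andbT.
apply/lee_addgt0Pr => e e0; rewrite add0e.
have [d d0 Hd] := ac e e0.
have Afin : (leb A < +oo)%E by rewrite A0 ltry.
have [U' [oU' AU' mU']] := @lebesgue_regularity_outer R A d mA Afin d0.
pose U := U' `&` `]- 2^-1, 2^-1[%classic.
have oU : open U by apply: openI => //; exact: interval_open.
have AU : A `<=` U by move=> x Ax; split; [exact: AU'|exact: AJ].
have mU : measurable U by exact: open_measurable.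
have lU : (leb U < d%:E)%E.
  have mU'A : measurable (U' `\` A) by apply: measurableD => //; exact: open_measurable.
  apply: le_lt_trans mU'; apply: (@le_trans _ _ (leb (U' `\` A) + leb A)%E); last first.
    by rewrite A0 adde0.
  apply: le_trans (measureU2 _ _ _) => //.
  apply: le_measure; rewrite ?inE//; first exact: measurableU.
  by move=> x [U'x _]; have [Ax|nAx] := pselect (A x); [right|left].
have [I [/all_and2[oI iI] tI UI]] := OpenSetDisjointItvs.open_disjoint_itv oU.
have disI k k' : k != k' -> I k `&` I k' = set0.
  by move=> nk; move/classical_sets.trivIsetP: tI => /(_ k k' _ _ nk); apply.
have IJ k : I k `<=` `]- 2^-1, 2^-1[.
  move=> x Ikx; suff : U x by case.
  by rewrite UI; exists k.
have mI k : measurable (I k) by exact: open_measurable.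
apply: le_trans (_ : (ls H U <= _)%E); first by apply: le_measure; rewrite ?inE.
rewrite UI (measure_bigcupT _ mI tI).
apply: lime_le; first by apply: is_cvg_nneseries => *; exact: measure_ge0.
apply: nearW => n.
pose ks := [seq k <- iota 0 n | `[< I k !=set0 >]].
pose pr (k : nat) := (inf (I k), sup (I k)).
have ksP k : k \in ks -> I k !=set0 by rewrite mem_filter => /andP[/asboolP].
have inj : {in ks &, injective pr}.
  move=> k k' /ksP k0 /ksP k'0 [E1 E2]; apply: contrapT => /eqP nk.
  have dis := disI _ _ nk.
  have [[_ lk _] _] := open_interval_bounds (oI k) (iI k) k0 (@IJ k).
  have := disjoint_intervals_le (oI k) (iI k) k0 (oI k') (iI k') k'0 (@IJ k) (@IJ k') dis.
  by rewrite -E1 lexx leNgt lk => /(_ isT).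
pose p := sort (fun x y : R * R => x.1 <= y.1) [seq pr k | k <- ks].
have pP K : K \in p -> exists2 k, k \in ks & K = pr k.
  by rewrite mem_sort => /mapP[k kks ->]; exists k.
have op : ordered p.
  have s1 : pairwise (fun x y : R * R => x.1 <= y.1) p.
    rewrite -sorted_pairwise; last by move=> x y z; exact: le_trans.
    by apply: sort_sorted => x y; exact: le_total.
  have s2 : uniq p by rewrite sort_uniq map_inj_in_uniq// filter_uniq// iota_uniq.
  move: s2; rewrite uniq_pairwise => s2.
  have := conj s1 s2 => /andP; rewrite -pairwise_relI.
  have sub : {in [in p] &, subrel [rel x y : R * R | (x.1 <= y.1) && (x != y)]
      (fun I I' : R * R => I.2 <= I'.1)}; last first.
    by move=> hp; apply: (sub_in_pairwise sub) hp; apply/allP.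
  move=> x y xp yp /andP[/= xy1 /eqP nxy].
  have [k kks xk] := pP x xp; have [k' kks' yk] := pP y yp.
  rewrite xk yk /pr /=; apply: (@disjoint_intervals_le _ _ (- 2^-1) (2^-1)) => //; try exact: ksP.
    by apply: disI; apply: contra_notN nxy => /eqP E; rewrite xk yk E.
  by move: xy1; rewrite xk yk.
have bnd k : k \in ks -> [/\ - 2^-1 <= inf (I k), inf (I k) < sup (I k), sup (I k) <= 2^-1,
    (I k `<=` `]inf (I k), sup (I k)])%classic & leb (I k) = (sup (I k) - inf (I k))%:E].
  by move=> /ksP k0; have [[? ? ?] [? ? ?]] := open_interval_bounds (oI k) (iI k) k0 (@IJ k).
have sumE (F : R * R -> R) (nu : {measure set (measurableTypeR R) -> \bar R}) :
    \sum_(0 <= k < n) nu (I k) = \sum_(k <- ks) nu (I k).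
  rewrite /ks big_filter /index_iota subn0 [LHS](bigID (fun k => `[< I k !=set0 >])) /=.
  rewrite [X in _ + X]big1 ?adde0// => k /asboolPn/set0P/negP; rewrite negbK => /eqP ->.
  exact: measure0.
have lp : lenp p < d.
  rewrite /lenp -lte_fin; apply: le_lt_trans lU; rewrite -sumEFin.
  rewrite (perm_big [seq pr k | k <- ks]) /=; last by rewrite perm_sort.
  rewrite big_map (eq_big_seq (fun k => leb (I k))); last by move=> k /bnd[].
  rewrite -(sumE fst) UI (measure_bigcupT _ mI tI).
  by apply: nneseries_lim_ge.
rewrite (sumE fst).
apply: (@le_trans _ _ (\sum_(K <- p) (H K.2 - H K.1))%:E); last first.
  rewrite lee_fin; apply: Hd => // K /pP[k /bnd[h1 h2 h3 _ _] ->] /=.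
  by rewrite !JE; split; lra.
rewrite -sumEFin (perm_big [seq pr k | k <- ks]) /=; last by rewrite perm_sort.
rewrite big_map; rewrite big_seq [leRHS]big_seq; apply: lee_sum => k /bnd[h1 h2 h3 h4 h5].
rewrite /pr /= -(ls_itvoc H (ltW h2)); apply: le_measure => //; rewrite inE//; exact: mI.
Qed.

End MonotoneDensity.

Section ACDensity.
Context {R : realType}.
Implicit Types (h : R -> R) (p : seq (R * R)).
Local Notation leb := (@lebesgue_measure R).
Local Notation ls := (@lebesgue_stieltjes_measure R).

(** The total increment over the intervals replaces the sum of absolute values,
as is natural for nondecreasing functions. *)
Definition mono_AC (H : R -> R) := forall e : R, 0 < e -> exists2 d : R, 0 < d & forall p,
    (forall I, I \in p -> [/\ J I.1, J I.2 & I.1 <= I.2]) -> ordered p -> lenp p < d ->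
    \sum_(I <- p) (H I.2 - H I.1) <= e.

Lemma mono_AC_end (H : cumulative R R) : mono_AC H -> ls H [set 2^-1] = 0%E.
Proof.
move=> ac; apply/eqP; rewrite eq_le measure_ge0 andbT.
apply/lee_addgt0Pr => e e0; rewrite add0e.
have [d d0 Hd] := ac e e0; pose r : R := Num.max 0 (2^-1 - d / 2).
have r0 : 0 <= r by rewrite le_max lexx.
have rd : 2^-1 - d / 2 <= r by rewrite le_max lexx orbT.
have r1 : r < 2^-1 by rewrite gt_max; apply/andP; split; lra.
apply: (@le_trans _ _ (ls H `]r, 2^-1]%classic)).
  by apply: le_measure; rewrite ?inE// => x ->; rewrite /= in_itv /= r1 lexx.
rewrite ls_itvoc ?(ltW r1)// lee_fin; have := Hd [:: (r, 2^-1)]; rewrite /lenp !big_seq1 /=; apply => //.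
  by move=> I; rewrite inE => /eqP -> /=; rewrite !JE; split; lra.
by lra.
Qed.

(** The Stieltjes measure of an absolutely continuous monotone function is
absolutely continuous with respect to Lebesgue measure, hence has a density by
the Radon-Nikodym theorem. *)
Lemma mono_AC_density (H : cumulative R R) : mono_AC H ->
  exists rho : R -> R, leb.-integrable setT (EFin \o rho) /\
    forall s1 s2, J s1 -> J s2 -> s1 <= s2 -> \int[leb]_(s in `]s1, s2]) rho s = H s2 - H s1.
Proof.
move=> ac; pose D : set (measurableTypeR R) := `]- 2^-1, 2^-1]%classic.
have mD : measurable D by exact: measurable_itv.
have finD : (ls H D < +oo)%E by rewrite ls_itvoc ?ltry//; lra.
pose nu : {finite_measure set _ -> \bar R} := mfrestr mD finD.
have nul : nu `<< leb.
  apply/null_content_dominatesP => A mA A0.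
  rewrite /nu /= /mfrestr /mrestr.
  apply/eqP; rewrite eq_le measure_ge0 andbT.
  have h1 : ls H (A `&` `]- 2^-1, 2^-1[) = 0%E.
    apply: monotone_AC_null => //; first exact: measurableI.
    apply/eqP; rewrite eq_le measure_ge0 andbT -[leRHS]A0.
    by apply: le_measure; rewrite ?inE//; exact: measurableI.
  pose A1 : set R := A `&` `]- 2^-1, 2^-1[; pose A2 : set R := [set 2^-1].
  apply: (@le_trans _ _ (ls H A1 + ls H A2)%E); last first.
    by have := mono_AC_end ac; rewrite -/A2 => ->; rewrite adde0 /A1 h1.
  have mA1 : measurable (A1 : set (measurableTypeR R)) by exact: measurableI.
  have mA2 : measurable (A2 : set (measurableTypeR R)) by exact: measurable_set1.
  apply: le_trans (measureU2 (ls H) mA1 mA2).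
  apply: le_measure; rewrite ?inE//; [exact: measurableI|exact: measurableU|].
  move=> x [Ax]; rewrite /D /= !in_itv /= => /andP[x1]; rewrite le_eqVlt => /predU1P[->|x2].
    by right.
  by left; split => //=; rewrite in_itv /= x1 x2.
have [f [f0 ffin fi fE]] := radon_nikodym_sigma_finite nul.
exists (fine \o f); have E : EFin \o (fine \o f) = f by apply/funext => x /=; rewrite fineK.
rewrite E; split => // s1 s2 Js1 Js2 s12.
rewrite /Rintegral (_ : (fun x => _) = f)//.
rewrite -fE// /nu /= /mfrestr /mrestr (_ : _ `&` D = `]s1, s2]%classic).
  by rewrite ls_itvoc.
apply/seteqP; split => [x []//|x /= xs]; split => //; move: xs Js1 Js2.
by rewrite /D /= !in_itv /= !JE; lra.
Qed.

End ACDensity.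

Section Clamp.
Context {R : realType}.
Variables c d : R.
Hypothesis cd : c < d.

(** Extension of functions on [c, d] by constants, so that they become functions on
the whole line as Stieltjes measures require. *)
Definition clamp (s : R) : R := Num.max c (Num.min s d).

Lemma clamp_in s : c <= clamp s <= d.
Proof. by move: cd => cd0; rewrite /clamp le_max lexx /= ge_max ge_min lexx orbT andbT; lra. Qed.

Lemma clamp_id s : c <= s <= d -> clamp s = s.
Proof. by rewrite /clamp => /andP[h1 h2]; rewrite (min_idPl h2) (max_idPr h1). Qed.

Lemma clamp_le : {homo clamp : x y / x <= y}.
Proof.
move: cd => cd0 x y xy; rewrite /clamp !maxEle !minEle.
by case: (leP x d) => ?; case: (leP y d) => ?; case: (leP c x) => ?; case: (leP c y) => ?; case: (leP c d) => ?; lra.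
Qed.

Lemma clamp_rc (k : R -> R) : (forall s, c <= s < d -> k x @[x --> s^'+] --> k s) ->
  right_continuous (k \o clamp).
Proof.
move: cd => cd0 H s; have [s1|s1] := ltP s c.
  apply: cvg_near_cst.
  apply: (@ex_near_right _ _ _ (c - s)); first by lra.
  move=> x hx /=; congr k; rewrite /clamp !(min_idPl _) ?(max_idPl _) //; lra.
have [s2|s2] := ltP s d; last first.
  apply: cvg_near_cst.
  apply: (@ex_near_right _ _ _ 1); first by lra.
  by move=> x hx /=; congr k; rewrite /clamp !(min_idPr _) //; lra.
rewrite /= clamp_id; last by rewrite s1 ltW.
apply: cvg_trans (H s _); last by rewrite s1 s2.
apply: near_eq_cvg; apply: (@ex_near_right _ _ _ (d - s)); first by lra.
by move=> x hx /=; rewrite clamp_id//; lra.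
Qed.

End Clamp.

Section ACFTC.
Context {R : realType}.
Implicit Types (h : R -> R) (p : seq (R * R)).
Local Notation leb := (@lebesgue_measure R).

Local Notation TV := (@total_variation R).

Local Notation clampJ := (@clamp R (- 2^-1) 2^-1).

Let halves : - 2^-1 < 2^-1 :> R. Proof. by lra. Qed.

Let clampJ_J s : J (clampJ s).
Proof. by rewrite JE; exact: clamp_in. Qed.

Let clampJ_id s : J s -> clampJ s = s.
Proof. by rewrite JE => /clamp_id. Qed.

Let clampJ_le : {homo clampJ : x y / x <= y}.
Proof. exact: clamp_le. Qed.

Let clampJ_rc (k : R -> R) : (forall s, - 2^-1 <= s < 2^-1 -> k x @[x --> s^'+] --> k s) ->
  right_continuous (k \o clampJ).
Proof. exact: clamp_rc. Qed.

Lemma ACJ_right h s : ACJ h -> - 2^-1 <= s < 2^-1 -> h x @[x --> s^'+] --> h s.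
Proof.
move=> ach hs; have [|c r l] := (continuous_within_itvP h _).1 (ACJ_within ach); first by lra.
move: hs; rewrite le_eqVlt => /andP[/predU1P[<-//|s1] s2].
by have [_] := iffRL (left_right_continuousP h s) (c s (ltac:(by rewrite in_itv /= s1 s2))).
Qed.

Lemma TV_fin h x y : ACJ h -> J x -> J y -> x <= y -> TV x y h \is a fin_num.
Proof.
move=> ach; rewrite !JE => hx hy xy; apply/bounded_variationP => //.
have B : bounded_variation x (2^-1) h.
  by apply: (@bounded_variationr _ (- 2^-1)); [lra|lra|exact: ACJ_BV].
by apply: (bounded_variationl _ _ B) => //; lra.
Qed.

Lemma TV_sub h x y : ACJ h -> J x -> J y -> x <= y ->
  fine (TV (- 2^-1) y h) - fine (TV (- 2^-1) x h) = fine (TV x y h).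
Proof.
move=> ach Jx Jy xy; have := Jx; rewrite JE => /andP[x1 x2].
rewrite (total_variationD _ x1 xy) fineD; [|exact: TV_fin Jl Jx x1|exact: TV_fin].
by rewrite addrC addKr.
Qed.

Lemma norm_le_TV h x y : ACJ h -> J x -> J y -> x <= y ->
  `|h y - h x| <= fine (TV x y h).
Proof.
move=> ach Jx Jy xy; rewrite -lee_fin fineK ?TV_fin//; exact: total_variation_ge.
Qed.

(** h is the difference of its variation and of variation minus h, both monotone
and absolutely continuous.  That the density is the derivative almost
everywhere is Lebesgue differentiation. *)
Lemma ACJ_density h : ACJ h -> exists rho : R -> R,
  [/\ leb.-integrable setT (EFin \o rho),
    forall s1 s2, J s1 -> J s2 -> s1 <= s2 -> \int[leb]_(s in `]s1, s2]) rho s = h s2 - h s1 &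
    {ae leb, forall s, - 2^-1 < s < 2^-1 -> derive1 h s = rho s}].
Proof.
move=> ach; pose p s := fine (TV (- 2^-1) (clampJ s) h).
pose q s := p s - h (clampJ s).
have pE x y : x <= y -> p y - p x = fine (TV (clampJ x) (clampJ y) h).
  by move=> xy; rewrite TV_sub//; exact: clampJ_le.
have hle x y : x <= y -> `|h (clampJ y) - h (clampJ x)| <= p y - p x.
  by move=> xy; rewrite pE//; apply: norm_le_TV; [exact: ach|exact: clampJ_J|exact: clampJ_J|exact: clampJ_le].
have ndp : {homo p : x y / x <= y}.
  by move=> x y /hle h1; have := normr_ge0 (h (clampJ y) - h (clampJ x)); lra.
have ndq : {homo q : x y / x <= y}.
  by move=> x y /hle; rewrite /q ler_norml; lra.
have rcp : right_continuous p.
  apply: (@clampJ_rc (fun s => fine (TV (- 2^-1) s h))) => s /andP[s1 s2].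
  apply: (total_variation_right_continuous s1 s2); last exact: ACJ_BV.
  by apply: ACJ_right; rewrite ?s1.
have rcq : right_continuous q.
  move=> s; apply: cvgB; first exact: rcp.
  by apply: (@clampJ_rc h) => r hr; apply: ACJ_right.
pose P := mkcumulative ndp rcp; pose Q := mkcumulative ndq rcq.
have acP : mono_AC P.
  move=> e e0; have [d d0 Hd] := ACJ_TV ach e0; exists d => // l Jl' ol ll.
  rewrite (eq_big_seq (fun I => fine (TV I.1 I.2 h))); first exact: Hd.
  by move=> I /Jl'[J1 J2 I12]; rewrite /P /= pE// !clampJ_id.
have acQ : mono_AC Q.
  move=> e e0; have e2 : 0 < e / 2 by lra.
  have [d1 d10 H1] := acP _ e2; have [d2 d20 H2] := ach _ e2.
  exists (Num.min d1 d2); first by rewrite lt_min d10.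
  move=> l Jl' ol; rewrite lt_min => /andP[l1 l2].
  have := H1 l Jl' ol l1; have := H2 l Jl' ol l2.
  suff : \sum_(I <- l) (Q I.2 - Q I.1) <= \sum_(I <- l) (P I.2 - P I.1) + \sum_(I <- l) `|h I.2 - h I.1| by lra.
  rewrite -big_split /= big_seq [leRHS]big_seq; apply: ler_sum => I /Jl'[J1 J2 _].
  by rewrite /q !clampJ_id//; have := ler_norm (- (h I.2 - h I.1)); rewrite normrN; lra.
have [rp [ip Hp]] := mono_AC_density acP; have [rq [iq Hq]] := mono_AC_density acQ.
have irho : leb.-integrable setT (EFin \o (fun s => rp s - rq s)).
  by rewrite (_ : EFin \o _ = (EFin \o rp) \- (EFin \o rq))%E; [exact: integrableB|apply/funext].
have iS (f : R -> R) (A : set R) : leb.-integrable setT (EFin \o f) -> measurable A ->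
    leb.-integrable A (EFin \o f).
  by move=> If mA; apply: integrableS If.
have E s1 s2 : J s1 -> J s2 -> s1 <= s2 ->
    \int[leb]_(s in `]s1, s2]) (rp s - rq s) = h s2 - h s1.
  move=> J1 J2 s12; rewrite RintegralB//; [|exact: iS|exact: iS].
  by rewrite Hp// Hq// /P /Q /= /q !clampJ_id//; ring.
exists (fun s => rp s - rq s); split => //.
have loc : locally_integrable setT (fun s => rp s - rq s).
  by apply: open_integrable_locally => //; exact: openT.
have := @FTC1Ny R (fun s => rp s - rq s) (fun y => iS _ _ irho (measurable_itv _)) loc.
set F := (fun x => _).
apply: filterS; first exact: (ae_filter_ringOfSetsType leb).
move=> s; rewrite /= => -[dF <-] hs.
rewrite !derive1E.
have -> : 'D_1 h s = 'D_1 (F \+ cst (h (- 2^-1) - F (- 2^-1))) s.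
  apply: near_eq_derive.
  have : \forall x \near s, - 2^-1 < x < 2^-1.
    by apply: (@near_in_itvoo R (- 2^-1) (2^-1)); rewrite in_itv.
  apply: filterS => x hx /=.
  have <- : \int[leb]_(s in `](- 2^-1), x]) (rp s - rq s) + h (- 2^-1) = h x.
    by rewrite E ?subrK// ?JE; lra.
  rewrite -(Rintegral_itvB (a := -oo%O)) /F; [by ring| exact: iS|by []|by rewrite bnd_simp; lra].
by rewrite deriveD// derive_cst addr0.
Qed.

End ACFTC.

(** * Integration and measurability *)

Section AlmostEverywhere.
Context {d : measure_display} {T : measurableType d} {R : realType}.
Variable mu : {measure set T -> \bar R}.
Import HBNNSimple.
Local Open Scope ereal_scope.

Lemma ge0_integral_le_off (f g : T -> \bar R) (N : set T) : measurable N -> mu N = 0 ->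
  (forall x, 0 <= f x) -> (forall x, 0 <= g x) -> (forall x, ~ N x -> f x <= g x) ->
  \int[mu]_x f x <= \int[mu]_x g x.
Proof.
move=> mN N0 f0 g0 fg; rewrite (ge0_integralTE mu f0) (ge0_integralTE mu g0).
apply: ge_ereal_sup => _ [h hf <-].
have mNC : measurable (~` N) by exact: measurableC.
pose h' := proj_nnsfun h mNC.
have h'E x : h' x = if x \in N then 0%R else h x.
  by rewrite /h' /= mindicE in_setC; case: (x \in N); rewrite ?mulr0 ?mulr1.
have -> : sintegral mu h = sintegral mu h'.
  rewrite -!integralT_nnsfun; apply: ge0_ae_eq_integral => //.
  - by apply/measurable_EFinP.
  - by apply/measurable_EFinP.
  - by move=> x _; rewrite lee_fin.
  - by move=> x _; rewrite lee_fin.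
  - exists N; split => // x /=; apply: contra_notP => nN _.
    by have /= -> := h'E x; rewrite memNset.
apply: ereal_sup_ubound; exists h' => // x; rewrite h'E; case: ifPn => [_|]; first exact: g0.
by rewrite notin_setE => nN; apply: le_trans (fg x nN); exact: hf.
Qed.

Lemma integral_eq_off (D : set T) (f g : T -> \bar R) (N : set T) : measurable N -> mu N = 0 ->
  (forall x, D x -> ~ N x -> f x = g x) ->
  \int[mu]_(x in D) f x = \int[mu]_(x in D) g x.
Proof.
move=> mN N0 fg; rewrite integral_mkcond [RHS]integral_mkcond.
rewrite integralE [RHS]integralE.
have E x : ~ N x -> (f \_ D) x = (g \_ D) x.
  by move=> nN; rewrite !patchE; case: ifPn => // /set_mem Dx; rewrite fg.
congr (_ - _); apply/eqP; rewrite eq_le; apply/andP; split;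
  apply: (ge0_integral_le_off mN N0) => // x nN.
all: by rewrite ?funeposE ?funenegE E.
Qed.

Lemma Rintegral_eq_off (D : set T) (f g : T -> R) (N : set T) : measurable N -> mu N = 0 ->
  (forall x, D x -> ~ N x -> f x = g x) ->
  (\int[mu]_(x in D) f x)%R = (\int[mu]_(x in D) g x)%R.
Proof.
move=> mN N0 fg; rewrite /Rintegral; congr fine; apply: integral_eq_off mN N0 _ => x Dx nN.
by rewrite fg.
Qed.

(** The integral of a nonnegative function is a supremum over simple functions
below it even if the function is not measurable, and a null set does not change
that supremum.  So the derivative can be replaced by a density. *)
Lemma Rintegral_ae_eq (D : set T) (f g : T -> R) :
  {ae mu, forall x, D x -> f x = g x} ->
  (\int[mu]_(x in D) f x)%R = (\int[mu]_(x in D) g x)%R.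
Proof.
move=> [N [mN N0 sN]]; apply: Rintegral_eq_off mN N0 _ => x Dx nN.
by apply: contrapT => nfg; apply: nN; apply: sN => /= /(_ Dx).
Qed.

End AlmostEverywhere.

Section Measurability.
Context {R : realType}.
Local Notation pt := (R *lexi[ring_display] R)%type.
Implicit Types (P Q : pt) (phi psi : @dyn R).

Lemma measurable_bool_indic (A : set R) (f : R -> R) : measurable A ->
  (forall x, f x = (`[< A x >])%:R) -> measurable_fun setT f.
Proof.
move=> mA E; rewrite (_ : f = \1_A); first exact: measurable_indic.
by apply/funext => x; rewrite E indicE; congr (nat_of_bool _)%:R; apply/asboolP/idP; rewrite inE.
Qed.

Lemma measurable_below Q t : measurable_fun setT (below Q t).
Proof.
have [tQ|Qt|E] := ltgtP t Q.1.
- apply: (@measurable_bool_indic setT) => // x.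
  by rewrite /below ltptE /= tQ; case: asboolP.
- apply: (@measurable_bool_indic set0) => // x.
  by rewrite /below ltptE /= ltNge (ltW Qt) gt_eqF //=; case: asboolP.
- apply: (@measurable_bool_indic `]-oo, Q.2[%classic) => // x.
  rewrite /below ltptE /= E ltxx eqxx /=; congr (nat_of_bool _)%:R.
  by apply/idP/asboolP; rewrite /= in_itv.
Qed.

Lemma measurable_ord_below Q : measurable_fun setT (ord (below Q)).
Proof.
have [h|h] := ltP 0 Q.2.
- apply: (@measurable_bool_indic `]-oo, Q.1]%classic) => // x.
  rewrite /ord /below ltptE /= h andbT; congr (nat_of_bool _)%:R.
  by apply/idP/asboolP; rewrite /= in_itv /= le_eqVlt orbC.
- apply: (@measurable_bool_indic `]-oo, Q.1[%classic) => // x.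
  rewrite /ord /below ltptE /= (ltNge 0) h andbF orbF; congr (nat_of_bool _)%:R.
  by apply/idP/asboolP; rewrite /= in_itv.
Qed.

Lemma measurable_sing Q t : measurable_fun setT (sing Q t).
Proof.
have [E|h] := eqVneq t Q.1.
- apply: (@measurable_bool_indic [set Q.2]) => // x.
  rewrite /sing; congr (nat_of_bool _)%:R; apply/eqP/asboolP => /=.
    by case: (Q) => p q [_ ->].
  by move=> ->; rewrite E; case: (Q).
- apply: (@measurable_bool_indic set0) => // x.
  rewrite /sing; case: asboolP => // _; case: eqP => // E'.
  by move: h; rewrite -E' eqxx.
Qed.

Lemma measurable_ord_sing Q : measurable_fun setT (ord (sing Q)).
Proof.
have [E|h] := eqVneq 0 Q.2.
- apply: (@measurable_bool_indic [set Q.1]) => // x.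
  rewrite /ord /sing; congr (nat_of_bool _)%:R; apply/eqP/asboolP => /=.
    by case: (Q) => p q [-> _].
  by move=> ->; rewrite E; case: (Q).
- apply: (@measurable_bool_indic set0) => // x.
  rewrite /ord /sing; case: asboolP => // _; case: eqP => // E'.
  by move: h; rewrite -E' eqxx.
Qed.

Lemma lexstep_measurable V P Q psi t : lexstep V P Q psi -> measurable_fun setT (psi t).
Proof.
elim=> [{}P {}Q c d _ _ _ _ _|{}P {}Q S p1 p2 _ IH1 _ IH2]; last exact: measurable_funD.
apply: measurable_funD; apply: measurable_funM; first [exact: measurable_cst|idtac].
  by apply: measurable_funB; exact: measurable_below.
exact: measurable_sing.
Qed.

Lemma lexstep_measurable_ord V P Q psi : lexstep V P Q psi -> measurable_fun setT (ord psi).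
Proof.
elim=> [{}P {}Q c d _ _ _ _ _|{}P {}Q S p1 p2 _ IH1 _ IH2]; last exact: measurable_funD.
apply: measurable_funD; apply: measurable_funM; first [exact: measurable_cst|idtac].
  by apply: measurable_funB; exact: measurable_ord_below.
exact: measurable_ord_sing.
Qed.

Lemma measurable_unif (D : set R) (f : R -> R) :
  (forall e : R, 0 < e -> exists2 g : R -> R, measurable_fun setT g & forall x, D x -> `|f x - g x| <= e) ->
  measurable_fun D f.
Proof.
move=> H; have A (k : nat) : { g : R -> R | measurable_fun setT g /\ forall x, D x -> `|f x - g x| <= k.+1%:R^-1 }.
  by apply: cid; have [//|g h1 h2] := H k.+1%:R^-1; exists g.
apply: (@measurable_fun_cvg _ _ _ _ (fun k => sval (A k))).
  by move=> k; apply: measurable_funTS; have [] := svalP (A k).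
move=> x Dx; apply/cvgrPdist_le => e e0.
have [N _ HN] := near_infty_natSinv_lt (PosNum e0).
exists N => // k Nk; have [_ h] := svalP (A k).
by apply: le_trans (h x Dx) _; exact: ltW (HN k Nk).
Qed.

(** A uniform limit of step functions. *)
Lemma ldG_measurable_ord a b phi c d : ldG a b phi -> oitv a b c -> oitv a b d ->
  measurable_fun `[c, d[ (ord phi).
Proof.
move=> rphi oc od; have [dc|cd] := leP d c.
  by rewrite set_itv_ge ?bnd_simp ?leNgt ?dc//; [exact: measurable_fun_set0|rewrite -leNgt].
apply: measurable_unif => e e0.
have cd' : ((c, - 2^-1) : pt) < (d, - 2^-1) by rewrite ltptE /= cd.
have [psi st h] := @approx_ldG R a b (fun _ => True) phi e (c, - 2^-1) (d, - 2^-1) rphi e0 Jl Jl oc od (ltW cd') (fun _ _ _ _ => I) cd'.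
exists (ord psi); first exact: lexstep_measurable_ord st.
move=> t /=; rewrite in_itv /= => /andP[ct td]; apply: h; first exact: J0.
rewrite ltptE /= td andbT leptE /=; move: ct; rewrite le_eqVlt => /predU1P[->|->//].
by rewrite ltxx eqxx /=; lra.
Qed.

Lemma regJ_measurable (k : R -> R) : regulatedJ k -> measurable_fun (`[- 2^-1, 2^-1[%classic : set R) k.
Proof.
move=> rk; apply: measurable_unif => e e0.
have cd' : ((0, - 2^-1) : pt) < (0, 2^-1) by rewrite ltptE /= ltxx eqxx /=; lra.
have l12 : - 2^-1 <= 2^-1 :> R by lra.
have [psi st h] := @approx_fibre R (fun _ => True) (fun _ => k) e 0 _ _ rk e0 Jl Jr l12 (fun _ _ _ => I) cd'.
exists (psi 0); first exact: lexstep_measurable st.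
move=> s /=; rewrite in_itv /= => hs; apply: (h 0 s); first by rewrite JE; lra.
by rewrite leptE ltptE /= ltxx eqxx /=; lra.
Qed.

Lemma regJ_bounded (k : R -> R) : regulatedJ k -> exists2 M : R, 0 <= M &
  forall s, J s -> `|k s| <= M.
Proof.
move=> [[M HM] _ _ _ _].
exists (Num.max (Num.max M `|k (- 2^-1)|) `|k 2^-1|); first by rewrite le_max normr_ge0 orbT.
move=> s; rewrite JE => /andP[]; rewrite le_eqVlt => /predU1P[<- _|s1].
  by rewrite !le_max lexx orbT.
rewrite le_eqVlt => /predU1P[->|s2]; first by rewrite le_max lexx orbT.
by rewrite !le_max HM.
Qed.

End Measurability.

Section IntegralBounds.
Context {d : measure_display} {T : measurableType d} {R : realType}.
Variables (mu : {measure set T -> \bar R}) (D : set T) (mD : measurable D).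

Lemma integrable_mulb (f h : T -> R) (M : R) :
  mu.-integrable D (EFin \o f) -> measurable_fun D h ->
  (forall x, D x -> `|h x| <= M) -> mu.-integrable D (EFin \o (fun x => h x * f x)).
Proof.
move=> intf mh hM.
rewrite (_ : EFin \o _ = (EFin \o f) \* (EFin \o h))%E; last first.
  by apply/funext => x /=; rewrite -EFinM mulrC.
apply: integrableMl => //; exists M; split; first exact: num_real.
by move=> x Mx y Dy /=; apply: le_trans (hM y Dy) (ltW Mx).
Qed.

Lemma integrable_norm (f : T -> R) : mu.-integrable D (EFin \o f) ->
  mu.-integrable D (EFin \o (fun x => `|f x|)).
Proof. by move=> /integrable_abse. Qed.

Lemma Rintegral_mulb_le (f h : T -> R) (M : R) :
  mu.-integrable D (EFin \o f) -> measurable_fun D h ->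
  (forall x, D x -> `|h x| <= M) ->
  `|\int[mu]_(x in D) (h x * f x)| <= M * \int[mu]_(x in D) `|f x|.
Proof.
move=> intf mh hM; have inthf := integrable_mulb intf mh hM.
apply: le_trans (le_normr_Rintegral mD inthf) _.
rewrite -RintegralZl//; last exact: integrable_norm.
apply: le_Rintegral => //; first exact: integrable_norm.
  by apply: (@integrable_mulb (fun x => `|f x|) (fun _ => M) `|M|) => //; exact: integrable_norm.
by move=> x Dx; rewrite normrM ler_wpM2r// hM.
Qed.

End IntegralBounds.

(** * Integration along a fibre *)

Section Fibre.
Context {R : realType}.
Local Notation pt := (R *lexi[ring_display] R)%type.
Local Notation leb := (@lebesgue_measure R).
Implicit Types (P Q : pt) (phi : @dyn R) (h psi : R -> R).

(** The term of [ddot] for one jump, seen as a functional of the test function. *)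
Definition fibint h psi : R := \int[leb]_(s in J) (psi s * derive1 h s).

Lemma regJ_measurableJ (k : R -> R) : regulatedJ k -> measurable_fun (@J R) k.
Proof. by move=> /regJ_measurable /measurable_fun_itv_bndo_bndcP. Qed.

Lemma mJ : measurable (@J R : set (measurableTypeR R)).
Proof. exact: measurable_itv. Qed.

(** The derivative is traded for an integrable density, for which linearity and
bounds are available. *)
Lemma fibint_density h : ACJ h -> exists rho : R -> R,
  [/\ leb.-integrable J (EFin \o rho),
    forall s, J s -> \int[leb]_(s in `[- 2^-1, s[) rho s = h s - h (- 2^-1) &
    forall psi, fibint h psi = \int[leb]_(s in J) (psi s * rho s)].
Proof.
move=> ach; have [rho [irho E aeE]] := ACJ_density ach.
have iS (A : set R) : measurable A -> leb.-integrable A (EFin \o rho).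
  by move=> mA; apply: integrableS irho.
exists rho; split; first by apply: iS; exact: mJ.
  move=> s Js; rewrite -(E (- 2^-1) s Jl Js); last by move: Js; rewrite JE => /andP[].
  by rewrite -Rintegral_itv_obnd_cbnd ?Rintegral_itv_bndo_bndc//; exact: iS.
move=> psi; rewrite /fibint; case: aeE => N [mN N0 sN].
pose N' := N `|` [set (- 2^-1)] `|` [set 2^-1 : R].
apply: (@Rintegral_eq_off _ _ _ _ _ _ _ N').
- by apply: measurableU => //; apply: measurableU.
- have h1 (A B : set R) : measurable (A : set (measurableTypeR R)) ->
      measurable (B : set (measurableTypeR R)) -> leb A = 0%E -> leb B = 0%E -> leb (A `|` B) = 0%E.
    move=> mA mB A0 B0; apply/eqP; rewrite eq_le measure_ge0 andbT.
    by apply: (@le_trans _ _ (leb A + leb B)%E); [exact: measureU2|rewrite A0 B0 adde0].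
  apply: (h1) => //; [by apply: measurableU| |exact: lebesgue_measure_set1].
  by apply: h1 => //; exact: lebesgue_measure_set1.
- move=> s; rewrite JE => /andP[s1 s2] nN; congr (_ * _); apply: contrapT => ne; apply: nN.
  move: s1 s2; rewrite /N' le_eqVlt => /predU1P[<- _|s1]; first by left; right.
  rewrite le_eqVlt => /predU1P[->|s2]; first by right.
  by left; left; apply: sN => /= /(_ (ltac:(by rewrite s1 s2))).
Qed.

Lemma fibint_lin h k psi1 psi2 : ACJ h -> regulatedJ psi1 -> regulatedJ psi2 ->
  fibint h (fun s => k * psi1 s + psi2 s) = k * fibint h psi1 + fibint h psi2.
Proof.
move=> ach r1 r2; have [rho [irho _ E]] := fibint_density ach; rewrite !E.
have [M1 _ H1] := regJ_bounded r1; have [M2 _ H2] := regJ_bounded r2.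
have i1 : leb.-integrable J (EFin \o (fun s => psi1 s * rho s)).
  exact: (integrable_mulb mJ irho (regJ_measurableJ r1) H1).
have i2 : leb.-integrable J (EFin \o (fun s => psi2 s * rho s)).
  exact: (integrable_mulb mJ irho (regJ_measurableJ r2) H2).
rewrite -RintegralZl//; [|exact: mJ]; rewrite -RintegralD//; [|exact: mJ|].
  by apply: eq_Rintegral => s _; ring.
by apply: (integrable_mulb (h := fun _ => k) (M := `|k|) mJ i1).
Qed.

Lemma fibint_bound0 h : ACJ h -> exists2 B : R, 0 <= B & forall psi e, regulatedJ psi ->
  (forall s, J s -> `|psi s| <= e) -> `|fibint h psi| <= B * e.
Proof.
move=> ach; have [rho [irho _ E]] := fibint_density ach.
exists (\int[leb]_(s in J) `|rho s|); first by apply: Rintegral_ge0.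
move=> psi e rpsi He; rewrite E mulrC; exact: (Rintegral_mulb_le mJ irho (regJ_measurableJ rpsi) He).
Qed.

(** The fundamental theorem of calculus. *)
Lemma fibint_lt h s : ACJ h -> J s ->
  fibint h (fun r => (r < s)%R%:R) = h s - h (- 2^-1).
Proof.
move=> ach Js; have [rho [irho E0 E]] := fibint_density ach.
rewrite E -(E0 s Js) (_ : `[- 2^-1, s[%classic = J `&` `]-oo, s[%classic).
  rewrite Rintegral_mkcondr; apply: eq_Rintegral => r _.
  rewrite patchE (_ : (r \in _) = (r < s)); last by apply/idP/idP; rewrite inE /= in_itv.
  by case: (r < s); rewrite ?mul1r ?mul0r.
by apply/seteqP; split => r /=; move: Js; rewrite /J /= !in_itv /=; [move=> /andP[_ h2] /andP[-> h1]|move=> _ [/andP[-> _] ->//]]; rewrite h1 (le_trans (ltW h1)).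
Qed.

Lemma fibint0 h psi : (forall s, J s -> psi s = 0) -> fibint h psi = 0.
Proof.
move=> H; rewrite /fibint (_ : \int[leb]_(s in J) _ = \int[leb]_(s in J) (cst 0 s)).
  by rewrite Rintegral_cst ?mul0r//; exact: mJ.
by apply: eq_Rintegral => s; rewrite inE => Js; rewrite H// mul0r.
Qed.

Lemma fibint_full h : ACJ h -> fibint h (fun _ => 1) = h 2^-1 - h (- 2^-1).
Proof.
move=> ach; have [rho [irho E0 E]] := fibint_density ach.
rewrite E -(E0 _ Jr) Rintegral_itv_bndo_bndc; last first.
  apply: integrableS irho; [exact: mJ|exact: measurable_itv|].
  by move=> r; rewrite /J /= !in_itv /= => /andP[-> /ltW].
by apply: eq_Rintegral => s _; rewrite mul1r.
Qed.

Lemma fibint_sing h s : fibint h (fun r => (r == s)%:R) = 0.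
Proof.
rewrite /fibint (@Rintegral_eq_off _ _ _ leb J _ (cst 0) [set s]) //.
- by rewrite Rintegral_cst ?mul0r//; exact: mJ.
- exact: lebesgue_measure_set1.
- by move=> r _ /eqP/negbTE ->; rewrite mul0r.
Qed.

End Fibre.

(** * Absolutely summable families *)

Section Summable.
Context {R : realType}.
Implicit Types (A B : set R) (f : R -> R) (F : seq R).

Definition fin_in A F := uniq F /\ forall x, x \in F -> A x.

Lemma fin_in_nil A : fin_in A [::]. Proof. by []. Qed.

Lemma fin_inS A B F : A `<=` B -> fin_in A F -> fin_in B F.
Proof. by move=> AB [uF FA]; split => // x /FA /AB. Qed.

Lemma fin_in_filter A B F : fin_in A F -> fin_in (A `&` B) [seq x <- F | `[< B x >]].
Proof.
move=> [uF FA]; split; first exact: filter_uniq.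
by move=> x; rewrite mem_filter => /andP[/asboolP Bx /FA].
Qed.

Lemma fin_in_cat A F F' : fin_in A F -> fin_in A F' -> fin_in A (undup (F ++ F')).
Proof.
move=> [_ FA] [_ FA']; split; first exact: undup_uniq.
by move=> x; rewrite mem_undup mem_cat => /orP[/FA|/FA'].
Qed.

Lemma esum_leP A f (C : R) : (forall x, 0 <= f x) ->
  (\esum_(t in A) (f t)%:E <= C%:E)%E <-> (forall F, fin_in A F -> \sum_(t <- F) f t <= C).
Proof.
move=> f0; split => [H F [uF FA]|H].
  rewrite -lee_fin; apply: le_trans H; rewrite -sumEFin; apply: esum_ge.
  exists [set` F]; first by split; [exact: finite_seq|move=> x /= /FA].
  by rewrite fsbig_seq.
apply: ge_ereal_sup => _ [X [finX XA] <-].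
have [F FX] := (finite_seqP X).1 finX.
rewrite (_ : X = [set` undup F]); last by rewrite FX; apply/seteqP; split => x /=; rewrite mem_undup.
rewrite -fsbig_seq ?undup_uniq// sumEFin lee_fin; apply: H; split; first exact: undup_uniq.
by move=> x; rewrite mem_undup => xF; apply: XA; rewrite FX.
Qed.

(** Unconditional convergence along finite subsets: unlike the definition of
[ssum] by positive and negative parts this is visibly linear and additive. *)
Definition is_ssum A f (S : R) := forall e : R, 0 < e -> exists2 F0, fin_in A F0 &
  forall F, fin_in A F -> {subset F0 <= F} -> `|\sum_(t <- F) f t - S| <= e.

Definition abs_summable A f (C : R) := forall F, fin_in A F -> \sum_(t <- F) `|f t| <= C.

Lemma sum_subset F F' f : (forall x, 0 <= f x) -> uniq F -> uniq F' -> {subset F <= F'} ->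
  \sum_(t <- F) f t <= \sum_(t <- F') f t.
Proof.
move=> f0 uF uF' sFF'; rewrite [leRHS](bigID (mem F)) /=.
have -> : \sum_(i <- F' | i \in F) f i = \sum_(i <- F) f i.
  rewrite -big_filter; apply: perm_big; apply: uniq_perm => //; first exact: filter_uniq.
  by move=> x; rewrite mem_filter; case: (boolP (x \in F)) => //= /sFF'.
by rewrite lerDl sumr_ge0.
Qed.

Lemma esum_approx A f (C e : R) : (forall x, 0 <= f x) -> 0 < e ->
  (forall F, fin_in A F -> \sum_(t <- F) f t <= C) ->
  let S := fine (\esum_(t in A) (f t)%:E) in
  exists2 F0, fin_in A F0 & forall F, fin_in A F ->
    (\sum_(t <- F) f t <= S) /\ ({subset F0 <= F} -> S - e <= \sum_(t <- F) f t).
Proof.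
move=> f0 e0 H S.
have E : \esum_(t in A) (f t)%:E = S%:E.
  rewrite fineK// ge0_fin_numE; last by apply: esum_ge0 => x _; rewrite lee_fin.
  by apply: le_lt_trans (_ : (_ <= C%:E)%E) (ltry _); apply/(esum_leP A C f0).
have le : forall F, fin_in A F -> \sum_(t <- F) f t <= S by apply/(esum_leP A S f0); rewrite E.
have [F0 finF0 hF0] : exists2 F0, fin_in A F0 & S - e < \sum_(t <- F0) f t.
  apply: contrapT => nex; suff : S <= S - e by lra.
  rewrite -lee_fin -E; apply/(esum_leP A (S - e) f0) => F finF; rewrite leNgt.
  by apply/negP => h; apply: nex; exists F.
exists F0 => // F finF; split; first exact: le.
move=> sub; apply: le_trans (ltW hF0) _; apply: sum_subset => //; [exact: finF0.1|exact: finF.1].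
Qed.

Lemma ssumP A f C : abs_summable A f C -> is_ssum A f (ssum A f).
Proof.
move=> H e e0; have e2 : 0 < e / 2 by lra.
have hp : forall x, 0 <= f^\+ x by move=> x; exact: funrpos_ge0.
have hn : forall x, 0 <= f^\- x by move=> x; exact: funrneg_ge0.
have bp F : fin_in A F -> \sum_(t <- F) f^\+ t <= C.
  move=> /H; apply: le_trans; apply: ler_sum => x _.
  by rewrite /funrpos ge_max ler_norm normr_ge0.
have bn F : fin_in A F -> \sum_(t <- F) f^\- t <= C.
  move=> /H; apply: le_trans; apply: ler_sum => x _.
  by rewrite /funrneg ge_max -normrN ler_norm normr_ge0.
have [F1 fin1 H1] := esum_approx hp e2 bp; have [F2 fin2 H2] := esum_approx hn e2 bn.
exists (undup (F1 ++ F2)); first exact: fin_in_cat.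
move=> F finF sub; have [p1 p2] := H1 F finF; have [n1 n2] := H2 F finF.
have {}p2 := p2 (fun x xF => sub x (ltac:(by rewrite mem_undup mem_cat xF))).
have {}n2 := n2 (fun x xF => sub x (ltac:(by rewrite mem_undup mem_cat xF orbT))).
have -> : \sum_(t <- F) f t = \sum_(t <- F) f^\+ t - \sum_(t <- F) f^\- t.
  rewrite -sumrB; apply: eq_bigr => x _; rewrite /funrpos /funrneg.
  by rewrite !maxEle; case: (leP (f x) 0) => ?; case: (leP (- f x) 0) => ?; lra.
by rewrite /ssum ler_norml; lra.
Qed.

Lemma is_ssum_uniq A f S T : is_ssum A f S -> is_ssum A f T -> S = T.
Proof.
move=> hS hT; apply/eqP; rewrite -subr_eq0 -normr_le0; apply/ler_addgt0Pr => e e0; rewrite add0r.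
have e2 : 0 < e / 2 by lra.
have [F1 fin1 H1] := hS _ e2; have [F2 fin2 H2] := hT _ e2.
have fin12 := fin_in_cat fin1 fin2.
have := H1 _ fin12 (fun x xF => ltac:(by rewrite mem_undup mem_cat xF)).
have := H2 _ fin12 (fun x xF => ltac:(by rewrite mem_undup mem_cat xF orbT)).
by rewrite !ler_norml; lra.
Qed.

Lemma is_ssumZD A f g k S T : is_ssum A f S -> is_ssum A g T ->
  is_ssum A (fun x => k * f x + g x) (k * S + T).
Proof.
move=> hS hT e e0; pose e1 := e / (2 * (`|k| + 1)).
have k1 : 0 < 2 * (`|k| + 1) by have := normr_ge0 k; lra.
have e10 : 0 < e1 by rewrite divr_gt0.
have e2 : 0 < e / 2 by lra.
have [F1 fin1 H1] := hS _ e10; have [F2 fin2 H2] := hT _ e2.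
exists (undup (F1 ++ F2)); first exact: fin_in_cat.
move=> F finF sub.
have h1 := H1 _ finF (fun x xF => sub x (ltac:(by rewrite mem_undup mem_cat xF))).
have h2 := H2 _ finF (fun x xF => sub x (ltac:(by rewrite mem_undup mem_cat xF orbT))).
rewrite big_split /= -mulr_sumr opprD addrACA -mulrBr.
apply: le_trans (ler_normD _ _) _; rewrite normrM.
have : `|k| * `|\sum_(t <- F) f t - S| <= `|k| * e1 by rewrite ler_wpM2l.
have : `|k| * e1 <= e / 2.
  rewrite /e1 mulrA ler_pdivrMr//; have := normr_ge0 k; nra.
lra.
Qed.

Lemma is_ssum_le A f S C : is_ssum A f S -> (forall F, fin_in A F -> `|\sum_(t <- F) f t| <= C) ->
  `|S| <= C.
Proof.
move=> hS H; apply/ler_addgt0Pr => e e0; have [F finF HF] := hS _ e0.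
have h1 := HF F finF (fun x => id); have h2 := H F finF.
have := ler_normB (\sum_(t <- F) f t) (\sum_(t <- F) f t - S); rewrite subKr; lra.
Qed.

Lemma is_ssumU A B f S T : A `&` B = set0 -> is_ssum A f S -> is_ssum B f T ->
  is_ssum (A `|` B) f (S + T).
Proof.
move=> AB hS hT e e0; have e2 : 0 < e / 2 by lra.
have [F1 fin1 H1] := hS _ e2; have [F2 fin2 H2] := hT _ e2.
exists (undup (F1 ++ F2)).
  by apply: fin_in_cat; [exact: fin_inS fin1|exact: fin_inS fin2].
move=> F finF sub; have -> : \sum_(t <- F) f t = \sum_(t <- [seq x <- F | `[< A x >]]) f t + \sum_(t <- [seq x <- F | ~~ `[< A x >]]) f t.
  by rewrite !big_filter; exact: (bigID (fun x => `[< A x >])).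
have s1 : fin_in A [seq x <- F | `[< A x >]] by apply: fin_inS (fin_in_filter A finF) => x [].
have s2 : fin_in B [seq x <- F | ~~ `[< A x >]].
  split; first by apply: filter_uniq; exact: finF.1.
  move=> x; rewrite mem_filter => /andP[/asboolPn nA xF].
  by have [] := finF.2 x xF.
have h1 := H1 _ s1; have h2 := H2 _ s2.
have {}h1 := h1 (fun x xF => ltac:(by rewrite mem_filter sub ?mem_undup ?mem_cat ?xF// andbT; apply/asboolP; exact: fin1.2)).
have {}h2 : `|\sum_(t <- [seq x <- F | ~~ `[< A x >]]) f t - T| <= e / 2.
  apply: h2 => x xF; rewrite mem_filter sub ?mem_undup ?mem_cat ?xF ?orbT// andbT.
  apply/asboolPn => Ax; have : (A `&` B) x by (split => //; exact: fin2.2).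
  by rewrite AB.
by move: h1 h2; rewrite !ler_norml; lra.
Qed.

Lemma is_ssum0 A f : (forall x, A x -> f x = 0) -> is_ssum A f 0.
Proof.
move=> H e e0; exists [::] => // F [uF FA] _.
by rewrite big_seq big1 ?subrr ?normr0 ?ltW// => x /FA /H.
Qed.

Lemma is_ssum1 t f : is_ssum [set t] f (f t).
Proof.
move=> e e0; exists [:: t]; first by split => // x; rewrite inE => /eqP.
move=> F [uF FA] sub; have tF : t \in F by apply: sub; rewrite inE.
have -> : \sum_(x <- F) f x = f t.
  rewrite (bigD1_seq t)//= big_seq_cond big1 ?addr0// => x /andP[/FA -> ].
  by rewrite eqxx.
by rewrite subrr normr0 ltW.
Qed.

Lemma is_ssumS A B f S : A `<=` B -> (forall x, B x -> ~ A x -> f x = 0) ->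
  is_ssum A f S -> is_ssum B f S.
Proof.
move=> AB H hA; rewrite -(addr0 S) (_ : B = A `|` (B `\` A)); last first.
  by rewrite setDUK.
apply: is_ssumU hA (is_ssum0 _) => [|x [Bx nAx]]; last exact: H.
by apply/seteqP; split => // x [Ax []].
Qed.

Lemma is_ssum_eq A f g S : (forall x, A x -> f x = g x) -> is_ssum A f S -> is_ssum A g S.
Proof.
move=> fg hS e /hS [F0 fin0 H]; exists F0 => // F finF sub.
rewrite (eq_big_seq f); first exact: H.
by move=> x /finF.2 /fg.
Qed.

Lemma ssumE A f S C : abs_summable A f C -> is_ssum A f S -> ssum A f = S.
Proof. by move=> /ssumP; exact: is_ssum_uniq. Qed.

Lemma abs_summableS A B f C : A `<=` B -> abs_summable B f C -> abs_summable A f C.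
Proof. by move=> AB H F finF; apply: H; exact: fin_inS finF. Qed.

Lemma abs_summable_tail A f C (e : R) : abs_summable A f C -> 0 < e ->
  exists2 F0, fin_in A F0 & forall F, fin_in A F -> (forall x, x \in F -> x \notin F0) ->
    \sum_(t <- F) `|f t| <= e.
Proof.
move=> H e0; have [F0 fin0 H0] := esum_approx (fun x => normr_ge0 (f x)) e0 H.
exists F0 => // F finF dis.
have finc : fin_in A (F0 ++ F).
  split; last by move=> x; rewrite mem_cat => /orP[/fin0.2|/finF.2].
  rewrite cat_uniq fin0.1 finF.1 andbT /=; apply/hasPn => x /dis //.
have [h1 _] := H0 _ finc; have [_ h2] := H0 _ fin0.
by have := h2 (fun x => id); move: h1; rewrite big_cat /=; lra.
Qed.

End Summable.

(** * Functions in sBV and their continuous parts *)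

Section Variation.
Context {R : realType}.
Implicit Types (a b : \bar R) (h : R -> R) (g : @dyn R).
Local Notation TV := (@total_variation R).

Lemma dlim_ord (F : set_system R) {FF : Filter F} g c : dlim F g c -> ord g x @[x --> F] --> c.
Proof.
move=> H; apply/cvgrPdist_le => e /H; apply: filterS => t Ht.
by rewrite distrC; apply: Ht; exact: J0.
Qed.

(** Left and right limits equal to the value; kept in this form because [llim]
and [rlim] are the limits that occur in [var]. *)
Definition one_sided_cts a b h := forall t, oitv a b t ->
  h x @[x --> t^'-] --> h t /\ h x @[x --> t^'+] --> h t.

Lemma osc_llim a b h t : one_sided_cts a b h -> oitv a b t -> llim h t = h t.
Proof. by move=> H /H[h1 _]; exact/cvg_lim. Qed.

Lemma osc_rlim a b h t : one_sided_cts a b h -> oitv a b t -> rlim h t = h t.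
Proof. by move=> H /H[_ h1]; exact/cvg_lim. Qed.

Lemma variation_var_sum a b h x y s : one_sided_cts a b h -> (forall t, t \in x :: s -> oitv a b t) ->
  \sum_(k < (size (x :: s)).-1) `|llim h (x :: s)`_k.+1 - rlim h (x :: s)`_k| = variation x y h s.
Proof.
move=> H os; rewrite /variation big_mkord /=; apply: eq_bigr => k _.
have k1 : (k < size s)%N by [].
have k2 : (k < (size s).+1)%N by rewrite ltnS ltnW.
rewrite (osc_llim H); last by apply: os; rewrite inE mem_nth ?orbT.
rewrite (osc_rlim H); last by apply: os; exact: mem_nth.
by rewrite (set_nth_default y 0 k1) (@set_nth_default _ (x :: s) y 0 k k2).
Qed.

Lemma TV_le_var a b h x y : one_sided_cts a b h -> oitv a b x -> oitv a b y -> x <= y ->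
  (TV x y h <= var a b h)%E.
Proof.
move=> H ox oy xy; apply: ge_ereal_sup => _ [_ [s [xs /eqP lsy] <-] <-].
have os t : t \in x :: s -> oitv a b t.
  move=> ts; apply: oitv_le ox oy _; apply/andP; split.
    move: ts; rewrite inE => /predU1P[->//|ts].
    by have /allP/(_ _ ts) := order_path_min lt_trans xs; exact: ltW.
  have [k ks <-] := nthP y ts.
  by apply: (@itv_partition_nth_le _ _ x y s) => //; split => //; exact/eqP.
rewrite -(variation_var_sum _ H os).
by apply: ereal_sup_ubound; exists (x :: s).
Qed.

(** For functions that agree with their one-sided limits [var] is ordinary total
variation over the inner segments. *)
Lemma var_le_TV a b h (C : \bar R) : one_sided_cts a b h -> (0 <= C)%E ->
  (forall x y, oitv a b x -> oitv a b y -> x <= y -> (TV x y h <= C)%E) -> (var a b h <= C)%E.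
Proof.
move=> H C0 HC; apply: ge_ereal_sup => _ [[|x s] [sp os] <-]; first by rewrite big_ord0.
rewrite (variation_var_sum (last x s) H os).
have xs : path <%R x s by [].
have part : itv_partition x (last x s) s by split.
have xl := itv_partition_le part.
apply: le_trans (HC x (last x s) _ _ xl); last by apply: os; exact: mem_last.
  by apply: ereal_sup_ubound; exists (variation x (last x s) h s) => //; exists s.
by apply: os; rewrite inE eqxx.
Qed.

Lemma ACJ_osc h : ACJ h -> one_sided_cts (- 2^-1)%:E (2^-1)%:E h.
Proof.
move=> ach t [t1 t2]; move: t1 t2; rewrite !lte_fin => t1 t2.
have [|c _ _] := (continuous_within_itvP h _).1 (ACJ_within ach); first by lra.
by apply: (iffRL (left_right_continuousP h t)); apply: c; rewrite in_itv /= t1.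
Qed.

Lemma varJ_TV h : ACJ h -> varJ h = TV (- 2^-1) (2^-1) h.
Proof.
move=> ach; have H := ACJ_osc ach.
have tv0 (x y : R) : x <= y -> (0 <= TV x y h)%E by exact: total_variation_ge0.
apply/eqP; rewrite eq_le; apply/andP; split.
  apply: (var_le_TV H); first by apply: tv0; lra.
  move=> x y [x1 x2] [y1 y2] xy; move: x1 x2 y1 y2; rewrite !lte_fin => x1 x2 y1 y2.
  rewrite (@total_variationD _ (- 2^-1) 2^-1 x); [|lra|lra].
  rewrite (@total_variationD _ x 2^-1 y); [|lra|lra].
  by rewrite addeCA leeDl// adde_ge0// tv0//; lra.
apply/lee_addgt0Pr => e e0; have e2 : 0 < e / 2 by lra.
have [d d0 Hd] := ach _ e2; pose r : R := Num.min (d / 2) (4^-1).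
have r0 : 0 < r by rewrite lt_min; apply/andP; split; lra.
have rd : r <= d / 2 by rewrite ge_min lexx.
have r4 : r <= 4^-1 by rewrite ge_min lexx orbT.
rewrite (@total_variationD _ (- 2^-1) 2^-1 (- 2^-1 + r)); [|lra|lra].
rewrite (@total_variationD _ (- 2^-1 + r) 2^-1 (2^-1 - r)); [|lra|lra].
have A1 : (TV (- 2^-1) (- 2^-1 + r)%R h <= (e / 2)%:E)%E.
  by apply: (ACJ_TV_le e2 Hd); rewrite ?JE; lra.
have A2 : (TV (2^-1 - r)%R (2^-1) h <= (e / 2)%:E)%E.
  by apply: (ACJ_TV_le e2 Hd); rewrite ?JE; lra.
have A3 : (TV (- 2^-1 + r)%R (2^-1 - r)%R h <= varJ h)%E.
  by apply: (TV_le_var H); [split; rewrite lte_fin; lra|split; rewrite lte_fin; lra|lra].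
apply: le_trans (leeD A1 (leeD A3 A2)) _.
by rewrite addeCA -EFinD -splitr.
Qed.

End Variation.

Section Tails.
Context {R : realType}.
Implicit Types (f : R -> R) (F : seq R).

(** Finitely many jump times do not accumulate at t, which lets the tail of the
jump sum be the only contribution near t. *)
Lemma avoid_right F (t : R) : exists2 e, 0 < e & forall x, x \in F -> ~~ (t < x < t + e).
Proof.
elim: F => [|y F [e e0 He]]; first by exists 1.
have [ty|yt] := ltP t y; last first.
  exists e => // x; rewrite inE => /predU1P[->|/He//].
  by rewrite ltNge yt.
exists (Num.min e (y - t)); first by rewrite lt_min e0 subr_gt0.
move=> x; rewrite inE => /predU1P[->|/He].
  by rewrite negb_and -!leNgt -lerBrDl ge_min lexx !orbT.
rewrite !negb_and -!leNgt => /orP[->//|h]; apply/orP; right.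
by apply: le_trans h; rewrite lerD2l ge_min lexx.
Qed.

Lemma avoid_left F (t : R) : exists2 e, 0 < e & forall x, x \in F -> ~~ (t - e < x < t).
Proof.
have [e e0 He] := avoid_right [seq - x | x <- F] (- t).
exists e => // x xF; have := He (- x) (map_f _ xF).
by apply: contra => /andP[h1 h2]; apply/andP; split; lra.
Qed.

Lemma tail_right (A : set R) f (C t e : R) : abs_summable A f C -> 0 < e ->
  exists2 d : R, 0 < d & forall F, fin_in A F -> (forall x, x \in F -> t < x < t + d) ->
    \sum_(x <- F) `|f x| <= e.
Proof.
move=> H e0; have [F0 _ H0] := abs_summable_tail H e0.
have [d d0 Hd] := avoid_right F0 t; exists d => // F finF FI; apply: H0 => // x /FI h.
by apply/negP => /Hd; rewrite h.
Qed.

Lemma tail_left (A : set R) f (C t e : R) : abs_summable A f C -> 0 < e ->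
  exists2 d : R, 0 < d & forall F, fin_in A F -> (forall x, x \in F -> t - d < x < t) ->
    \sum_(x <- F) `|f x| <= e.
Proof.
move=> H e0; have [F0 _ H0] := abs_summable_tail H e0.
have [d d0 Hd] := avoid_left F0 t; exists d => // F finF FI; apply: H0 => // x /FI h.
by apply/negP => /Hd; rewrite h.
Qed.

End Tails.

Section ContinuousPart.
Context {R : realType}.
Local Notation TV := (@total_variation R).
Variables (c d : R) (g : @dyn R).
Hypothesis bvg : sBV c%:E d%:E g.
Local Notation I := (oitv c%:E d%:E).

(** The variation of the jump at t, including what is traversed back and forth
in the fast time. *)
Definition fvar (t : R) : R := fine (varJ (g t)).
Definition cp := cpart c%:E (ord g).

Lemma oitvE (x y t : R) : oitv x%:E y%:E t <-> x < t < y.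
Proof. by rewrite /oitv /= !lte_fin; split => [[-> ->]|/andP[]]. Qed.

Lemma sBV_ACJ t : I t -> ACJ (g t).
Proof. by case: bvg => -[_ h _ _] _ _; exact: h. Qed.

Lemma sBV_left t : I t -> dlim t^'- g (g t (- 2^-1)).
Proof. by case: bvg => -[_ _ h _] _ _; exact: h. Qed.

Lemma sBV_right t : I t -> dlim t^'+ g (g t 2^-1).
Proof. by case: bvg => -[_ _ _ h] _ _; exact: h. Qed.

Lemma sBV_llim t : I t -> llim (ord g) t = g t (- 2^-1).
Proof. by move=> It; apply/cvg_lim => //; exact: dlim_ord (sBV_left It). Qed.

Lemma sBV_rlim t : I t -> rlim (ord g) t = g t 2^-1.
Proof. by move=> It; apply/cvg_lim => //; exact: dlim_ord (sBV_right It). Qed.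

Lemma sBV_jump t : I t -> jump (ord g) t = g t 2^-1 - g t (- 2^-1).
Proof. by move=> It; rewrite /jump sBV_llim// sBV_rlim. Qed.

Lemma var_ge0 (a b : \bar R) h : (0 <= var a b h)%E.
Proof. by apply: ereal_sup_ubound; exists [::]; rewrite ?big_ord0//; split. Qed.

Lemma fvar_ge0 t : 0 <= fvar t.
Proof. by rewrite fine_ge0// var_ge0. Qed.

Lemma fvarE t : I t -> fvar t = fine (TV (- 2^-1) (2^-1) (g t)).
Proof. by move=> It; rewrite /fvar varJ_TV//; exact: sBV_ACJ. Qed.

Lemma varJ_fvar t : I t -> varJ (g t) = (fvar t)%:E.
Proof.
move=> It; rewrite /fvar fineK// varJ_TV; last exact: sBV_ACJ.
by apply: (TV_fin (sBV_ACJ It) Jl Jr); lra.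
Qed.

Lemma TVJ_cst (h : R -> R) (k : R) : (forall s, J s -> h s = k) -> TV (- 2^-1) (2^-1) h = 0%E.
Proof.
move=> H; apply/eqP; rewrite eq_le total_variation_ge0 ?andbT; last by lra.
apply: ge_ereal_sup => _ [_ [s [xs /eqP ls] <-] <-]; rewrite lee_fin.
have part : itv_partition (- 2^-1) (2^-1) s by split => //; exact/eqP.
have [H1 _ _ <-] := partition_intervals h part.
rewrite /osc big_seq big1// => K /H1[h1 h2 h3].
by rewrite !H ?subrr ?normr0// JE; lra.
Qed.

Lemma fvar_cts t : I t -> ~ Tdisc c%:E d%:E g t -> fvar t = 0.
Proof.
move=> It nT; rewrite fvarE//.
have [k [H _ _]] : dcontinuous_at g t by apply: contrapT => h; apply: nT.
by rewrite (TVJ_cst H).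
Qed.

Definition jumpmass : R := fine (\esum_(t in Tdisc c%:E d%:E g) varJ (g t)).

Lemma jumpmassE : \esum_(t in Tdisc c%:E d%:E g) varJ (g t) = jumpmass%:E.
Proof.
rewrite /jumpmass fineK// ge0_fin_numE; first by case: bvg.
by apply: esum_ge0 => t _; exact: var_ge0.
Qed.

Lemma fvar_sum F : fin_in I F -> \sum_(t <- F) fvar t <= jumpmass.
Proof.
move=> finF; have finT := fin_in_filter (Tdisc c%:E d%:E g) finF.
have -> : \sum_(t <- F) fvar t = \sum_(t <- [seq x <- F | `[< Tdisc c%:E d%:E g x >]]) fvar t.
  rewrite big_filter (bigID (fun x => `[< Tdisc c%:E d%:E g x >])) /= [X in _ + X]big_seq_cond.
  rewrite [X in _ + X]big1 ?addr0// => x /andP[/finF.2 Ix /asboolPn]; exact: fvar_cts.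
suff : (\esum_(t in Tdisc c%:E d%:E g) (fvar t)%:E <= jumpmass%:E)%E.
  move/(esum_leP _ _ fvar_ge0); apply; apply: fin_inS finT => x [] //.
rewrite -jumpmassE; apply: le_esum => t [It _]; by rewrite varJ_fvar.
Qed.

Lemma fvar_summable : abs_summable I fvar jumpmass.
Proof. by move=> F /fvar_sum; under [in X in _ -> X]eq_bigr do rewrite ger0_norm ?fvar_ge0//. Qed.

Lemma jumpmass_ge0 : 0 <= jumpmass.
Proof. by have := fvar_sum (fin_in_nil I); rewrite big_nil. Qed.

Lemma jump_fvar t : I t -> `|jump (ord g) t| <= fvar t.
Proof.
move=> It; rewrite sBV_jump// fvarE//; apply: (norm_le_TV (sBV_ACJ It) Jl Jr); lra.
Qed.

Lemma jump_summable : abs_summable I (jump (ord g)) jumpmass.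
Proof.
move=> F finF; apply: le_trans (fvar_sum finF); rewrite big_seq [leRHS]big_seq.
by apply: ler_sum => t /finF.2 It; exact: jump_fvar.
Qed.

Lemma oitv_sub x y : c <= x -> y <= d -> oitv x%:E y%:E `<=` I.
Proof. by move=> cx yd t /oitvE h; apply/oitvE; lra. Qed.

Definition SV (x y : R) : R := ssum (oitv x%:E y%:E) fvar.

Lemma SVP x y : c <= x -> y <= d -> is_ssum (oitv x%:E y%:E) fvar (SV x y).
Proof.
by move=> cx yd; apply: ssumP; exact: abs_summableS (oitv_sub cx yd) fvar_summable.
Qed.

Lemma SV_split x y z : c <= x -> x < y -> y < z -> z <= d ->
  SV x z = SV x y + (fvar y + SV y z).
Proof.
move=> cx xy yz zd; apply: is_ssum_uniq (SVP cx zd) _.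
rewrite (_ : oitv x%:E z%:E = oitv x%:E y%:E `|` ([set y] `|` oitv y%:E z%:E)); last first.
  apply/seteqP; split => t.
    move=> /oitvE h; have [ty|yt|->] := ltgtP t y; [left|right;right|right;left] => //; apply/oitvE; lra.
  by move=> [|[->|]]; [|apply/oitvE; lra|]; move=> /oitvE h; apply/oitvE; lra.
apply: is_ssumU.
- apply/seteqP; split => // t [/oitvE h [h1|/oitvE]]; last by lra.
  by move: h; rewrite h1 ltxx andbF.
- by apply: SVP => //; lra.
- apply: is_ssumU; [|exact: is_ssum1|by apply: SVP => //; lra].
  by apply/seteqP; split => // t [-> /oitvE]; rewrite ltxx.
Qed.

Lemma SV_ge0 x y : c <= x -> y <= d -> 0 <= SV x y.
Proof.
move=> cx yd; apply/ler_addgt0Pr => e e0; have [F0 fin0 H0] := SVP cx yd e0.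
have := H0 _ fin0 (fun t => id); have : 0 <= \sum_(t <- F0) fvar t by apply: sumr_ge0 => t _; exact: fvar_ge0.
by rewrite ler_norml; lra.
Qed.

Lemma SV_le x y C : c <= x -> y <= d ->
  (forall F, fin_in I F -> (forall t, t \in F -> x < t < y) -> \sum_(t <- F) fvar t <= C) ->
  SV x y <= C.
Proof.
move=> cx yd H; rewrite -(ger0_norm (SV_ge0 cx yd)); apply: is_ssum_le (SVP cx yd) _ => F finF.
rewrite ger0_norm ?sumr_ge0// => [|t _]; last exact: fvar_ge0.
by apply: H; [exact: fin_inS (oitv_sub cx yd) finF|move=> t /finF.2 /oitvE].
Qed.

(** The jump part is subtracted from the one-sided values, so only the interior
jump sum and the two outer one-sided values remain. *)
Lemma cp_sub x y : c < x -> x < y -> y < d ->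
  cp y - cp x = g y (- 2^-1) - g x 2^-1 - ssum (oitv x%:E y%:E) (jump (ord g)).
Proof.
move=> cx xy yd; have Ix : I x by apply/oitvE; lra.
have Iy : I y by apply/oitvE; lra.
have ss u v : c <= u -> v <= d -> is_ssum (oitv u%:E v%:E) (jump (ord g)) (ssum (oitv u%:E v%:E) (jump (ord g))).
  by move=> cu vd; apply: ssumP; exact: abs_summableS (oitv_sub cu vd) jump_summable.
rewrite /cp /cpart !sBV_llim//.
have -> : ssum (oitv c%:E y%:E) (jump (ord g)) = ssum (oitv c%:E x%:E) (jump (ord g)) +
    (jump (ord g) x + ssum (oitv x%:E y%:E) (jump (ord g))).
  apply: is_ssum_uniq (ss c y _ _) _; [by []|lra|].
  rewrite (_ : oitv c%:E y%:E = oitv c%:E x%:E `|` ([set x] `|` oitv x%:E y%:E)); last first.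
    apply/seteqP; split => t.
      move=> /oitvE h; have [ty|yt|->] := ltgtP t x; [left|right;right|right;left] => //; apply/oitvE; lra.
    by move=> [|[->|]]; [|apply/oitvE; lra|]; move=> /oitvE h; apply/oitvE; lra.
  apply: is_ssumU.
  - apply/seteqP; split => // t [/oitvE h [h1|/oitvE]]; last by lra.
    by move: h; rewrite h1 ltxx andbF.
  - by apply: ss => //; lra.
  - apply: is_ssumU; [|exact: is_ssum1|by apply: ss => //; lra].
    by apply/seteqP; split => // t [-> /oitvE]; rewrite ltxx.
by rewrite sBV_jump//; ring.
Qed.

Lemma ssum_jump_le x y : c <= x -> y <= d ->
  `|ssum (oitv x%:E y%:E) (jump (ord g))| <= SV x y.
Proof.
move=> cx yd.
have AS := abs_summableS (oitv_sub cx yd) jump_summable.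
apply: is_ssum_le (ssumP AS) _ => F finF.
apply: (@le_trans _ _ (\sum_(t <- F) fvar t)).
  apply: le_trans (ler_norm_sum _ _ _) _; rewrite big_seq [leRHS]big_seq.
  by apply: ler_sum => t /finF.2 /(oitv_sub cx yd) It; exact: jump_fvar.
apply/ler_addgt0Pr => e e0; have [F0 fin0 H0] := SVP cx yd e0.
have fc := fin_in_cat fin0 finF.
have := H0 _ fc (fun t tF => ltac:(by rewrite mem_undup mem_cat tF)).
have : \sum_(t <- F) fvar t <= \sum_(t <- undup (F0 ++ F)) fvar t.
  apply: sum_subset; [exact: fvar_ge0|exact: finF.1|exact: undup_uniq|].
  by move=> t tF; rewrite mem_undup mem_cat tF orbT.
by rewrite ler_norml; lra.
Qed.

Lemma cp_sub_le x y : c < x -> x < y -> y < d ->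
  `|cp y - cp x| <= `|g y (- 2^-1) - g x 2^-1| + SV x y.
Proof.
move=> cx xy yd; rewrite cp_sub//; apply: le_trans (ler_normB _ _) _.
by rewrite lerD2l; apply: ssum_jump_le; lra.
Qed.

(** Near t the increment of the continuous part is the increment of g, which tends
to 0 off the fibre over t, minus a tail of the jump sum. *)
Lemma cp_osc : one_sided_cts c%:E d%:E cp.
Proof.
move=> t It; have /oitvE/andP[ct td] := It; split; apply/cvgrPdist_le => e e0; have e2 : 0 < e / 2 by lra.
- have [d1 d10 H1] := tail_left t fvar_summable e2.
  have [d2 d20 H2] := near_left_ex (sBV_left It e2).
  apply: (@ex_near_left _ _ _ (Num.min (t - c) (Num.min d1 d2))).
    by rewrite !lt_min d10 d20 subr_gt0 ct.
  move=> x /andP[+ xt]; rewrite ltrBlDl -ltrBlDr !lt_min => /and3P[cx x1 x2].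
  apply: le_trans (cp_sub_le _ xt td) _; first by lra.
  have : SV x t <= e / 2.
    apply: SV_le; [lra|lra|move=> F finF HF].
    have := H1 F finF (fun y yF => ltac:(by have := HF y yF; lra)).
    by under eq_bigr do rewrite ger0_norm ?fvar_ge0//.
  have : `|g x 2^-1 - g t (- 2^-1)| <= e / 2 by apply: H2; [lra|exact: Jr].
  by rewrite distrC; lra.
- have [d1 d10 H1] := tail_right t fvar_summable e2.
  have [d2 d20 H2] := near_right_ex (sBV_right It e2).
  apply: (@ex_near_right _ _ _ (Num.min (d - t) (Num.min d1 d2))).
    by rewrite !lt_min d10 d20 subr_gt0 td.
  move=> x /andP[tx]; rewrite -ltrBlDl !lt_min => /and3P[cx x1 x2]; rewrite distrC.
  apply: le_trans (cp_sub_le ct tx _) _; first by lra.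
  have : SV t x <= e / 2.
    apply: SV_le; [lra|lra|move=> F finF HF].
    have := H1 F finF (fun y yF => ltac:(by have := HF y yF; lra)).
    by under eq_bigr do rewrite ger0_norm ?fvar_ge0//.
  have : `|g x (- 2^-1) - g t 2^-1| <= e / 2 by apply: H2; [lra|exact: Jl].
  by lra.
Qed.

Lemma cp_variation x y s : c < x -> y < d -> itv_partition x y s ->
  variation x y cp s <= \sum_(k < size s) `|llim (ord g) (x :: s)`_k.+1 - rlim (ord g) (x :: s)`_k| + SV x y.
Proof.
elim: s x => [|z s IH] x cx yd.
  move=> /itv_partition_nil E; rewrite -{}E in yd *; rewrite variation_nil big_ord0 add0r.
  by apply: SV_ge0; lra.
move=> part; have [xz] : x < z /\ itv_partition z y s.
  by case: part => /= /andP[xz zs] l; split.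
move=> zpart; have zy := itv_partition_le zpart; have zd := le_lt_trans zy yd.
have {}IH := IH z (lt_trans cx xz) yd zpart.
have h1 := cp_sub_le cx xz (le_lt_trans zy yd).
rewrite big_ord_recl /= -cat1s (variation_cat _ (ltW xz) zy)//; last exact: itv_partition1.
rewrite {1}/variation big_nat1 /=.
rewrite sBV_llim ?sBV_rlim; [|by apply/oitvE; lra|by apply/oitvE; lra].
have : SV x z + SV z y <= SV x y; last by lra.
move: zy; rewrite le_eqVlt => /predU1P[<-|zy]; last by rewrite (@SV_split x z y); [have := fvar_ge0 z; lra|lra|lra|lra|lra].
by rewrite [X in _ + X <= _](_ : _ = 0) ?addr0//; apply: is_ssum_uniq (SVP _ _) (is_ssum0 _); [lra|lra|move=> t /oitvE; lra].
Qed.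

Lemma cp_TV_le x y : I x -> I y -> x <= y ->
  (TV x y cp <= var c%:E d%:E (ord g) + jumpmass%:E)%E.
Proof.
move=> /oitvE Ix /oitvE Iy xy; apply: ge_ereal_sup => _ [_ [s xys <-] <-].
have cx : c < x by lra. have yd : y < d by lra.
apply: le_trans (_ : ((\sum_(k < size s) `|llim (ord g) (x :: s)`_k.+1 - rlim (ord g) (x :: s)`_k| + SV x y)%:E <= _)%E).
  by rewrite lee_fin; exact: cp_variation.
rewrite EFinD; apply: leeD; last first.
  rewrite lee_fin; apply: SV_le; [lra|lra|by move=> F finF _; exact: fvar_sum].
have [sp _] := xys.
apply: ereal_sup_ubound; exists (x :: s) => //; split => // t ts; apply/oitvE.
have [tx ty] : x <= t /\ t <= y; last by lra.
split.
  move: ts; rewrite inE => /predU1P[->//|ts].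
  by have /allP/(_ _ ts) := order_path_min lt_trans sp; exact: ltW.
by have [k ks <-] := nthP y ts; exact: (@itv_partition_nth_le _ _ x y s).
Qed.

Lemma cp_BV x y : I x -> I y -> x <= y -> bounded_variation x y cp.
Proof.
move=> Ix Iy xy; apply: TV_fin_BV => //; apply: le_lt_trans (cp_TV_le Ix Iy xy) _.
by rewrite lte_add_pinfty ?ltry//; case: bvg => _ [].
Qed.

Definition contmass : R := fine (var c%:E d%:E cp).

Lemma contmassE : var c%:E d%:E cp = contmass%:E.
Proof.
rewrite /contmass fineK// ge0_fin_numE ?var_ge0//.
apply: le_lt_trans (_ : (_ <= var c%:E d%:E (ord g) + jumpmass%:E)%E) _; last first.
  by rewrite lte_add_pinfty ?ltry//; case: bvg => _ [].
apply: (var_le_TV cp_osc); last exact: cp_TV_le.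
by rewrite adde_ge0 ?var_ge0// lee_fin jumpmass_ge0.
Qed.

Lemma cp_TV_contmass x y : I x -> I y -> x <= y -> fine (TV x y cp) <= contmass.
Proof.
move=> Ix Iy xy; rewrite -lee_fin -contmassE fineK; first exact: TV_le_var cp_osc Ix Iy xy.
by apply/bounded_variationP => //; exact: cp_BV.
Qed.

End ContinuousPart.

(** * Controls *)

Section Control.
Context {R : realType}.
Local Notation pt := (R *lexi[ring_display] R)%type.
Local Notation TV := (@total_variation R).
Implicit Types (a b : \bar R) (g w : @dyn R).

(** The increments of g along the lexicographic line are dominated by those of w,
which is absolutely continuous along the fibres and continuous from fibre to
fibre, and whose total increment is at most K. *)
Definition control a b g w (K : R) : Prop :=
  [/\ forall P Q : pt, oitv a b P.1 -> oitv a b Q.1 -> J P.2 -> J Q.2 -> P <= Q ->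
        `|g Q.1 Q.2 - g P.1 P.2| <= w Q.1 Q.2 - w P.1 P.2,
      forall t, oitv a b t -> dlim t^'- w (w t (- 2^-1)) /\ dlim t^'+ w (w t 2^-1),
      forall t, oitv a b t -> ACJ (w t) &
      forall P Q : pt, oitv a b P.1 -> oitv a b Q.1 -> J P.2 -> J Q.2 -> P <= Q ->
        w Q.1 Q.2 - w P.1 P.2 <= K].

Section SBVControl.
Variables (c d : R) (g : @dyn R).
Hypothesis cd : c < d.
Hypothesis bvg : sBV c%:E d%:E g.
Local Notation I := (oitv c%:E d%:E).
Local Notation h := (cp c g).

Let m := (c + d) / 2.

Let Im : I m. Proof. by move: cd => cd0; apply/oitvE; rewrite /m; lra. Qed.

(** Measured from the midpoint, with sign, because [total_variation] lives on
closed segments, which have to stay inside the open interval. *)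
Definition contvar (t : R) : R := if m <= t then fine (TV m t h) else - fine (TV t m h).

Let TVfin x y : I x -> I y -> x <= y -> TV x y h \is a fin_num.
Proof. by move=> Ix Iy xy; apply/bounded_variationP => //; exact: (cp_BV bvg). Qed.

Let TVadd x y z : I x -> I z -> x <= y -> y <= z ->
  fine (TV x z h) = fine (TV x y h) + fine (TV y z h).
Proof.
move=> Ix Iz xy yz; have Iy : I y by apply: oitv_le Ix Iz _; rewrite xy.
by rewrite (total_variationD _ xy yz) fineD// TVfin.
Qed.

Let TVge0 x y : x <= y -> 0 <= fine (TV x y h).
Proof. by move=> xy; rewrite fine_ge0// total_variation_ge0. Qed.

Lemma contvar_sub x y : I x -> I y -> x <= y -> contvar y - contvar x = fine (TV x y h).
Proof.
move=> Ix Iy xy.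
have subl (p q r : R) : r = p + q -> r - p = q by move=> ->; rewrite addrC addKr.
have subr (p q r : R) : r = p + q -> r - q = p by move=> ->; rewrite addrK.
rewrite /contvar; case: (leP m x) => mx; case: (leP m y) => my.
- exact: (subl _ _ _ (TVadd Im Iy mx xy)).
- by have := le_lt_trans (le_trans mx xy) my; rewrite ltxx.
- by rewrite opprK addrC; apply/esym; exact: (TVadd Ix Iy (ltW mx) my).
- by rewrite opprK addrC; exact: (subr _ _ _ (TVadd Ix Im xy (ltW my))).
Qed.

(** The variation function of a continuous function is continuous. *)
Lemma contvar_right t : I t -> contvar x @[x --> t^'+] --> contvar t.
Proof.
move=> It; have [t' tt' It'] := oitv_right It.
have := @total_variation_right_continuous R t t' t h (lexx t) tt' (cp_osc bvg It).2
   (cp_BV bvg It It' (ltW tt')).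
rewrite total_variationxx /= => H; apply/cvgrPdist_le => e e0.
have [r r0 Hr] := near_right_ex ((cvgrPdist_le _ _).1 H e e0).
apply: (@ex_near_right _ _ _ (Num.min r (t' - t))); first by rewrite lt_min r0 subr_gt0.
move=> x /andP[tx]; rewrite -ltrBlDl lt_min => /andP[x1 x2].
have Ix : I x by apply: oitv_le It It' _; lra.
have := Hr x (ltac:(by lra)); rewrite sub0r normrN /= distrC.
by rewrite contvar_sub// ltW.
Qed.

Lemma contvar_left t : I t -> contvar x @[x --> t^'-] --> contvar t.
Proof.
move=> It; have [t' tt' It'] := oitv_left It.
have := @total_variation_left_continuous R t' t t h tt' (lexx t) (cp_osc bvg It).1
   (cp_BV bvg It' It (ltW tt')).
move=> H; apply/cvgrPdist_le => e e0.
have [r r0 Hr] := near_left_ex ((cvgrPdist_le _ _).1 H e e0).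
apply: (@ex_near_left _ _ _ (Num.min r (t - t'))); first by rewrite lt_min r0 subr_gt0.
move=> x /andP[+ tx]; rewrite ltrBlDl -ltrBlDr lt_min => /andP[x1 x2].
have Ix : I x by apply: oitv_le It' It _; lra.
have := Hr x (ltac:(by lra)); rewrite /= contvar_sub ?(ltW tx)//.
by rewrite (@TVadd t' x t)//; [rewrite addrC addKr|lra|lra].
Qed.

(** The three parts of the variation up to the point (t, s): of the continuous
part up to t, of the jumps before t, and of the jump at t up to s. *)
Definition ctrl : @dyn R := fun t s =>
  contvar t + SV g c t + fine (TV (- 2^-1) s (g t)).

Let ach t (It : I t) := sBV_ACJ bvg It.

Let FT t s : R := fine (TV (- 2^-1) s (g t)).

Let FT0 t s : J s -> 0 <= FT t s.
Proof. by rewrite JE => /andP[h1 _]; rewrite fine_ge0// total_variation_ge0. Qed.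

Let FTle t s : I t -> J s -> FT t s <= fvar g t.
Proof.
move=> It Js; rewrite (fvarE bvg It); have := Js; rewrite JE => /andP[h1 h2].
rewrite -subr_ge0 (TV_sub (ach It) Js Jr h2) fine_ge0//; exact: total_variation_ge0.
Qed.

Let ctrl_same t s s' : ctrl t s' - ctrl t s = FT t s' - FT t s.
Proof. by rewrite /ctrl /FT; ring. Qed.

Let ctrl_diff t s t' s' : I t -> I t' -> t < t' ->
  ctrl t' s' - ctrl t s = fine (TV t t' h) + SV g t t' + (fvar g t - FT t s) + FT t' s'.
Proof.
move=> It It' tt'; have /oitvE h1 := It; have /oitvE h2 := It'.
rewrite /ctrl -(contvar_sub It It' (ltW tt')) (@SV_split _ _ _ _ bvg c t t'); [rewrite /FT|lra..].
move: (fine (TV _ _ (g t'))) (fine (TV _ _ (g t))) (contvar t') (contvar t) (fvar g t) (SV g t t') (SV g c t) => A1 A2 A3 A4 A5 A6 A7.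
ring.
Qed.

Lemma SV_mass x y F : c <= x -> y <= d -> fin_in I F -> (forall t, t \in F -> ~~ (x < t < y)) ->
  SV g x y + \sum_(t <- F) fvar g t <= jumpmass c d g.
Proof.
move=> cx yd finF HF; rewrite -lerBrDr; apply: (SV_le bvg cx yd) => F' finF' HF'.
rewrite lerBrDr -big_cat /=; apply: (fvar_sum bvg); split; last first.
  by move=> t; rewrite mem_cat => /orP[/finF'.2|/finF.2].
rewrite cat_uniq finF'.1 finF.1 andbT /=; apply/hasPn => t /HF; apply: contra => /HF' //.
Qed.

(** The jump sum is continuous from fibre to fibre because its tails are small.  In
the total increment the jump at the time of Q is counted along its fibre and
the earlier ones in the sum, so that no jump is counted twice ([SV_mass]). *)
Lemma sBV_ctrl : control c%:E d%:E g ctrl (contmass c d g + jumpmass c d g).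
Proof.
have cm0 : 0 <= contmass c d g by rewrite fine_ge0// var_ge0.
have jm0 : 0 <= jumpmass c d g := jumpmass_ge0 bvg.
split.
- move=> [t s] [t' s'] /= It It' Js Js'; rewrite leptE /= => /orP[tt'|/andP[/eqP <- ss']]; last first.
    by rewrite ctrl_same /FT TV_sub//; [exact: norm_le_TV (ach It) _ _ _|exact: ach].
  rewrite ctrl_diff//; have /oitvE h1 := It; have /oitvE h2 := It'.
  have J1 := Js; have J2 := Js'; rewrite !JE in J1 J2.
  have e1 : `|g t' s' - g t' (- 2^-1)| <= FT t' s'.
    by apply: norm_le_TV => //; [exact: ach|exact: Jl|lra].
  have e2 : `|g t 2^-1 - g t s| <= fvar g t - FT t s.
    rewrite (fvarE bvg It) /FT (TV_sub (ach It) Js Jr); last by lra.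
    by apply: norm_le_TV => //; [exact: ach|exact: Jr|lra].
  have e3 : `|h t' - h t| <= fine (TV t t' h).
    by rewrite -lee_fin fineK ?TVfin ?(ltW tt')//; apply: total_variation_ge; exact: ltW.
  have e4 := @ssum_jump_le _ _ _ _ bvg t t' (ltac:(by lra)) (ltac:(by lra)).
  have e5 := @cp_sub _ _ _ _ bvg t t' (ltac:(by lra)) tt' (ltac:(by lra)).
  move: e1 e2 e3 e4; rewrite e5 !ler_norml.
  move: (FT t' s') (FT t s) (fvar g t) (fine (TV t t' h)) (SV g t t') (ssum _ _) => A1 A2 A3 A4 A5 A6; lra.
- move=> t It; have /oitvE h0 := It; split => e e0; have e4 : 0 < e / 4 by lra.
    have [d1 d10 H1] := tail_left t (fvar_summable bvg) e4.
    have [d2 d20 H2] := near_left_ex ((cvgrPdist_le _ _).1 (contvar_left It) _ e4).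
    apply: (@ex_near_left _ _ _ (Num.min (t - c) (Num.min d1 d2))).
      by rewrite !lt_min d10 d20 subr_gt0; lra.
    move=> x /andP[+ xt]; rewrite ltrBlDl -ltrBlDr !lt_min => /and3P[cx x1 x2] s Js.
    have Ix : I x by apply/oitvE; lra.
    rewrite distrC ctrl_diff//.
    have := H2 x (ltac:(by lra)); rewrite contvar_sub ?(ltW xt)//.
    have sv : SV g x t <= e / 4.
      apply: (SV_le bvg); [lra|lra|move=> F finF HF].
      have := H1 F finF (fun y yF => ltac:(by have := HF y yF; lra)).
      by under eq_bigr do rewrite ger0_norm ?fvar_ge0//.
    have fv : fvar g x <= e / 4.
      have finx : fin_in I [:: x] by split => // y; rewrite inE => /eqP ->.
      have := H1 _ finx (fun y yF => ltac:(by move: yF; rewrite inE => /eqP ->; lra)).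
      by rewrite big_seq1 ger0_norm ?fvar_ge0.
    have z : FT t (- 2^-1) = 0 by rewrite /FT total_variationxx.
    have := FTle Ix Js; have := FT0 x Js; have := @SV_ge0 _ _ _ _ bvg x t (ltac:(by lra)) (ltac:(by lra)).
    rewrite z; move=> f1 f2 f3; have := TVge0 (ltW xt); rewrite !ler_norml.
    move: f1 f2 f3 fv sv; move: (FT x s) (fvar g x) (fine (TV x t h)) (SV g x t) => A1 A2 A3 A4; lra.
  have [d1 d10 H1] := tail_right t (fvar_summable bvg) e4.
  have [d2 d20 H2] := near_right_ex ((cvgrPdist_le _ _).1 (contvar_right It) _ e4).
  apply: (@ex_near_right _ _ _ (Num.min (d - t) (Num.min d1 d2))).
    by rewrite !lt_min d10 d20 subr_gt0; lra.
  move=> x /andP[tx]; rewrite -ltrBlDl !lt_min => /and3P[cx x1 x2] s Js.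
  have Ix : I x by apply/oitvE; lra.
  rewrite ctrl_diff//.
  have := H2 x (ltac:(by lra)); rewrite distrC contvar_sub ?(ltW tx)//.
  have sv : SV g t x <= e / 4.
    apply: (SV_le bvg); [lra|lra|move=> F finF HF].
    have := H1 F finF (fun y yF => ltac:(by have := HF y yF; lra)).
    by under eq_bigr do rewrite ger0_norm ?fvar_ge0//.
  have fv : fvar g x <= e / 4.
    have finx : fin_in I [:: x] by split => // y; rewrite inE => /eqP ->.
    have := H1 _ finx (fun y yF => ltac:(by move: yF; rewrite inE => /eqP ->; lra)).
    by rewrite big_seq1 ger0_norm ?fvar_ge0.
  have z : FT t 2^-1 = fvar g t by rewrite /FT (fvarE bvg It).
  have := FTle Ix Js; have := FT0 x Js; have := @SV_ge0 _ _ _ _ bvg t x (ltac:(by lra)) (ltac:(by lra)).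
  rewrite z; move=> f1 f2 f3; have := TVge0 (ltW tx); rewrite !ler_norml.
  move: f1 f2 f3 fv sv; move: (fvar g t) (FT x s) (fvar g x) (fine (TV t x h)) (SV g t x) => A0 A1 A2 A3 A4; lra.
- move=> t It e e0; have e2 : 0 < e / 2 by lra.
  have [r r0 Hr] := ACJ_TV (ach It) e2; exists r => // p Jp op lp.
  apply: le_lt_trans (_ : _ <= e / 2) _; last by lra.
  apply: le_trans (Hr p Jp op lp); rewrite big_seq [leRHS]big_seq; apply: ler_sum => K /Jp[J1 J2 K12].
  by rewrite ctrl_same /FT TV_sub ?ger0_norm//; [rewrite fine_ge0// total_variation_ge0|exact: ach].
- move=> [t s] [t' s'] /= It It' Js Js'; rewrite leptE /= => /orP[tt'|/andP[/eqP <- ss']]; last first.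
    rewrite ctrl_same; have := FTle It Js'; have := FT0 t Js.
    have finx : fin_in I [:: t] by split => // y; rewrite inE => /eqP ->.
    have := fvar_sum bvg finx; rewrite big_seq1.
    move: cm0 jm0; move: (contmass c d g) (jumpmass c d g) (fvar g t) (FT t s) (FT t s') => A1 A2 A3 A4 A5; lra.
  rewrite ctrl_diff//; have /oitvE h1 := It; have /oitvE h2 := It'.
  have := cp_TV_contmass bvg It It' (ltW tt').
  have fin2 : fin_in I [:: t; t'].
    split; first by rewrite /= inE lt_eqF.
    by move=> y; rewrite !inE => /orP[/eqP ->|/eqP ->].
  have := @SV_mass t t' _ (ltac:(by lra)) (ltac:(by lra)) fin2
    (fun y yF => ltac:(by move: yF; rewrite !inE => /orP[/eqP ->|/eqP ->]; rewrite ltxx ?andbF)).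
  rewrite big_cons big_seq1; have := FTle It' Js'; have := FT0 t Js.
  move: cm0 jm0; move: (contmass c d g) (jumpmass c d g) (fvar g t) (fvar g t') (FT t s) (FT t' s') (SV g t t') (fine (TV t t' h)) => A1 A2 A3 A4 A5 A6 A7 A8; lra.
Qed.

End SBVControl.

Lemma sBV_control (c d : R) g : c < d -> sBV c%:E d%:E g ->
  exists w, control c%:E d%:E g w (contmass c d g + jumpmass c d g).
Proof. by move=> cd bvg; exists (ctrl c d g); exact: sBV_ctrl. Qed.

End Control.

Section OfControl.
Context {R : realType}.
Local Notation pt := (R *lexi[ring_display] R)%type.
Local Notation TV := (@total_variation R).
Implicit Types (g w : @dyn R).

Lemma ACJ_regJ (h : R -> R) : ACJ h -> regulatedJ h.
Proof.
move=> ach; have osc := ACJ_osc ach.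
have [|_ hr hl] := (continuous_within_itvP h _).1 (ACJ_within ach); first by lra.
have [M [_ HM]] := compact_bounded (continuous_compact (ACJ_within ach) (@segment_compact _ _ _)).
split.
- exists (M + 1) => t [t1 t2]; apply: HM; first by rewrite ltrDl.
  by exists t => //; move: t1 t2; rewrite !lte_fin /= in_itv /=; lra.
- by move=> t /osc[_ h1]; apply/cvg_ex; eexists; exact: h1.
- by move=> t /osc[h1 _]; apply/cvg_ex; eexists; exact: h1.
- by apply/cvg_ex; eexists; exact: hr.
- by apply/cvg_ex; eexists; exact: hl.
Qed.

Section Fixed.
Variables (a b : \bar R) (g w : @dyn R) (K : R).
Hypothesis ctl : control a b g w K.

Lemma ctl_le t s t' s' : oitv a b t -> oitv a b t' -> J s -> J s' ->
  ((t, s) : pt) <= (t', s') -> `|g t' s' - g t s| <= w t' s' - w t s.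
Proof. by case: ctl => H _ _ _ ot ot' Js Js' PQ; exact: (H (t, s) (t', s')). Qed.

Lemma ctl_mono t s t' s' : oitv a b t -> oitv a b t' -> J s -> J s' ->
  ((t, s) : pt) <= (t', s') -> w t s <= w t' s'.
Proof.
move=> ot ot' Js Js' PQ; rewrite -subr_ge0; apply: le_trans (ctl_le ot ot' Js Js' PQ).
exact: normr_ge0.
Qed.

Lemma ctl_mass t s t' s' : oitv a b t -> oitv a b t' -> J s -> J s' ->
  ((t, s) : pt) <= (t', s') -> w t' s' - w t s <= K.
Proof. by case: ctl => _ _ _ H ot ot' Js Js' PQ; exact: (H (t, s) (t', s')). Qed.

Lemma pt_lt (t t' s s' : R) : t < t' -> ((t, s) : pt) <= (t', s').
Proof. by rewrite leptE /= => ->. Qed.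

Lemma pt_col (t s s' : R) : s <= s' -> ((t, s) : pt) <= (t, s').
Proof. by rewrite leptE /= eqxx => ->; rewrite orbT. Qed.

(** The squeeze by the control carries its continuity over to g. *)
Lemma ctl_left t : oitv a b t -> dlim t^'- g (g t (- 2^-1)).
Proof.
move=> ot e e0; case: ctl => _ /(_ t ot)[+ _] _ _ => /(_ e e0) /near_left_ex[r r0 Hr].
have [t' t't ot'] := oitv_left ot.
apply: (@ex_near_left _ _ _ (Num.min r (t - t'))); first by rewrite lt_min r0 subr_gt0.
move=> x /andP[+ xt]; rewrite ltrBlDl -ltrBlDr lt_min => /andP[x1 x2] s Js.
have ox : oitv a b x by apply: oitv_le ot' ot _; lra.
have := Hr x (ltac:(by lra)) s Js; rewrite distrC => h1.
rewrite distrC; apply: le_trans (ctl_le ox ot Js Jl (pt_lt _ _ xt)) _.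
by move: h1; rewrite ler_norml; lra.
Qed.

Lemma ctl_right t : oitv a b t -> dlim t^'+ g (g t 2^-1).
Proof.
move=> ot e e0; case: ctl => _ /(_ t ot)[_ +] _ _ => /(_ e e0) /near_right_ex[r r0 Hr].
have [t' t't ot'] := oitv_right ot.
apply: (@ex_near_right _ _ _ (Num.min r (t' - t))); first by rewrite lt_min r0 subr_gt0.
move=> x /andP[tx]; rewrite -ltrBlDl lt_min => /andP[x1 x2] s Js.
have ox : oitv a b x by apply: oitv_le ot ot' _; lra.
have := Hr x (ltac:(by lra)) s Js => h1.
apply: le_trans (ctl_le ot ox Jr Js (pt_lt _ _ tx)) _.
by move: h1; rewrite ler_norml; lra.
Qed.

Lemma ctl_ACJ t : oitv a b t -> ACJ (g t).
Proof.
move=> ot e e0; case: ctl => _ _ /(_ t ot e e0)[d d0 Hd] _; exists d => // p Jp op lp.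
apply: le_lt_trans (Hd p Jp op lp); rewrite big_seq [leRHS]big_seq.
apply: ler_sum => k /Jp[J1 J2 k12]; apply: le_trans (ler_norm _).
exact: ctl_le (pt_col _ k12).
Qed.

Lemma ctl_ldG : ldG a b g.
Proof.
split => t ot; first by apply: ACJ_regJ; exact: ctl_ACJ.
  by exists (g t 2^-1); exact: ctl_right.
by exists (g t (- 2^-1)); exact: ctl_left.
Qed.

Lemma ctl_bounded t0 : oitv a b t0 -> forall t s, oitv a b t -> J s -> `|g t s - g t0 0| <= K.
Proof.
move=> o0 t s ot Js; case: (leP ((t0, 0) : pt) (t, s)) => h.
  exact: le_trans (ctl_le o0 ot J0 Js h) (ctl_mass o0 ot J0 Js h).
rewrite distrC; exact: le_trans (ctl_le ot o0 Js J0 (ltW h)) (ctl_mass ot o0 Js J0 (ltW h)).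
Qed.

(** A bounded monotone function has a limit at the end of the interval, so g is
a Cauchy function there. *)
Lemma ctl_osc_lb t0 (e : R) : oitv a b t0 -> 0 < e -> exists2 t1, oitv a b t1 &
  forall t s t' s', oitv a b t -> oitv a b t' -> t < t1 -> t' < t1 -> J s -> J s' ->
    `|g t s - g t' s'| <= e.
Proof.
move=> o0 e0; pose X := [set w t 0 | t in oitv a b].
have X0 : X !=set0 by exists (w t0 0), t0.
have lX : has_lbound X.
  exists (w t0 0 - K) => _ [t ot <-]; case: (leP ((t0, 0) : pt) (t, 0)) => h.
    have := ctl_mono o0 ot J0 J0 h; have := ctl_mass o0 o0 J0 J0 (lexx _); lra.
  have := ctl_mass ot o0 J0 J0 (ltW h); lra.
have [_ [t1 o1' <-] Ht1] := inf_adherent e0 (conj X0 lX).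
exists t1 => // t s t' s' ot ot' tt1 t't1 Js Js'.
have lb x r : oitv a b x -> J r -> inf X <= w x r.
  move=> ox Jr'; have [y yx oy] := oitv_left ox.
  apply: le_trans (ctl_mono oy ox J0 Jr' (pt_lt _ _ yx)); apply: inf_lbound => //; by exists y.
have ub x r : oitv a b x -> J r -> x < t1 -> w x r <= w t1 0.
  by move=> ox Jr' xt1; exact: (ctl_mono ox o1' Jr' J0 (pt_lt _ _ xt1)).
have := lb t s ot Js; have := lb t' s' ot' Js'; have := ub t s ot Js tt1; have := ub t' s' ot' Js' t't1.
case: (leP ((t, s) : pt) (t', s')) => h.
  have := ctl_le ot ot' Js Js' h; rewrite distrC; lra.
have := ctl_le ot' ot Js' Js (ltW h); lra.
Qed.

Lemma ctl_osc_ub t0 (e : R) : oitv a b t0 -> 0 < e -> exists2 t1, oitv a b t1 &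
  forall t s t' s', oitv a b t -> oitv a b t' -> t1 < t -> t1 < t' -> J s -> J s' ->
    `|g t s - g t' s'| <= e.
Proof.
move=> o0 e0; pose X := [set w t 0 | t in oitv a b].
have X0 : X !=set0 by exists (w t0 0), t0.
have lX : has_ubound X.
  exists (w t0 0 + K) => _ [t ot <-]; case: (leP ((t, 0) : pt) (t0, 0)) => h.
    have := ctl_mono ot o0 J0 J0 h; have := ctl_mass o0 o0 J0 J0 (lexx _); lra.
  have := ctl_mass o0 ot J0 J0 (ltW h); lra.
have [_ [t1 o1' <-] Ht1] := sup_adherent e0 (conj X0 lX).
exists t1 => // t s t' s' ot ot' tt1 t't1 Js Js'.
have lb x r : oitv a b x -> J r -> w x r <= sup X.
  move=> ox Jr'; have [y yx oy] := oitv_right ox.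
  apply: (le_trans (ctl_mono ox oy Jr' J0 (pt_lt _ _ yx))); apply: ub_le_sup => //; by exists y.
have ub x r : oitv a b x -> J r -> t1 < x -> w t1 0 <= w x r.
  by move=> ox Jr' xt1; exact: (ctl_mono o1' ox J0 Jr' (pt_lt _ _ xt1)).
have := lb t s ot Js; have := lb t' s' ot' Js'; have := ub t s ot Js tt1; have := ub t' s' ot' Js' t't1.
case: (leP ((t, s) : pt) (t', s')) => h.
  have := ctl_le ot ot' Js Js' h; rewrite distrC; lra.
have := ctl_le ot' ot Js' Js (ltW h); lra.
Qed.

End Fixed.

Lemma dlim_cauchy (F : set_system R) {FF : ProperFilter F} g :
  (forall e : R, 0 < e -> exists2 t1, True & \forall t \near F, forall s, J s -> `|g t s - g t1 0| <= e) ->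
  exists l, dlim F g l.
Proof.
move=> H.
have cv : cvg (ord g x @[x --> F]).
  apply/cauchy_cvgP; apply: cauchy_exP => e e0; have e2 : 0 < e / 2 by lra.
  have [t1 _ Ht1] := H _ e2; exists (g t1 0).
  apply: filterS Ht1 => t Ht; rewrite /ball /= distrC.
  by apply: le_lt_trans (Ht 0 J0) _; lra.
exists (lim (ord g x @[x --> F])) => e e0; have e4 : 0 < e / 4 by lra.
have [t1 _ Ht1] := H _ e4.
have Hl := (cvgrPdist_le _ _).1 cv _ e4.
have h0 : `|lim (ord g x @[x --> F]) - g t1 0| <= e / 2.
  have [t [h1 h2]] := filter_ex (filterI (Hl _) Ht1).
  have := h2 0 J0; move: h1; rewrite /ord; set l := lim _; rewrite !ler_norml; lra.
apply: filterS Ht1 => t Ht s Js; have := Ht s Js; move: h0; set l := lim _; rewrite !ler_norml; lra.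
Qed.

Section RealItv.
Variables (c d : R) (g w : @dyn R) (K : R).
Hypothesis cd : c < d.
Hypothesis ctl : control c%:E d%:E g w K.
Local Notation I := (oitv c%:E d%:E).

Let Im : I ((c + d) / 2).
Proof. by move: cd => cd0; apply/oitvE; lra. Qed.

Let K0 : 0 <= K.
Proof. by have := ctl_mass ctl Im Im J0 J0 (lexx _); rewrite subrr. Qed.

Lemma ctl_sG : sG c%:E d%:E g.
Proof.
split; [|exact: ctl_ACJ ctl|exact: ctl_left ctl|exact: ctl_right ctl].
have [h1 h2 h3] := ctl_ldG ctl; split => //.
- apply: (@dlim_cauchy c^'+) => e e0; have [t1 It1 Ht1] := ctl_osc_lb ctl Im e0.
  have /oitvE h := It1; exists ((c + t1) / 2) => //.
  apply: (@ex_near_right _ _ _ (t1 - c)); first by lra.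
  move=> x hx s Js; apply: Ht1; [apply/oitvE; lra|apply/oitvE; lra|lra|lra|exact: Js|exact: J0].
- apply: (@dlim_cauchy d^'-) => e e0; have [t1 It1 Ht1] := ctl_osc_ub ctl Im e0.
  have /oitvE h := It1; exists ((d + t1) / 2) => //.
  apply: (@ex_near_left _ _ _ (d - t1)); first by lra.
  move=> x hx s Js; apply: Ht1; [apply/oitvE; lra|apply/oitvE; lra|lra|lra|exact: Js|exact: J0].
Qed.

Let llimE t : I t -> llim (ord g) t = g t (- 2^-1).
Proof. by move=> It; apply/cvg_lim => //; exact: dlim_ord (ctl_left ctl It). Qed.

Let rlimE t : I t -> rlim (ord g) t = g t 2^-1.
Proof. by move=> It; apply/cvg_lim => //; exact: dlim_ord (ctl_right ctl It). Qed.

Lemma ctl_var : (var c%:E d%:E (ord g) <= K%:E)%E.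
Proof.
apply: ge_ereal_sup => _ [[|x s] [sp Is] <-]; first by rewrite big_ord0 lee_fin K0.
rewrite lee_fin /=.
apply: (@le_trans _ _ (w (last x s) 0 - w x 0)); last first.
  have Ix : I x by apply: Is; rewrite inE eqxx.
  have Il : I (last x s) by apply: Is; exact: mem_last.
  apply: (ctl_mass ctl) => //; [exact: J0|exact: J0|].
  move: sp => /= xs; case: (s) xs Il => [//|y s'] /= xs _.
  apply: pt_lt; have /allP := @order_path_min R <%R x (y :: s') lt_trans xs; apply; exact: mem_last.
elim: s x sp Is => [|y s IH] x /=; first by move=> _ _; rewrite big_ord0 subrr.
move=> /andP[xy ys] Is.
have Ix : I x by apply: Is; rewrite inE eqxx.
have Iy : I y by apply: Is; rewrite !inE eqxx orbT.
have := IH y ys (fun t tI => Is t (ltac:(by rewrite inE tI orbT))).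
rewrite big_ord_recl /= llimE// rlimE// => h.
have h1 := ctl_le ctl Ix Iy Jr Jl (pt_lt _ _ xy).
have h2 : w x 0 <= w x 2^-1 by apply: (ctl_mono ctl) => //; [exact: J0|exact: Jr|apply: pt_col; lra].
have h3 : w y (- 2^-1) <= w y 0 by apply: (ctl_mono ctl) => //; [exact: Jl|exact: J0|apply: pt_col; lra].
move: h h1 h2 h3; set A := \sum_(_ < _) _; lra.
Qed.

Let TVle t : I t -> (TV (- 2^-1) 2^-1 (g t) <= (w t 2^-1 - w t (- 2^-1))%:E)%E.
Proof.
move=> It; apply: ge_ereal_sup => _ [_ [s part <-] <-]; rewrite lee_fin.
have [H1 _ _ <-] := partition_intervals (g t) part.
have [_ _ _] := partition_intervals (w t) part; rewrite /osc.
have J' (r : R) : - 2^-1 <= r -> r <= 2^-1 -> J r by rewrite JE => -> ->.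
suff -> : variation (- 2^-1) (2^-1) (w t) s = w t 2^-1 - w t (- 2^-1).
  move=> <-; rewrite big_seq [leRHS]big_seq; apply: ler_sum => k /H1[h1 h2 h3].
  apply: le_trans (ler_norm _); apply: (ctl_le ctl) => //; [by apply: J' => //; lra|by apply: J' => //; lra|exact: pt_col].
apply: (@nondecreasing_variation R (- 2^-1) 2^-1 (w t) s _ part).
move=> x y; rewrite !in_itv /= => hx hy xy.
by apply: (ctl_mono ctl) => //; exact: pt_col.
Qed.

Let fibre_sum s x : sorted <%R (x :: s) -> (forall t, t \in x :: s -> I t) ->
  \sum_(t <- x :: s) (w t 2^-1 - w t (- 2^-1)) <= w (last x s) 2^-1 - w x (- 2^-1).
Proof.
elim: s x => [|y s IH] x /=; first by move=> _ _; rewrite big_seq1.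
move=> /andP[xy ys] Is.
have Ix : I x by apply: Is; rewrite inE eqxx.
have Iy : I y by apply: Is; rewrite !inE eqxx orbT.
have h := IH y ys (fun t tI => Is t (ltac:(by rewrite inE tI orbT))).
rewrite big_cons; have h1 := ctl_mono ctl Ix Iy Jr Jl (pt_lt _ _ xy).
move: h h1; set A := \sum_(_ <- _) _; lra.
Qed.

(** The fibres over finitely many times are disjoint pieces of the lexicographic
line, on which the increments of w add up to at most K. *)
Lemma ctl_fibres F : fin_in I F -> \sum_(t <- F) fine (varJ (g t)) <= K.
Proof.
move=> [uF FI].
have FIs t : t \in sort <=%R F -> I t by rewrite mem_sort => /FI.
have : \sum_(t <- F) (w t 2^-1 - w t (- 2^-1)) <= K.
  rewrite (perm_big (sort <=%R F)) /=; last by rewrite perm_sym perm_sort.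
  have : sorted <%R (sort <=%R F) by rewrite sort_lt_sorted.
  case: (sort _ _) FIs => [|x s] FIs sF; first by rewrite big_nil K0.
  apply: le_trans (fibre_sum sF FIs) _.
  have Ix : I x by apply: FIs; rewrite inE eqxx.
  have Il : I (last x s) by apply: FIs; exact: mem_last.
  apply: (ctl_mass ctl) => //; [exact: Jl|exact: Jr|].
  move: sF => /= xs; case: (s) xs => [|y s'] /= xs; first by apply: pt_col; lra.
  apply: pt_lt; have /allP := @order_path_min R <%R x (y :: s') lt_trans xs; apply; exact: mem_last.
apply: le_trans; rewrite big_seq [leRHS]big_seq; apply: ler_sum => t /FI It.
rewrite varJ_TV; last exact: ctl_ACJ ctl _ It.
rewrite -lee_fin fineK ?TVle//; apply: (TV_fin (ctl_ACJ ctl It) Jl Jr); lra.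
Qed.

Lemma ctl_esum : (\esum_(t in Tdisc c%:E d%:E g) varJ (g t) <= K%:E)%E.
Proof.
rewrite (eq_esum (b := fun t => (fine (varJ (g t)))%:E)); last first.
  move=> t [It _]; rewrite fineK// varJ_TV; last exact: ctl_ACJ ctl _ It.
  by apply: (TV_fin (ctl_ACJ ctl It) Jl Jr); lra.
apply/esum_leP => [t|F finF]; first by rewrite fine_ge0// var_ge0.
by apply: ctl_fibres; apply: fin_inS finF => t [].
Qed.

(** The converse of [sBV_control]: domination by a control of finite mass is
all that membership in sBV amounts to. *)
Lemma sBV_of_control : sBV c%:E d%:E g.
Proof.
have [[_ _ _ [l1 h1] [l2 h2]] _ _ _] := ctl_sG; split; first exact: ctl_sG.
  split; last by apply: le_lt_trans ctl_var _; rewrite ltry.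
  split.
  - exists (`|g ((c + d) / 2) 0| + K) => t It; have := ctl_bounded ctl Im It J0.
    by move=> h; rewrite -[ord g t](subrK (g ((c + d) / 2) 0)) addrC; apply: le_trans (ler_normD _ _) _; rewrite lerD2l.
  - by move=> t It; apply/cvg_ex; exists (g t 2^-1); exact: dlim_ord (ctl_right ctl It).
  - by move=> t It; apply/cvg_ex; exists (g t (- 2^-1)); exact: dlim_ord (ctl_left ctl It).
  - by apply/cvg_ex; exists l1; exact: (@dlim_ord _ c^'+ _ g).
  - by apply/cvg_ex; exists l2; exact: (@dlim_ord _ d^'- _ g).
by apply: le_lt_trans ctl_esum _; rewrite ltry.
Qed.

Let lim_le (F : set_system R) {FF : ProperFilter F} (h : R -> R) (M : R) : 0 <= M ->
  (\forall t \near F, `|h t| <= M) -> `|lim (h x @[x --> F])| <= M.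
Proof.
move=> M0 hM; case: (pselect (cvg (h x @[x --> F]))) => [cv|ncv].
  rewrite ler_norml; apply/andP; split.
    by apply: limr_ge => //; apply: filterS hM => t; rewrite ler_norml => /andP[].
  by apply: limr_le => //; apply: filterS hM => t; rewrite ler_norml => /andP[].
by rewrite (dvgP ncv) normr0.
Qed.

(** The value at a+ and the value of the continuous part there give 2 B; each of
the variations is at most a fixed multiple of the total mass of the control. *)
Lemma norm_le_control (B : R) : (forall t s, I t -> J s -> `|g t s| <= B) ->
  (sBV_norm c%:E d%:E g <= (2 * B + 4 * K)%:E)%E.
Proof.
move=> gB; have bvg := sBV_of_control.
have B0 : 0 <= B by apply: le_trans (gB _ _ Im J0); exact: normr_ge0.
have jm : jumpmass c d g <= K by rewrite -lee_fin -(jumpmassE bvg) ctl_esum.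
have near_c (P : R -> Prop) : (forall t, I t -> P t) -> \forall t \near c^'+, P t.
  move=> HP; apply: (@ex_near_right _ _ _ (d - c)); first by rewrite subr_gt0.
  by move=> t ht; apply: HP; apply/oitvE; lra.
have l1 : `|lim (ord g x @[x --> c^'+])| <= B.
  by apply: lim_le => //; apply: near_c => t It; apply: gB => //; exact: J0.
have l2 : `|lim (cp c g x @[x --> c^'+])| <= B + K.
  apply: lim_le; first exact: addr_ge0.
  apply: near_c => t It; have /oitvE ht := It; rewrite /cp /cpart llimE//.
  apply: le_trans (ler_normB _ _) _; apply: lerD; first by apply: gB => //; exact: Jl.
  apply: le_trans (ssum_jump_le bvg _ _) _; [lra|lra|].
  apply: le_trans jm; have := @SV_mass R c d g bvg c t [::] (lexx _) (ltac:(by lra)) (@fin_in_nil _ _) (fun t h => ltac:(by [])).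
  by rewrite big_nil addr0.
have l3 : (var c%:E d%:E (cp c g) <= (K + K)%:E)%E.
  apply: le_trans (_ : _ <= var c%:E d%:E (ord g) + (jumpmass c d g)%:E)%E _; last first.
    by rewrite EFinD leeD ?ctl_var ?lee_fin.
  apply: (var_le_TV (cp_osc bvg)); last exact: cp_TV_le.
  by rewrite adde_ge0 ?var_ge0// lee_fin (jumpmass_ge0 bvg).
rewrite /sBV_norm /CBV_norm; apply: le_trans (_ : _ <= B%:E + ((B + K)%:E + (K + K)%:E) + K%:E)%E _.
  by apply: leeD; [apply: leeD; [rewrite lee_fin|apply: leeD; [rewrite lee_fin|exact: l3]]|exact: ctl_esum].
rewrite -!EFinD lee_fin; lra.
Qed.

End RealItv.

Lemma control_sub (a b a' b' : \bar R) g w K : oitv a' b' `<=` oitv a b -> control a b g w K ->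
  control a' b' g w K.
Proof.
move=> sub [h1 h2 h3 h4]; split.
- by move=> P Q /sub oP /sub oQ; exact: h1.
- by move=> t /sub; exact: h2.
- by move=> t /sub; exact: h3.
- by move=> P Q /sub oP /sub oQ; exact: h4.
Qed.

Lemma sBV_sub (c d c' d' : R) g : c < d -> c <= c' -> c' < d' -> d' <= d -> sBV c%:E d%:E g ->
  sBV c'%:E d'%:E g.
Proof.
move=> cd cc' c'd' d'd /(sBV_control cd)[w ctl].
exact: sBV_of_control c'd' (control_sub (oitv_sub cc' d'd) ctl).
Qed.

Lemma sBV_loc (c d : R) g : sBV c%:E d%:E g -> sBVloc c%:E d%:E g.
Proof.
move=> bvg c' d' c'd' sub.
have /oitvE h1 : oitv c%:E d%:E c' by apply: sub; rewrite /= in_itv /= lexx ltW.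
have /oitvE h2 : oitv c%:E d%:E d' by apply: sub; rewrite /= in_itv /= lexx ltW.
by apply: sBV_sub bvg => //; lra.
Qed.

(** Both masses are summands of the norm, so convergence in norm produces
controls of mass tending to 0. *)
Lemma mass_le_norm (c d : R) g : c < d -> sBV c%:E d%:E g ->
  ((contmass c d g + jumpmass c d g)%:E <= sBV_norm c%:E d%:E g)%E.
Proof.
move=> cd bvg; rewrite EFinD -(contmassE bvg) -(jumpmassE bvg) /sBV_norm /CBV_norm.
apply: leeD => //; rewrite -[leLHS]add0e; apply: leeD; first by rewrite lee_fin.
by rewrite -[leLHS]add0e; apply: leeD => //; rewrite lee_fin.
Qed.

End OfControl.

(** * Differences of Lebesgue-Stieltjes measures *)

Section LSPair.
Context {R : realType}.
Local Notation pt := (R *lexi[ring_display] R)%type.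
Local Notation ls := (@lebesgue_stieltjes_measure R).
Implicit Types (phi : @dyn R) (p q : cumulative R R).

Lemma ls_fin p (c d : R) (A : set R) : measurable A -> A `<=` `]c, d]%classic ->
  (ls p A < +oo)%E.
Proof.
move=> mA sA; have [cd|dc] := leP c d; last first.
  by rewrite (_ : A = set0) ?measure0 ?ltry//; apply/seteqP; split => // x /sA; rewrite /= in_itv /=; lra.
apply: le_lt_trans (_ : _ <= ls p `]c, d]%classic)%E _; last by rewrite ls_itvoc// ltry.
by apply: le_measure => //; rewrite inE; [exact: mA|exact: measurable_itv].
Qed.

Lemma ls_open_fin p (c d : R) : (ls p `]c, d[%classic < +oo)%E.
Proof.
apply: (@ls_fin _ c d); first exact: measurable_itv.
by move=> x; rewrite /= !in_itv /=; lra.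
Qed.

Lemma ls_bounded_integrable p (c d M : R) (h : R -> R) : measurable_fun `]c, d[ h ->
  (forall t, c < t < d -> `|h t| <= M) -> (ls p).-integrable `]c, d[ (EFin \o h).
Proof.
move=> mh hM; apply: measurable_bounded_integrable => //.
- exact: ls_open_fin.
- exists M; split; first exact: num_real.
  by move=> x Mx t; rewrite /= in_itv /= => /hM /le_trans; apply; exact: ltW.
Qed.

Lemma ls_set1_cvg p (t : R) : (p t - p (t - k.+1%:R^-1)) @[k --> \oo] --> fine (ls p [set t]).
Proof.
have cvf : ls p `]t - k.+1%:R^-1, t]%classic @[k --> \oo] --> ls p [set t].
  rewrite set1_bigcap_oc; apply: nonincreasing_cvg_mu => //.
  - by apply: (@ls_fin _ (t - 1) t) => // x; rewrite /= !in_itv /= invr1.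
  - by apply: bigcap_measurable.
  - move=> k l kl; apply/subsetPset => x /=; rewrite !in_itv /= => /andP[h1 ->].
    by rewrite andbT; apply: le_lt_trans h1; rewrite lerD2l lerN2 lef_pV2 ?posrE// ler_nat ltnS.
have f1 : ls p [set t] \is a fin_num.
  by rewrite ge0_fin_numE//; apply: (@ls_fin _ (t - 1) t) => // x /= ->; rewrite in_itv /=; lra.
move: cvf; rewrite -(fineK f1) => /fine_cvg /=; apply: cvg_trans; apply: near_eq_cvg.
by apply: nearW => k; rewrite /= ls_itvoc// gerBl invr_ge0.
Qed.

(** The atoms are the jumps of p and q, and p - q does not jump. *)
Lemma ls_set1_diff p q (t : R) : (p x - q x) @[x --> t^'-] --> (p t - q t) ->
  fine (ls p [set t]) = fine (ls q [set t]).
Proof.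
move=> H; apply/eqP; rewrite -subr_eq0; apply/eqP.
have := cvgB (@ls_set1_cvg p t) (@ls_set1_cvg q t); set l := _ - fine _ => C.
suff C0 : ((fun k : nat => p t - p (t - k.+1%:R^-1)) - (fun k : nat => q t - q (t - k.+1%:R^-1))) x
    @[x --> \oo] --> (0 : R) by rewrite -(cvg_lim _ (C _))// (cvg_lim _ C0).
apply/cvgrPdist_le => e e0.
have [r r0 Hr] := near_left_ex ((cvgrPdist_le _ _).1 H e e0).
have := near_infty_natSinv_lt (PosNum r0); apply: filterS => k /= hk; rewrite sub0r normrN.
have k0 : 0 < k.+1%:R^-1 :> R by rewrite invr_gt0.
have := Hr (t - k.+1%:R^-1) (ltac:(by move: hk k0; set z := k.+1%:R^-1; rewrite ltrD2l ltrN2 gtrBl => -> ->)).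
by rewrite !fctE; congr (`|_| <= e); ring.
Qed.

(** Integration against the signed measure d(p - q). *)
Definition lsdiff p q (c d : R) phi : R :=
  \int[ls p]_(t in `]c, d[) ord phi t - \int[ls q]_(t in `]c, d[) ord phi t.

Lemma suppin_measurable (c d x y : R) phi : c < x -> x <= y -> y < d ->
  ldG c%:E d%:E phi -> suppin c%:E d%:E x y phi -> measurable_fun `]c, d[ (ord phi).
Proof.
move=> cx xy yd rphi sphi; pose z := (y + d) / 2.
have oi t : c < t < d -> oitv c%:E d%:E t by move=> h; apply/oitvE.
have m1 := ldG_measurable_ord rphi (oi x (ltac:(by lra))) (oi z (ltac:(by rewrite /z; lra))).
have z0 t : c < t < d -> ~~ (x <= t <= y) -> ord phi t = 0.
  by move=> /oi ot nt; exact: sphi ot J0 nt.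
have mz (A : set R) : (forall t, A t -> ord phi t = 0) -> measurable_fun A (ord phi).
  move=> hA; apply: (@eq_measurable_fun _ _ _ _ A (cst (0 : R))); last exact: measurable_cst.
  by move=> t; rewrite inE => /hA ->.
rewrite (_ : `]c, d[%classic = `]c, x[%classic `|` `[x, z[%classic `|` `[z, d[%classic); last first.
  apply/seteqP; split => t; rewrite /= !in_itv /=.
    by move=> h; case: (ltP t x) => h1; [left; left; lra|case: (ltP t z) => h2; [left; right; lra|right; lra]].
  by move=> [[|]|]; rewrite /z; lra.
apply/measurable_funU => //; [exact: measurableU|split; last first].
  apply: mz => t; by rewrite /= in_itv /= => h; rewrite z0//; [move: h; rewrite /z; lra|apply/negP; move: h; rewrite /z; lra].
apply/measurable_funU => //; split => //.
by apply: mz => t; rewrite /= in_itv /= => h; rewrite z0//; [lra|apply/negP; lra].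
Qed.

Lemma lsdiff_ext p q (c d : R) phi psi : (forall t, c < t < d -> ord phi t = ord psi t) ->
  lsdiff p q c d phi = lsdiff p q c d psi.
Proof.
move=> H; rewrite /lsdiff; congr (_ - _); apply: eq_Rintegral => t;
  by rewrite inE /= in_itv /= => /H.
Qed.

Lemma test_itv (c d : R) phi : c < d -> test c%:E d%:E phi -> ldG c%:E d%:E phi /\
  exists x y, [/\ c < x, x <= y, y < d & suppin c%:E d%:E x y phi].
Proof.
move=> cd tphi; have om : oitv c%:E d%:E ((c + d) / 2) by apply/oitvE; lra.
have [rphi [x [y [/oitvE ox /oitvE oy xy sphi]]]] := test_suppin om tphi; split => //.
by exists x, y; split => //; lra.
Qed.

Lemma test_integrable p (c d : R) phi : c < d -> test c%:E d%:E phi ->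
  (ls p).-integrable `]c, d[ (EFin \o ord phi).
Proof.
move=> cd tphi; have [rphi [x [y [cx xy yd sphi]]]] := test_itv cd tphi.
have [[rJ _ _ _ _] _ _] := tphi.
have mphi := suppin_measurable cx xy yd rphi sphi.
have [M M0 HM] : exists2 M : R, 0 <= M & forall t, c < t < d -> `|ord phi t| <= M.
  pose z := (y + d) / 2.
  have [|||M M0 HM] := @ldG_bounded _ _ _ phi (x, - 2^-1) (z, - 2^-1) rphi _ _ Jl Jl _.
  - by apply/oitvE => /=; lra.
  - by apply/oitvE => /=; rewrite /z; lra.
  - by apply: ltW; rewrite ltptE /= /z; lra.
  exists M => // t ht; have [xt|tx] := leP x t; last first.
    rewrite [ord phi t](sphi t 0 _ J0) ?normr0//; [exact/oitvE|apply/negP; lra].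
  have [ty|yt] := leP t y; last first.
    rewrite [ord phi t](sphi t 0 _ J0) ?normr0//; [exact/oitvE|apply/negP; lra].
  apply: HM; first exact: J0.
  by rewrite leptE ltptE /= /z; lra.
exact: ls_bounded_integrable mphi HM.
Qed.

Lemma lsdiff_bound p q (c d x y e : R) phi : c < x -> x <= y -> y < d ->
  ldG c%:E d%:E phi -> suppin c%:E d%:E x y phi -> (forall t, c < t < d -> `|ord phi t| <= e) ->
  `|lsdiff p q c d phi| <= (fine (ls p `]c, d[%classic) + fine (ls q `]c, d[%classic)) * e.
Proof.
move=> cx xy yd rphi sphi He.
have bd (f : cumulative R R) : `|\int[ls f]_(t in `]c, d[) ord phi t| <= e * fine (ls f `]c, d[%classic).
  have mphi : measurable_fun `]c, d[ (ord phi) by apply: (suppin_measurable _ _ _ rphi sphi); lra.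
  have i1 := ls_bounded_integrable f mphi He.
  apply: le_trans (le_normr_Rintegral _ i1) _ => //.
  rewrite -Rintegral_cst//; apply: le_Rintegral => //.
  - exact: integrable_norm.
  - apply: measurable_bounded_integrable => //; [exact: ls_open_fin|exact: bounded_cst].
rewrite /lsdiff mulrC mulrDr; apply: le_trans (ler_normB _ _) _; exact: lerD.
Qed.

Lemma lsdiff_distr p q (c d : R) : c < d -> Defs.distribution c%:E d%:E (lsdiff p q c d).
Proof.
move=> cd; apply: bounded_distribution; last by exists ((c + d) / 2); apply/oitvE; lra.
  move=> t0 _ k phi psi tphi tpsi.
  have lin (f : cumulative R R) : \int[ls f]_(t in `]c, d[) ord (fun t s => k * phi t s + psi t s) t =
      k * \int[ls f]_(t in `]c, d[) ord phi t + \int[ls f]_(t in `]c, d[) ord psi t.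
    have i1 := test_integrable f cd tphi; have i2 := test_integrable f cd tpsi.
    rewrite -RintegralZl// -RintegralD//.
    rewrite (_ : EFin \o _ = (fun x => k%:E * (ord phi x)%:E)%E); last by apply/funext.
    exact: integrableZl.
  by rewrite /lsdiff !lin mulrBr opprD addrACA.
move=> x y /oitvE ox /oitvE oy xy; exists (fine (ls p `]c, d[%classic) + fine (ls q `]c, d[%classic)).
  by rewrite addr_ge0// fine_ge0.
move=> phi e rphi sphi e0 He.
have [cx yd] : c < x /\ y < d by lra.
by apply: (lsdiff_bound p q cx xy yd rphi sphi) => t ht; apply: He J0; apply/oitvE.
Qed.

Section Pair.
Variables (p q : cumulative R R) (c d : R).
Hypothesis cd : c < d.
Hypothesis cts : forall t, c < t < d -> (p x - q x) @[x --> t^'-] --> (p t - q t).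

Let atom t : c < t < d -> fine (ls p [set t]) = fine (ls q [set t]).
Proof. by move=> /cts; exact: ls_set1_diff. Qed.

Let indic_int (f : cumulative R R) (A : set R) : measurable A -> A `<=` `]c, d[%classic ->
  \int[ls f]_(t in `]c, d[) (\1_A t : R) = fine (ls f A) /\
  (ls f).-integrable `]c, d[ (EFin \o (\1_A : R -> R)).
Proof.
move=> mA sA; split.
  by rewrite /Rintegral integral_indic//; congr (fine (_ _)); exact: setIidl.
apply: (@ls_bounded_integrable _ _ _ 1); first exact: measurable_indic.
by move=> t _; rewrite indicE; case: (t \in A); rewrite ?normr1 ?normr0.
Qed.

Lemma lsdiff_sing P : c < P.1 < d -> lsdiff p q c d (sing P) = 0.
Proof.
move=> hP; have [P0|P0] := eqVneq 0 P.2; last first.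
  rewrite (@lsdiff_ext _ _ _ _ _ (fun _ _ => 0)) /lsdiff ?Rintegral_cst//; first by rewrite !mul0r subrr.
  by move=> t _; rewrite /ord /sing -pair_eqE /pair_eq /= (negbTE P0) andbF.
rewrite (@lsdiff_ext _ _ _ _ _ (fun t _ => \1_[set P.1] t)); last first.
  move=> t _; rewrite /ord /sing -pair_eqE /pair_eq /= P0 eqxx andbT indicE.
  by congr (nat_of_bool _)%:R; apply/eqP/idP; rewrite inE.
have sP : [set P.1] `<=` `]c, d[%classic by move=> t /= ->; rewrite in_itv.
have mP : measurable [set P.1] by [].
by rewrite /lsdiff /ord !(indic_int _ mP sP).1 atom// subrr.
Qed.

(** The atoms at the two end points cancel, so it does not matter whether the end
points belong to the interval. *)
Lemma lsdiff_ind (P Q : pt) : c < P.1 < d -> c < Q.1 < d -> P <= Q ->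
  lsdiff p q c d (ind P Q) = (p Q.1 - q Q.1) - (p P.1 - q P.1).
Proof.
move=> hP hQ PQ; have PQ1 := lept1 PQ.
pose kP : R := (P.2 <= 0)%R%:R; pose kQ : R := (Q.2 <= 0)%R%:R.
pose f1 : R -> R := \1_(`]P.1, Q.1]%classic); pose f2 : R -> R := \1_[set Q.1]; pose f3 : R -> R := \1_[set P.1].
have bE S t : ord (below S) t = (t <= S.1)%R%:R - (S.2 <= 0)%R%:R * \1_[set S.1] t :> R.
  rewrite /ord /below ltptE /= indicE (_ : (t \in [set S.1]) = (t == S.1)); last by apply/idP/eqP; rewrite inE.
  by case: (ltgtP t S.1) => /= _; case: (leP S.2 0) => /= _; rewrite ?mulr0 ?mulr1 ?subr0 ?subrr ?mul0r ?subr0.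
have eqf t : c < t < d -> ord (ind P Q) t = f1 t - kQ * f2 t + kP * f3 t.
  move=> _; have -> : ord (ind P Q) t = ord (below Q) t - ord (below P) t by [].
  rewrite !bE /f1 /f2 /f3 [in RHS]indicE.
  have -> : ((t \in `]P.1, Q.1]%classic) : bool)%:R = (t <= Q.1)%R%:R - (t <= P.1)%R%:R :> R.
    rewrite (_ : (t \in _) = (P.1 < t <= Q.1)); last by apply/idP/idP; rewrite inE /= in_itv.
    case: (leP t P.1) => /= tP; last by rewrite subr0.
    by rewrite (le_trans tP PQ1) subrr.
  rewrite /kP /kQ; ring.
rewrite (@lsdiff_ext _ _ _ _ _ (fun t _ => f1 t - kQ * f2 t + kP * f3 t)) // {eqf bE}.
have s1 : `]P.1, Q.1]%classic `<=` `]c, d[%classic by move=> t; rewrite /= !in_itv /=; lra.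
have s2 : [set Q.1] `<=` `]c, d[%classic by move=> t /= ->; rewrite in_itv.
have s3 : [set P.1] `<=` `]c, d[%classic by move=> t /= ->; rewrite in_itv.
have m2 : measurable [set Q.1] by []. have m3 : measurable [set P.1] by [].
have m1 : measurable `]P.1, Q.1]%classic by exact: measurable_itv.
have E (f : cumulative R R) : \int[ls f]_(t in `]c, d[) ord (fun t _ => f1 t - kQ * f2 t + kP * f3 t) t =
    f Q.1 - f P.1 - kQ * fine (ls f [set Q.1]) + kP * fine (ls f [set P.1]).
  have [e1 i1] := indic_int f m1 s1; have [e2 i2] := indic_int f m2 s2; have [e3 i3] := indic_int f m3 s3.
  have iZ (k : R) (h : R -> R) : (ls f).-integrable `]c, d[ (EFin \o h) ->
      (ls f).-integrable `]c, d[ (EFin \o (fun t => k * h t)).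
    move=> ih; rewrite (_ : EFin \o _ = (fun x => k%:E * (h x)%:E)%E); last by apply/funext.
    exact: integrableZl.
  have i2' : (ls f).-integrable `]c, d[ (EFin \o (fun t => kQ * f2 t)) by exact: iZ.
  have i3' : (ls f).-integrable `]c, d[ (EFin \o (fun t => kP * f3 t)) by exact: iZ.
  rewrite /ord RintegralD//; last first.
    rewrite (_ : EFin \o _ = (fun x => (f1 x)%:E - (kQ * f2 x)%:E)%E); last by apply/funext.
    exact: integrableB.
  rewrite RintegralB// !RintegralZl// e1 e2 e3 ls_itvoc//.
rewrite /lsdiff !E !atom//.
move: (fine _) (fine _) (p Q.1) (q Q.1) (p P.1) (q P.1) => A1 A2 A3 A4 A5 A6; ring.
Qed.

End Pair.

End LSPair.

(** * The derivative of a function in sBV as a distribution *)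

Section FibreBound.
Context {R : realType}.
Local Notation pt := (R *lexi[ring_display] R)%type.
Local Notation TV := (@total_variation R).
Implicit Types (phi : @dyn R) (P Q S : pt) (h psi : R -> R).

(** The part of the increment of h that lies below Q, for the fibre over t. *)
Definition fibinc (h : R -> R) (t : R) Q : R :=
  if t < Q.1 then h 2^-1 - h (- 2^-1) else if t == Q.1 then h Q.2 - h (- 2^-1) else 0.

Lemma below_regJ t Q : regulatedJ (below Q t).
Proof.
have [H _ _] := @ldG_below R (t - 1)%:E (t + 1)%:E Q.
by apply: H; rewrite /oitv /= !lte_fin; lra.
Qed.

Lemma fibint_eq h psi1 psi2 : (forall s, J s -> psi1 s = psi2 s) -> fibint h psi1 = fibint h psi2.
Proof. by move=> H; rewrite /fibint; apply: eq_Rintegral => s; rewrite inE => /H ->. Qed.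

Lemma fibint_below h t Q : ACJ h -> J Q.2 -> fibint h (below Q t) = fibinc h t Q.
Proof.
move=> ach JQ; rewrite /fibinc; case: (ltgtP t Q.1) => tQ.
- by rewrite -(fibint_full ach); apply: fibint_eq => s _; rewrite /below ltptE /= tQ.
- by apply: fibint0 => s _; rewrite /below ltptE /= ltNge (ltW tQ) /= gt_eqF.
- by rewrite -(fibint_lt ach JQ); apply: fibint_eq => s _; rewrite /below ltptE /= tQ ltxx eqxx.
Qed.

Lemma fibint_ind h t P Q : ACJ h -> J P.2 -> J Q.2 -> fibint h (ind P Q t) = fibinc h t Q - fibinc h t P.
Proof.
move=> ach JP JQ; rewrite -!fibint_below// addrC -mulN1r -fibint_lin//; [|exact: below_regJ..].
by apply: fibint_eq => s _; rewrite /ind mulN1r addrC.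
Qed.

Lemma fibint_singc h t P : fibint h (sing P t) = 0.
Proof.
have [tP|tP] := eqVneq t P.1; last first.
  by apply: fibint0 => s _; rewrite /sing -pair_eqE /pair_eq /= (negbTE tP).
by rewrite -(fibint_sing h P.2); apply: fibint_eq => s _; rewrite /sing -pair_eqE /pair_eq /= tP eqxx.
Qed.

Lemma fibre_distribution a b t0 h : oitv a b t0 -> ACJ h ->
  Defs.distribution a b (fun phi : @dyn R => fibint h (phi t0)).
Proof.
move=> ot0 ach; apply: bounded_distribution; last by exists t0.
  by move=> _ _ k phi psi [[r1 _ _ _ _] _ _] [[r2 _ _ _ _] _ _]; apply: fibint_lin => //; [exact: r1|exact: r2].
move=> c d oc od cd; have [B B0 HB] := fibint_bound0 ach; exists B => // phi e [rphi _ _] _ e0 He.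
by apply: HB; [exact: rphi|move=> s Js; exact: He].
Qed.

Lemma fibint_le h psi e : ACJ h -> regulatedJ psi -> 0 <= e -> (forall s, J s -> `|psi s| <= e) ->
  `|fibint h psi| <= e * fine (TV (- 2^-1) 2^-1 h).
Proof.
move=> ach rpsi e0 He; pose a : \bar R := (-1)%:E; pose b : \bar R := 1%:E.
have ot0 : oitv a b (0 : R) by rewrite /oitv /= !lte_fin; lra.
have ot1 : oitv a b (2^-1 : R) by rewrite /oitv /= !lte_fin; lra.
pose P : pt := (0, - 2^-1); pose Q : pt := (2^-1, 0).
pose V s := fine (TV (- 2^-1) s h).
pose w : @dyn R := fun t s => if 0 < t then V 2^-1 else if 0 == t then V s else 0.
pose phi : @dyn R := fun t s => if t == 0 then psi s else 0.
have rphi : ldG a b phi.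
  have z t : \forall x \near t^'+, forall s, phi x s = 0.
    have [t0|t0] := ltP t 0.
      apply: (@ex_near_right _ _ _ (- t)); first by lra.
      by move=> x hx s; rewrite /phi lt_eqF//; lra.
    apply: (@ex_near_right _ _ _ 1) => // x hx s; rewrite /phi gt_eqF//; lra.
  have z' t : \forall x \near t^'-, forall s, phi x s = 0.
    have [t0|t0] := ltP 0 t.
      apply: (@ex_near_left _ _ _ t) => // x hx s; rewrite /phi gt_eqF//; lra.
    apply: (@ex_near_left _ _ _ 1) => // x hx s; rewrite /phi lt_eqF//; lra.
  split.
  - by move=> t _; rewrite /phi; case: eqP => _ //; exact: regJ_cst.
  - move=> t _; exists 0 => r r0; apply: filterS (z t) => x Hx s _; rewrite Hx subrr normr0; exact: ltW.
  - move=> t _; exists 0 => r r0; apply: filterS (z' t) => x Hx s _; rewrite Hx subrr normr0; exact: ltW.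
have PQ : P <= Q by rewrite leptE /=; apply/orP; left; lra.
have fin : forall s, J s -> TV (- 2^-1) s h \is a fin_num.
  by move=> s Js; apply: (TV_fin ach Jl Js); move: Js; rewrite JE; lra.
have V0 : V (- 2^-1) = 0 by rewrite /V total_variationxx.
have := @distr_bound R a b _ w phi e P Q (fibre_distribution ot0 ach) (fun S _ _ => fibint_singc h 0 S)
  ot0 ot1 Jl J0 PQ.
rewrite /w /= ltxx eqxx V0 subr0 (_ : 0 < 2^-1 = true); last by apply/idP; lra.
rewrite (_ : fibint h _ = fibint h psi); last first.
  apply: fibint_eq => s Js; rewrite /phi eqxx indE// leptE ltptE /= ltxx eqxx /= (_ : 0 < 2^-1 = true); last by apply/idP; lra.
  by move: Js; rewrite JE => /andP[-> _] /=; rewrite mulr1.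
apply => //; last first.
  move=> t s Js _; rewrite /phi; case: eqP => _; [exact: He|by rewrite normr0].
move=> S S' JS JS' PS SS' S'Q; have S'1 := lept1 (ltW SS'); rewrite fibint_ind//.
have hS : 0 <= S.1 by have := lept1 PS.
move: S'1 hS; rewrite /fibinc le_eqVlt => /predU1P[E|lt1]; rewrite le_eqVlt => /predU1P[E0|lt0].
- rewrite -E -E0 ltxx eqxx.
  have h2 : S.2 <= S'.2 by move: SS'; rewrite ltptE E ltxx eqxx /= => /ltW.
  by rewrite opprB addrA subrK /V TV_sub//; apply: norm_le_TV.
- by rewrite -E lt0 !subrr normr0.
- rewrite -E0 ltxx eqxx (_ : 0 < S'.1); last by rewrite E0.
  rewrite opprB addrA subrK /V TV_sub//; [|exact: Jr|by move: JS; rewrite JE; lra].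
  by apply: norm_le_TV => //; [exact: Jr|move: JS; rewrite JE; lra].
- by rewrite lt0 (lt_trans lt0 lt1) !subrr normr0.
Qed.

End FibreBound.

Section CPartIntegral.
Context {R : realType}.
Local Notation pt := (R *lexi[ring_display] R)%type.
Local Notation TV := (@total_variation R).
Implicit Types (phi : @dyn R) (P Q S : pt).
Variables (a b : \bar R) (g : @dyn R).
Hypothesis bvg : sBVloc a b g.

Lemma sBVloc_in c d : oitv a b c -> oitv a b d -> c < d -> sBV c%:E d%:E g.
Proof. by move=> oc od cd; apply: bvg => //; exact: segment_oitv. Qed.

Lemma oitv_widen c d : oitv a b c -> oitv a b d -> c < d ->
  exists c' d', [/\ oitv a b c', oitv a b d', c' < c & d < d'].
Proof.
move=> oc od _; have [c' h1 h2] := oitv_left oc; have [d' h3 h4] := oitv_right od.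
by exists c', d'.
Qed.

(** The variation and the variation minus the function, taken on a slightly larger
interval to have room at the end points, and extended by constants. *)
Lemma cpair_ex c d : oitv a b c -> oitv a b d -> c < d ->
  exists p q : cumulative R R, forall t, c < t < d -> cpart c%:E (ord g) t = p t - q t.
Proof.
move=> oc od cd; have [c' [d' [oc' od' c'c dd']]] := oitv_widen oc od cd.
have c'd' : c' < d' by lra.
have bv := sBVloc_in oc od cd; have bv' := sBVloc_in oc' od' c'd'.
pose P t := contvar c' d' g (clamp c d t); pose Q t := P t - cp c' g (clamp c d t).
have I' t : oitv c'%:E d'%:E (clamp c d t).
  by apply/oitvE; have := clamp_in cd t; lra.
have PE x y : x <= y -> P y - P x = fine (TV (clamp c d x) (clamp c d y) (cp c' g)).
  by move=> xy; rewrite /P (contvar_sub c'd' bv')//; exact: clamp_le.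
have cpTV x y : x <= y -> `|cp c' g (clamp c d y) - cp c' g (clamp c d x)| <= P y - P x.
  move=> xy; rewrite PE// -lee_fin fineK; first by apply: total_variation_ge; exact: clamp_le.
  apply/bounded_variationP; first exact: clamp_le.
  by apply: (cp_BV bv') => //; exact: clamp_le.
have ndP : {homo P : x y / x <= y}.
  by move=> x y xy; rewrite -subr_ge0; apply: le_trans (cpTV _ _ xy); exact: normr_ge0.
have ndQ : {homo Q : x y / x <= y}.
  move=> x y xy; rewrite /Q; have := cpTV _ _ xy; rewrite ler_norml.
  by move: (P x) (P y) (cp _ _ _) (cp _ _ _) => A1 A2 A3 A4; lra.
have rcP : right_continuous P.
  apply: (@clamp_rc _ _ _ cd (contvar c' d' g)) => s hs; apply: (contvar_right c'd' bv').
  by apply/oitvE; lra.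
have rcQ : right_continuous Q.
  move=> s; apply: cvgB; first exact: rcP.
  apply: (@clamp_rc _ _ _ cd (cp c' g)) => r hr; apply: (cp_osc bv' _).2.
  by apply/oitvE; lra.
pose m := (c + d) / 2; pose K := cp c g m - cp c' g m.
pose Q' t := Q t - K.
have ndQ' : {homo Q' : x y / x <= y} by move=> x y xy; rewrite /Q' lerD2r ndQ.
have rcQ' : right_continuous Q' by move=> s; apply: cvgB; [exact: rcQ|exact: cvg_cst].
exists (mkcumulative ndP rcP), (mkcumulative ndQ' rcQ') => t ht /=.
rewrite /Q' /Q clamp_id; last by lra.
suff : cp c g t - cp c g m = cp c' g t - cp c' g m by rewrite /K /cp; lra.
have hm : c < m < d by rewrite /m; lra.
have [tm|mt|->] := ltgtP t m; last by rewrite !subrr.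
  have h1 := @cp_sub _ _ _ _ bv t m (ltac:(by lra)) tm (ltac:(by lra)).
  have h2 := @cp_sub _ _ _ _ bv' t m (ltac:(by lra)) tm (ltac:(by lra)).
  by rewrite -(opprB (cp c g m)) -(opprB (cp c' g m)) h1 h2.
have h1 := @cp_sub _ _ _ _ bv m t (ltac:(by lra)) mt (ltac:(by lra)).
have h2 := @cp_sub _ _ _ _ bv' m t (ltac:(by lra)) mt (ltac:(by lra)).
by rewrite h1 h2.
Qed.

Definition cpair c d (p q : cumulative R R) := forall t, c < t < d -> cpart c%:E (ord g) t = p t - q t.

Lemma cpair_cts c d p q : oitv a b c -> oitv a b d -> c < d -> cpair c d p q ->
  forall t, c < t < d -> (p x - q x) @[x --> t^'-] --> (p t - q t).
Proof.
move=> oc od cd pq t ht; rewrite -pq//; have bv := sBVloc_in oc od cd.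
have [H _] := cp_osc bv (iffRL (oitvE _ _ _) ht).
apply: cvg_trans H; apply: near_eq_cvg; apply: (@ex_near_left _ _ _ (t - c)); first by lra.
by move=> x hx; rewrite /cp pq//; lra.
Qed.

Lemma lsdiff_shrink p q c d c' d' x y phi : oitv a b c -> oitv a b d -> c <= c' -> d' <= d ->
  c' < x -> y < d' -> suppin a b x y phi -> lsdiff p q c d phi = lsdiff p q c' d' phi.
Proof.
move=> oc od cc' d'd c'x yd' sphi.
have E (f : cumulative R R) : \int[lebesgue_stieltjes_measure f]_(t in `]c, d[) ord phi t =
    \int[lebesgue_stieltjes_measure f]_(t in `]c', d'[) ord phi t.
  rewrite Rintegral_mkcond [RHS]Rintegral_mkcond; congr (fine _); apply: eq_integral => t _.
  congr (_%:E); rewrite !patchE; case: ifPn => h1; case: ifPn => h2 //.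
    apply: sphi; [|exact: J0|].
      by apply: (oitv_le oc od); move: h1; rewrite inE /= in_itv /=; lra.
    by apply: contra h2; rewrite inE /= in_itv /=; lra.
  by case/negP: h1; move: h2; rewrite !inE /= !in_itv /=; lra.
by rewrite /lsdiff !E.
Qed.

Lemma suppin_sub c d x y phi : oitv a b c -> oitv a b d -> suppin a b x y phi ->
  suppin c%:E d%:E x y phi.
Proof. by move=> oc od sphi t s /oitvE ht; apply: sphi; apply: (oitv_le oc od); lra. Qed.

Lemma ldG_sub c d phi : oitv a b c -> oitv a b d -> ldG a b phi -> ldG c%:E d%:E phi.
Proof.
move=> oc od [h1 h2 h3].
have sub t : oitv c%:E d%:E t -> oitv a b t by move=> /oitvE ht; apply: (oitv_le oc od); lra.
by split => t /sub; [exact: h1|exact: h2|exact: h3].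
Qed.

(** Both functionals are distributions that vanish on points and have the same
values on intervals; the values depend on the continuous part only through its
increments, which are the same for all base points. *)
Lemma lsdiff_uniq c d p q c' d' p' q' x y phi : oitv a b c -> oitv a b d -> c < d ->
  oitv a b c' -> oitv a b d' -> c' < d' -> cpair c d p q -> cpair c' d' p' q' ->
  ldG a b phi -> suppin a b x y phi -> c < x -> y < d -> c' < x -> y < d' -> x <= y ->
  lsdiff p q c d phi = lsdiff p' q' c' d' phi.
Proof.
move=> oc od cd oc' od' cd' pq pq' rphi sphi cx yd cx' yd' xy.
pose e := Num.max c c'; pose f := Num.min d d'.
have ce : c <= e by rewrite le_max lexx. have c'e : c' <= e by rewrite le_max lexx orbT.
have fd : f <= d by rewrite ge_min lexx. have fd' : f <= d' by rewrite ge_min lexx orbT.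
have ex : e < x by rewrite gt_max cx. have yf : y < f by rewrite lt_min yd.
have oe : oitv a b e by apply: (oitv_le oc od); lra.
have of' : oitv a b f by apply: (oitv_le oc od); lra.
have ef : e < f by lra.
rewrite (lsdiff_shrink p q oc od ce fd ex yf sphi) (lsdiff_shrink p' q' oc' od' c'e fd' ex yf sphi).
have c1 := cpair_cts oc od cd pq; have c2 := cpair_cts oc' od' cd' pq'.
have om : oitv e%:E f%:E ((e + f) / 2) by apply/oitvE; lra.
have bv := sBVloc_in oc od cd; have bv' := sBVloc_in oc' od' cd'.
have k1 t : e < t < f -> (p x0 - q x0) @[x0 --> t^'-] --> (p t - q t) by move=> ht; apply: c1; lra.
have k2 t : e < t < f -> (p' x0 - q' x0) @[x0 --> t^'-] --> (p' t - q' t) by move=> ht; apply: c2; lra.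
apply: (distr_eq_test (lsdiff_distr p q ef) (lsdiff_distr p' q' ef) om).
- by move=> S /oitvE hS _; rewrite !lsdiff_sing.
- move=> S S' _ _ /oitvE hS /oitvE hS' SS'; rewrite !lsdiff_ind// ?(ltW SS')//.
  have := lept1 (ltW SS'); rewrite le_eqVlt => /predU1P[->|lt1]; first by rewrite !subrr.
  rewrite -!pq -?pq'; [|lra|lra|lra|lra].
  have h1 := @cp_sub _ _ _ _ bv S.1 S'.1 (ltac:(by lra)) lt1 (ltac:(by lra)).
  have h2 := @cp_sub _ _ _ _ bv' S.1 S'.1 (ltac:(by lra)) lt1 (ltac:(by lra)).
  by move: h1 h2; rewrite /cp => -> ->.
- apply: (@mk_test _ _ _ x y); [exact: ldG_sub rphi|apply/oitvE; lra|apply/oitvE; lra|exact: suppin_sub sphi].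
Qed.

(** The integral was defined by an arbitrary choice of interval and pair; any
other choice gives the same value. *)
Lemma cpart_integralE c d p q x y phi : oitv a b c -> oitv a b d -> c < d -> cpair c d p q ->
  ldG a b phi -> suppin a b x y phi -> c < x -> x <= y -> y < d ->
  cpart_integral a b g phi = lsdiff p q c d phi.
Proof.
move=> oc od cd pq rphi sphi cx xy yd.
have ex : is_cpart_integral a b g phi (lsdiff p q c d phi).
  exists c, d, p, q; split => //; first by split => //; exact: segment_oitv.
  by move=> t /(dsupp_suppin sphi); rewrite /= !in_itv /=; lra.
rewrite /cpart_integral; case: xgetP => [v _ [c' [d' [p' [q' [[c'd' sub'] sp' pq' ->]]]]]|/(_ _ ex)//].
have oc' : oitv a b c' by apply: sub'; rewrite /= in_itv /= lexx ltW.
have od' : oitv a b d' by apply: sub'; rewrite /= in_itv /= lexx ltW.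
have [|ne] := pselect (dsupp a b phi !=set0); last first.
  have z t s : oitv a b t -> J s -> phi t s = 0.
    move=> ot Js; apply: contrapT => nz; apply: ne; exists t; apply: subset_closure.
    by split => //; exists s => //; apply/eqP.
  have E (f : cumulative R R) u u' : oitv a b u -> oitv a b u' ->
      \int[lebesgue_stieltjes_measure f]_(t in `]u, u'[) ord phi t = 0.
    move=> ou ov; rewrite /Rintegral integral0_eq// => t; rewrite /= in_itv /= => ht.
    by rewrite /ord z//; [apply: (oitv_le ou ov); lra|exact: J0].
  by rewrite /lsdiff !E.
move=> ne.
have tphi : test a b phi.
  by apply: (mk_test rphi _ _ sphi); apply: (oitv_le oc od); lra.
have [_ cK _] := tphi.
pose K := dsupp a b phi.
have [m Km] := ne.
have om : oitv c'%:E d'%:E m by apply/oitvE; have := sp' m Km; rewrite /= in_itv.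
have Ksub : K `<=` oitv c'%:E d'%:E by move=> t /sp'; rewrite /= in_itv /= => ht; apply/oitvE.
have [x' [y' [/oitvE ox' /oitvE oy' xy' Ks]]] := compact_oitv om cK Ksub.
have h1 := dsupp_suppin sphi Km; have h2 := Ks _ Km.
rewrite -[LHS]/(lsdiff p' q' c' d' phi).
pose x2 := Num.max x x'; pose y2 := Num.min y y'.
have hx2 : x <= x2 /\ x' <= x2 by rewrite !le_max !lexx orbT.
have hy2 : y2 <= y /\ y2 <= y' by rewrite !ge_min !lexx orbT.
have xy2 : x2 <= y2.
  move: h1 h2; rewrite /= !in_itv /= => /andP[h1 h1'] /andP[h2 h2'].
  by apply: (@le_trans _ _ m); rewrite /x2 /y2 ?ge_max ?le_min ?h1 ?h2 ?h1' ?h2'.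
apply: (@lsdiff_uniq _ _ _ _ _ _ _ _ x2 y2) => //; try lra.
apply: suppin_dsupp => t Kt; have := dsupp_suppin sphi Kt; have := Ks _ Kt.
by rewrite /= !in_itv /= /x2 /y2 ge_max le_min => /andP[-> ->] /andP[-> ->].
Qed.

Lemma test_bounded x y phi : ldG a b phi -> suppin a b x y phi -> oitv a b x -> oitv a b y -> x <= y ->
  exists2 M : R, 0 <= M & forall t s, oitv a b t -> J s -> `|phi t s| <= M.
Proof.
move=> rphi sphi ox oy xy; have [z yz oz] := oitv_right oy.
have [|||M M0 HM] := @ldG_bounded _ _ _ phi (x, - 2^-1) (z, - 2^-1) rphi _ _ Jl Jl _ => //.
  by apply: ltW; rewrite ltptE /=; lra.
exists M => // t s ot Js; case: (boolP (x <= t <= y)) => h; last by rewrite sphi// normr0.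
by apply: HM; first exact: Js; rewrite leptE ltptE /=; move: Js; rewrite JE; lra.
Qed.

Definition fibs phi (t : R) : R := fibint (g t) (phi t).

Lemma fibs_summable c d phi e : oitv a b c -> oitv a b d -> c < d -> ldG a b phi -> 0 <= e ->
  (forall t s, oitv a b t -> J s -> `|phi t s| <= e) ->
  abs_summable (oitv c%:E d%:E) (fibs phi) (e * jumpmass c d g).
Proof.
move=> oc od cd [rphi _ _] e0 He F finF; have bv := sBVloc_in oc od cd.
apply: le_trans (_ : _ <= e * \sum_(t <- F) fvar g t) _; last first.
  by rewrite ler_wpM2l// (fvar_sum bv).
rewrite mulr_sumr big_seq [leRHS]big_seq; apply: ler_sum => t /finF.2 It.
have ot : oitv a b t by have /oitvE ht := It; apply: (oitv_le oc od); lra.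
rewrite (fvarE bv It); apply: fibint_le => //; [exact: sBV_ACJ bv _ It|exact: rphi|].
by move=> s; exact: He.
Qed.

(** On a frame (c, d) around the support the derivative is explicit; all
properties below are read off from this formula. *)
Lemma ddotE c d p q x y phi : oitv a b c -> oitv a b d -> c < d -> cpair c d p q ->
  ldG a b phi -> suppin a b x y phi -> c < x -> x <= y -> y < d ->
  ddot a b g phi = lsdiff p q c d phi + ssum (oitv c%:E d%:E) (fibs phi).
Proof.
move=> oc od cd pq rphi sphi cx xy yd.
have bv := sBVloc_in oc od cd.
rewrite /ddot (cpart_integralE oc od cd pq rphi sphi cx xy yd); congr (_ + _).
have ox : oitv a b x by apply: (oitv_le oc od); lra.
have oy : oitv a b y by apply: (oitv_le oc od); lra.
have [M M0 HM] := test_bounded rphi sphi ox oy xy.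
have sub : oitv c%:E d%:E `<=` oitv a b by move=> t /oitvE ht; apply: (oitv_le oc od); lra.
have AS := fibs_summable oc od cd rphi M0 HM.
have z0 t : oitv a b t -> ~ oitv c%:E d%:E t -> fibs phi t = 0.
  move=> ot nt; apply: fibint0 => s Js; apply: sphi => //.
  by apply: contra_notN nt => ht; apply/oitvE; lra.
have z1 t : oitv c%:E d%:E t -> ~ Tdisc a b g t -> fibs phi t = 0.
  move=> It nT; have ot := sub _ It.
  have [k [hk _ _]] : dcontinuous_at g t by apply: contrapT => h; apply: nT.
  have [rphi' _ _] := rphi.
  have := fibint_le (sBV_ACJ bv It) (rphi' _ ot) M0 (fun s => HM t s ot).
  by rewrite (TVJ_cst hk) mulr0 normr_le0 => /eqP.
have iA : is_ssum (oitv c%:E d%:E) (fibs phi) (ssum (oitv c%:E d%:E) (fibs phi)) by exact: ssumP AS.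
have iB : is_ssum (oitv c%:E d%:E `&` Tdisc a b g) (fibs phi) (ssum (oitv c%:E d%:E) (fibs phi)).
  have AS' : abs_summable (oitv c%:E d%:E `&` Tdisc a b g) (fibs phi) (M * jumpmass c d g).
    by apply: abs_summableS AS => t [].
  have h := ssumP AS'.
  suff <- : ssum (oitv c%:E d%:E `&` Tdisc a b g) (fibs phi) = ssum (oitv c%:E d%:E) (fibs phi) by [].
  apply: is_ssum_uniq iA; apply: is_ssumS h => [t []//|t It nt]; apply: z1 => // T; exact: nt.
have iC : is_ssum (Tdisc a b g) (fibs phi) (ssum (oitv c%:E d%:E) (fibs phi)).
  by apply: is_ssumS iB => [t []//|t Tt nt]; apply: z0; [case: Tt|move=> It; exact: nt].
apply: ssumE iC => F finF.
have finF' : fin_in (oitv c%:E d%:E) [seq t <- F | `[< oitv c%:E d%:E t >]].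
  split; first by rewrite filter_uniq ?finF.1.
  by move=> t; rewrite mem_filter => /andP[/asboolP].
apply: le_trans (AS _ finF'); rewrite big_filter [leRHS]big_mkcond /= big_seq [leRHS]big_seq.
apply: ler_sum => t /finF.2[ot _]; case: asboolP => // nt; by rewrite z0 ?normr0.
Qed.

Lemma suppin_frame x y : oitv a b x -> oitv a b y -> x <= y -> exists c d p q,
  [/\ oitv a b c /\ oitv a b d, c < d, cpair c d p q, c < x & y < d].
Proof.
move=> ox oy xy; have [c cx oc] := oitv_left ox; have [d yd od] := oitv_right oy.
have cd : c < d by lra.
by have [p [q pq]] := cpair_ex oc od cd; exists c, d, p, q; split.
Qed.

Lemma ddot_distribution : (exists t, oitv a b t) -> Defs.distribution a b (ddot a b g).
Proof.
move=> ne; apply: bounded_distribution => //.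
  move=> t0 o0 k phi psi tphi tpsi.
  have [rphi [x [y [ox oy xy sphi]]]] := test_suppin o0 tphi.
  have [rpsi [x' [y' [ox' oy' xy' spsi]]]] := test_suppin o0 tpsi.
  pose x2 := Num.min x x'; pose y2 := Num.max y y'.
  have ox2 : oitv a b x2 by exact: oitv_min. have oy2 : oitv a b y2 by exact: oitv_max.
  have xy2 : x2 <= y2 by rewrite ge_min le_max xy.
  have sphi2 : suppin a b x2 y2 phi by apply: suppinS sphi; rewrite ?ge_min ?le_max lexx.
  have spsi2 : suppin a b x2 y2 psi by apply: suppinS spsi; rewrite ?ge_min ?le_max lexx orbT.
  have schi : suppin a b x2 y2 (fun t s => k * phi t s + psi t s).
    by move=> t s ot Js h; rewrite sphi2// spsi2// mulr0 addr0.
  have rchi : ldG a b (fun t s => k * phi t s + psi t s) by apply: ldGD => //; exact: ldGZ.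
  have [c [d [p [q [[oc od] cd pq cx yd]]]]] := suppin_frame ox2 oy2 xy2.
  rewrite !(ddotE oc od cd pq _ _ cx xy2 yd)//.
  have ocd : oitv c%:E d%:E ((c + d) / 2) by apply/oitvE; lra.
  have tst chi : ldG a b chi -> suppin a b x2 y2 chi -> test c%:E d%:E chi.
    move=> rc sc; apply: (@mk_test _ _ _ x2 y2); [exact: ldG_sub rc|apply/oitvE; lra|apply/oitvE; lra|exact: suppin_sub sc].
  rewrite (lsdiff_distr p q cd).1; [|exact: tst|exact: tst].
  have [M1 M10 HM1] := test_bounded rphi sphi2 ox2 oy2 xy2.
  have [M2 M20 HM2] := test_bounded rpsi spsi2 ox2 oy2 xy2.
  have [M3 M30 HM3] := test_bounded rchi schi ox2 oy2 xy2.
  rewrite (ssumE (fibs_summable oc od cd rchi M30 HM3) (S := k * ssum (oitv c%:E d%:E) (fibs phi) + ssum (oitv c%:E d%:E) (fibs psi))).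
    move: (lsdiff _ _ _ _ phi) (lsdiff _ _ _ _ psi) (ssum _ (fibs phi)) (ssum _ (fibs psi)) => A1 A2 A3 A4; ring.
  apply: is_ssum_eq (is_ssumZD k (ssumP (fibs_summable oc od cd rphi M10 HM1)) (ssumP (fibs_summable oc od cd rpsi M20 HM2))).
  move=> t It; have ot : oitv a b t by have /oitvE ht := It; apply: (oitv_le oc od); lra.
  have [rphi' _ _] := rphi; have [rpsi' _ _] := rpsi.
  rewrite /fibs -fibint_lin//; [exact: sBV_ACJ (sBVloc_in oc od cd) _ It|exact: rphi'|exact: rpsi'].
move=> x y ox oy xy; have [c [d [p [q [[oc od] cd pq cx yd]]]]] := suppin_frame ox oy xy.
have bv := sBVloc_in oc od cd.
pose C := fine (lebesgue_stieltjes_measure p `]c, d[%classic) + fine (lebesgue_stieltjes_measure q `]c, d[%classic).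
have C0 : 0 <= C by rewrite addr_ge0// fine_ge0.
exists (C + jumpmass c d g); first by rewrite addr_ge0// (jumpmass_ge0 bv).
move=> phi e rphi sphi e0 He; rewrite (ddotE oc od cd pq rphi sphi cx xy yd) mulrDl.
apply: le_trans (ler_normD _ _) _; apply: lerD; last first.
  have AS := fibs_summable oc od cd rphi e0 He.
  rewrite mulrC; apply: is_ssum_le (ssumP AS) _ => F finF.
  exact: le_trans (ler_norm_sum _ _ _) (AS _ finF).
apply: (lsdiff_bound p q cx xy yd (ldG_sub oc od rphi) (suppin_sub oc od sphi)).
by move=> t ht; apply: He J0; apply: (oitv_le oc od); lra.
Qed.

Lemma ddot_sing P : oitv a b P.1 -> ddot a b g (sing P) = 0.
Proof.
move=> oP; have [c [d [p [q [[oc od] cd pq cx yd]]]]] := suppin_frame oP oP (lexx _).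
have sP : suppin a b P.1 P.1 (sing P).
  move=> t s _ _ nt; rewrite /sing -pair_eqE /pair_eq /=; case: eqP => //= E.
  by move: nt; rewrite E lexx.
rewrite (ddotE oc od cd pq (@ldG_sing _ a b P) sP cx (lexx _) yd).
rewrite (lsdiff_sing (cpair_cts oc od cd pq)) ?cx// add0r.
have z t : fibs (sing P) t = 0 by exact: fibint_singc.
apply: (@ssumE _ _ _ _ 0); first by move=> F _; rewrite big1// => t _; rewrite z normr0.
exact: is_ssum0.
Qed.

(** The continuous part contributes its own increment, the fibres strictly
between P and Q their full jumps and the two outer fibres partial jumps. *)
Lemma ddot_ind (P Q : pt) : oitv a b P.1 -> oitv a b Q.1 -> J P.2 -> J Q.2 -> P <= Q ->
  ddot a b g (ind P Q) = g Q.1 Q.2 - g P.1 P.2.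
Proof.
move=> oP oQ JP JQ PQ; have PQ1 := lept1 PQ.
have [c [d [p [q [[oc od] cd pq cx yd]]]]] := suppin_frame oP oQ PQ1.
have bv := sBVloc_in oc od cd.
have sP : suppin a b P.1 Q.1 (ind P Q).
  by have := @suppin_ind _ a b P Q; rewrite (min_idPl PQ1) (max_idPr PQ1).
rewrite (ddotE oc od cd pq (@ldG_ind _ a b P Q) sP cx PQ1 yd).
have hP : c < P.1 < d by lra. have hQ : c < Q.1 < d by lra.
rewrite (lsdiff_ind (cpair_cts oc od cd pq))// -!pq//.
have IP : oitv c%:E d%:E P.1 by apply/oitvE. have IQ : oitv c%:E d%:E Q.1 by apply/oitvE.
have E t : oitv c%:E d%:E t -> fibs (ind P Q) t = fibinc (g t) t Q - fibinc (g t) t P.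
  by move=> It; rewrite /fibs fibint_ind//; exact: sBV_ACJ bv _ It.
have AS := fibs_summable oc od cd (@ldG_ind _ a b P Q) ler01 (fun t s _ _ => norm_ind P Q t s).
move: PQ1; rewrite le_eqVlt => /predU1P[PQ1|PQ1].
  rewrite PQ1 subrr add0r (ssumE AS (S := g Q.1 Q.2 - g Q.1 P.2))//.
  have -> : g Q.1 Q.2 - g Q.1 P.2 = fibs (ind P Q) Q.1.
    by rewrite E// /fibinc PQ1 ltxx eqxx opprB addrA subrK.
  apply: (@is_ssumS _ [set Q.1]); [by move=> t ->|move=> t It /= /eqP nt|exact: is_ssum1].
  by rewrite E// /fibinc PQ1 (negbTE nt); case: ifP => _; rewrite subrr.
have h := @cp_sub _ _ _ _ bv P.1 Q.1 (ltac:(by lra)) PQ1 (ltac:(by lra)).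
move: h; rewrite /cp => ->.
set S := ssum (oitv P.1%:E Q.1%:E) _.
have sub : oitv P.1%:E Q.1%:E `<=` oitv c%:E d%:E by apply: oitv_sub; lra.
rewrite (ssumE AS (S := (g P.1 2^-1 - g P.1 P.2) + (S + (g Q.1 Q.2 - g Q.1 (- 2^-1))))); first by ring.
have iS : is_ssum (oitv P.1%:E Q.1%:E) (fibs (ind P Q)) S.
  have := ssumP (abs_summableS sub (jump_summable bv)); apply: is_ssum_eq => t It.
  have It' := sub _ It; have /oitvE ht := It.
  rewrite E// (sBV_jump bv)// /fibinc (_ : t < Q.1); last by lra.
  by rewrite ltNge (ltW (_ : P.1 < t)) ?gt_eqF ?subr0//; lra.
have iQ : is_ssum [set Q.1] (fibs (ind P Q)) (g Q.1 Q.2 - g Q.1 (- 2^-1)).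
  rewrite (_ : g Q.1 Q.2 - _ = fibs (ind P Q) Q.1); first exact: is_ssum1.
  by rewrite E// /fibinc ltxx eqxx ltNge (ltW PQ1) /= gt_eqF// subr0.
have iP : is_ssum [set P.1] (fibs (ind P Q)) (g P.1 2^-1 - g P.1 P.2).
  rewrite (_ : g P.1 2^-1 - _ = fibs (ind P Q) P.1); first exact: is_ssum1.
  by rewrite E// /fibinc ltxx eqxx PQ1; ring.
have iSQ : is_ssum (oitv P.1%:E Q.1%:E `|` [set Q.1]) (fibs (ind P Q)) (S + (g Q.1 Q.2 - g Q.1 (- 2^-1))).
  apply: is_ssumU iS iQ; apply/seteqP; split => // t [/oitvE ht /= tQ]; move: ht; rewrite tQ ltxx andbF//.
have iPSQ : is_ssum ([set P.1] `|` (oitv P.1%:E Q.1%:E `|` [set Q.1])) (fibs (ind P Q))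
    ((g P.1 2^-1 - g P.1 P.2) + (S + (g Q.1 Q.2 - g Q.1 (- 2^-1)))).
  apply: is_ssumU iP iSQ; apply/seteqP; split => // t [/= -> [/oitvE|/= E1]]; first by rewrite ltxx.
  by move: PQ1; rewrite E1 ltxx.
apply: is_ssumS iPSQ; first by move=> t [/= ->//|[/sub//|/= ->//]].
move=> t It nt; rewrite E// /fibinc; have [tP|Pt|tP] := ltgtP t P.1.
- by rewrite (lt_trans tP PQ1) subrr.
- have [tQ|Qt|tQ] := ltgtP t Q.1; last by exfalso; apply: nt; right; right.
    by exfalso; apply: nt; right; left; apply/oitvE; rewrite Pt.
  by rewrite subrr.
- by exfalso; apply: nt; left.
Qed.

End CPartIntegral.

(** * Curves on the lexicographic line *)

Section VectorNorm.
Context {R : realType}.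

Lemma mx_norm_le m n (v : 'M[R]_(m, n)) B : 0 <= B -> (forall i j, `|v i j| <= B) -> `|v| <= B.
Proof.
by move=> B0 H; rewrite [`|v|]mx_normrE; apply/bigmax_leP; split => // -[i j] _; exact: H.
Qed.

Lemma coord_norm_le m n (v : 'M[R]_(m, n)) i j : `|v i j| <= `|v|.
Proof. by rewrite [`|v|]mx_normrE; exact: (le_bigmax _ (fun ij => `|v ij.1 ij.2|) (i, j)). Qed.

Lemma cV_norm_le n (v : 'cV[R]_n) B : 0 <= B -> (forall i, `|v i 0| <= B) -> `|v| <= B.
Proof. by move=> B0 H; apply: mx_norm_le => // i j; rewrite ord1. Qed.

End VectorNorm.

Section Curves.
Context {R : realType} {n : nat}.
Local Notation pt := (R *lexi[ring_display] R)%type.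
Implicit Types (x : R -> R -> 'cV[R]_n) (D : set (R * 'cV[R]_n)).

Definition ctsJ (h : R -> R) := forall s, J s -> forall e : R, 0 < e ->
  exists2 d : R, 0 < d & forall r, J r -> `|r - s| < d -> `|h r - h s| <= e.

(** Continuity along the lexicographic line: along each fibre, and from each
fibre to the neighbouring ones. *)
Definition lexcts (a b : \bar R) x := forall i,
  [/\ forall t, oitv a b t -> ctsJ (fun s => x t s i 0),
      forall t, oitv a b t -> dlim t^'- (Defs.coord x i) (x t (- 2^-1) i 0) &
      forall t, oitv a b t -> dlim t^'+ (Defs.coord x i) (x t 2^-1 i 0)].

Lemma near_forall_ord (T : Type) (F : set_system T) {FF : Filter F} (P : 'I_n -> T -> Prop) :
  (forall i, \forall t \near F, P i t) -> \forall t \near F, forall i, P i t.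
Proof.
move=> H; suff : \forall t \near F, forall i, i \in enum 'I_n -> P i t.
  by apply: filterS => t h i; apply: h; rewrite mem_enum.
elim: (enum _) => [|i l IH]; first exact: nearW.
apply: filterS2 IH (H i) => t h1 h2 k; rewrite inE => /predU1P[->//|]; exact: h1.
Qed.

Lemma lexcts_dlim (F : set_system R) {FF : Filter F} x (c : 'cV[R]_n) :
  (forall i, dlim F (Defs.coord x i) (c i 0)) ->
  forall e : R, 0 < e -> \forall t \near F, forall s, J s -> `|x t s - c| <= e.
Proof.
move=> H e e0; have : \forall t \near F, forall i s, J s -> `|Defs.coord x i t s - c i 0| <= e.
  by apply: near_forall_ord => i; exact: H.
apply: filterS => t Ht s Js.
by apply: cV_norm_le; [exact: ltW|move=> i; rewrite !mxE; exact: Ht].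
Qed.

Lemma lexcts_left (a b : \bar R) x t : lexcts a b x -> oitv a b t ->
  forall e : R, 0 < e -> \forall r \near t^'-, forall s, J s -> `|x r s - x t (- 2^-1)| <= e.
Proof. by move=> lx ot; apply: lexcts_dlim => i; have [_ h _] := lx i; exact: h. Qed.

Lemma lexcts_right (a b : \bar R) x t : lexcts a b x -> oitv a b t ->
  forall e : R, 0 < e -> \forall r \near t^'+, forall s, J s -> `|x r s - x t 2^-1| <= e.
Proof. by move=> lx ot; apply: lexcts_dlim => i; have [_ _ h] := lx i; exact: h. Qed.

Lemma curve_near (a b : \bar R) x t u : lexcts a b x -> oitv a b t -> J u -> forall e : R, 0 < e ->
  exists2 d : R, 0 < d & forall r, J r -> `|r - u| < d -> `|x t r - x t u| <= e.
Proof.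
move=> lx ot Ju e e0.
have : \forall d \near (0 : R)^'+, forall i r, J r -> `|r - u| < d -> `|x t r i 0 - x t u i 0| <= e.
  apply: near_forall_ord => i; have [lxi _ _] := lx i; have [d d0 Hd] := lxi t ot u Ju e e0.
  apply: (@ex_near_right _ _ _ d) => // d' hd' r Jr' hr; apply: Hd => //; lra.
move=> /near_right_ex[d d0 Hd]; exists (d / 2); first by lra.
move=> r Jr' hr; apply: cV_norm_le; [exact: ltW|move=> i; rewrite !mxE].
by apply: (Hd (d / 2)) => //; lra.
Qed.

Definition graph (c d : R) x : set (R * 'cV[R]_n) :=
  [set p | exists t s, [/\ c <= t <= d, J s & p = (t, x t s)]].

(** Near each point of the line the graph is close to a single point or to a
compact fibre; [cousin] glues the pieces together. *)
Lemma graph_compact (a b : \bar R) (c d : R) x : lexcts a b x -> oitv a b c -> oitv a b d ->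
  compact (graph c d x).
Proof.
move=> lx oc od; have [dc|cd] := ltP d c.
  rewrite (_ : graph c d x = set0); first exact: compact0.
  by apply/seteqP; split => // p [t [s [h _ _]]]; lra.
apply/compact_near_coveringP => T F P FF H.
have nb t u : c <= t <= d -> J u -> exists2 e : R, 0 < e & \forall i \near F, forall r (y : 'cV[R]_n),
    `|r - t| < e -> `|y - x t u| < e -> P i (r, y).
  move=> ht Ju; have Kt : graph c d x (t, x t u) by exists t, u.
  have [[A1 B1] [/= /nbhs_ballP[e /= e0 He] FB] sAB] := H _ Kt.
  exists e => //; apply: filterS FB => i Bi r y hr hy; apply: (sAB (_, _)); split => //=.
  by apply: He; split; [rewrite /ball /= distrC|rewrite -ball_normE /ball_ /= distrC].
have fib t : c <= t <= d -> \forall i \near F, forall s, J s -> P i (t, x t s).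
  move=> ht; have ot : oitv a b t by exact: (oitv_le oc od).
  pose E y z := \forall i \near F, forall s, y <= s <= z -> P i (t, x t s).
  suff : E (- 2^-1) 2^-1.
    by apply: filterS => i h s; rewrite JE; exact: h.
  have step u : J u -> exists2 e : R, 0 < e & \forall i \near F, forall s, J s -> `|s - u| < e -> P i (t, x t s).
    move=> Ju; have [e e0 He] := nb t u ht Ju; have e2 : 0 < e / 2 by lra.
    have [k k0 Hk] := curve_near lx ot Ju e2.
    exists k => //; apply: filterS He => i h s Js /(Hk _ Js) hs; apply: h; last by lra.
    by rewrite subrr normr0.
  apply: (@cousin R _ _ E) => //; first by lra.
  - move=> p q r _ pq qr _; apply: filterS2 => i h1 h2 s hs.
    by case: (leP s q) => sq; [apply: h1; lra|apply: h2; lra].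
  - move=> p hp; have Jp : J p by rewrite JE.
    have [e e0] := step p Jp; apply: filterS => i h s hs; have -> : s = p by lra.
    by apply: h => //; rewrite subrr normr0.
  - move=> p hp; have Jp : J p by rewrite JE; lra.
    have [e e0 He] := step p Jp; exists e => // q hq q1; apply: filterS He => i h s hs; apply: h.
      by rewrite JE; lra.
    by rewrite ger0_norm; lra.
  - move=> p hp; have Jp : J p by rewrite JE; lra.
    have [e e0 He] := step p Jp; exists e => // q hq q1; apply: filterS He => i h s hs; apply: h.
      by rewrite JE; lra.
    by rewrite ler0_norm; lra.
pose E c d := \forall i \near F, forall t s, c <= t <= d -> J s -> P i (t, x t s).
suff : E c d.
  by apply: filterS => i h _ [t [s [ht Js ->]]]; exact: h.
apply: (@cousin R _ _ E) => //.
- move=> p q r _ pq qr _; apply: filterS2 => i h1 h2 t s ht.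
  by case: (leP t q) => tq; [apply: h1; lra|apply: h2; lra].
- move=> t ht; apply: filterS (fib t ht) => i h t' s ht'; have -> : t' = t by lra.
  exact: h.
- move=> t ht; have ht' : c <= t <= d by lra.
  have ot : oitv a b t by exact: (oitv_le oc od).
  have [e e0 He] := nb t _ ht' Jr; have e2 : 0 < e / 2 by lra.
  have [k k0 Hk] := near_right_ex (lexcts_right lx ot e2).
  exists (Num.min e k); first by rewrite lt_min e0.
  move=> t' /andP[tt' h] t'd; move: h; rewrite -ltrBlDl lt_min => /andP[h1 h2].
  apply: filterS2 He (fib t ht') => i Hi Fi r s hr Js.
  have [->|nt] := eqVneq r t; first exact: Fi.
  have rt : t < r by rewrite lt_neqAle eq_sym nt; case/andP: hr.
  apply: Hi; first by rewrite gtr0_norm; lra.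
  by apply: le_lt_trans (Hk r _ s Js) _; lra.
- move=> t ht; have ht' : c <= t <= d by lra.
  have ot : oitv a b t by exact: (oitv_le oc od).
  have [e e0 He] := nb t _ ht' Jl; have e2 : 0 < e / 2 by lra.
  have [k k0 Hk] := near_left_ex (lexcts_left lx ot e2).
  exists (Num.min e k); first by rewrite lt_min e0.
  move=> t' /andP[h tt'] t'd; move: h; rewrite ltrBlDl -ltrBlDr lt_min => /andP[h1 h2].
  apply: filterS2 He (fib t ht') => i Hi Fi r s hr Js.
  have [->|nt] := eqVneq r t; first exact: Fi.
  have rt : r < t by rewrite lt_neqAle nt; case/andP: hr.
  apply: Hi; first by rewrite ltr0_norm; lra.
  by apply: le_lt_trans (Hk r _ s Js) _; lra.
Qed.

Lemma compact_tube (K D : set (R * 'cV[R]_n)) : compact K -> open D -> K `<=` D ->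
  exists2 r : R, 0 < r & forall t y t' y', K (t, y) -> `|t' - t| < r -> `|y' - y| < r -> D (t', y').
Proof.
move=> /compact_near_coveringP cK oD KD.
have : \forall r \near (0 : R)^'+, K `<=` (fun p => forall t' y', `|t' - p.1| < r -> `|y' - p.2| < r -> D (t', y')).
  apply: cK => p Kp.
  have /nbhs_ballP[e /= e0 He] : nbhs p D by apply: open_nbhs_nbhs; split => //; exact: KD.
  exists (ball p (e / 2), [set r : R | 0 < r < e / 2]).
    split; first by apply: nbhsx_ballx; lra.
    by apply: (@ex_near_right _ _ _ (e / 2)) => [|r hr /=]; lra.
  move=> [q r] /= [[]]; rewrite -ball_normE /ball_ /= => h1 h2 hr t' y' ht hy; apply: He; split => /=.
    rewrite /ball /=; have := ler_distD q.1 p.1 t'; rewrite [`|q.1 - t'|]distrC; lra.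
  rewrite -ball_normE /ball_ /=; have := ler_distD q.2 p.2 y'; rewrite [`|q.2 - y'|]distrC.
  move: h2; rewrite -ball_normE /ball_ /=; lra.
move=> /near_right_ex[r r0 Hr]; exists (r / 2); first by lra.
by move=> t y t' y' Kty; apply: (Hr (r / 2) _ (t, y) Kty); lra.
Qed.

End Curves.

Section CtsJ.
Context {R : realType}.
Implicit Types (h : R -> R).

Lemma ctsJ_regJ h : ctsJ h -> regulatedJ h.
Proof.
move=> ch.
have H t e : J t -> 0 < e -> exists2 k : R, 0 < k & forall r, J r -> `|r - t| < k -> `|h t - h r| <= e.
  by move=> Jt e0; have [k k0 Hk] := ch t Jt e e0; exists k => // r Jr' hr; rewrite distrC; exact: Hk.
have rl t : - 2^-1 <= t < 2^-1 -> cvg (h x @[x --> t^'+]).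
  move=> ht; apply/cvg_ex; exists (h t); apply/cvgrPdist_le => e e0.
  have [k k0 Hk] := H t e (ltac:(by rewrite JE; lra)) e0.
  apply: (@ex_near_right _ _ _ (Num.min k (2^-1 - t))); first by rewrite lt_min k0; lra.
  move=> x /andP[tx]; rewrite -ltrBlDl lt_min => /andP[h1 h2]; apply: Hk; first by rewrite JE; lra.
  by rewrite gtr0_norm; lra.
have ll t : - 2^-1 < t <= 2^-1 -> cvg (h x @[x --> t^'-]).
  move=> ht; apply/cvg_ex; exists (h t); apply/cvgrPdist_le => e e0.
  have [k k0 Hk] := H t e (ltac:(by rewrite JE; lra)) e0.
  apply: (@ex_near_left _ _ _ (Num.min k (t + 2^-1))); first by rewrite lt_min k0; lra.
  move=> x /andP[+ xt]; rewrite ltrBlDl -ltrBlDr lt_min => /andP[h1 h2]; apply: Hk; first by rewrite JE; lra.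
  by rewrite ltr0_norm; lra.
split; [|by move=> t [/=]; rewrite !lte_fin => t1 t2; apply: rl; lra|
  by move=> t [/=]; rewrite !lte_fin => t1 t2; apply: ll; lra|by apply: rl; lra|by apply: ll; lra].
pose E (x y : R) := exists M : R, forall s, x <= s <= y -> `|h s| <= M.
have loc t : J t -> exists2 e : R, 0 < e & exists M : R, forall s, J s -> `|s - t| < e -> `|h s| <= M.
  move=> Jt; have [k k0 Hk] := H t 1 Jt ltr01; exists k => //; exists (`|h t| + 1) => s Js hs.
  by have := Hk s Js hs; have := ler_normB (h t) (h t - h s); rewrite subKr; lra.
suff [M HM] : E (- 2^-1) 2^-1.
  by exists M => t [/=]; rewrite !lte_fin => t1 t2; apply: HM; lra.
apply: (@cousin R _ _ E) => //; first by lra.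
- move=> x y z _ xy yz _ [M1 h1] [M2 h2]; exists (Num.max M1 M2) => s hs; rewrite le_max.
  by case: (leP s y) => sy; apply/orP; [left; apply: h1; lra|right; apply: h2; lra].
- by move=> x _; exists `|h x| => s hs; have -> : s = x by lra.
- move=> x hx; have [e e0 [M HM]] := loc x (ltac:(by rewrite JE; lra)); exists e => // y hy y2.
  by exists M => s hs; apply: HM; [rewrite JE; lra|rewrite ger0_norm; lra].
- move=> x hx; have [e e0 [M HM]] := loc x (ltac:(by rewrite JE; lra)); exists e => // y hy y2.
  by exists M => s hs; apply: HM; [rewrite JE; lra|rewrite ler0_norm; lra].
Qed.

Lemma ACJ_ctsJ h : ACJ h -> ctsJ h.
Proof.
move=> ach s Js e /ach[d d0 Hd]; exists d => // r Jr' hr.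
case: (leP s r) => sr.
  have := Hd [:: (s, r)]; rewrite !big_seq1 /= => /(_ _ _ _)/ltW; apply => //.
    by move=> K; rewrite inE => /eqP ->.
  by move: hr; rewrite ger0_norm ?subr_ge0.
have := Hd [:: (r, s)]; rewrite !big_seq1 /= distrC => /(_ _ _ _)/ltW; apply => //.
  by move=> K; rewrite inE => /eqP ->; split => //; exact: ltW.
by move: hr; rewrite ler0_norm ?opprB// subr_le0 ltW.
Qed.

End CtsJ.

(** * The coefficients along a curve *)

Section Composite.
Context {R : realType} {n : nat}.
Local Notation pt := (R *lexi[ring_display] R)%type.
Implicit Types (x : R -> R -> 'cV[R]_n).

Lemma lipP (V W : normedModType R) (K : R) (A : set V) (f : V -> W) : K.-lipschitz_A f ->
  forall y z, A y -> A z -> `|f y - f z| <= K * `|y - z|.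
Proof. by move=> H y z Ay Az; exact: (H (y, z)). Qed.

Lemma control_lexcts (a b : \bar R) x (w : 'I_n -> @dyn R) (K : 'I_n -> R) :
  (forall i, control a b (Defs.coord x i) (w i) (K i)) -> lexcts a b x.
Proof.
move=> ctl i; split.
- by move=> t ot; apply: ACJ_ctsJ; exact: ctl_ACJ (ctl i) _ ot.
- by move=> t ot; exact: (ctl_left (ctl i)).
- by move=> t ot; exact: (ctl_right (ctl i)).
Qed.

Lemma sBVloc_lexcts (a b : \bar R) x : sBVn_loc a b x -> lexcts a b x.
Proof.
move=> bv i.
have sg t : oitv a b t -> exists c d, sG c%:E d%:E (Defs.coord x i) /\ oitv c%:E d%:E t.
  move=> ot; have [c ct oc] := oitv_left ot; have [d td od] := oitv_right ot.
  exists c, d; split; last by apply/oitvE; rewrite ct.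
  by have [||h _ _] := bv i c d; [lra|exact: segment_oitv|exact: h].
by split => t /sg[c [d [[_ h1 h2 h3] It]]]; [apply: ACJ_ctsJ; exact: h1|exact: h2|exact: h3].
Qed.

Variables (D : set (R * 'cV[R]_n)) (G : R -> 'cV[R]_n -> R -> 'M[R]_n) (Kg : R).
Hypothesis oD : open D.
Hypothesis hg : forall (y : 'cV[R]_n) (i j : 'I_n) (c d : \bar R), (c < d)%E ->
     (forall t, oitv c d t -> D (t, y)) -> sG c d (fun t s => G t y s i j).
Hypothesis Kg0 : 0 < Kg.
Hypothesis hgLip : forall t s, J s -> Kg.-lipschitz_[set y | D (t, y)] (fun y => G t y s).

Lemma G_lip t s y z i j : J s -> D (t, y) -> D (t, z) -> `|G t y s i j - G t z s i j| <= Kg * `|y - z|.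
Proof.
move=> Js Dy Dz; apply: le_trans (lipP (hgLip Js) Dy Dz).
by have := coord_norm_le (G t y s - G t z s) i j; rewrite !mxE.
Qed.

Lemma G_slice t y : D (t, y) -> exists2 r : R, 0 < r &
  forall i j, sG (t - r)%:E (t + r)%:E (fun t s => G t y s i j) /\
    (forall t' y', `|t' - t| < r -> `|y' - y| < r -> D (t', y')).
Proof.
move=> Dty.
have [||r r0 Hr] := @compact_tube R n [set (t, y)] D _ oD; [exact: compact_set1|by move=> ? ->|].
exists r => // i j; split; last by move=> t' y' h1 h2; exact: (Hr t y).
apply: hg; first by rewrite lte_fin; move: r0 => r0'; lra.
by move=> t' /oitvE ht; apply: (Hr t y) => //; [rewrite ltr_norml; lra|rewrite subrr normr0].
Qed.

(** For a fixed state y the coefficient has one-sided limits, and near a time t the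
curve is close to its value there; the Lipschitz condition compares the two. *)
Lemma lexG_ldG (a b : \bar R) x i j : lexcts a b x -> (forall t s, oitv a b t -> J s -> D (t, x t s)) ->
  ldG a b (fun t s => G t (x t s) s i j).
Proof.
move=> lx xD.
have small (e : R) : 0 < e -> 0 < e / (2 * Kg) /\ Kg * (e / (2 * Kg)) = e / 2.
  by move=> e0; split; [rewrite divr_gt0 ?mulr_gt0//|field; rewrite gt_eqF].
split => t ot.
- apply: ctsJ_regJ => s Js e e0; have [e1 e1E] := small e e0.
  have [r r0 /(_ i j)[[_ acG _ _] _]] := G_slice (xD t s ot Js).
  have It : oitv (t - r)%:E (t + r)%:E t by apply/oitvE; lra.
  have e2 : 0 < e / 2 by lra.
  have [d1 d10 H1] := ACJ_ctsJ (acG t It) Js e2.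
  have [d2 d20 H2] := curve_near lx ot Js e1.
  exists (Num.min d1 d2); first by rewrite lt_min d10.
  move=> p Jp; rewrite lt_min => /andP[p1 p2].
  have h1 := H1 p Jp p1; have h2 := H2 p Jp p2.
  have h3 := G_lip i j Jp (xD t p ot Jp) (xD t s ot Js).
  have h4 : Kg * `|x t p - x t s| <= e / 2 by rewrite -e1E ler_wpM2l// ltW.
  have := ler_distD (G t (x t s) p i j) (G t (x t p) p i j) (G t (x t s) s i j); lra.
- exists (G t (x t 2^-1) 2^-1 i j) => e e0; have [e1 e1E] := small e e0.
  have [r r0 /(_ i j)[[_ _ _ Gr] Dr]] := G_slice (xD t _ ot Jr).
  have It : oitv (t - r)%:E (t + r)%:E t by apply/oitvE; lra.
  have e2 : 0 < e / 2 by lra.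
  have e1' : 0 < Num.min (e / (2 * Kg)) (r / 2) by rewrite lt_min e1; lra.
  have [t' tt' ot'] := oitv_right ot.
  have N0 : \forall y \near t^'+, t < y < t + Num.min (t' - t) r.
    by apply: (@ex_near_right _ _ _ (Num.min (t' - t) r)) => //; rewrite lt_min r0 subr_gt0 tt'.
  apply: filterS3 N0 (Gr t It _ e2) (lexcts_right lx ot e1') => y.
  move=> /andP[ty]; rewrite -ltrBlDl lt_min => /andP[yt' yr] h1 h2 s Js.
  have oy : oitv a b y by apply: (oitv_le ot ot'); lra.
  have := h2 s Js; rewrite le_min => /andP[h3 h4].
  have Dy : D (y, x t 2^-1) by apply: Dr; [rewrite gtr0_norm; lra|rewrite subrr normr0].
  have h5 := G_lip i j Js (xD y s oy Js) Dy.
  have h6 : Kg * `|x y s - x t 2^-1| <= e / 2 by rewrite -e1E ler_wpM2l// ltW.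
  have := h1 s Js; have := ler_distD (G y (x t 2^-1) s i j) (G y (x y s) s i j) (G t (x t 2^-1) 2^-1 i j); lra.
- exists (G t (x t (- 2^-1)) (- 2^-1) i j) => e e0; have [e1 e1E] := small e e0.
  have [r r0 /(_ i j)[[_ _ Gl _] Dr]] := G_slice (xD t _ ot Jl).
  have It : oitv (t - r)%:E (t + r)%:E t by apply/oitvE; lra.
  have e2 : 0 < e / 2 by lra.
  have e1' : 0 < Num.min (e / (2 * Kg)) (r / 2) by rewrite lt_min e1; lra.
  have [t' tt' ot'] := oitv_left ot.
  have N0 : \forall y \near t^'-, t - Num.min (t - t') r < y < t.
    by apply: (@ex_near_left _ _ _ (Num.min (t - t') r)) => //; rewrite lt_min r0 subr_gt0 tt'.
  apply: filterS3 N0 (Gl t It _ e2) (lexcts_left lx ot e1') => y.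
  move=> /andP[+ ty]; rewrite ltrBlDl -ltrBlDr lt_min => /andP[yt' yr] h1 h2 s Js.
  have oy : oitv a b y by apply: (oitv_le ot' ot); lra.
  have := h2 s Js; rewrite le_min => /andP[h3 h4].
  have Dy : D (y, x t (- 2^-1)) by apply: Dr; [rewrite ltr0_norm; lra|rewrite subrr normr0].
  have h5 := G_lip i j Js (xD y s oy Js) Dy.
  have h6 : Kg * `|x y s - x t (- 2^-1)| <= e / 2 by rewrite -e1E ler_wpM2l// ltW.
  have := h1 s Js; have := ler_distD (G y (x t (- 2^-1)) s i j) (G y (x y s) s i j) (G t (x t (- 2^-1)) (- 2^-1) i j); lra.
Qed.

End Composite.

Section CompletedLebesgue.
Context {R : realType}.
Local Notation leb := (@lebesgue_measure R).
Local Notation clm := (@completed_lebesgue_measure R).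
Local Notation LT := (caratheodory_type (@wlength R idfun)^*%mu).

Lemma clmE (A : set R) : clm A = leb A.
Proof. by []. Qed.

Lemma cmeasurable (A : set R) : measurable (A : set (measurableTypeR R)) -> measurable (A : set LT).
Proof. by move=> mA; apply: sub_caratheodory. Qed.

Lemma cmeasurable_fun (A : set R) (h : R -> R) :
  measurable (A : set (measurableTypeR R)) ->
  measurable_fun (A : set (measurableTypeR R)) h -> measurable_fun (A : set LT) h.
Proof. by move=> mA mh _ Y mY; apply: cmeasurable; exact: mh. Qed.
Section Nemytskii.
Variable n : nat.
Variables (D : set (R * 'cV[R]_n)) (f : R -> 'cV[R]_n -> 'cV[R]_n) (Kf : R).
Hypothesis oD : open D.
Hypothesis Kf0 : 0 < Kf.
Hypothesis cf : caratheodory D f.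
Hypothesis hfLip : forall t, Kf.-lipschitz_[set y | D (t, y)] (f t).

Lemma f_lip t y z i : D (t, y) -> D (t, z) -> `|f t y i 0 - f t z i 0| <= Kf * `|y - z|.
Proof.
move=> Dy Dz; have h1 := lipP (@hfLip t) Dy Dz.
by have := le_trans (coord_norm_le (f t y - f t z) i 0) h1; rewrite !mxE.
Qed.

Let y_ (k : nat) : 'cV[R]_n := map_mx ratr (odflt 0 (unpickle k : option 'cV[rat]_n)).

Let dist1 (v w : 'cV[R]_n) : R := \sum_i `|v i 0 - w i 0|.

Let dist1_ge v w : `|v - w| <= dist1 v w.
Proof.
apply: cV_norm_le; first by apply: sumr_ge0.
move=> i; rewrite !mxE /dist1 (bigD1 i)//= lerDl; exact: sumr_ge0.
Qed.

Let dense_y (v : 'cV[R]_n) (e : R) : 0 < e -> exists k, dist1 v (y_ k) <= e.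
Proof.
move=> e0; pose e1 := e / n.+1%:R.
have e10 : 0 < e1 by rewrite divr_gt0.
have H i : exists q : rat, `|v i 0 - ratr q| <= e1.
  have [q] := @rat_in_itvoo R (v i 0) (v i 0 + e1) (ltac:(by rewrite ltrDl)).
  by rewrite in_itv /= => hq; exists q; rewrite distrC gtr0_norm; lra.
pose q i := projT1 (cid (H i)); exists (pickle (\col_i q i)).
rewrite /y_ pickleK /= /dist1; apply: (@le_trans _ _ (\sum_(i < n) e1)).
  by apply: ler_sum => i _; rewrite !mxE; exact: (projT2 (cid (H i))).
rewrite sumr_const card_ord -mulr_natr /e1 mulrAC ler_pdivrMr// ler_wpM2l ?ler_nat//; exact: ltW.
Qed.

Let openD y : open [set t | D (t, y)].
Proof.
rewrite openE => t Dt; have /nbhs_ballP[e /= e0 He] : nbhs (t, y) D by exact: open_nbhs_nbhs.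
by apply/nbhs_ballP; exists e => // r hr; apply: He; split => //=; exact: ballxx.
Qed.

(** A Lipschitz extension in the manner of McShane, with only countably many base
points, which makes the infimum measurable. *)
Let h_ i (z : R -> 'cV[R]_n) (k : nat) (t : R) : \bar R :=
  if `[< D (t, y_ k) >] then (f t (y_ k) i 0 + Kf * dist1 (z t) (y_ k))%:E else +oo%E.

(** The Lipschitz bound makes f the infimum; its value is approached at rational
points close to the state, which are in the domain because it is open. *)
Let h_inf i z t : D (t, z t) -> (f t (z t) i 0)%:E = einfs ((h_ i z) ^~ t) 0%N.
Proof.
move=> Dz; apply/eqP; rewrite eq_le; apply/andP; split.
  apply: le_ereal_inf_tmp => _ [k _ <-]; rewrite /h_; case: asboolP => [Dk|]; last by rewrite leey.
  rewrite lee_fin; have := f_lip i Dz Dk; have : Kf * `|z t - y_ k| <= Kf * dist1 (z t) (y_ k) by rewrite ler_pM2l.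
  rewrite ler_norml; lra.
apply/lee_addgt0Pr => e e0.
have /nbhs_ballP[r /= r0 Hr] : nbhs (t, z t) D by exact: open_nbhs_nbhs.
pose e1 := Num.min (r / 2) (e / (2 * Kf)).
have e10 : 0 < e1 by rewrite lt_min !divr_gt0 ?mulr_gt0.
have [k hk] := dense_y (z t) e10; have hk' := le_trans (dist1_ge (z t) (y_ k)) hk.
have [k1 k2] : dist1 (z t) (y_ k) <= r / 2 /\ dist1 (z t) (y_ k) <= e / (2 * Kf).
  by move: hk; rewrite /e1 le_min => /andP[].
have Dk : D (t, y_ k).
  apply: Hr; split => /=; first exact: ballxx.
  by rewrite -ball_normE /ball_ /=; have := dist1_ge (z t) (y_ k); lra.
apply: (@le_trans _ _ (h_ i z k t)); first by apply: ereal_inf_lbound; exists k.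
rewrite /h_ asboolT// lee_fin.
have h1 : Kf * dist1 (z t) (y_ k) <= e / 2.
  by rewrite (_ : e / 2 = Kf * (e / (2 * Kf))) ?ler_pM2l//; field; rewrite gt_eqF.
have := f_lip i Dz Dk; have : Kf * `|z t - y_ k| <= Kf * dist1 (z t) (y_ k) by rewrite ler_pM2l.
rewrite ler_norml; lra.
Qed.

Lemma nemytskii_measurable (A : set R) (z : R -> 'cV[R]_n) i :
  measurable (A : set (measurableTypeR R)) ->
  (forall j, measurable_fun (A : set (measurableTypeR R)) (fun t => z t j 0)) ->
  (forall t, A t -> D (t, z t)) ->
  measurable_fun (A : set LT) (fun t => f t (z t) i 0).
Proof.
move=> mA mz zD; have [mf _ _] := cf.
have mA' := cmeasurable mA.
have mDk k : measurable ([set t | D (t, y_ k)] : set LT).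
  by apply: cmeasurable; apply: open_measurable; exact: openD.
apply/measurable_EFinP.
apply: (@eq_measurable_fun _ _ LT (\bar R) A (fun t => einfs ((h_ i z) ^~ t) 0%N)).
  by move=> t; rewrite inE => At; rewrite /= h_inf//; exact: zD.
apply: measurable_fun_einfs => k; rewrite /h_.
apply: (measurable_fun_if mA'); last exact: measurable_cst.
- apply: (measurable_fun_bool true).
  rewrite (_ : _ @^-1` _ = [set t | D (t, y_ k)]); first exact: measurableI.
  by apply/seteqP; split => t /= /asboolP.
- apply/measurable_EFinP; apply: measurable_funD.
    apply: (measurable_funS (mDk k)); last exact: mf.
    by move=> t [_ /= /asboolP].
  apply: measurable_funM; first exact: measurable_cst.
  apply: (measurable_funS mA'); first by move=> t [].
  rewrite /dist1; apply: measurable_sum => j; apply: (@measurableT_comp _ _ _ LT _ _ (@Num.norm R R)); first exact: normr_measurable.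
  apply: measurable_funB; last exact: measurable_cst.
  exact: cmeasurable_fun.
Qed.

Lemma lexcts_ldG (a b : \bar R) (x : R -> R -> 'cV[R]_n) i : lexcts a b x -> ldG a b (Defs.coord x i).
Proof.
move=> lx; have [h1 h2 h3] := lx i; split => t ot.
- by apply: ctsJ_regJ; exact: h1.
- by exists (x t 2^-1 i 0); exact: h3.
- by exists (x t (- 2^-1) i 0); exact: h2.
Qed.

(** The graph of the curve is compact, so the summable bound of the Caratheodory
condition applies. *)
Lemma nemytskii_integrable (a b : \bar R) (x : R -> R -> 'cV[R]_n) i c d : lexcts a b x ->
  (forall t s, oitv a b t -> J s -> D (t, x t s)) -> oitv a b c -> oitv a b d ->
  clm.-integrable `[c, d] (EFin \o (fun t => f t (x t 0) i 0)).
Proof.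
move=> lx xD oc od; have [dc|cd] := ltP d c.
  by rewrite set_itv_ge ?bnd_simp -?ltNge//; exact: integrable_set0.
have [d' dd' od'] := oitv_right od.
have sub t : c <= t < d' -> oitv a b t by move=> ht; apply: (oitv_le oc od'); lra.
have mcd' : measurable (`[c, d']%classic : set (measurableTypeR R)) by exact: measurable_itv.
have m1 : measurable (`[c, d'[%classic : set (measurableTypeR R)) by exact: measurable_itv.
have m2 : measurable (`[c, d]%classic : set LT) by apply: cmeasurable; exact: measurable_itv.
have mF : measurable_fun (`[c, d]%classic : set LT) (fun t => f t (x t 0) i 0).
  apply: (@measurable_funS _ _ LT _ (`[c, d'[%classic : set LT)); first exact: cmeasurable.
    by move=> t; rewrite /= !in_itv /= => /andP[-> h]; lra.
  apply: (@nemytskii_measurable _ (fun t => x t 0)) => //.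
    by move=> j; exact: (ldG_measurable_ord (lexcts_ldG j lx) oc od').
  by move=> t; rewrite /= in_itv /= => /sub ot; apply: xD => //; exact: J0.
have [_ _ /(_ (graph c d x))] := cf.
have gD : graph c d x `<=` D.
  by move=> _ [t [s [ht Js ->]]]; apply: xD => //; exact: (oitv_le oc od).
move=> /(_ (graph_compact lx oc od) gD)[m [im [N [mN N0 sN]]]].
have im' : clm.-integrable `[c, d] (EFin \o m) by apply: (@integrableS _ LT _ _ setT) => //.
apply/integrableP; split; first exact/measurable_EFinP.
apply: (@le_lt_trans _ _ (\int[clm]_(t in `[c, d]) `|(EFin \o m) t|)%E); last by case/integrableP: im'.
apply: (ae_ge0_le_integral m2).
- by move=> t _; exact: abse_ge0.
- by apply: measurableT_comp => //; exact/measurable_EFinP.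
- by move=> t _; exact: abse_ge0.
- by apply: measurableT_comp => //; case/integrableP: im'.
- exists N; split => //; first exact: cmeasurable.
  move=> t /= nt; apply: sN => h; apply: nt; rewrite in_itv /= => ht.
  rewrite lee_fin; have := h (x t 0) (ex_intro _ t (ex_intro _ 0 (And3 ht J0 erefl))).
  have := coord_norm_le (f t (x t 0)) i 0; have := ler_norm (m t); lra.
Qed.

End Nemytskii.

Definition locint (a b : \bar R) (F : R -> R) := forall c d, oitv a b c -> oitv a b d ->
  clm.-integrable `[c, d] (EFin \o F).

Lemma clm_itvoc (p q : R) : measurable (`]p, q]%classic : set LT).
Proof. by apply: cmeasurable; exact: measurable_itv. Qed.

Lemma clm_itvcc (p q : R) : measurable (`[p, q]%classic : set LT).
Proof. by apply: cmeasurable; exact: measurable_itv. Qed.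

Section Regular.
Variables (a b : \bar R) (F : R -> R).
Hypothesis lF : locint a b F.

Lemma locint_oc p q : oitv a b p -> oitv a b q -> clm.-integrable `]p, q] (EFin \o F).
Proof.
move=> op oq; apply: (@integrableS _ LT _ _ `[p, q]%classic); [exact: clm_itvcc|exact: clm_itvoc| |exact: lF].
by move=> t; rewrite /= !in_itv /= => /andP[/ltW -> ->].
Qed.

Lemma regular_eq x y phi : oitv a b x -> oitv a b y -> suppin a b x y phi ->
  regular a b F phi = \int[clm]_(t in `[x, y]) (ord phi t * F t).
Proof.
move=> ox oy sphi; rewrite /regular Rintegral_mkcond [RHS]Rintegral_mkcond; congr (fine _).
apply: eq_integral => t _; congr (_%:E); rewrite !patchE; case: ifPn => h1; case: ifPn => h2 //.
- by rewrite mulrC.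
- rewrite (_ : ord phi t = 0) ?mulr0//; apply: sphi J0 _; first by rewrite inE in h1.
  by apply: contra h2; rewrite inE /= in_itv.
- exfalso; case/negP: h1; rewrite inE; move: h2; rewrite inE /= in_itv /= => ht.
  exact: (oitv_le ox oy).
Qed.

Lemma ord_cmeasurable x y phi : oitv a b x -> oitv a b y -> ldG a b phi ->
  measurable_fun (`[x, y]%classic : set LT) (ord phi).
Proof.
move=> ox oy rphi; have [z yz oz] := oitv_right oy.
apply: (@measurable_funS _ _ LT _ (`[x, z[%classic : set LT)).
- by apply: cmeasurable; exact: measurable_itv.
- by move=> t; rewrite /= !in_itv /= => /andP[-> h]; lra.
- by apply: cmeasurable_fun; [exact: measurable_itv|exact: ldG_measurable_ord rphi ox oz].
Qed.

Lemma regular_distribution : (exists t, oitv a b t) -> Defs.distribution a b (regular a b F).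
Proof.
move=> ne; apply: bounded_distribution => //.
  move=> t0 o0 k phi psi tphi tpsi.
  have [rphi [x [y [ox oy xy sphi]]]] := test_suppin o0 tphi.
  have [rpsi [x' [y' [ox' oy' xy' spsi]]]] := test_suppin o0 tpsi.
  pose x2 := Num.min x x'; pose y2 := Num.max y y'.
  have ox2 : oitv a b x2 by exact: oitv_min. have oy2 : oitv a b y2 by exact: oitv_max.
  have xy2 : x2 <= y2 by rewrite ge_min le_max xy.
  have sphi2 : suppin a b x2 y2 phi by apply: suppinS sphi; rewrite ?ge_min ?le_max lexx.
  have spsi2 : suppin a b x2 y2 psi by apply: suppinS spsi; rewrite ?ge_min ?le_max lexx orbT.
  have schi : suppin a b x2 y2 (fun t s => k * phi t s + psi t s).
    by move=> t s ot Js h; rewrite sphi2// spsi2// mulr0 addr0.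
  rewrite !(regular_eq ox2 oy2)//.
  have I0 chi : ldG a b chi -> suppin a b x2 y2 chi ->
      clm.-integrable `[x2, y2] (EFin \o (fun t => ord chi t * F t)).
    move=> rc sc; have [M M0 HM] := test_bounded rc sc ox2 oy2 xy2.
    apply: (integrable_mulb (M := M) (clm_itvcc x2 y2) (lF ox2 oy2) (ord_cmeasurable ox2 oy2 rc)).
    by move=> t; rewrite /= in_itv /= => ht; apply: HM J0; exact: (oitv_le ox2 oy2).
  have i1 := I0 _ rphi sphi2; have i2 := I0 _ rpsi spsi2.
  rewrite -RintegralZl//; [|exact: clm_itvcc]; rewrite -RintegralD//; [|exact: clm_itvcc|].
    by apply: eq_Rintegral => t _; rewrite /ord; ring.
  rewrite (_ : EFin \o _ = (fun t => k%:E * (ord phi t * F t)%:E)%E); last by apply/funext.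
  by apply: integrableZl => //; exact: clm_itvcc.
move=> x y ox oy xy; exists (\int[clm]_(t in `[x, y]) `|F t|); first exact: Rintegral_ge0.
move=> phi e rphi sphi e0 He; rewrite (regular_eq ox oy sphi) mulrC.
apply: (Rintegral_mulb_le (clm_itvcc x y) (lF ox oy) (ord_cmeasurable ox oy rphi)).
by move=> t; rewrite /= in_itv /= => ht; apply: He J0; exact: (oitv_le ox oy).
Qed.

Lemma clm_set1 (t : R) : clm [set t] = 0%E.
Proof. by rewrite clmE lebesgue_measure_set1. Qed.

Lemma cmeas_set1 (t : R) : measurable ([set t] : set LT).
Proof. by apply: cmeasurable; exact: measurable_set1. Qed.

Lemma regular_sing P : regular a b F (sing P) = 0.
Proof.
rewrite /regular (@Rintegral_eq_off _ LT _ clm _ _ (cst 0) [set P.1] (cmeas_set1 _) (clm_set1 _)).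
  by rewrite /Rintegral integral0.
move=> t _ /= nt; rewrite /ord /sing -pair_eqE /pair_eq /= (_ : t == P.1 = false) ?mulr0//; exact/eqP.
Qed.

Local Notation pt := (R *lexi[ring_display] R)%type.

(** A single time is a null set, so the fast times of P and Q do not matter. *)
Lemma regular_ind (P Q : pt) : oitv a b P.1 -> oitv a b Q.1 -> P <= Q ->
  regular a b F (ind P Q) = \int[clm]_(t in `]P.1, Q.1]) F t.
Proof.
move=> oP oQ PQ; have PQ1 := lept1 PQ.
have sP : suppin a b P.1 Q.1 (ind P Q).
  by have := @suppin_ind _ a b P Q; rewrite (min_idPl PQ1) (max_idPr PQ1).
rewrite (regular_eq oP oQ sP) Rintegral_mkcond [RHS]Rintegral_mkcond.
rewrite (@Rintegral_eq_off _ LT _ clm _ _ (F \_ `]P.1, Q.1]) ([set P.1] `|` [set Q.1])) //.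
- by apply: measurableU; exact: cmeas_set1.
- exact: (null_set_setU (cmeas_set1 _) (cmeas_set1 _) (clm_set1 _) (clm_set1 _)).
- move=> t _ /not_orP[/eqP tP /eqP tQ]; rewrite !patchE.
  rewrite (_ : (t \in `[P.1, Q.1]%classic) = (P.1 <= t <= Q.1)); last by apply/idP/idP; rewrite inE /= in_itv.
  rewrite (_ : (t \in `]P.1, Q.1]%classic) = (P.1 < t <= Q.1)); last by apply/idP/idP; rewrite inE /= in_itv.
  rewrite lt_neqAle eq_sym tP /=; case: ifP => // /andP[h1 h2].
  by rewrite /ord indE// leptE ltptE /= !lt_neqAle tQ h2 (eq_sym P.1) tP h1 mul1r.
Qed.

Lemma int_diff_le (F' : R -> R) p q B : locint a b F' -> oitv a b p -> oitv a b q -> p <= q ->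
  (forall t, p < t < q -> `|F t - F' t| <= B) ->
  `|\int[clm]_(t in `]p, q]) F t - \int[clm]_(t in `]p, q]) F' t| <= B * (q - p).
Proof.
move=> lF' op oq; rewrite le_eqVlt => /predU1P[<- _|pq HB].
  by rewrite set_itvoc0 !Rintegral_set0 !subrr mulr0 normr0.
have B0 : 0 <= B by apply: le_trans (HB ((p + q) / 2) _); [exact: normr_ge0|lra].
have oo (K : R -> R) : \int[clm]_(t in `]p, q]) K t = \int[clm]_(t in `]p, q[) K t.
  rewrite Rintegral_mkcond [RHS]Rintegral_mkcond.
  apply: (@Rintegral_eq_off _ LT _ clm _ _ _ [set q] (cmeas_set1 _) (clm_set1 _)) => t _ /eqP tq.
  rewrite !patchE (_ : (t \in `]p, q]%classic) = (p < t <= q)); last by apply/idP/idP; rewrite inE /= in_itv.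
  rewrite (_ : (t \in `]p, q[%classic) = (p < t < q)); last by apply/idP/idP; rewrite inE /= in_itv.
  by rewrite [t < q]lt_neqAle tq.
have mo : measurable (`]p, q[%classic : set LT) by apply: cmeasurable; exact: measurable_itv.
have io (K : R -> R) : locint a b K -> clm.-integrable `]p, q[ (EFin \o K).
  move=> lK; apply: (@integrableS _ LT _ _ `[p, q]%classic); [exact: clm_itvcc|exact: mo| |exact: lK].
  by move=> t; rewrite /= !in_itv /= => /andP[/ltW -> /ltW ->].
have iF := io _ lF; have iF' := io _ lF'.
rewrite !oo -RintegralB//.
have iD : clm.-integrable `]p, q[ (EFin \o (fun t => F t - F' t)).
  rewrite (_ : EFin \o _ = (fun x => (F x)%:E - (F' x)%:E)%E); last by apply/funext.
  exact: integrableB.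
apply: le_trans (le_normr_Rintegral mo iD) _.
have flt : (clm `]p, q[%classic < +oo)%E by rewrite clmE lebesgue_measure_itv /= lte_fin pq ltry.
have fin : clm `]p, q[%classic = (q - p)%:E by rewrite clmE lebesgue_measure_itv /= lte_fin pq.
have -> : B * (q - p) = \int[clm]_(t in `]p, q[) B.
  by transitivity (B * fine (clm `]p, q[%classic)); [rewrite fin|symmetry; exact: Rintegral_cst].
apply: le_Rintegral => //.
- exact: integrable_norm.
- apply: measurable_bounded_integrable => //; exact: bounded_cst.
Qed.

Lemma int_cat p q r : oitv a b p -> oitv a b r -> p <= q -> q <= r ->
  \int[clm]_(t in `]p, r]) F t = \int[clm]_(t in `]p, q]) F t + \int[clm]_(t in `]q, r]) F t.
Proof.
move=> op or_ pq qr.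
have E : `]p, r]%classic = `]p, q]%classic `|` `]q, r]%classic.
  apply/seteqP; split => t; rewrite /= !in_itv /=.
    by move=> h; case: (leP t q) => tq; [left|right]; lra.
  by move=> [|]; lra.
rewrite E Rintegral_setU//.
- exact: clm_itvoc.
- exact: clm_itvoc.
- by rewrite -E; exact: locint_oc.
- by apply/disj_setPS => t [/=]; rewrite !in_itv /= => h1 h2; lra.
Qed.

(** Absolute continuity of the integral. *)
Lemma int_small t0 e : oitv a b t0 -> 0 < e -> exists2 r : R, 0 < r &
  forall p q, p <= q -> `|p - t0| < r -> `|q - t0| < r ->
    \int[clm]_(t in `]p, q]) `|F t| <= e.
Proof.
move=> o0 e0; have [c ct oc] := oitv_left o0; have [d td od] := oitv_right o0.
have iF : clm.-integrable setT (EFin \o (F \_ `[c, d])).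
  rewrite -restrict_EFin; apply/(integrable_mkcond _ (clm_itvcc c d)); exact: lF.
have [r [r0 Hr]] := integral_normr_continuous iF e0.
exists (Num.min (r / 2) (Num.min (t0 - c) (d - t0))).
  by rewrite !lt_min !subr_gt0 ct td !andbT divr_gt0.
move=> p q pq; rewrite !lt_min => /and3P[p1 p2 p3] /and3P[q1 q2 q3].
have hpq : (if (p%:E < q%:E)%E then (q%:E - p%:E)%E else 0%E) = (q - p)%:E.
  by case: ifP => //; rewrite lte_fin => h; have -> : p = q by [move: h; lra]; rewrite subrr.
have lpq : (leb `]p, q]%classic < r%:E)%E.
  by rewrite lebesgue_measure_itv /= hpq lte_fin; move: p1 q1; rewrite !ltr_norml; lra.
apply: le_trans (ltW (Hr `]p, q]%classic (clm_itvoc p q) lpq)).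
move: p2 p3 q2 q3; rewrite !ltr_norml => p2 p3 q2 q3.
rewrite le_eqVlt; apply/orP; left; apply/eqP; apply: eq_Rintegral => t.
rewrite inE /= in_itv /= => ht; rewrite patchE mem_set//= in_itv /=; lra.
Qed.

End Regular.

End CompletedLebesgue.

(** * The integral equation *)

Section Distributions.
Context {R : realType}.
Local Notation pt := (R *lexi[ring_display] R)%type.
Implicit Types (phi g : @dyn R) (P Q S : pt) (L M : @functional R).

Lemma distribution_lin a b (k : R) L M : Defs.distribution a b L -> Defs.distribution a b M ->
  Defs.distribution a b (fun phi => L phi + k * M phi).
Proof.
move=> [l1 c1] [l2 c2]; split.
  by move=> r phi psi tphi tpsi; rewrite l1// l2//; ring.
move=> phi_ phi cv; apply: cvgD; first exact: c1.
by apply: cvgMr; exact: c2.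
Qed.

Lemma distribution0 a b : Defs.distribution a b (fun _ : @dyn R => 0 : R).
Proof. by split => [k phi psi _ _|phi_ phi _]; [rewrite mulr0 addr0|exact: cvg_cst]. Qed.

Lemma distribution_sum a b n (L_ : 'I_n -> @functional R) :
  (forall j, Defs.distribution a b (L_ j)) -> Defs.distribution a b (fun phi => \sum_j L_ j phi).
Proof.
move=> H.
suff K (s : seq 'I_n) : Defs.distribution a b (fun phi => \sum_(j <- s) L_ j phi).
  by have := K (index_enum _).
elim: s => [|j s IH].
  rewrite (_ : (fun phi => _) = (fun _ : @dyn R => 0 : R)); first exact: distribution0.
  by apply/funext => phi; rewrite big_nil.
rewrite (_ : (fun phi => _) = (fun phi => L_ j phi + 1 * \sum_(j <- s) L_ j phi)).
  exact: (distribution_lin 1 (H j) IH).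
by apply/funext => phi; rewrite big_cons mul1r.
Qed.

Lemma testM a b t0 g phi : oitv a b t0 -> ldG a b g -> test a b phi -> test a b (fun t s => g t s * phi t s).
Proof.
move=> o0 rg tphi; have [rphi [x [y [ox oy xy sphi]]]] := test_suppin o0 tphi.
by apply: (mk_test (ldGM rg rphi) ox oy); exact: suppinM.
Qed.

Lemma distribution_dmul a b g L : (exists t, oitv a b t) -> ldG a b g -> Defs.distribution a b L ->
  Defs.distribution a b (dmul g L).
Proof.
move=> [t0 o0] rg dL; split.
  move=> k phi psi tphi tpsi; rewrite /dmul -dL.1; [|exact: testM o0 _ _|exact: testM o0 _ _].
  by congr (L _); apply/funext => t; apply/funext => s; ring.
move=> phi_ phi [tk tphi cv [K [cK sK dK]]].
have [c [d [oc od cd Kcd]]] := compact_oitv o0 cK sK.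
have [rphi [x [y [ox oy xy sphi]]]] := test_suppin o0 tphi.
pose c2 := Num.min c x; pose d2 := Num.max d y.
have oc2 : oitv a b c2 by exact: oitv_min. have od2 : oitv a b d2 by exact: oitv_max.
have cd2 : c2 <= d2 by rewrite ge_min le_max cd.
have sk k : suppin a b c2 d2 (phi_ k).
  have : suppin a b c d (phi_ k) by apply: suppin_dsupp; apply: subset_trans (dK k) Kcd.
  by apply: suppinS; rewrite ?ge_min ?le_max lexx.
have sphi2 : suppin a b c2 d2 phi by apply: suppinS sphi; rewrite ?ge_min ?le_max lexx orbT.
have [z yz oz] := oitv_right od2.
have [|||M M0 HM] := @ldG_bounded _ _ _ g (c2, - 2^-1) (z, - 2^-1) rg _ _ Jl Jl _ => //.
  by apply: ltW; rewrite ltptE /=; apply/orP; left; lra.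
have tgk k : test a b (fun t s => g t s * phi_ k t s) by exact: testM o0 rg (tk k).
have tg : test a b (fun t s => g t s * phi t s) by exact: testM o0 rg tphi.
apply: dL.2; split => //; last first.
  exists `[c2, d2]%classic; split; [exact: segment_compact|exact: segment_oitv|].
  by move=> k; apply: dsupp_suppin; exact: suppinM.
move=> e e0; have e1 : 0 < e / (M + 1) by rewrite divr_gt0//; lra.
apply: filterS (cv _ e1) => k Hk t s ot Js.
case: (boolP (c2 <= t <= d2)) => ht; last by rewrite sk// sphi2// !mulr0 subrr normr0 ltW.
have Mg : `|g t s| <= M by apply: HM => //; rewrite leptE ltptE /=; move: Js; rewrite JE; lra.
rewrite -mulrBr normrM; apply: le_trans (ler_pM _ _ Mg (Hk t s ot Js)) _ => //.
rewrite mulrCA ger_pMr// ler_pdivrMr; lra.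
Qed.

Lemma dmul_sing a b g L P : oitv a b P.1 -> Defs.distribution a b L -> L (sing P) = 0 -> dmul g L (sing P) = 0.
Proof.
move=> oP dL L0; rewrite /dmul (_ : (fun t s => _) = (fun t s => g P.1 P.2 * sing P t s)).
  by rewrite (distrZ dL)// ?L0 ?mulr0//; exact: test_sing.
apply/funext => t; apply/funext => s; rewrite /sing.
by have [<-//|_] := eqVneq ((t, s) : pt) P; rewrite !mulr0.
Qed.

End Distributions.

Section Problem.
Context {R : realType} {n : nat}.
Local Notation pt := (R *lexi[ring_display] R)%type.
Local Notation clm := (@completed_lebesgue_measure R).
Implicit Types (x u v : R -> R -> 'cV[R]_n) (a b : \bar R).
Variables (D : set (R * 'cV[R]_n)) (f : R -> 'cV[R]_n -> 'cV[R]_n)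
  (G : R -> 'cV[R]_n -> R -> 'M[R]_n) (Kf Kg : R).
Hypothesis oD : open D.
Hypothesis Kf0 : 0 < Kf.
Hypothesis cf : caratheodory D f.
Hypothesis hfLip : forall t, Kf.-lipschitz_[set y | D (t, y)] (f t).
Hypothesis hg : forall (y : 'cV[R]_n) (i j : 'I_n) (c d : \bar R), (c < d)%E ->
     (forall t, oitv c d t -> D (t, y)) -> sG c d (fun t s => G t y s i j).
Hypothesis Kg0 : 0 < Kg.

Hypothesis hgLip : forall t s, J s -> Kg.-lipschitz_[set y | D (t, y)] (fun y => G t y s).

Definition fx x i : R -> R := fun t => f t (x t 0) i 0.
Definition Gx x i j : @dyn R := fun t s => G t (x t s) s i j.
Definition inD a b x := forall t s, oitv a b t -> J s -> D (t, x t s).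

(** The right hand side of the equation on the indicator of [P, Q). *)
Definition rhs_int a b u x i (P Q : pt) : R :=
  \int[clm]_(t in `]P.1, Q.1]) fx x i t +
  \sum_j ddot a b (Defs.coord u j) (fun t s => Gx x i j t s * ind P Q t s).

(** The integrated form of the equation, equivalent to the equation in the sense
of distributions. *)
Definition integral_solution a b u x := [/\ lexcts a b x, inD a b x &
  forall (P Q : pt), oitv a b P.1 -> oitv a b Q.1 -> J P.2 -> J Q.2 -> P <= Q ->
    forall i, x Q.1 Q.2 i 0 - x P.1 P.2 i 0 = rhs_int a b u x i P Q].

Lemma fx_locint a b x i : lexcts a b x -> inD a b x -> locint a b (fx x i).
Proof. by move=> lx xD c d oc od; exact: (nemytskii_integrable oD Kf0 cf hfLip i lx xD). Qed.

Lemma Gx_ldG a b x i j : lexcts a b x -> inD a b x -> ldG a b (Gx x i j).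
Proof. by move=> lx xD; exact: (lexG_ldG oD hg Kg0 hgLip). Qed.

(** Products with functions that have one-sided limits preserve distributions. *)
Lemma rhs_distribution a b u x i : (exists t, oitv a b t) -> sBVn_loc a b u -> lexcts a b x -> inD a b x ->
  Defs.distribution a b (rhs a b f G u x i).
Proof.
move=> ne bu lx xD.
rewrite (_ : rhs a b f G u x i = (fun phi => regular a b (fx x i) phi +
   1 * \sum_j dmul (Gx x i j) (ddot a b (Defs.coord u j)) phi)); last first.
  by apply/funext => phi; rewrite mul1r.
apply: distribution_lin; first exact: regular_distribution (fx_locint i lx xD) ne.
apply: distribution_sum => j; apply: distribution_dmul => //; first exact: Gx_ldG.
exact: ddot_distribution (bu j) ne.
Qed.

Lemma rhs_ind a b u x i (P Q : pt) : oitv a b P.1 -> oitv a b Q.1 -> P <= Q ->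
  rhs a b f G u x i (ind P Q) = rhs_int a b u x i P Q.
Proof.
by move=> oP oQ PQ; rewrite /rhs /rhs_int -(regular_ind (fx x i) oP oQ PQ).
Qed.

Lemma rhs_sing a b u x i (P : pt) : sBVn_loc a b u -> oitv a b P.1 ->
  rhs a b f G u x i (sing P) = 0.
Proof.
move=> bu oP; have ne : exists t, oitv a b t by exists P.1.
rewrite /rhs regular_sing big1 ?addr0// => j _; apply: (dmul_sing _ oP).
  exact: ddot_distribution (bu j) ne.
refine (ddot_sing (bu j) oP).
Qed.

(** The equation is tested with indicators, and the initial value at t0- is the
value at the beginning of the fibre over t0. *)
Lemma solution_integral a b t0 (x0 : 'cV[R]_n) u x : sBVn_loc a b u -> solution a b t0 x0 D f G u x ->
  integral_solution a b u x /\ x t0 (- 2^-1) = x0.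
Proof.
move=> bu [it0 bx xD E lim]; have lx := sBVloc_lexcts bx; split.
  split => // P Q oP oQ JP JQ PQ i; rewrite -rhs_ind//.
  have [_ _ <-] := E i; last exact: test_ind1.
  by rewrite (ddot_ind (bx i)).
apply/matrixP => i j; rewrite ord1.
have [_ h _] := lx i; have h1 := dlim_ord (h t0 it0); have h2 := dlim_ord (lim i).
exact: (cvg_unique _ (h1 _) (h2 _)).
Qed.

(** Two distributions that vanish on points and agree on intervals are equal. *)
Lemma integral_solution_solution a b t0 (x0 : 'cV[R]_n) u x : sBVn_loc a b u -> sBVn_loc a b x -> oitv a b t0 ->
  integral_solution a b u x -> x t0 (- 2^-1) = x0 -> solution a b t0 x0 D f G u x.
Proof.
move=> bu bx o0 [lx xD E] x00; have ne : exists t, oitv a b t by exists t0.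
split => // i; last by have [_ h _] := lx i; rewrite -x00; exact: h.
have d1 := ddot_distribution (bx i) ne; have d2 := rhs_distribution i ne bu lx xD.
split => // phi tphi; apply: (distr_eq_test d1 d2 o0) => //.
  by move=> P oP _; rewrite rhs_sing// (ddot_sing (bx i) oP).
move=> P Q JP JQ oP oQ PQ; rewrite rhs_ind// ?(ltW PQ)// (ddot_ind (bx i))// ?(ltW PQ)//.
by rewrite -E// ltW.
Qed.

Lemma sBVloc_sub a b a' b' (h : @dyn R) : oitv a' b' `<=` oitv a b -> sBVloc a b h -> sBVloc a' b' h.
Proof. by move=> sub bh c d cd h1; apply: bh => //; exact: subset_trans sub. Qed.

Lemma ldG_subset a b a' b' phi : oitv a' b' `<=` oitv a b -> @ldG R a b phi -> ldG a' b' phi.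
Proof. by move=> sub [h1 h2 h3]; split => t /sub; [exact: h1|exact: h2|exact: h3]. Qed.

Lemma lexcts_sub a b a' b' x : oitv a' b' `<=` oitv a b -> lexcts a b x -> lexcts a' b' x.
Proof. by move=> sub lx i; have [h1 h2 h3] := lx i; split => t /sub; [exact: h1|exact: h2|exact: h3]. Qed.

(** On a frame inside the smaller interval both derivatives are given by the same
formula [ddotE]. *)
Lemma ddot_local a b a' b' (h : @dyn R) phi (P Q : pt) : oitv a' b' `<=` oitv a b -> sBVloc a b h ->
  ldG a b phi -> oitv a' b' P.1 -> oitv a' b' Q.1 -> P <= Q ->
  ddot a b h (fun t s => phi t s * ind P Q t s) = ddot a' b' h (fun t s => phi t s * ind P Q t s).
Proof.
move=> sub bh rphi oP oQ PQ; have PQ1 := lept1 PQ.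
have bh' := sBVloc_sub sub bh.
have [c [d [p [q [[oc od] cd pq cP Qd]]]]] := suppin_frame bh' oP oQ PQ1.
have sP a1 b1 : suppin a1 b1 P.1 Q.1 (fun t s => phi t s * ind P Q t s).
  apply: suppinM; have := @suppin_ind _ a1 b1 P Q; by rewrite (min_idPl PQ1) (max_idPr PQ1).
rewrite (ddotE bh (sub _ oc) (sub _ od) cd pq _ (sP a b) cP PQ1 Qd); last first.
  by apply: ldGM => //; exact: ldG_ind.
rewrite (ddotE bh' oc od cd pq _ (sP a' b') cP PQ1 Qd)//.
by apply: ldGM; [exact: ldG_subset rphi|exact: ldG_ind].
Qed.

Lemma integral_solution_sub a b a' b' u x : oitv a' b' `<=` oitv a b -> sBVn_loc a b u ->
  integral_solution a b u x -> integral_solution a' b' u x.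
Proof.
move=> sub bu [lx xD E]; split; [exact: lexcts_sub lx|by move=> t s /sub; exact: xD|].
move=> P Q oP oQ JP JQ PQ i; rewrite E//; [|exact: sub|exact: sub].
rewrite /rhs_int; congr (_ + _); apply: eq_bigr => j _.
by apply: ddot_local => //; exact: Gx_ldG.
Qed.

Lemma ddot_bound a b (h w : @dyn R) K phi M (P Q : pt) : sBVloc a b h -> control a b h w K ->
  oitv a b P.1 -> oitv a b Q.1 -> J P.2 -> J Q.2 -> P <= Q -> ldG a b phi -> 0 <= M ->
  (forall t s, J s -> P <= ((t, s) : pt) < Q -> `|phi t s| <= M) ->
  `|ddot a b h (fun t s => phi t s * ind P Q t s)| <= M * (w Q.1 Q.2 - w P.1 P.2).
Proof.
move=> bh ctl oP oQ JP JQ PQ rphi M0 HM; have ne : exists t, oitv a b t by exists P.1.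
have PQ1 := lept1 PQ.
apply: (distr_bound (ddot_distribution bh ne) _ oP oQ JP JQ PQ _ rphi M0 HM).
  by move=> S oS _; refine (ddot_sing bh oS).
move=> S S' JS JS' PS SS' S'Q.
have oS : oitv a b S.1.
  by apply: (oitv_le oP oQ); rewrite (lept1 PS) (lept1 (le_trans (ltW SS') S'Q)).
have oS' : oitv a b S'.1.
  by apply: (oitv_le oP oQ); rewrite (lept1 S'Q) (lept1 (le_trans PS (ltW SS'))).
rewrite (ddot_ind bh oS oS' JS JS' (ltW SS')).
by case: ctl => H _ _ _; apply: H => //; exact: ltW.
Qed.

(** The same for the difference of two integrators, without forming it. *)
Lemma ddot_bound2 a b (h k w : @dyn R) K phi M (P Q : pt) : sBVloc a b h -> sBVloc a b k ->
  control a b (fun t s => k t s - h t s) w K ->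
  oitv a b P.1 -> oitv a b Q.1 -> J P.2 -> J Q.2 -> P <= Q -> ldG a b phi -> 0 <= M ->
  (forall t s, J s -> P <= ((t, s) : pt) < Q -> `|phi t s| <= M) ->
  `|ddot a b k (fun t s => phi t s * ind P Q t s) - ddot a b h (fun t s => phi t s * ind P Q t s)|
    <= M * (w Q.1 Q.2 - w P.1 P.2).
Proof.
move=> bh bk ctl oP oQ JP JQ PQ rphi M0 HM; have ne : exists t, oitv a b t by exists P.1.
have dL := distribution_lin (-1) (ddot_distribution bk ne) (ddot_distribution bh ne).
rewrite -[X in _ - X]mul1r -mulNr.
apply: (distr_bound dL _ oP oQ JP JQ PQ _ rphi M0 HM).
  by move=> S oS _; rewrite (ddot_sing bh oS) (ddot_sing bk oS) mulr0 addr0.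
move=> S S' JS JS' PS SS' S'Q.
have oS : oitv a b S.1.
  by apply: (oitv_le oP oQ); rewrite (lept1 PS) (lept1 (le_trans (ltW SS') S'Q)).
have oS' : oitv a b S'.1.
  by apply: (oitv_le oP oQ); rewrite (lept1 S'Q) (lept1 (le_trans PS (ltW SS'))).
rewrite (ddot_ind bh oS oS' JS JS' (ltW SS')) (ddot_ind bk oS oS' JS JS' (ltW SS')) mulN1r.
case: ctl => H _ _ _; have := H _ _ oS oS' JS JS' (ltW SS'); congr (`|_| <= _); ring.
Qed.

Lemma rhs_int_bound a b u x (w_ : 'I_n -> @dyn R) (K_ : 'I_n -> R) M i (P Q : pt) :
  sBVn_loc a b u -> (forall j, control a b (Defs.coord u j) (w_ j) (K_ j)) ->
  lexcts a b x -> inD a b x ->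
  oitv a b P.1 -> oitv a b Q.1 -> J P.2 -> J Q.2 -> P <= Q -> 0 <= M ->
  (forall j t s, J s -> P <= ((t, s) : pt) < Q -> `|Gx x i j t s| <= M) ->
  `|rhs_int a b u x i P Q| <= \int[clm]_(t in `]P.1, Q.1]) `|fx x i t| +
    M * \sum_j (w_ j Q.1 Q.2 - w_ j P.1 P.2).
Proof.
move=> bu ctl lx xD oP oQ JP JQ PQ M0 HM; rewrite /rhs_int.
apply: le_trans (ler_normD _ _) _; apply: lerD.
  by apply: le_normr_Rintegral; [exact: clm_itvoc|exact (locint_oc (fx_locint i lx xD) oP oQ)].
apply: le_trans (ler_norm_sum _ _ _) _; rewrite mulr_sumr; apply: ler_sum => j _.
by apply: (ddot_bound (bu j) (ctl j)) => //; [exact: Gx_ldG|exact: HM].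
Qed.

Lemma rhs_int_diff a b u v x z (w_ v_ : 'I_n -> @dyn R) (K_ N_ : 'I_n -> R) M B i (P Q : pt) :
  sBVn_loc a b u -> sBVn_loc a b v ->
  (forall j, control a b (Defs.coord u j) (w_ j) (K_ j)) ->
  (forall j, control a b (fun t s => Defs.coord v j t s - Defs.coord u j t s) (v_ j) (N_ j)) ->
  lexcts a b x -> inD a b x -> lexcts a b z -> inD a b z ->
  oitv a b P.1 -> oitv a b Q.1 -> J P.2 -> J Q.2 -> P <= Q -> 0 <= M -> 0 <= B ->
  (forall j t s, J s -> P <= ((t, s) : pt) < Q -> `|Gx x i j t s| <= M) ->
  (forall t s, J s -> P <= ((t, s) : pt) < Q -> `|z t s - x t s| <= B) ->
  `|rhs_int a b v z i P Q - rhs_int a b u x i P Q| <= Kf * B * (Q.1 - P.1) +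
    Kg * B * \sum_j (w_ j Q.1 Q.2 - w_ j P.1 P.2) + (M + Kg * B) * \sum_j (v_ j Q.1 Q.2 - v_ j P.1 P.2).
Proof.
move=> bu bv ctl ctlv lx xD lz zD oP oQ JP JQ PQ M0 B0 HM HB; rewrite /rhs_int.
have PQ1 := lept1 PQ.
have oi t s : P <= ((t, s) : pt) < Q -> oitv a b t.
  by move=> /andP[h1 h2]; apply: (oitv_le oP oQ); rewrite (lept1 h1) (lept1 (ltW h2)).
have KB : 0 <= Kg * B by rewrite mulr_ge0// ltW.
rewrite opprD addrACA -[leRHS]addrA; apply: le_trans (ler_normD _ _) _; apply: lerD.
  apply: (int_diff_le (fx_locint i lz zD) (fx_locint i lx xD) oP oQ PQ1) => t ht.
  have ot : oitv a b t by apply: (oitv_le oP oQ); lra.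
  apply: le_trans (f_lip hfLip _ _ _) _; [exact: zD ot J0|exact: xD ot J0|].
  rewrite ler_pM2l//; apply: HB; first exact: J0.
  by rewrite leptE ltptE /=; lra.
rewrite !mulr_sumr -big_split -sumrB /=; apply: le_trans (ler_norm_sum _ _ _) _; apply: ler_sum => j _.
set A := ddot _ _ _ _; set C := ddot _ _ _ _.
pose E := ddot a b (Defs.coord u j) (fun t s => Gx z i j t s * ind P Q t s).
have rz := Gx_ldG i j lz zD; have rx := Gx_ldG i j lx xD.
have dG t s : J s -> P <= ((t, s) : pt) < Q -> `|Gx z i j t s - Gx x i j t s| <= Kg * B.
  move=> Js h; have ot := oi _ _ h.
  apply: le_trans (G_lip hgLip _ _ Js (zD t s ot Js) (xD t s ot Js)) _.
  by rewrite ler_pM2l//; exact: HB.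
rewrite (_ : A - C = (E - C) + (A - E)); last by ring.
apply: le_trans (ler_normD _ _) _; apply: lerD.
  rewrite (_ : E - C = ddot a b (Defs.coord u j) (fun t s => (Gx z i j t s - Gx x i j t s) * ind P Q t s)).
    by apply: (ddot_bound (bu j) (ctl j)) => //; exact: ldGB.
  have du := ddot_distribution (bu j) (ex_intro _ P.1 oP).
  rewrite /E /C -(distrB du); [|exact: test_ind|exact: test_ind].
  by congr (ddot _ _ _); apply/funext => t; apply/funext => s; ring.
apply: (ddot_bound2 (bu j) (bv j) (ctlv j)) => //; first exact: addr_ge0.
move=> t s Js h; have := HM j t s Js h; have := dG t s Js h.
by have := ler_normD (Gx x i j t s) (Gx z i j t s - Gx x i j t s); rewrite subrKC; lra.
Qed.

Lemma geom_small (B e : R) : 0 <= B -> 0 < e -> exists k, B / 2 ^+ k <= e.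
Proof.
move=> B0 e0; have e1 : 0 < e / (B + 1) by rewrite divr_gt0//; lra.
have [N _ /(_ N (leqnn N)) /= hN] := near_infty_natSinv_expn_lt (PosNum e1).
exists N; have p0 : 0 <= 1 / 2 ^+ N :> R by rewrite divr_ge0// exprn_ge0.
move: hN; rewrite /= ltr_pdivlMr; last by lra.
by rewrite -[B / _]mulr1 -mulrA (mulrC _ 1); move: p0; set z := 1 / _ => p0 hz; nra.
Qed.

(** A bound that reproduces itself with half of its size can be replaced by
twice the remainder. *)
Lemma halving (T : Type) (X : set T) (d : T -> R) (A B0 : R) : 0 <= A ->
  (forall p, X p -> `|d p| <= B0) ->
  (forall B, 0 <= B -> (forall p, X p -> `|d p| <= B) -> forall p, X p -> `|d p| <= A + B / 2) ->
  forall p, X p -> `|d p| <= 2 * A.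
Proof.
move=> A0 hB0 H p Xp; have B00 : 0 <= B0 by apply: le_trans (hB0 p Xp); exact: normr_ge0.
have K k : forall q, X q -> `|d q| <= 2 * A + B0 / 2 ^+ k.
  elim: k => [|k IH] q Xq; first by rewrite expr0 divr1; have := hB0 q Xq; lra.
  have p2 : 0 < 2 ^+ k :> R by rewrite exprn_gt0.
  have h0 : 0 <= B0 / 2 ^+ k by rewrite divr_ge0// ltW.
  have := H _ _ IH q Xq; rewrite exprS invfM mulrCA; move: h0; set z := B0 / _ => h0.
  by move=> /(_ (ltac:(lra))); lra.
apply/ler_addgt0Pr => e e0.
have [k hk] := geom_small B00 e0.
by apply: le_trans (K k p Xp) _; rewrite lerD2l.
Qed.

Lemma pt_between a b (P Q : pt) t s : oitv a b P.1 -> oitv a b Q.1 -> P <= ((t, s) : pt) < Q -> oitv a b t.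
Proof.
by move=> oP oQ /andP[h1 h2]; apply: (oitv_le oP oQ); rewrite (lept1 h1) (lept1 (ltW h2)).
Qed.

Section Stability.
Variables (a b : \bar R) (t0 : R) (u x : R -> R -> 'cV[R]_n) (w_ : 'I_n -> @dyn R) (K_ : 'I_n -> R) (M : R).
Hypothesis (bu : sBVn_loc a b u) (ot0 : oitv a b t0).
Hypothesis ctl : forall j, control a b (Defs.coord u j) (w_ j) (K_ j).
Hypothesis solx : integral_solution a b u x.
Hypothesis M0 : 0 <= M.
Hypothesis HM : forall i j t s, oitv a b t -> J s -> `|Gx x i j t s| <= M.

Let W (t s : R) : R := \sum_j w_ j t s.

Let W_mono t s t' s' : oitv a b t -> oitv a b t' -> J s -> J s' -> ((t, s) : pt) <= (t', s') ->
  W t s <= W t' s'.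
Proof. by move=> ot ot' Js Js' h; apply: ler_sum => j _; exact: (ctl_mono (ctl j)). Qed.

(** What the comparison of [x] with another solution [z], driven by [v], needs:
[e] bounds the total mass of controls of [v - u]. *)
Definition perturbed v z (e : R) : Prop :=
  [/\ sBVn_loc a b v, integral_solution a b v z,
    exists (v_ : 'I_n -> @dyn R) (N_ : 'I_n -> R), \sum_j N_ j <= e /\
      (forall j, control a b (fun t s => Defs.coord v j t s - Defs.coord u j t s) (v_ j) (N_ j)),
    Kg * e <= 4^-1 &
    (exists B0 : R, forall t s, oitv a b t -> J s -> `|z t s - x t s| <= B0) /\
      z t0 (- 2^-1) = x t0 (- 2^-1)].

(** The increments of z - x are those of the difference of the right hand sides. *)
Lemma delta_step v z e B (P Q : pt) : perturbed v z e -> 0 <= B -> oitv a b P.1 -> oitv a b Q.1 ->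
  J P.2 -> J Q.2 -> P <= Q ->
  (forall t s, J s -> P <= ((t, s) : pt) < Q -> `|z t s - x t s| <= B) ->
  `|(z Q.1 Q.2 - x Q.1 Q.2) - (z P.1 P.2 - x P.1 P.2)| <=
     Kf * B * (Q.1 - P.1) + Kg * B * (W Q.1 Q.2 - W P.1 P.2) + (M + Kg * B) * e.
Proof.
move=> [bv solz [v_ [N_ [Ne ctlv]]] _ _] B0 oP oQ JP JQ PQ HB.
have [lx xD Ex] := solx; have [lz zD Ez] := solz.
have KB : 0 <= Kg * B by rewrite mulr_ge0// ltW.
have h1 : 0 <= Kf * B * (Q.1 - P.1) by rewrite mulr_ge0 ?subr_ge0 ?lept1// mulr_ge0// ltW.
have h2 : 0 <= W Q.1 Q.2 - W P.1 P.2.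
  by rewrite subr_ge0; apply: W_mono => //; case: (P) PQ => p1 p2; case: (Q).
have N0 : \sum_j (v_ j Q.1 Q.2 - v_ j P.1 P.2) <= e.
  by apply: le_trans Ne; apply: ler_sum => j _; have [_ _ _ H] := ctlv j; exact: H.
have e0 : 0 <= e.
  apply: le_trans N0; apply: sumr_ge0 => j _; rewrite subr_ge0; exact: (ctl_mono (ctlv j)).
apply: cV_norm_le.
  by rewrite addr_ge0// ?mulr_ge0 ?addr_ge0// mulr_ge0.
move=> i; rewrite !mxE.
have := rhs_int_diff (i := i) bu bv ctl ctlv lx xD lz zD oP oQ JP JQ PQ M0 B0
  (fun j t s Js h => HM i j (ltac:(exact: (pt_between oP oQ h))) Js) HB.
rewrite -Ex// -Ez// /W -sumrB.
have -> : z Q.1 Q.2 i 0 - x Q.1 Q.2 i 0 - (z P.1 P.2 i 0 - x P.1 P.2 i 0) =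
  z Q.1 Q.2 i 0 - z P.1 P.2 i 0 - (x Q.1 Q.2 i 0 - x P.1 P.2 i 0) by ring.
move=> /le_trans; apply; rewrite lerD2l; apply: ler_wpM2l N0; exact: addr_ge0.
Qed.

Lemma perturbed_e0 v z e : perturbed v z e -> 0 <= e.
Proof.
move=> [_ _ [v_ [N_ [Ne ctlv]]] _ _]; apply: le_trans Ne; apply: sumr_ge0 => j _.
by have := ctl_mass (ctlv j) ot0 ot0 J0 J0 (lexx _); rewrite subrr.
Qed.

(** With B the bound of |z - x| on [P, Q] the term in B of [delta_step] is at most
B / 2, because each of the two smallness conditions contributes B / 4; so
[halving] applies. *)
Lemma perturbed_right v z e (P Q : pt) : perturbed v z e -> oitv a b P.1 -> oitv a b Q.1 -> J P.2 -> J Q.2 ->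
  P <= Q -> Kf * (Q.1 - P.1) + Kg * (W Q.1 Q.2 - W P.1 P.2) <= 4^-1 ->
  `|z Q.1 Q.2 - x Q.1 Q.2| <= 2 * (`|z P.1 P.2 - x P.1 P.2| + M * e).
Proof.
move=> pz oP oQ JP JQ PQ small; have [_ _ _ Ke [[B0 HB0] _]] := pz.
have e0 := perturbed_e0 pz.
pose X := [set S : pt | [/\ J S.2, P <= S & S <= Q]].
pose d (S : pt) : R := `|z S.1 S.2 - x S.1 S.2|.
have oS S : X S -> oitv a b S.1.
  by move=> [_ PS SQ]; apply: (oitv_le oP oQ); rewrite !lept1.
suff H : forall S, X S -> `|d S| <= 2 * (d P + M * e).
  by have := H Q (And3 JQ PQ (lexx _)); rewrite /d normr_id.
apply: (halving (B0 := B0)); first by rewrite /d addr_ge0// mulr_ge0.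
  by move=> S XS; rewrite normr_id; apply: HB0; [exact: oS|case: XS].
move=> B Bp HB S XS; have [JS PS SQ] := XS; rewrite normr_id.
have HB' t s : J s -> P <= ((t, s) : pt) < S -> `|z t s - x t s| <= B.
  move=> Js /andP[h1 h2]; have XT : X (t, s) by split => //; exact: le_trans (ltW h2) SQ.
  by have := HB _ XT; rewrite normr_id.
have := delta_step pz Bp oP (oS S XS) JP JS PS HB'.
have h1 : Kf * B * (S.1 - P.1) + Kg * B * (W S.1 S.2 - W P.1 P.2) <= B / 4.
  have h2 : W S.1 S.2 <= W Q.1 Q.2.
    by apply: W_mono => //; exact: oS.
  have h3 := lept1 SQ.
  have h4 : Kf * (S.1 - P.1) + Kg * (W S.1 S.2 - W P.1 P.2) <= 4^-1.
    by apply: le_trans small; apply: lerD; rewrite ler_pM2l// lerD2r.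
  have := ler_wpM2l Bp h4; lra.
have h2 : (M + Kg * B) * e <= M * e + B / 4.
  by rewrite mulrDl lerD2l mulrAC mulrC; apply: ler_wpM2l.
have := ler_normD (z P.1 P.2 - x P.1 P.2) (z S.1 S.2 - x S.1 S.2 - (z P.1 P.2 - x P.1 P.2)).
rewrite subrKC /d; move: h1 h2; set A1 := Kf * B * _ + _; set A2 := (M + _) * e; lra.
Qed.

(** The equation is symmetric under reversal of the line. *)
Lemma perturbed_left v z e (P Q : pt) : perturbed v z e -> oitv a b P.1 -> oitv a b Q.1 -> J P.2 -> J Q.2 ->
  P <= Q -> Kf * (Q.1 - P.1) + Kg * (W Q.1 Q.2 - W P.1 P.2) <= 4^-1 ->
  `|z P.1 P.2 - x P.1 P.2| <= 2 * (`|z Q.1 Q.2 - x Q.1 Q.2| + M * e).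
Proof.
move=> pz oP oQ JP JQ PQ small; have [_ _ _ Ke [[B0 HB0] _]] := pz.
have e0 := perturbed_e0 pz.
pose X := [set S : pt | [/\ J S.2, P <= S & S <= Q]].
pose d (S : pt) : R := `|z S.1 S.2 - x S.1 S.2|.
have oS S : X S -> oitv a b S.1.
  by move=> [_ PS SQ]; apply: (oitv_le oP oQ); rewrite !lept1.
suff H : forall S, X S -> `|d S| <= 2 * (d Q + M * e).
  by have := H P (And3 JP (lexx _) PQ); rewrite /d normr_id.
apply: (halving (B0 := B0)); first by rewrite /d addr_ge0// mulr_ge0.
  by move=> S XS; rewrite normr_id; apply: HB0; [exact: oS|case: XS].
move=> B Bp HB S XS; have [JS PS SQ] := XS; rewrite normr_id.
have HB' t s : J s -> S <= ((t, s) : pt) < Q -> `|z t s - x t s| <= B.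
  move=> Js /andP[h1 h2]; have XT : X (t, s) by split => //; [exact: le_trans PS h1|exact: ltW].
  by have := HB _ XT; rewrite normr_id.
have := delta_step pz Bp (oS S XS) oQ JS JQ SQ HB'.
have h1 : Kf * B * (Q.1 - S.1) + Kg * B * (W Q.1 Q.2 - W S.1 S.2) <= B / 4.
  have h2 : W P.1 P.2 <= W S.1 S.2.
    by apply: W_mono => //; exact: oS.
  have h3 := lept1 PS.
  have h4 : Kf * (Q.1 - S.1) + Kg * (W Q.1 Q.2 - W S.1 S.2) <= 4^-1.
    by apply: le_trans small; apply: lerD; rewrite ler_pM2l// lerD2l lerN2.
  have := ler_wpM2l Bp h4; lra.
have h2 : (M + Kg * B) * e <= M * e + B / 4.
  by rewrite mulrDl lerD2l mulrAC mulrC; apply: ler_wpM2l.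
have := ler_normB (z Q.1 Q.2 - x Q.1 Q.2) (z Q.1 Q.2 - x Q.1 Q.2 - (z S.1 S.2 - x S.1 S.2)).
rewrite subKr /d; move: h1 h2; set A1 := Kf * B * _ + _; set A2 := (M + _) * e; lra.
Qed.

(** Within a fibre a control is absolutely continuous. *)
Lemma ctsJ_W : ctsJ (W t0).
Proof.
move=> s Js e e0; pose e1 := e / n.+1%:R.
have e10 : 0 < e1 by rewrite divr_gt0.
have : \forall d \near (0 : R)^'+, forall j r, J r -> `|r - s| < d -> `|w_ j t0 r - w_ j t0 s| <= e1.
  apply: near_forall_ord => j; have [_ _ acw _] := ctl j.
  have [d d0 Hd] := ACJ_ctsJ (acw t0 ot0) Js e10.
  apply: (@ex_near_right _ _ _ d) => // d' hd' r Jr' hr; apply: Hd => //; lra.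
move=> /near_right_ex[d d0 Hd]; exists (d / 2); first by lra.
move=> r Jr' hr; rewrite /W -sumrB; apply: le_trans (ler_norm_sum _ _ _) _.
apply: (@le_trans _ _ (\sum_(i < n) e1)).
  by apply: ler_sum => j _; apply: (Hd (d / 2)) => //; lra.
rewrite sumr_const card_ord -mulr_natr /e1 mulrAC ler_pdivrMr// ler_wpM2l ?ler_nat//; exact: ltW.
Qed.

(** On the fibre over [t0] the controls need not be small: it is cut into
finitely many pieces on which they are, and the constants multiply. *)
Lemma perturbed_fibre : exists2 C : R, 0 <= C & forall v z e, perturbed v z e ->
  forall s, J s -> `|z t0 s - x t0 s| <= C * e.
Proof.
pose E s1 s2 := exists2 C : R, 0 <= C & forall v z e, perturbed v z e ->
  forall s, s1 <= s <= s2 -> `|z t0 s - x t0 s| <= C * (`|z t0 s1 - x t0 s1| + e).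
suff [C C0 HC] : E (- 2^-1) 2^-1.
  exists C => // v z e pz s; rewrite JE => /(HC v z e pz).
  by have [_ _ _ _ [_ ->]] := pz; rewrite subrr normr0 add0r.
(* pieces of the fibre on which Kg times the increment of W is at most 1 / 4 *)
have K4 : 0 < (4 * Kg)^-1 by rewrite invr_gt0 mulr_gt0.
have step s : J s -> exists2 d : R, 0 < d & forall s1 s2, J s1 -> J s2 -> `|s1 - s| < d -> `|s2 - s| < d ->
    s1 <= s2 -> Kg * (W t0 s2 - W t0 s1) <= 4^-1.
  move=> Js; have e1 : 0 < (4 * Kg)^-1 / 2 by rewrite divr_gt0.
  have [d d0 Hd] := ctsJ_W Js e1; exists d => // s1 s2 J1 J2 /(Hd _ J1) h1 /(Hd _ J2) h2 s12.
  rewrite (_ : 4^-1 = Kg * (4 * Kg)^-1); last by field; rewrite gt_eqF.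
  rewrite ler_pM2l//; move: h1 h2; rewrite !ler_norml; lra.
have loc s1 s2 : J s1 -> J s2 -> s1 <= s2 -> Kg * (W t0 s2 - W t0 s1) <= 4^-1 -> E s1 s2.
  move=> J1 J2 s12 small; exists (2 * (1 + M)); first by rewrite mulr_ge0// addr_ge0.
  move=> v z e pz s hs; have Js : J s by move: J1 J2; rewrite !JE; lra.
  have e0 := perturbed_e0 pz.
  have PQ : ((t0, s1) : pt) <= (t0, s) by apply: pt_col; case/andP: hs.
  have := @perturbed_right v z e (t0, s1) (t0, s) pz ot0 ot0 J1 Js PQ.
  rewrite /= subrr mulr0 add0r => H; apply: (le_trans (H _)).
    apply: le_trans small; rewrite ler_pM2l// lerD2r; by apply: W_mono => //; apply: pt_col; case/andP: hs.
  rewrite -mulrA ler_pM2l//; have := normr_ge0 (z t0 s1 - x t0 s1).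
  move: (`|_|) => A A0; rewrite mulrDl mul1r mulrDr.
  have : 0 <= M * A by rewrite mulr_ge0.
  lra.
apply: (@cousin R _ _ E); first by lra.
- move=> s1 s2 s3 _ s12 s23 _ [C1 C10 H1] [C2 C20 H2].
  exists (C1 + C2 * (C1 + 1)); first by rewrite addr_ge0// mulr_ge0// addr_ge0.
  move=> v z e pz s hs; have e0 := perturbed_e0 pz.
  have A0 := normr_ge0 (z t0 s1 - x t0 s1); set A := `|_| in A0 *.
  have CA : 0 <= C1 * (A + e) by rewrite mulr_ge0// addr_ge0.
  have CCA : 0 <= C2 * (C1 + 1) * (A + e) by rewrite mulr_ge0// ?addr_ge0// mulr_ge0// addr_ge0.
  rewrite mulrDl; case: (leP s s2) => ss2.
    have := H1 v z e pz s (ltac:(by lra)); rewrite -/A; lra.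
  have h2 := H2 v z e pz s (ltac:(by lra)); apply: (le_trans h2).
  have h1 := H1 v z e pz s2 (ltac:(by lra)).
  apply: (@le_trans _ _ (C2 * (C1 * (A + e) + e))); first by rewrite ler_wpM2l// lerD2r.
  rewrite -mulrA (mulrDl C1) mul1r -[leLHS]add0r; apply: lerD => //.
  by rewrite ler_wpM2l// lerD2l lerDr.
- move=> s hs; have Js : J s by rewrite JE.
  by apply: loc => //; rewrite subrr mulr0; lra.
- move=> s hs; have Js : J s by rewrite JE; lra.
  have [d d0 Hd] := step s Js; exists d => // r hr r1; have Jr' : J r by rewrite JE; lra.
  apply: loc => //; first by lra.
  apply: Hd => //; [by rewrite subrr normr0|rewrite gtr0_norm; lra|lra].
- move=> s hs; have Js : J s by rewrite JE; lra.
  have [d d0 Hd] := step s Js; exists d => // r hr r1; have Jr' : J r by rewrite JE; lra.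
  apply: loc => //; first by lra.
  apply: Hd => //; [rewrite ltr0_norm; lra|by rewrite subrr normr0|lra].
Qed.

(** Off the fibre over [t0] the interval is short enough for one step. *)
Definition short : Prop := forall t s, oitv a b t -> J s ->
  (t0 < t -> Kf * (t - t0) + Kg * (W t s - W t0 2^-1) <= 4^-1) /\
  (t < t0 -> Kf * (t0 - t) + Kg * (W t0 (- 2^-1) - W t s) <= 4^-1).

(** The fibre over t0 comes first, because from its two ends the other points are
reached in one short step. *)
Theorem stability : short -> exists2 C : R, 0 <= C & forall v z e, perturbed v z e ->
  forall t s, oitv a b t -> J s -> `|z t s - x t s| <= C * e.
Proof.
move=> sh; have [C C0 HC] := perturbed_fibre; exists (C + 2 * (C + M)).
  by rewrite addr_ge0// mulr_ge0// addr_ge0.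
move=> v z e pz t s ot Js; have e0 := perturbed_e0 pz.
have Ce : 0 <= C * e by rewrite mulr_ge0.
have Me : 0 <= M * e by rewrite mulr_ge0.
rewrite mulrDl -mulrA mulrDl; case: (ltgtP t t0) => tt0.
- have := @perturbed_left v z e (t, s) (t0, - 2^-1) pz ot ot0 Js Jl (pt_lt _ _ tt0) ((sh t s ot Js).2 tt0).
  have [_ _ _ _ [_ ->]] := pz; rewrite /= subrr normr0; lra.
- have := @perturbed_right v z e (t0, 2^-1) (t, s) pz ot0 ot Jr Js (pt_lt _ _ tt0) ((sh t s ot Js).1 tt0).
  have := HC v z e pz _ Jr; rewrite /=; lra.
- by rewrite tt0; have := HC v z e pz s Js; lra.
Qed.

End Stability.

End Problem.

(** * Operations on controls *)

Section ControlAlgebra.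
Context {R : realType}.
Local Notation pt := (R *lexi[ring_display] R)%type.
Implicit Types (a b : \bar R) (g h w v : @dyn R).

Lemma control_self a b g w K : control a b g w K -> control a b w w K.
Proof.
move=> ctl; have [h1 h2 h3 h4] := ctl; split => // P Q oP oQ JP JQ PQ.
rewrite ger0_norm// subr_ge0; exact: (ctl_mono ctl oP oQ JP JQ PQ).
Qed.

Lemma control_dom a b g w K : control a b w w K ->
  (forall P Q : pt, oitv a b P.1 -> oitv a b Q.1 -> J P.2 -> J Q.2 -> P <= Q ->
     `|g Q.1 Q.2 - g P.1 P.2| <= w Q.1 Q.2 - w P.1 P.2) -> control a b g w K.
Proof. by move=> [_ h2 h3 h4] H; split. Qed.

Lemma ACJ_lin (k : R) (p q : R -> R) : ACJ p -> ACJ q -> ACJ (fun s => p s + k * q s).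
Proof.
move=> ap aq e e0; have e2 : 0 < e / 2 by lra.
have e3 : 0 < e / (2 * (`|k| + 1)) by rewrite divr_gt0// mulr_gt0// ltr_wpDl.
have [d1 d10 H1] := ap _ e2; have [d2 d20 H2] := aq _ e3.
exists (Num.min d1 d2); first by rewrite lt_min d10.
move=> l Jl' ol; rewrite lt_min => /andP[l1 l2].
have h1 := H1 l Jl' ol l1; have h2 := H2 l Jl' ol l2.
apply: (@le_lt_trans _ _ (\sum_(I <- l) `|p I.2 - p I.1| + `|k| * \sum_(I <- l) `|q I.2 - q I.1|)).
  rewrite mulr_sumr -big_split /=; apply: ler_sum => I _.
  rewrite -normrM; apply: le_trans (ler_normD _ _); rewrite le_eqVlt; apply/orP; left; apply/eqP.
  by congr (`|_|); ring.
have h3 : `|k| * \sum_(I <- l) `|q I.2 - q I.1| <= e / 2.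
  have k0 := normr_ge0 k; have k1 : 0 < `|k| + 1 by lra.
  apply: (@le_trans _ _ ((`|k| + 1) * (e / (2 * (`|k| + 1))))); last first.
    by rewrite le_eqVlt; apply/orP; left; apply/eqP; field; rewrite gt_eqF.
  by apply: ler_pM => //; [exact: sumr_ge0|lra|exact: ltW].
by rewrite (_ : e = e / 2 + e / 2); [exact: ltr_leD|lra].
Qed.

Lemma control_lin a b (k : R) v w K N : 0 <= k -> control a b v v K -> control a b w w N ->
  control a b (fun t s => v t s + k * w t s) (fun t s => v t s + k * w t s) (K + k * N).
Proof.
move=> k0 cv cw; have [_ v2 v3 v4] := cv; have [_ w2 w3 w4] := cw; split.
- move=> P Q oP oQ JP JQ PQ.
  have h1 := ctl_mono cv oP oQ JP JQ (PQ : ((P.1, P.2) : pt) <= (Q.1, Q.2)).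
  have h2 := ctl_mono cw oP oQ JP JQ (PQ : ((P.1, P.2) : pt) <= (Q.1, Q.2)).
  by rewrite ger0_norm// subr_ge0 lerD// ler_wpM2l.
- move=> t ot; have [vl vr] := v2 t ot; have [wl wr] := w2 t ot; split.
    by apply: dlimD => //; apply: dlimM => //; exact: dlim_cst.
  by apply: dlimD => //; apply: dlimM => //; exact: dlim_cst.
- by move=> t ot; apply: ACJ_lin; [exact: v3|exact: w3].
- move=> P Q oP oQ JP JQ PQ; rewrite opprD addrACA -mulrBr; apply: lerD; first exact: v4.
  by rewrite ler_wpM2l//; exact: w4.
Qed.

Lemma control0 a b : control a b (fun _ _ => 0) (fun _ _ => 0) 0.
Proof.
split.
- by move=> P Q _ _ _ _ _; rewrite subrr normr0.
- by move=> t _; split; exact: dlim_cst.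
- by move=> t _ e e0; exists 1 => // l _ _ _; rewrite big1 // => I _; rewrite subrr normr0.
- by move=> P Q _ _ _ _ _; rewrite subrr.
Qed.

Lemma control_sum a b n (w_ : 'I_n -> @dyn R) (K_ : 'I_n -> R) :
  (forall j, control a b (w_ j) (w_ j) (K_ j)) ->
  control a b (fun t s => \sum_j w_ j t s) (fun t s => \sum_j w_ j t s) (\sum_j K_ j).
Proof.
move=> H.
suff K (l : seq 'I_n) : control a b (fun t s => \sum_(j <- l) w_ j t s) (fun t s => \sum_(j <- l) w_ j t s) (\sum_(j <- l) K_ j).
  exact: K (index_enum _).
elim: l => [|j l IH].
  rewrite big_nil (_ : (fun t s => _) = (fun _ _ => 0)); first exact: control0.
  by apply/funext => t; apply/funext => s; rewrite big_nil.
rewrite big_cons -[X in _ + X]mul1r (_ : (fun t s => _) = (fun t s => w_ j t s + 1 * \sum_(j <- l) w_ j t s)).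
  exact: control_lin.
by apply/funext => t; apply/funext => s; rewrite big_cons mul1r.
Qed.

Lemma controlB a b g h w v K N : control a b g w K -> control a b h v N ->
  control a b (fun t s => g t s - h t s) (fun t s => w t s + 1 * v t s) (K + 1 * N).
Proof.
move=> cg ch; apply: control_dom.
  by apply: control_lin => //; [exact: control_self cg|exact: control_self ch].
move=> P Q oP oQ JP JQ PQ; have [g1 _ _ _] := cg; have [h1 _ _ _] := ch.
have := g1 P Q oP oQ JP JQ PQ; have := h1 P Q oP oQ JP JQ PQ; rewrite !ler_norml; lra.
Qed.

Lemma control_time a b (m : R -> R) K : (forall p q, oitv a b p -> oitv a b q -> p <= q -> m p <= m q <= m p + K) ->
  (forall t, oitv a b t -> forall e : R, 0 < e -> exists2 r : R, 0 < r & forall t', oitv a b t' ->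
     `|t' - t| < r -> `|m t' - m t| <= e) ->
  control a b (fun t _ => m t) (fun t _ => m t) K.
Proof.
move=> mm cm; split.
- by move=> P Q oP oQ _ _ /lept1 PQ; have := mm _ _ oP oQ PQ => h; rewrite ger0_norm; lra.
- move=> t ot; split => e e0; have [r r0 Hr] := cm t ot e e0.
    have [t' h ot'] := oitv_left ot; apply: (@ex_near_left _ _ _ (Num.min r (t - t'))).
      by rewrite lt_min r0 subr_gt0.
    move=> x /andP[+ xt] s _; rewrite ltrBlDl -ltrBlDr lt_min => /andP[x1 x2].
    by apply: Hr; [apply: (oitv_le ot' ot); lra|rewrite ltr0_norm; lra].
  have [t' h ot'] := oitv_right ot; apply: (@ex_near_right _ _ _ (Num.min r (t' - t))).
    by rewrite lt_min r0 subr_gt0.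
  move=> x /andP[tx] + s _; rewrite -ltrBlDl lt_min => /andP[x1 x2].
  by apply: Hr; [apply: (oitv_le ot ot'); lra|rewrite gtr0_norm; lra].
- by move=> t _ e e0; exists 1 => // l _ _ _; rewrite big1 // => I _; rewrite subrr normr0.
- by move=> P Q oP oQ _ _ /lept1 PQ; have := mm _ _ oP oQ PQ => h; lra.
Qed.

End ControlAlgebra.

(** * The equation on one fibre *)

Section FibreProblem.
Context {R : realType}.
Local Notation pt := (R *lexi[ring_display] R)%type.
Local Notation leb := (@lebesgue_measure R).
Implicit Types (a b : \bar R) (h : @dyn R) (phi : @dyn R).

(** Within one fibre [ddot] is the integral over J of the definition. *)
Lemma ddot_fibre a b h phi t0 s1 s2 : sBVloc a b h -> ldG a b phi -> oitv a b t0 -> J s1 -> J s2 -> s1 <= s2 ->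
  ddot a b h (fun t s => phi t s * ind (t0, s1) (t0, s2) t s) =
  fibint (h t0) (fun s => phi t0 s * ind (t0, s1) (t0, s2) t0 s).
Proof.
move=> bh rphi ot0 J1 J2 s12; have ne : exists t, oitv a b t by exists t0.
have ach : ACJ (h t0).
  have [c ct oc] := oitv_left ot0; have [d td od] := oitv_right ot0.
  have bv := sBVloc_in bh oc od (lt_trans ct td).
  by apply: (sBV_ACJ bv); apply/oitvE; rewrite ct.
apply: (@distr_eq _ a b (ddot a b h) (fun psi => fibint (h t0) (psi t0)) phi (t0, s1) (t0, s2)) => //.
- exact: ddot_distribution.
- exact: fibre_distribution.
- by move=> P oP _; rewrite (ddot_sing bh oP) fibint_singc.
- exact: pt_col.
- move=> S S' JS JS' PS SS' S'Q.
  have S1 : S.1 = t0 by have := lept1 PS; have := lept1 (le_trans (ltW SS') S'Q) => /=; lra.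
  have S'1 : S'.1 = t0 by have := lept1 S'Q; have := lept1 (le_trans PS (ltW SS')) => /=; lra.
  have oS : oitv a b S.1 by rewrite S1.
  have oS' : oitv a b S'.1 by rewrite S'1.
  by rewrite (ddot_ind bh oS oS' JS JS' (ltW SS')) fibint_ind// /fibinc S1 S'1 ltxx eqxx; ring.
Qed.

Local Instance ae_leb_filter : Filter (nbhs (almost_everywhere leb)).
Proof. exact: ae_filter_ringOfSetsType. Qed.

(** Derivatives at the two end points of J see values outside of J. *)
Lemma ae_endpoints (P : R -> Prop) : {ae leb, forall s, - 2^-1 < s < 2^-1 -> P s} ->
  {ae leb, forall s, J s -> P s}.
Proof.
have ne (x : R) : {ae leb, forall s, s != x}.
  exists [set x]; split; [exact: measurable_set1|exact: lebesgue_measure_set1|].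
  by move=> s /= /negP; rewrite negbK => /eqP.
move=> H; apply: filterS3 H (ne (- 2^-1)) (ne 2^-1) => s Hs n1 n2; rewrite JE => /andP[s1 s2].
by apply: Hs; rewrite !lt_neqAle s1 s2 n2 eq_sym n1.
Qed.

(** The differential equation of the jump is integrated. *)
Lemma fibint_ae n (xi : R -> R) (h : 'I_n -> R -> R) (psi : 'I_n -> R -> R) s :
  ACJ xi -> (forall j, ACJ (h j)) -> (forall j, regulatedJ (psi j)) -> J s ->
  {ae leb, forall r, J r -> derive1 xi r = \sum_j psi j r * derive1 (h j) r} ->
  xi s - xi (- 2^-1) = \sum_j fibint (h j) (fun r => psi j r * (r < s)%R%:R).
Proof.
move=> axi ah rpsi Js ae; rewrite -(fibint_lt axi Js).
have rind j : regulatedJ (fun r => psi j r * (r < s)%R%:R).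
  apply: regJM => //; apply: (regJ_eq (below_regJ 0 (0, s))) => r _.
  by rewrite /below ltptE /= ltxx eqxx.
have H j := cid (ACJ_density (ah j)).
pose rho j := projT1 (H j).
have irho j : leb.-integrable J (EFin \o rho j).
  have [i1 _ _] := projT2 (H j); apply: (integrableS _ _ _ i1) => //; exact: mJ.
have aer : {ae leb, forall r, J r -> forall j, derive1 (h j) r = rho j r}.
  have : {ae leb, forall r, forall j, J r -> derive1 (h j) r = rho j r}.
    apply: (@near_forall_ord n _ (almost_everywhere leb)) => j; apply: ae_endpoints.
    by have [_ _] := projT2 (H j).
  by apply: filterS => r Hr Jr' j; exact: Hr.
have ichi j : leb.-integrable J (EFin \o (fun r => psi j r * (r < s)%R%:R * rho j r)).
  have [M M0 HM] := regJ_bounded (rind j).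
  exact: (integrable_mulb mJ (irho j) (regJ_measurableJ (rind j)) HM).
transitivity (\int[leb]_(r in J) \sum_j (psi j r * (r < s)%R%:R * rho j r)).
  rewrite /fibint; apply: Rintegral_ae_eq; apply: filterS2 ae aer => r H1 H2 Jr'.
  rewrite (H1 Jr') mulr_sumr; apply: eq_bigr => j _; rewrite (H2 Jr') ; ring.
have gen (l : seq 'I_n) : leb.-integrable J (EFin \o (fun r => \sum_(j <- l) psi j r * (r < s)%R%:R * rho j r)) /\
    \int[leb]_(r in J) (\sum_(j <- l) psi j r * (r < s)%R%:R * rho j r) =
    \sum_(j <- l) \int[leb]_(r in J) (psi j r * (r < s)%R%:R * rho j r).
  elim: l => [|j l [IH1 IH2]].
    rewrite big_nil (_ : (fun r => _) = cst 0); last by apply/funext => r; rewrite big_nil.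
    split; first exact: integrable0.
    by rewrite Rintegral_cst ?mul0r//; exact: mJ.
  rewrite big_cons -IH2 -RintegralD//; [|exact: mJ].
  have E : (fun r => \sum_(j0 <- j :: l) psi j0 r * (r < s)%R%:R * rho j0 r) =
    (fun r => psi j r * (r < s)%R%:R * rho j r + \sum_(j0 <- l) psi j0 r * (r < s)%R%:R * rho j0 r).
    by apply/funext => r; rewrite big_cons.
  rewrite E; split => //.
  rewrite (_ : EFin \o _ = (fun r => (psi j r * (r < s)%R%:R * rho j r)%:E +
     (\sum_(j0 <- l) psi j0 r * (r < s)%R%:R * rho j0 r)%:E)%E); last by apply/funext.
  exact: (integrableD mJ (ichi j) IH1).
rewrite (gen _).2; apply: eq_bigr => j _; rewrite /fibint; apply: Rintegral_ae_eq.
by apply: filterS aer => r H2 Jr'; rewrite (H2 Jr').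
Qed.

Lemma fibint_cst (h : R -> R) c psi : ACJ h -> regulatedJ psi -> (forall s, J s -> h s = c) -> fibint h psi = 0.
Proof.
move=> ach rpsi hc; have [M M0 HM] := regJ_bounded rpsi.
by have := fibint_le ach rpsi M0 HM; rewrite (TVJ_cst hc) mulr0 normr_le0 => /eqP.
Qed.

End FibreProblem.

Section GeometricLimit.
Context {R : realType}.

(** The limit comes with the error bound, which is uniform in whatever the
sequence depends on. *)
Lemma geom_limit (u : nat -> R) (c : R) : 0 <= c -> (forall k, `|u k.+1 - u k| <= c / 2 ^+ k) ->
  exists l, forall k, `|l - u k| <= 2 * c / 2 ^+ k.
Proof.
move=> c0 H; pose lo k := u k - 2 * c / 2 ^+ k; pose hi k := u k + 2 * c / 2 ^+ k.
have halve k : 2 * c / 2 ^+ k.+1 = c / 2 ^+ k.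
  by rewrite exprS invfM; field; rewrite expf_neq0.
have dbl k : 2 * c / 2 ^+ k = c / 2 ^+ k + c / 2 ^+ k by rewrite -mulrA mulr_natl mulr2n.
have lo_nd : nondecreasing_seq lo.
  apply/nondecreasing_seqP => k; rewrite /lo halve dbl; have := H k; rewrite ler_norml; lra.
have hi_ni : nonincreasing_seq hi.
  apply/nonincreasing_seqP => k; rewrite /hi halve dbl; have := H k; rewrite ler_norml; lra.
have lohi k l : lo k <= hi l.
  pose m := maxn k l; apply: (le_trans (lo_nd _ _ (leq_maxl k l))); apply: le_trans (hi_ni _ _ (leq_maxr k l)).
  by rewrite /lo /hi lerD2l ge0_cp// mulr_ge0// ?mulr_ge0// invr_ge0 exprn_ge0.
exists (sup (range lo)) => k; rewrite ler_norml; apply/andP; split.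
  rewrite lerBrDr addrC -/(lo k); apply: ub_le_sup; last by exists k.
  by exists (hi 0%N) => _ [l _ <-].
by rewrite lerBlDl -/(hi k); apply: ge_sup; [exists (lo 0%N), 0%N|move=> _ [l _ <-]].
Qed.

Lemma modulus_le (m m' M w w' z r : R) : z <= m + M * w - (m' + M * w') -> m - m' + M * (w - w') <= r -> z <= r.
Proof. by move=> h h'; apply: le_trans h (le_trans _ h'); rewrite mulrBr opprD addrACA. Qed.

End GeometricLimit.

(** * Local existence by Picard iteration *)

Section Existence.
Context {R : realType} {n : nat}.
Local Notation pt := (R *lexi[ring_display] R)%type.
Local Notation clm := (@completed_lebesgue_measure R).
Local Notation leb := (@lebesgue_measure R).
Variables (A B : \bar R) (D : set (R * 'cV[R]_n)) (f : R -> 'cV[R]_n -> 'cV[R]_n)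
  (G : R -> 'cV[R]_n -> R -> 'M[R]_n) (u : R -> R -> 'cV[R]_n) (Kf Kg t0 : R) (x0 : 'cV[R]_n).
Hypothesis oD : open D.
Hypothesis Kf0 : 0 < Kf.
Hypothesis cf : caratheodory D f.
Hypothesis hfLip : forall t, Kf.-lipschitz_[set y | D (t, y)] (f t).
Hypothesis hg : forall (y : 'cV[R]_n) (i j : 'I_n) (c d : \bar R), (c < d)%E ->
     (forall t, oitv c d t -> D (t, y)) -> sG c d (fun t s => G t y s i j).
Hypothesis Kg0 : 0 < Kg.
Hypothesis hgLip : forall t s, J s -> Kg.-lipschitz_[set y | D (t, y)] (fun y => G t y s).
Hypothesis bu : sBVn_loc A B u.
Hypothesis o0 : oitv A B t0.
Hypothesis Dx0 : D (t0, x0).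
Hypothesis hjump : Tdiscn A B u t0 -> jump_in_domain t0 x0 D G u.

Definition jump_curve (xi : R -> 'cV[R]_n) : R -> R -> 'cV[R]_n :=
  fun t s => if t < t0 then xi (- 2^-1) else if t == t0 then xi s else xi 2^-1.

Lemma jump_curve_before (xi : R -> 'cV[R]_n) t s : t < t0 -> jump_curve xi t s = xi (- 2^-1).
Proof. by rewrite /jump_curve => ->. Qed.

Lemma jump_curve_at (xi : R -> 'cV[R]_n) s : jump_curve xi t0 s = xi s.
Proof. by rewrite /jump_curve ltxx eqxx. Qed.

Lemma jump_curve_after (xi : R -> 'cV[R]_n) t s : t0 < t -> jump_curve xi t s = xi 2^-1.
Proof. by rewrite /jump_curve => h; rewrite ltNge (ltW h) gt_eqF. Qed.

Lemma jump_curve_lexcts a b (xi : R -> 'cV[R]_n) : (forall i, ctsJ (fun s => xi s i 0)) -> lexcts a b (jump_curve xi).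
Proof.
move=> cxi i; split.
- move=> t _ s Js e e0; have [tt0|tt0|->] := ltgtP t t0.
  + by exists 1 => // r _ _; rewrite !jump_curve_before// subrr normr0 ltW.
  + by exists 1 => // r _ _; rewrite !jump_curve_after// subrr normr0 ltW.
  + have [d d0 Hd] := cxi i s Js e e0; exists d => // r Jr' hr; rewrite !jump_curve_at; exact: Hd.
- move=> t _ e e0; rewrite /Defs.coord; have [tt0|tt0] := leP t t0.
    apply: (@ex_near_left _ _ _ 1) => // r hr s _.
    rewrite [jump_curve xi r s]jump_curve_before; last by lra.
    suff -> : jump_curve xi t (- 2^-1) = xi (- 2^-1) by rewrite subrr normr0 ltW.
    by move: tt0; rewrite le_eqVlt => /predU1P[->|/jump_curve_before //]; rewrite jump_curve_at.
  apply: (@ex_near_left _ _ _ (t - t0)); first by lra.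
  by move=> r hr s _; rewrite !jump_curve_after ?subrr ?normr0 ?(ltW e0)//; lra.
- move=> t _ e e0; rewrite /Defs.coord; have [tt0|tt0] := leP t0 t.
    apply: (@ex_near_right _ _ _ 1) => // r hr s _.
    rewrite [jump_curve xi r s]jump_curve_after; last by lra.
    suff -> : jump_curve xi t 2^-1 = xi 2^-1 by rewrite subrr normr0 ltW.
    by move: tt0; rewrite le_eqVlt => /predU1P[<-|/jump_curve_after //]; rewrite jump_curve_at.
  apply: (@ex_near_right _ _ _ (t0 - t)); first by lra.
  by move=> r hr s _; rewrite !jump_curve_before ?subrr ?normr0 ?(ltW e0)//; lra.
Qed.

(** The two constant branches stay in D for a short time because D is open. *)
Lemma jump_curve_frame (xi : R -> 'cV[R]_n) : (forall s, J s -> D (t0, xi s)) -> exists c d : R,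
  [/\ c < t0, t0 < d, oitv A B c, oitv A B d & inD D c%:E d%:E (jump_curve xi)].
Proof.
move=> Dxi.
have tube s : J s -> exists2 r : R, 0 < r & forall t, `|t - t0| < r -> D (t, xi s).
  move=> Js; have [||r r0 Hr] := @compact_tube R n [set (t0, xi s)] D _ oD.
  - exact: compact_set1.
  - by move=> ? ->; exact: Dxi.
  - by exists r => // t ht; apply: (Hr t0 (xi s)) => //; rewrite subrr normr0.
have [r1 r10 H1] := tube _ Jl; have [r2 r20 H2] := tube _ Jr.
have [c' c't oc'] := oitv_left o0; have [d' td' od'] := oitv_right o0.
exists (Num.max c' (t0 - r1)), (Num.min d' (t0 + r2)).
have c1 : Num.max c' (t0 - r1) < t0 by rewrite gt_max c't; lra.
have c2 : c' <= Num.max c' (t0 - r1) by rewrite le_max lexx.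
have c3 : t0 - r1 <= Num.max c' (t0 - r1) by rewrite le_max lexx orbT.
have d1 : t0 < Num.min d' (t0 + r2) by rewrite lt_min td'; lra.
have d2 : Num.min d' (t0 + r2) <= d' by rewrite ge_min lexx.
have d3 : Num.min d' (t0 + r2) <= t0 + r2 by rewrite ge_min lexx orbT.
split => //; [by apply: (oitv_le oc' o0); lra|by apply: (oitv_le o0 od'); lra|].
move=> t s /oitvE ht Js; have [tt0|tt0|tt0] := ltgtP t t0.
- rewrite jump_curve_before//; apply: H1; rewrite ltr0_norm; lra.
- by rewrite jump_curve_after//; apply: H2; rewrite gtr0_norm; lra.
- by rewrite tt0 jump_curve_at; exact: Dxi.
Qed.

(** The integrated form of the fast-time problem at t0. *)
Definition solves_fibre (xi : R -> 'cV[R]_n) : Prop := forall i s, J s ->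
  xi s i 0 - x0 i 0 = \sum_j fibint (Defs.coord u j t0) (fun r => G t0 (xi r) r i j * (r < s)%R%:R).

Lemma u_ACJ j : ACJ (Defs.coord u j t0).
Proof.
have [c ct oc] := oitv_left o0; have [d td od] := oitv_right o0.
have bv := sBVloc_in (bu j) oc od (lt_trans ct td).
by apply: (sBV_ACJ bv); apply/oitvE; rewrite ct.
Qed.

Lemma G_regJ (xi : R -> 'cV[R]_n) i j : (forall i, ctsJ (fun s => xi s i 0)) -> (forall s, J s -> D (t0, xi s)) ->
  regulatedJ (fun r => G t0 (xi r) r i j).
Proof.
move=> cxi Dxi; have [c [d [ct td _ _ cD]]] := jump_curve_frame Dxi.
have [H _ _] := Gx_ldG oD hg Kg0 hgLip i j (@jump_curve_lexcts c%:E d%:E xi cxi) cD.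
have It : oitv c%:E d%:E t0 by apply/oitvE; rewrite ct.
by apply: regJ_eq (H t0 It) _ => s _; rewrite /Gx jump_curve_at.
Qed.

(** Without a jump of u at t0 the constant x0 solves the fibre problem, because
the derivative of u vanishes in the fibre. *)
Lemma fibre_value : exists xi : R -> 'cV[R]_n, [/\ forall i, ctsJ (fun s => xi s i 0), xi (- 2^-1) = x0,
  forall s, J s -> D (t0, xi s) & solves_fibre xi].
Proof.
have rlt s : regulatedJ (fun r : R => (r < s)%R%:R).
  apply: (regJ_eq (below_regJ 0 (0, s))) => r _; by rewrite /below ltptE /= ltxx eqxx.
have [/hjump[xi [axi xi0 Dxi ae]]|nT] := pselect (Tdiscn A B u t0).
  have cxi i : ctsJ (fun s => xi s i 0) by exact: ACJ_ctsJ.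
  exists xi; split => // i s Js; rewrite -xi0.
  apply: (fibint_ae (psi := fun j r => G t0 (xi r) r i j) (axi i) u_ACJ _ Js).
    by move=> j; exact: G_regJ.
  by apply: (@filterS _ _ ae_leb_filter) ae => r H Jr'; exact: H.
have cx i : ctsJ (fun s : R => x0 i 0).
  by move=> s Js e e0; exists 1 => // r _ _; rewrite subrr normr0 ltW.
exists (fun _ => x0); split => // i s Js; rewrite subrr big1// => j _.
have [k [hk _ _]] : dcontinuous_at (Defs.coord u j) t0.
  by apply: contrapT => h; apply: nT; exists j; split.
apply: (fibint_cst (u_ACJ j) _ hk); apply: regJM => //.
by apply: (@G_regJ (fun _ => x0)).
Qed.

Section Picard.
Variables (xi : R -> 'cV[R]_n) (al be r M0 Km : R) (mu : R -> R) (w_ : 'I_n -> @dyn R) (K_ : 'I_n -> R).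
Local Notation I := (oitv al%:E be%:E).
Local Notation xb := (jump_curve xi).
Hypothesis cxi : forall i, ctsJ (fun s => xi s i 0).
Hypothesis xi0 : xi (- 2^-1) = x0.
Hypothesis sxi : solves_fibre xi.
Hypotheses (alt0 : al < t0) (t0be : t0 < be).
Hypothesis sub : I `<=` oitv A B.
Hypothesis r0 : 0 < r.
Hypothesis tube : forall t s y, I t -> J s -> `|y - xb t s| < r -> D (t, y).
Hypothesis M00 : 0 <= M0.
Hypothesis HM0 : forall i j t s, I t -> J s -> `|Gx G xb i j t s| <= M0.
Hypothesis ctl : forall j, control al%:E be%:E (Defs.coord u j) (w_ j) (K_ j).
Hypothesis cmu : control al%:E be%:E (fun t _ => mu t) (fun t _ => mu t) Km.
Hypothesis Hmu : forall z i p q, lexcts al%:E be%:E z -> inD D al%:E be%:E z -> I p -> I q -> p <= q ->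
  (forall t, I t -> `|z t 0 - xb t 0| <= r) ->
  \int[clm]_(t in `]p, q]) `|fx f z i t| <= mu q - mu p.

Let W (t s : R) : R := \sum_j w_ j t s.
Let M := M0 + Kg * r.

Hypothesis small : forall t s, I t -> J s ->
  (t0 < t -> [/\ mu t - mu t0 + M * (W t s - W t0 2^-1) <= r / 2 &
     Kf * (t - t0) + Kg * (W t s - W t0 2^-1) <= 4^-1]) /\
  (t < t0 -> [/\ mu t0 - mu t + M * (W t0 (- 2^-1) - W t s) <= r / 2 &
     Kf * (t0 - t) + Kg * (W t0 (- 2^-1) - W t s) <= 4^-1]).

Let It0 : I t0.
Proof. by apply/oitvE; rewrite alt0 t0be. Qed.

Let M_ge0 : 0 <= M.
Proof. by rewrite addr_ge0// mulr_ge0 ?ltW. Qed.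

Let buI : sBVn_loc al%:E be%:E u.
Proof. by move=> i; exact: sBVloc_sub sub (bu i). Qed.

(** The curves on which the iteration acts.  Fixing the value over t0 removes the
only place where the control of u need not be small. *)
Definition admissible (z : R -> R -> 'cV[R]_n) : Prop :=
  [/\ lexcts al%:E be%:E z, forall t s, I t -> J s -> `|z t s - xb t s| <= r / 2 &
     forall s, J s -> z t0 s = xi s].

Let tubeD z t s : I t -> J s -> `|z t s - xb t s| <= r / 2 -> D (t, z t s).
Proof. by move=> It Js h; apply: (tube It Js); apply: le_lt_trans h _; rewrite ltr_pdivrMr// ltr_pMr// ltr1n. Qed.

Lemma admissible_inD z : admissible z -> inD D al%:E be%:E z.
Proof. by move=> [_ h _] t s It Js; apply: tubeD => //; exact: h. Qed.

Let xbD : inD D al%:E be%:E xb.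
Proof. by move=> t s It Js; apply: (tube It Js); rewrite subrr normr0. Qed.

Lemma admissible_G z i j t s : admissible z -> I t -> J s -> `|Gx G z i j t s| <= M.
Proof.
move=> az It Js; have [_ h _] := az.
have h1 := G_lip hgLip i j Js (admissible_inD az It Js) (xbD It Js).
have h2 : Kg * `|z t s - xb t s| <= Kg * r.
  by rewrite ler_pM2l//; apply: le_trans (h t s It Js) _; have := r0; lra.
have := HM0 i j It Js; have := ler_normD (Gx G xb i j t s) (Gx G z i j t s - Gx G xb i j t s).
rewrite subrKC /M; move: h1 h2; rewrite /Gx; lra.
Qed.

(** One step of the iteration.  The indicator of an interval with reversed end
points is negative, so the formula serves for both sides of t0. *)
Definition picard (z : R -> R -> 'cV[R]_n) : R -> R -> 'cV[R]_n := fun t s =>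
  \col_i (x0 i 0 + rhs al%:E be%:E f G u z i (ind (t0, - 2^-1) (t, s))).

Let Iex : exists t, I t. Proof. by exists t0. Qed.

Lemma picard_incr z (P Q : pt) i : admissible z -> I P.1 -> I Q.1 -> P <= Q ->
  picard z Q.1 Q.2 i 0 - picard z P.1 P.2 i 0 = rhs_int f G al%:E be%:E u z i P Q.
Proof.
move=> az IP IQ PQ; have [lz _ _] := az.
have dr := rhs_distribution oD Kf0 cf hfLip hg Kg0 hgLip i Iex buI lz (admissible_inD az).
transitivity (rhs al%:E be%:E f G u z i (ind P Q)); last exact: (rhs_ind f G u z i IP IQ PQ).
rewrite !mxE opprD addrACA subrr add0r -(distrB dr); [|exact: test_ind1|exact: test_ind1].
congr (rhs _ _ _ _ _ _ _ _); apply/funext => t; apply/funext => s.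
by rewrite /ind; case: (P) (Q) => p1 p2 [q1 q2] /=; ring.
Qed.

(** The common modulus of continuity of all Picard iterates. *)
Definition modulus : @dyn R := fun t s => mu t + M * W t s.

Lemma modulus_control : control al%:E be%:E modulus modulus (Km + M * \sum_j K_ j).
Proof. by apply: control_lin => //; apply: control_sum => j; exact: control_self (ctl j). Qed.

(** The bounds for f and g in the tube. *)
Lemma picard_modulus z (P Q : pt) i : admissible z -> I P.1 -> I Q.1 -> J P.2 -> J Q.2 -> P <= Q ->
  `|picard z Q.1 Q.2 i 0 - picard z P.1 P.2 i 0| <= modulus Q.1 Q.2 - modulus P.1 P.2.
Proof.
move=> az IP IQ JP JQ PQ; have [lz hz _] := az; rewrite picard_incr//.
have := rhs_int_bound oD Kf0 cf hfLip hg Kg0 hgLip (i := i) buI ctl lz (admissible_inD az) IP IQ JP JQ PQ M_ge0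
  (fun j t s Js h => admissible_G i j az (pt_between IP IQ h) Js).
move=> /le_trans; apply; rewrite /modulus opprD addrACA -mulrBr /W -sumrB lerD2r.
apply: (Hmu i lz (admissible_inD az) IP IQ (lept1 PQ)) => t It.
by apply: le_trans (hz t 0 It J0) _; have := r0; lra.
Qed.

Lemma picard_control z i : admissible z ->
  control al%:E be%:E (Defs.coord (picard z) i) modulus (Km + M * \sum_j K_ j).
Proof.
move=> az; apply: control_dom modulus_control _ => P Q IP IQ JP JQ PQ; exact: picard_modulus.
Qed.

(** On the fibre over t0 the right hand side involves only the value on this
fibre, which solves the fibre problem. *)
Lemma picard_fibre z s : admissible z -> J s -> picard z t0 s = xi s.
Proof.
move=> az Js; have [lz _ fz] := az; apply/matrixP => i j; rewrite ord1 {j} !mxE.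
have PQ : ((t0, - 2^-1) : pt) <= (t0, s) by apply: pt_col; move: Js; rewrite JE => /andP[].
rewrite (rhs_ind f G u z i (It0 : I (t0, - 2^-1).1) (It0 : I (t0, s).1) PQ).
suff -> : rhs_int f G al%:E be%:E u z i (t0, - 2^-1) (t0, s) = xi s i 0 - x0 i 0 by rewrite subrKC.
rewrite (sxi i Js) /rhs_int set_itvoc0 Rintegral_set0 add0r; apply: eq_bigr => j _.
rewrite (ddot_fibre (buI j) (Gx_ldG oD hg Kg0 hgLip i j lz (admissible_inD az)) It0 Jl Js); last first.
  by move: Js; rewrite JE => /andP[].
apply: fibint_eq => q Jq; rewrite /Gx fz// indE// leptE ltptE /= ltxx eqxx /=.
by move: Jq; rewrite JE => /andP[-> _].
Qed.

Lemma picard_admissible z : admissible z -> admissible (picard z).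
Proof.
move=> az; split; [exact: control_lexcts (fun i => picard_control i az)| |by move=> s; exact: picard_fibre].
move=> t s It Js; have [tt0|tt0|tt0] := ltgtP t t0.
- rewrite jump_curve_before// -(picard_fibre az Jl); apply: cV_norm_le; first by have := r0; lra.
  move=> i; rewrite !mxE -/(picard z t s i 0) distrC.
  have := @picard_modulus z (t, s) (t0, - 2^-1) i az It It0 Js Jl (pt_lt _ _ tt0).
  by have [_ /(_ tt0)[h _]] := small It Js; rewrite !mxE /modulus /= => H; exact: modulus_le H h.
- rewrite jump_curve_after// -(picard_fibre az Jr); apply: cV_norm_le; first by have := r0; lra.
  move=> i; rewrite !mxE.
  have := @picard_modulus z (t0, 2^-1) (t, s) i az It0 It Jr Js (pt_lt _ _ tt0).
  by have [/(_ tt0)[h _] _] := small It Js; rewrite !mxE /modulus /= => H; exact: modulus_le H h.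
- by rewrite tt0 jump_curve_at picard_fibre// subrr normr0; have := r0; lra.
Qed.

(** Off the fibre over t0 the smallness condition bounds the increments of the
difference from the nearer end of that fibre by C / 4. *)
Lemma picard_contraction z z' C : admissible z -> admissible z' -> 0 <= C ->
  (forall t s, I t -> J s -> `|z t s - z' t s| <= C) ->
  forall t s, I t -> J s -> `|picard z t s - picard z' t s| <= C / 2.
Proof.
move=> az az' C0 HC t s It Js; have [lz _ _] := az; have [lz' _ _] := az'.
have zero_ctl j : control al%:E be%:E (fun t s => Defs.coord u j t s - Defs.coord u j t s) (fun _ _ => 0) 0.
  by apply: control_dom (control0 _ _) _ => P Q _ _ _ _ _; rewrite !subrr normr0.
have C2 : 0 <= C / 2 by lra.
have step (P Q : pt) : I P.1 -> I Q.1 -> J P.2 -> J Q.2 -> P <= Q ->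
    Kf * (Q.1 - P.1) + Kg * (W Q.1 Q.2 - W P.1 P.2) <= 4^-1 ->
    forall i, `|(picard z Q.1 Q.2 i 0 - picard z P.1 P.2 i 0) - (picard z' Q.1 Q.2 i 0 - picard z' P.1 P.2 i 0)| <= C / 2.
  move=> IP IQ JP JQ PQ h i.
  have z00 : \sum_(j < n) ((0 : R) - 0) = 0 by rewrite big1// => j _; rewrite subrr.
  suff H : `|rhs_int f G al%:E be%:E u z i P Q - rhs_int f G al%:E be%:E u z' i P Q| <= C / 2.
    by apply: le_trans H; rewrite le_eqVlt; apply/orP; left; apply/eqP; congr (`|_ - _|); exact: picard_incr.
  have := rhs_int_diff oD Kf0 cf hfLip hg Kg0 hgLip (i := i) buI buI ctl zero_ctl lz' (admissible_inD az')
    lz (admissible_inD az) IP IQ JP JQ PQ M_ge0 C0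
    (fun j t s Js h => admissible_G i j az' (pt_between IP IQ h) Js)
    (fun t s Js h => HC t s (pt_between IP IQ h) Js).
  rewrite z00.
  rewrite mulr0 addr0 sumrB -/(W Q.1 Q.2) -/(W P.1 P.2) => /le_trans; apply.
  have := ler_wpM2l C0 h; lra.
have [tt0|tt0|tt0] := ltgtP t t0.
- apply: cV_norm_le => // i; have -> : (picard z t s - picard z' t s) i 0 = picard z t s i 0 - picard z' t s i 0.
    by move: (picard z t s) (picard z' t s) => p q; rewrite !mxE.
  have [_ /(_ tt0)[_ h]] := small It Js.
  have := @step (t, s) (t0, - 2^-1) It It0 Js Jl (pt_lt _ _ tt0) h i; rewrite /= !picard_fibre ?Jl//; [|exact: Jl..].
  move: (picard z t s) (picard z' t s) (xi _) => p q v.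
  by rewrite -normrN; congr (`|_| <= _); ring.
- apply: cV_norm_le => // i.
  have [/(_ tt0)[_ h] _] := small It Js.
  have := @step (t0, 2^-1) (t, s) It0 It Jr Js (pt_lt _ _ tt0) h i; rewrite /= !picard_fibre ?Jr//; [|exact: Jr..].
  move: (picard z t s) (picard z' t s) (xi _) => p q v.
  by rewrite !mxE; congr (`|_| <= _); ring.
- by rewrite tt0 !picard_fibre// subrr normr0.
Qed.
Let z_ k := iter k picard xb.

Let z_adm k : admissible (z_ k).
Proof.
elim: k => [|k IH]; last exact: picard_admissible.
split; [exact: jump_curve_lexcts| |by move=> s _; rewrite /z_ /= jump_curve_at].
by move=> t s _ _; rewrite /z_ /= subrr normr0 divr_ge0// ltW.
Qed.

Let z_step k t s : I t -> J s -> `|z_ k.+1 t s - z_ k t s| <= r / 2 / 2 ^+ k.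
Proof.
elim: k t s => [|k IH] t s It Js.
  by rewrite expr0 divr1; have [_ h _] := z_adm 1; exact: h.
have c0 : 0 <= r / 2 / 2 ^+ k by rewrite !divr_ge0 ?exprn_ge0// ltW.
have := picard_contraction (z_adm k.+1) (z_adm k) c0 IH It Js.
by move=> /le_trans; apply; rewrite exprS invfM (mulrC 2^-1) mulrA.
Qed.

Lemma picard_limit : exists x, admissible x /\
  forall t s, I t -> J s -> forall k, `|x t s - z_ k t s| <= r / 2 ^+ k.
Proof.
pose x t s : 'cV[R]_n := \col_i xget 0 [set l : R | forall k, `|l - z_ k t s i 0| <= r / 2 ^+ k].
have Hx t s : I t -> J s -> forall k, `|x t s - z_ k t s| <= r / 2 ^+ k.
  move=> It Js k; apply: cV_norm_le; first by rewrite divr_ge0 ?exprn_ge0// ltW.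
  move=> i; rewrite !mxE; case: xgetP => [l _ /(_ k)//|/=].
  have [|l Hl] := @geom_limit R (fun k => z_ k t s i 0) (r / 2) (ltac:(by rewrite divr_ge0// ltW)).
    move=> m; apply: le_trans (z_step m It Js).
    by have := coord_norm_le (z_ m.+1 t s - z_ m t s) i 0; rewrite !mxE.
  by move=> /(_ l) []; move=> m; have := Hl m; rewrite (_ : 2 * (r / 2) = r)//; field.
have close t s e : I t -> J s -> 0 < e -> exists k, `|x t s - z_ k.+1 t s| <= e.
  move=> It Js e0; have [k hk] := geom_small (ltW r0) e0; exists k.
  apply: le_trans (Hx t s It Js k.+1) _; apply: le_trans hk; rewrite ler_pM2l//.
  by rewrite lef_pV2 ?posrE ?exprn_gt0// ler_weXn2l// ler1n.
exists x; split => //; split.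
- suff ctlx i : control al%:E be%:E (Defs.coord x i) modulus (Km + M * \sum_j K_ j) by exact: control_lexcts ctlx.
  apply: control_dom modulus_control _ => P Q IP IQ JP JQ PQ; apply/ler_addgt0Pr => e e0.
  have e2 : 0 < e / 2 by lra.
  have [k hk] := geom_small (ltW r0) e2.
  have le1 : r / 2 ^+ k.+1 <= e / 2.
    apply: le_trans hk; rewrite ler_pM2l// lef_pV2 ?posrE ?exprn_gt0// ler_weXn2l// ler1n//.
  have h1 := le_trans (coord_norm_le (x Q.1 Q.2 - z_ k.+1 Q.1 Q.2) i 0) (le_trans (Hx _ _ IQ JQ k.+1) le1).
  have h2 := le_trans (coord_norm_le (x P.1 P.2 - z_ k.+1 P.1 P.2) i 0) (le_trans (Hx _ _ IP JP k.+1) le1).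
  have h3 : `|z_ k.+1 Q.1 Q.2 i 0 - z_ k.+1 P.1 P.2 i 0| <= modulus Q.1 Q.2 - modulus P.1 P.2.
    exact: (@picard_modulus (z_ k) P Q i (z_adm k) IP IQ JP JQ PQ).
  move: h1 h2 h3; rewrite /Defs.coord.
  move: (z_ k.+1 Q.1 Q.2) (z_ k.+1 P.1 P.2) (x Q.1 Q.2) (x P.1 P.2) => p q p' q'; rewrite !mxE.
  move: (p i 0) (q i 0) (p' i 0) (q' i 0) => a1 a2 a3 a4.
  move: (modulus _ _) (modulus _ _) => m1 m2; rewrite !ler_norml; lra.
- move=> t s It Js; apply/ler_addgt0Pr => e e0; have [k hk] := close t s e It Js e0.
  have [_ h _] := z_adm k.+1; have := h t s It Js.
  have := ler_distD (z_ k.+1 t s) (x t s) (xb t s); move: hk; lra.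
- move=> s Js; apply/eqP; rewrite -subr_eq0 -normr_le0; apply/ler_addgt0Pr => e e0.
  have [k hk] := close t0 s e It0 Js e0; rewrite add0r.
  by have [_ _ h] := z_adm k.+1; move: hk; rewrite h.
Qed.

(** The limit is a fixed point, because the image of the limit and the limit are
both close to the next iterate. *)
Theorem picard_solution : exists x, [/\ integral_solution D f G al%:E be%:E u x, x t0 (- 2^-1) = x0,
  forall i, control al%:E be%:E (Defs.coord x i) modulus (Km + M * \sum_j K_ j) &
  forall i j t s, I t -> J s -> `|Gx G x i j t s| <= M].
Proof.
have [x [ax Hx]] := picard_limit; have [lx hx fx] := ax.
have fixed t s : I t -> J s -> picard x t s = x t s.
  move=> It Js; apply/eqP; rewrite -subr_eq0 -normr_le0; apply/ler_addgt0Pr => e e0; rewrite add0r.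
  have e2 : 0 < e / 2 by lra.
  have [k hk] := geom_small (ltW r0) e2.
  have c0 : 0 <= r / 2 ^+ k by rewrite divr_ge0 ?exprn_ge0// ltW.
  have h1 : `|picard x t s - z_ k.+1 t s| <= r / 2 ^+ k / 2.
    exact: (picard_contraction ax (z_adm k) c0 (fun t s It Js => Hx t s It Js k) It Js).
  have h2 := Hx t s It Js k.+1.
  have h3 : r / 2 ^+ k.+1 <= r / 2 ^+ k.
    by rewrite ler_pM2l// lef_pV2 ?posrE ?exprn_gt0// ler_weXn2l// ler1n.
  move: h1 h2; move: (z_ k.+1 t s) (picard x t s) (x t s) => p q v h1 h2.
  have := ler_distD p q v; rewrite [`|p - v|]distrC.
  move: h1 h2 h3 hk c0; lra.
have modx (P Q : pt) i : I P.1 -> I Q.1 -> J P.2 -> J Q.2 -> P <= Q ->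
    x Q.1 Q.2 i 0 - x P.1 P.2 i 0 = picard x Q.1 Q.2 i 0 - picard x P.1 P.2 i 0.
  by move=> IP IQ JP JQ PQ; rewrite !fixed.
exists x; split.
- split => //; first exact: admissible_inD.
  by move=> P Q IP IQ JP JQ PQ i; rewrite modx//; exact: picard_incr.
- by rewrite fx//; exact: Jl.
- move=> i; apply: control_dom modulus_control _ => P Q IP IQ JP JQ PQ.
  by rewrite /Defs.coord modx//; exact: picard_modulus.
- by move=> i j t s It Js; exact: admissible_G.
Qed.

End Picard.

Lemma locint_add a b (F F' : R -> R) : locint a b F -> locint a b F' -> locint a b (fun t => F t + F' t).
Proof.
move=> l1 l2 c d oc od; rewrite (_ : EFin \o _ = (fun t => (F t)%:E + (F' t)%:E)%E); last by apply/funext.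
by apply: (integrableD (clm_itvcc c d)); [exact: l1|exact: l2].
Qed.

Lemma locint_cst a b (k : R) : locint a b (fun _ => k).
Proof.
move=> c d oc od; apply: measurable_bounded_integrable; [exact: clm_itvcc| |exact: measurable_cst|exact: bounded_cst].
change (leb `[c, d]%classic < +oo)%E.
by rewrite lebesgue_measure_itv /=; case: ifP => // _; rewrite -EFinB ltry.
Qed.

Lemma locint_norm a b (F : R -> R) : locint a b F -> locint a b (fun t => `|F t|).
Proof. by move=> l1 c d oc od; exact: integrable_norm (l1 c d oc od). Qed.

Lemma locint_sum a b (F_ : 'I_n -> R -> R) : (forall i, locint a b (F_ i)) -> locint a b (fun t => \sum_i F_ i t).
Proof.
move=> H; suff K (l : seq 'I_n) : locint a b (fun t => \sum_(i <- l) F_ i t) by exact: K.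
elim: l => [|i l IH].
  rewrite (_ : (fun t => _) = (fun _ => 0)); first exact: locint_cst.
  by apply/funext => t; rewrite big_nil.
rewrite (_ : (fun t => _) = (fun t => F_ i t + \sum_(j <- l) F_ j t)); first exact: locint_add.
by apply/funext => t; rewrite big_cons.
Qed.

Lemma integral_control c d (m : R -> R) (p q : R) : locint c d m -> (forall t, 0 <= m t) ->
  oitv c d p -> oitv c d q -> p <= q ->
  let mu t := \int[clm]_(x in `]p, t]) m x in
  (forall x y, p <= x -> x <= y -> y <= q -> mu y - mu x = \int[clm]_(t in `]x, y]) m t) /\
  control p%:E q%:E (fun t _ => mu t) (fun t _ => mu t) (mu q).
Proof.
move=> lm m0 op oq pq mu.
have E x y : p <= x -> x <= y -> y <= q -> mu y - mu x = \int[clm]_(t in `]x, y]) m t.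
  move=> px xy yq; have oy : oitv c d y by apply: (oitv_le op oq); lra.
  by rewrite /mu (int_cat lm op oy px xy) addrC addKr.
have pos x y : 0 <= \int[clm]_(t in `]x, y]) m t by exact: Rintegral_ge0.
split => //; apply: control_time.
  move=> x y /oitvE/andP[px xq] /oitvE/andP[py yq] xy.
  have h1 := E x y (ltW px) xy (ltW yq); have h2 := E y q (ltW py) (ltW yq) (lexx _).
  rewrite -subr_ge0 h1 pos /= -lerBlDl; apply: (@le_trans _ _ (mu y)); first by rewrite lerBlDr lerDl pos.
  by rewrite -subr_ge0 h2 pos.
move=> t /oitvE/andP[pt tq] e e0; have ot : oitv c d t by apply: (oitv_le op oq); rewrite !ltW.
have [r r0 Hr] := int_small lm ot e0; exists r => // t' /oitvE/andP[pt' t'q] htt'.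
have r0' : `|t - t| < r by rewrite subrr normr0.
have [tt'|t't] := leP t t'.
  rewrite (E _ _ (ltW pt) tt' (ltW t'q)); have := Hr t t' tt' r0' htt'; under eq_Rintegral do rewrite ger0_norm//.
  by rewrite ger0_norm.
rewrite distrC (E _ _ (ltW pt') (ltW t't) (ltW tq)); have := Hr t' t (ltW t't) htt' r0'.
under eq_Rintegral do rewrite ger0_norm//.
by rewrite ger0_norm.
Qed.

Lemma sum_bound (a_ : 'I_n -> 'I_n -> R) : (forall i j, 0 <= a_ i j) -> forall i j, a_ i j <= \sum_k \sum_l a_ k l.
Proof.
move=> a0 i j; rewrite (bigD1 i)//= (bigD1 j)//= -addrA lerDl.
apply: addr_ge0; first exact: sumr_ge0.
by apply: sumr_ge0 => k _; exact: sumr_ge0.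
Qed.

(** A function with one-sided limits is bounded on compact intervals. *)
Lemma G_curve_bound c d x p q : lexcts c d x -> inD D c d x -> oitv c d p -> oitv c d q -> p < q ->
  exists2 M : R, 0 <= M & forall i j t s, oitv p%:E q%:E t -> J s -> `|Gx G x i j t s| <= M.
Proof.
move=> lx xD op oq pq.
have H i j : exists M : R, 0 <= M /\ forall t s, oitv p%:E q%:E t -> J s -> `|Gx G x i j t s| <= M.
  have [|||M M0 HM] := @ldG_bounded _ _ _ (Gx G x i j) (p, - 2^-1) (q, - 2^-1)
      (Gx_ldG oD hg Kg0 hgLip i j lx xD) _ _ Jl Jl _ => //.
    by apply: ltW; rewrite ltptE /= pq.
  exists M; split => // t s /oitvE/andP[h1 h2] Js; apply: HM => //.
  by rewrite leptE ltptE /= h1 h2.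
pose a_ i j := projT1 (cid (H i j)).
have a0 i j : 0 <= a_ i j by exact: (projT2 (cid (H i j))).1.
exists (\sum_k \sum_l a_ k l); first by apply: sumr_ge0 => k _; exact: sumr_ge0.
move=> i j t s It Js; apply: le_trans (sum_bound a0 i j); exact: (projT2 (cid (H i j))).2.
Qed.

End Existence.

(** * The choice of the interval *)

Section SmallInterval.
Context {R : realType}.

Lemma scaled_le (K e k : R) : 0 < K -> e <= (8 * K)^-1 -> k <= e -> K * k <= 8^-1.
Proof.
move=> K0 h1 h2; apply: (@le_trans _ _ (K * (8 * K)^-1)); first by rewrite ler_pM2l// (le_trans h2).
by rewrite le_eqVlt; apply/orP; left; apply/eqP; field; rewrite gt_eqF.
Qed.

Lemma scaled_le' (M r e k : R) : 0 <= M -> 0 < r -> e <= r / (4 * (M + 1)) -> 0 <= e -> k <= e -> M * k <= r / 4.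
Proof.
move=> M0 r0 h1 e0 h2; have M1 : 0 < M + 1 by lra.
apply: (@le_trans _ _ ((M + 1) * (r / (4 * (M + 1))))).
  apply: (@le_trans _ _ (M * e)); first by rewrite ler_wpM2l.
  by apply: ler_pM => //; lra.
by rewrite le_eqVlt; apply/orP; left; apply/eqP; field; rewrite gt_eqF.
Qed.

(** The four limits at t0 make the increments of the controls small; the last
bound on h makes the interval itself short compared to 1 / Kf. *)
Lemma small_interval (t0 c d r M Kf Kg : R) (mu : R -> R) (W : @dyn R) : c < t0 -> t0 < d -> 0 < r -> 0 <= M ->
  0 < Kf -> 0 < Kg ->
  dlim t0^'- W (W t0 (- 2^-1)) -> dlim t0^'+ W (W t0 2^-1) ->
  dlim t0^'- (fun t _ => mu t) (mu t0) -> dlim t0^'+ (fun t _ => mu t) (mu t0) ->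
  exists h : R, [/\ 0 < h, h < t0 - c, h < d - t0 & forall t s, t0 - h < t < t0 + h -> J s ->
    (t0 < t -> [/\ mu t - mu t0 + M * (W t s - W t0 2^-1) <= r / 2 &
       Kf * (t - t0) + Kg * (W t s - W t0 2^-1) <= 4^-1]) /\
    (t < t0 -> [/\ mu t0 - mu t + M * (W t0 (- 2^-1) - W t s) <= r / 2 &
       Kf * (t0 - t) + Kg * (W t0 (- 2^-1) - W t s) <= 4^-1])].
Proof.
move=> ct td r0 M0 Kf0 Kg0 Wl Wr Ml Mr.
(* the control of u is to contribute at most r / 4 to the first bound and
   1 / 8 to the second, and likewise mu and the length of the interval *)
pose e := Num.min (r / (4 * (M + 1))) (8 * Kg)^-1.
have e0 : 0 < e by rewrite lt_min divr_gt0 ?mulr_gt0 ?invr_gt0 ?mulr_gt0//; lra.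
have [em ek] : e <= r / (4 * (M + 1)) /\ e <= (8 * Kg)^-1 by rewrite !ge_min !lexx orbT.
have r4 : 0 < r / 4 by lra.
have [h1 h10 H1r] := near_right_ex (Wr _ e0); have [h2 h20 H2l] := near_left_ex (Wl _ e0).
have [h3 h30 H3r] := near_right_ex (Mr _ r4); have [h4 h40 H4l] := near_left_ex (Ml _ r4).
have k0 : 0 < (8 * Kf)^-1 by rewrite invr_gt0 mulr_gt0.
have c0 : 0 < (t0 - c) / 2 by lra.
have d0 : 0 < (d - t0) / 2 by lra.
have [h [h0 hh [hh1 hh2] [hh3 hh4]]] : exists h : R, [/\ 0 < h, h <= (8 * Kf)^-1 /\ (h <= (t0 - c) / 2 /\ h <= (d - t0) / 2),
    h <= h1 /\ h <= h2 & h <= h3 /\ h <= h4].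
  exists (Num.min (Num.min (8 * Kf)^-1 (Num.min ((t0 - c) / 2) ((d - t0) / 2))) (Num.min (Num.min h1 h2) (Num.min h3 h4))).
  by rewrite !lt_min k0 c0 d0 h10 h20 h30 h40 !ge_min !lexx !orbT.
have [hk [hc hd]] := hh; exists h; split; [exact: h0|lra|lra|].
move=> t s /andP[ht1 ht2] Js; split => tt0.
  have w1 : W t s - W t0 2^-1 <= e.
    apply: le_trans (ler_norm _) (H1r t _ s Js); rewrite tt0 /=.
    by apply: lt_le_trans ht2 _; rewrite lerD2l.
  have m1 : mu t - mu t0 <= r / 4.
    apply: le_trans (ler_norm _) (H3r t _ 0 J0); rewrite tt0 /=.
    by apply: lt_le_trans ht2 _; rewrite lerD2l.
  have th : t - t0 <= h by rewrite lerBlDl ltW.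
  have a1 := scaled_le' M0 r0 em (ltW e0) w1; have a2 := scaled_le Kg0 ek w1; have a3 := scaled_le Kf0 hk th.
  by clear -m1 a1 a2 a3; split; lra.
have w1 : W t0 (- 2^-1) - W t s <= e.
  apply: le_trans (ler_norm _) _; rewrite distrC; apply: (H2l t _ s Js); rewrite tt0 andbT.
  by apply: le_lt_trans ht1; rewrite lerD2l lerN2.
have m1 : mu t0 - mu t <= r / 4.
  apply: le_trans (ler_norm _) _; rewrite distrC; apply: (H4l t _ 0 J0); rewrite tt0 andbT.
  by apply: le_lt_trans ht1; rewrite lerD2l lerN2.
have th : t0 - t <= h by rewrite lerBlDr -lerBlDl ltW.
have a1 := scaled_le' M0 r0 em (ltW e0) w1; have a2 := scaled_le Kg0 ek w1; have a3 := scaled_le Kf0 hk th.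
by clear -m1 a1 a2 a3; split; lra.
Qed.

End SmallInterval.

Section LocalExistence.
Context {R : realType} {n : nat}.
Local Notation clm := (@completed_lebesgue_measure R).
Variables (A B : \bar R) (D : set (R * 'cV[R]_n)) (f : R -> 'cV[R]_n -> 'cV[R]_n)
  (G : R -> 'cV[R]_n -> R -> 'M[R]_n) (u : R -> R -> 'cV[R]_n) (Kf Kg t0 : R) (x0 : 'cV[R]_n).
Hypothesis oD : open D.
Hypothesis Kf0 : 0 < Kf.
Hypothesis cf : caratheodory D f.
Hypothesis hfLip : forall t, Kf.-lipschitz_[set y | D (t, y)] (f t).
Hypothesis hg : forall (y : 'cV[R]_n) (i j : 'I_n) (c d : \bar R), (c < d)%E ->
     (forall t, oitv c d t -> D (t, y)) -> sG c d (fun t s => G t y s i j).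
Hypothesis Kg0 : 0 < Kg.
Hypothesis hgLip : forall t s, J s -> Kg.-lipschitz_[set y | D (t, y)] (fun y => G t y s).
Hypothesis bu : sBVn_loc A B u.
Hypothesis o0 : oitv A B t0.
Hypothesis Dx0 : D (t0, x0).
Hypothesis hjump : Tdiscn A B u t0 -> jump_in_domain t0 x0 D G u.

Lemma oitv_mono (c d c' d' : R) : c <= c' -> d' <= d -> oitv c'%:E d'%:E `<=` oitv c%:E d%:E.
Proof.
move=> cc dd t /oitvE/andP[h1 h2]; apply/oitvE; apply/andP; split.
  exact: le_lt_trans h1.
exact: lt_le_trans dd.
Qed.

Lemma oitv_between (a b : \bar R) (c d : R) : oitv a b c -> oitv a b d -> oitv c%:E d%:E `<=` oitv a b.
Proof.
move=> [ac _] [_ db] t /oitvE/andP[h1 h2]; split.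
  by apply: lt_trans ac _; rewrite lte_fin.
by apply: lt_trans _ db; rewrite lte_fin.
Qed.

(** In the tube f differs by at most Kf r from its value along the central curve. *)
Lemma nemytskii_near_bound (c d r : R) (x z : R -> R -> 'cV[R]_n) i p q :
  lexcts c%:E d%:E x -> inD D c%:E d%:E x -> lexcts c%:E d%:E z -> inD D c%:E d%:E z ->
  oitv c%:E d%:E p -> oitv c%:E d%:E q -> p <= q ->
  (forall t, oitv c%:E d%:E t -> `|z t 0 - x t 0| <= r) ->
  \int[clm]_(t in `]p, q]) `|fx f z i t| <= \int[clm]_(t in `]p, q]) (\sum_k `|fx f x k t| + Kf * r).
Proof.
move=> lx xD lz zD op oq pq H.
have l1 : locint c%:E d%:E (fun t => `|fx f z i t|) by apply: locint_norm; refine (fx_locint oD Kf0 cf hfLip _ lz zD).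
have l2 : locint c%:E d%:E (fun t => \sum_k `|fx f x k t| + Kf * r).
  apply: locint_add; last exact: locint_cst.
  by apply: locint_sum => k; apply: locint_norm; refine (fx_locint oD Kf0 cf hfLip _ lx xD).
apply: le_Rintegral; [exact: clm_itvoc|exact (locint_oc l1 op oq)|exact (locint_oc l2 op oq)|].
move=> t; rewrite /= in_itv /= => /andP[pt tq].
have It : oitv c%:E d%:E t.
  move: op oq => /oitvE/andP[cp _] /oitvE/andP[_ qd]; apply/oitvE.
  by rewrite (lt_trans cp pt) (le_lt_trans tq qd).
have h1 := f_lip hfLip i (zD _ _ It J0) (xD _ _ It J0).
have h2 : Kf * `|z t 0 - x t 0| <= Kf * r by rewrite ler_pM2l// H.
have h3 : `|fx f x i t| <= \sum_k `|fx f x k t| by rewrite (bigD1 i)//= lerDl; exact: sumr_ge0.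
have := ler_normD (f t (x t 0) i 0) (f t (z t 0) i 0 - f t (x t 0) i 0).
rewrite subrKC => h4; apply: (le_trans h4); apply: lerD; [exact: h3|exact: le_trans h1 h2].
Qed.

Lemma frame_control (c d : R) : c < t0 -> t0 < d -> oitv A B c -> oitv A B d ->
  exists (w_ : 'I_n -> @dyn R) (K_ : 'I_n -> R),
    (forall j, sBV c%:E d%:E (Defs.coord u j)) /\ forall j, control c%:E d%:E (Defs.coord u j) (w_ j) (K_ j).
Proof.
move=> ct td oc od; have cd : c < d := lt_trans ct td.
have bv j : sBV c%:E d%:E (Defs.coord u j) by exact (sBVloc_in (bu j) oc od cd).
exists (fun j => projT1 (cid (sBV_control cd (bv j)))).
exists (fun j => contmass c d (Defs.coord u j) + jumpmass c d (Defs.coord u j)).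
by split => // j; exact: (projT2 (cid (sBV_control cd (bv j)))).
Qed.

(** One modulus serves for all curves in the tube, so that it can be fixed before
the iteration starts. *)
Lemma nemytskii_modulus (c d r c1 d1 : R) (x : R -> R -> 'cV[R]_n) : 0 <= r ->
  lexcts c%:E d%:E x -> inD D c%:E d%:E x ->
  c < c1 -> c1 <= d1 -> d1 < d -> exists (mu : R -> R) (Km : R),
  control c1%:E d1%:E (fun t _ => mu t) (fun t _ => mu t) Km /\
  forall a b, c1 <= a -> b <= d1 -> forall z i p q, lexcts a%:E b%:E z -> inD D a%:E b%:E z ->
    oitv a%:E b%:E p -> oitv a%:E b%:E q -> p <= q ->
    (forall t, oitv a%:E b%:E t -> `|z t 0 - x t 0| <= r) ->
    \int[clm]_(t in `]p, q]) `|fx f z i t| <= mu q - mu p.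
Proof.
move=> r0 lx xD cc cd dd.
have lm : locint c%:E d%:E (fun t => \sum_k `|fx f x k t| + Kf * r).
  apply: locint_add; last exact: locint_cst.
  by apply: locint_sum => k; apply: locint_norm; refine (fx_locint oD Kf0 cf hfLip _ lx xD).
have m0 t : 0 <= \sum_k `|fx f x k t| + Kf * r.
  by apply: addr_ge0; [exact: sumr_ge0|exact: mulr_ge0 (ltW Kf0) r0].
have oc1 : oitv c%:E d%:E c1 by apply/oitvE; rewrite cc (le_lt_trans cd dd).
have od1 : oitv c%:E d%:E d1 by apply/oitvE; rewrite dd (lt_le_trans cc cd).
have [muE cmu] := integral_control lm m0 oc1 od1 cd.
exists (fun t : R => \int[clm]_(x0 in `]c1, t]) (\sum_k `|fx f x k x0| + Kf * r)).
exists (\int[clm]_(x0 in `]c1, d1]) (\sum_k `|fx f x k x0| + Kf * r)); split; first exact: cmu.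
move=> a b ca bd z i p q lz zD op oq pq H.
have [/oitvE/andP[ap pb] /oitvE/andP[aq qb]] := (op, oq).
have subab : oitv a%:E b%:E `<=` oitv c%:E d%:E.
  by apply: oitv_mono; [exact: ltW (lt_le_trans cc ca)|exact: ltW (le_lt_trans bd dd)].
rewrite (muE p q (ltW (le_lt_trans ca ap)) pq (ltW (lt_le_trans qb bd))).
refine (nemytskii_near_bound _ (lexcts_sub subab lx) _ lz zD op oq pq H).
by move=> t s It; exact: xD (subab _ It).
Qed.

(** Everything is first set up on a compact interval around t0 that is independent
of h; then h is chosen and the iteration runs on (t0 - h, t0 + h). *)
Lemma local_existence : exists (h : R) (w_ : 'I_n -> @dyn R) (K_ : 'I_n -> R) (M : R) (x : R -> R -> 'cV[R]_n),
  let al := (t0 - h)%:E in let be := (t0 + h)%:E in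
  [/\ 0 < h /\ oitv al be `<=` oitv A B,
     sBVn al be u /\ (forall j, control al be (Defs.coord u j) (w_ j) (K_ j)),
     short Kf Kg al be t0 w_,
     integral_solution D f G al be u x /\ x t0 (- 2^-1) = x0 &
     [/\ exists (w : @dyn R) (K : R), forall i, control al be (Defs.coord x i) w K, 0 <= M &
       forall i j t s, oitv al be t -> J s -> `|Gx G x i j t s| <= M]].
Proof.
have [xi [cxi xi0 Dxi sxi]] := fibre_value oD hg Kg0 hgLip bu o0 Dx0 hjump.
have [c [d [ct td oc od xbD]]] := jump_curve_frame oD o0 Dxi.
have lxb : lexcts c%:E d%:E (jump_curve t0 xi) := jump_curve_lexcts t0 _ _ cxi.
(* strictly inside (c, d), so that the graph over [c1, d1] is compact *)
pose c1 := (c + t0) / 2; pose d1 := (t0 + d) / 2.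
have [cc1 c1t t1d d1d] : [/\ c < c1, c1 < t0, t0 < d1 & d1 < d].
  by have [-> ->] := midf_lt ct; have [-> ->] := midf_lt td.
have c1d1 := lt_trans c1t t1d.
have oc1 : oitv c%:E d%:E c1 by apply/oitvE; rewrite cc1 (lt_trans c1d1 d1d).
have od1 : oitv c%:E d%:E d1 by apply/oitvE; rewrite d1d (lt_trans cc1 c1d1).
have subcd : oitv c%:E d%:E `<=` oitv A B := oitv_between oc od.
have [oAc1 oAd1] := (subcd _ oc1, subcd _ od1).
have gD : graph c1 d1 (jump_curve t0 xi) `<=` D.
  move=> [t y] [t' [s [/andP[h1 h2] Js [-> ->]]]]; apply: xbD => //; apply/oitvE.
  by rewrite (lt_le_trans cc1 h1) (le_lt_trans h2 d1d).
have [r r0 Hr] := compact_tube (graph_compact lxb oc1 od1) oD gD.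
have [M0 M00 HM0] := G_curve_bound oD hg Kg0 hgLip lxb xbD oc1 od1 c1d1.
have [w_ [K_ [bv ctl]]] := frame_control c1t t1d oAc1 oAd1.
have [mu [Km [cmu Hmu]]] := nemytskii_modulus (ltW r0) lxb xbD cc1 (ltW c1d1) d1d.
have o1t0 : oitv c1%:E d1%:E t0 by apply/oitvE; rewrite c1t t1d.
have [_ /(_ t0 o1t0)[Wl Wr] _ _] := control_sum (fun j => control_self (ctl j)).
have [_ /(_ t0 o1t0)[Ml Mr] _ _] := cmu.
have Mge : 0 <= M0 + Kg * r by rewrite addr_ge0// mulr_ge0// ltW.
have [h [h0 hc hd small]] := small_interval c1t t1d r0 Mge Kf0 Kg0 Wl Wr Ml Mr.
have [ca bd] : c1 <= t0 - h /\ t0 + h <= d1 by split; [rewrite lerBrDl -lerBrDr ltW|rewrite -lerBrDl ltW].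
have [at0 t0b] : t0 - h < t0 /\ t0 < t0 + h by rewrite ltrBlDr ltrDl.
have sub1 : oitv (t0 - h)%:E (t0 + h)%:E `<=` oitv c1%:E d1%:E := oitv_mono ca bd.
have subA : oitv (t0 - h)%:E (t0 + h)%:E `<=` oitv A B.
  by move=> t /sub1; exact: oitv_between.
have tube t s (y : 'cV[R]_n) : oitv (t0 - h)%:E (t0 + h)%:E t -> J s -> `|y - jump_curve t0 xi t s| < r -> D (t, y).
  move=> /sub1/oitvE/andP[h1 h2] Js hy; apply: (Hr t (jump_curve t0 xi t s)) => //; last by rewrite subrr normr0.
  by exists t, s; rewrite !ltW.
have HM i j t s : oitv (t0 - h)%:E (t0 + h)%:E t -> J s -> `|Gx G (jump_curve t0 xi) i j t s| <= M0.
  by move=> /sub1; exact: HM0.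
have ctl1 j := control_sub sub1 (ctl j).
have cmu1 := control_sub sub1 cmu.
have small1 t s (It : oitv (t0 - h)%:E (t0 + h)%:E t) (Js : J s) := small t s (proj1 (oitvE _ _ _) It) Js.
have [x [sx xx cx Gxb]] := picard_solution oD Kf0 cf hfLip hg Kg0 hgLip bu cxi xi0 sxi at0 t0b subA r0 tube M00 HM
  ctl1 cmu1 (Hmu _ _ ca bd) small1.
exists h, w_, K_, (M0 + Kg * r), x; split => //.
- split => // j; refine (sBV_sub c1d1 ca _ bd (bv j)); exact: lt_trans t0b.
- by move=> t s It Js; have [s1 s2] := small1 t s It Js; split => [/s1[]|/s2[]].
- by split => //; eexists; eexists; exact: cx.
Qed.

End LocalExistence.

(** * Uniqueness and continuous dependence *)

Section Wellposedness.
Context {R : realType} {n : nat}.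
Local Notation pt := (R *lexi[ring_display] R)%type.

(** [stability] asks for some bound on the difference of two solutions, however
large. *)
Lemma curve_bounded (a b : \bar R) (x : R -> R -> 'cV[R]_n) (e f : R) : lexcts a b x -> oitv a b e -> oitv a b f ->
  exists B : R, forall t s, oitv e%:E f%:E t -> J s -> `|x t s| <= B.
Proof.
move=> lx oe of_; have [ef|fe] := ltP e f; last first.
  by exists 0 => t s /oitvE/andP[h1 h2]; have := lt_le_trans (lt_trans h1 h2) fe; rewrite ltxx.
have PQ : ((e, 0) : pt) <= (f, 0) by rewrite leptE /= ef.
pose m i := projT1 (cid2 (ldG_bounded (P := (e, 0) : pt) (Q := (f, 0) : pt) (lexcts_ldG i lx) oe of_ J0 J0 PQ)).
exists (\sum_i m i) => t s /oitvE/andP[et tf] Js.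
have m_ i : 0 <= m i by rewrite /m; case: cid2.
apply: cV_norm_le => [|i]; first exact: sumr_ge0.
apply: (@le_trans _ _ (m i)); last by rewrite (bigD1 i)//= lerDl; exact: sumr_ge0.
rewrite /m; case: cid2 => M M0 H /=; apply: H => //.
by rewrite leptE ltptE /= et tf.
Qed.

Lemma common_left (a b c d : \bar R) p : oitv a b p -> oitv c d p -> exists e, [/\ e < p, oitv a b e & oitv c d e].
Proof.
move=> oa oc; have [e1 e1p o1'] := oitv_left oa; have [e2 e2p o2'] := oitv_left oc.
exists (Num.max e1 e2); rewrite gt_max e1p e2p; split => //.
  by apply: (oitv_le o1' oa); rewrite le_max lexx /= ge_max (ltW e1p) (ltW e2p).
by apply: (oitv_le o2' oc); rewrite le_max lexx orbT ge_max (ltW e1p) (ltW e2p).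
Qed.

Lemma common_right (a b c d : \bar R) p : oitv a b p -> oitv c d p -> exists e, [/\ p < e, oitv a b e & oitv c d e].
Proof.
move=> oa oc; have [e1 e1p o1'] := oitv_right oa; have [e2 e2p o2'] := oitv_right oc.
exists (Num.min e1 e2); rewrite lt_min e1p e2p; split => //.
  by apply: (oitv_le oa o1'); rewrite ge_min lexx le_min (ltW e1p) (ltW e2p).
by apply: (oitv_le oc o2'); rewrite ge_min lexx orbT le_min (ltW e1p) (ltW e2p).
Qed.

Lemma cvge0P (f : nat -> \bar R) : (forall k, 0 <= f k)%E ->
  (f k @[k --> \oo] --> 0%E) <-> forall e : R, 0 < e -> \forall k \near \oo, (f k <= e%:E)%E.
Proof.
move=> f0; split=> [/fine_cvgP[fn cf] e e0|H].
  apply: filterS (filterI fn (@cvgr_le _ _ _ _ _ _ cf e e0)) => k [fk] /=.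
  by rewrite -lee_fin fineK.
apply/fine_cvgP; split.
  by apply: filterS (H 1 ltr01) => k fk; rewrite ge0_fin_numE// (le_lt_trans fk)// ltry.
apply/cvgrPdist_le => e e0; apply: filterS (H e e0) => k fk; rewrite sub0r normrN /= ger0_norm ?fine_ge0//.
by rewrite -lee_fin fineK// ge0_fin_numE// (le_lt_trans fk)// ltry.
Qed.

Variables (D : set (R * 'cV[R]_n)) (f : R -> 'cV[R]_n -> 'cV[R]_n)
  (G : R -> 'cV[R]_n -> R -> 'M[R]_n) (Kf Kg : R).
Hypothesis oD : open D.
Hypothesis Kf0 : 0 < Kf.
Hypothesis cf : caratheodory D f.
Hypothesis hfLip : forall t, Kf.-lipschitz_[set y | D (t, y)] (f t).
Hypothesis hg : forall (y : 'cV[R]_n) (i j : 'I_n) (c d : \bar R), (c < d)%E ->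
     (forall t, oitv c d t -> D (t, y)) -> sG c d (fun t s => G t y s i j).
Hypothesis Kg0 : 0 < Kg.
Hypothesis hgLip : forall t s, J s -> Kg.-lipschitz_[set y | D (t, y)] (fun y => G t y s).
Variables (al be t0 : R) (u x : R -> R -> 'cV[R]_n) (w_ : 'I_n -> @dyn R) (K_ : 'I_n -> R) (M : R).
Local Notation a := al%:E.
Local Notation b := be%:E.
Hypotheses (bu : sBVn_loc a b u) (ot0 : oitv a b t0).
Hypothesis ctl : forall j, control a b (Defs.coord u j) (w_ j) (K_ j).
Hypothesis solx : integral_solution D f G a b u x.
Hypothesis M0 : 0 <= M.
Hypothesis HM : forall i j t s, oitv a b t -> J s -> `|Gx G x i j t s| <= M.
Hypothesis hshort : short Kf Kg a b t0 w_.

(** To compare the solutions at t it is enough to have both on one interval that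
contains t and t0; there [stability] applies with vanishing perturbation. *)
Lemma solution_unique (c d : \bar R) y : sBVn_loc c d u -> oitv c d t0 -> integral_solution D f G c d u y ->
  y t0 (- 2^-1) = x t0 (- 2^-1) -> forall t s, oitv a b t -> oitv c d t -> J s -> y t s = x t s.
Proof.
move=> buc oc0 soly yx t s ot oct Js.
have omin (p q : R) a1 b1 : oitv a1 b1 p -> oitv a1 b1 q -> oitv a1 b1 (Num.min p q) /\ oitv a1 b1 (Num.max p q).
  by move=> o1 o2; rewrite /Num.min /Num.max; case: ifP.
have [om oM] := omin _ _ _ _ ot ot0; have [ocm ocM] := omin _ _ _ _ oct oc0.
have [e [em oae oce]] := common_left om ocm; have [r [Mr oar ocr]] := common_right oM ocM.
move: em Mr; rewrite lt_min gt_max => /andP[et et0] /andP[tr t0r].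
have subab := oitv_between oae oar; have subcd := oitv_between oce ocr.
have It0 : oitv e%:E r%:E t0 by apply/oitvE; rewrite et0.
have It : oitv e%:E r%:E t by apply/oitvE; rewrite et.
have bue : sBVn_loc e%:E r%:E u by move=> i; exact: sBVloc_sub subab (bu i).
have sx : integral_solution D f G e%:E r%:E u x by exact (integral_solution_sub oD hg Kg0 hgLip subab bu solx).
have sy : integral_solution D f G e%:E r%:E u y by exact (integral_solution_sub oD hg Kg0 hgLip subcd buc soly).
have HMe i j t' s' : oitv e%:E r%:E t' -> J s' -> `|Gx G x i j t' s'| <= M by move=> /subab; exact: HM.
have she : short Kf Kg e%:E r%:E t0 w_ by move=> t' s' /subab; exact: hshort.
have ctle j := control_sub subab (ctl j).
have [C C0 HC] := stability oD Kf0 cf hfLip hg Kg0 hgLip bue It0 ctle sx M0 HMe she.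
have [[lx _ _] [ly _ _]] := (solx, soly).
have [B1 HB1] := curve_bounded lx oae oar; have [B2 HB2] := curve_bounded ly oce ocr.
have per : perturbed D f G Kg e%:E r%:E t0 u x u y 0.
  split => //.
  - exists (fun _ _ _ => 0), (fun _ => 0); split; first by rewrite big1.
    by move=> j; apply: control_dom (control0 _ _) _ => P Q _ _ _ _ _; rewrite !subrr normr0.
  - by rewrite mulr0 invr_ge0.
  - split => //; exists (B2 + B1) => t' s' ot' Js'.
    by apply: le_trans (ler_normB _ _) _; apply: lerD; [exact: HB2|exact: HB1].
have := HC _ _ _ per t s It Js; rewrite mulr0 normr_le0 subr_eq0.
by move=> /eqP.
Qed.

(** The estimate of the right hand side, with its three terms read as increments
of a linear function of time, of the controls of u and of those of v - u. *)
Lemma solution_diff_control v z (v_ : 'I_n -> @dyn R) (N_ : 'I_n -> R) (beta : R) i :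
  sBVn_loc a b v -> integral_solution D f G a b v z ->
  (forall j, control a b (fun t s => Defs.coord v j t s - Defs.coord u j t s) (v_ j) (N_ j)) ->
  0 <= beta -> (forall t s, oitv a b t -> J s -> `|z t s - x t s| <= beta) ->
  exists w, control a b (fun t s => Defs.coord z i t s - Defs.coord x i t s) w
    (Kf * beta * (be - al) + (Kg * beta) * \sum_j K_ j + (M + Kg * beta) * \sum_j N_ j).
Proof.
move=> bv solz ctlv b0 Hb; have albe : al < be by move: ot0 => /oitvE/andP[]; exact: lt_trans.
have kf0 : 0 <= Kf * beta by rewrite mulr_ge0// ltW.
have kg0 : 0 <= Kg * beta by rewrite mulr_ge0// ltW.
have mg0 : 0 <= M + Kg * beta by rewrite addr_ge0.
have ct : control a b (fun t _ => Kf * beta * t) (fun t _ => Kf * beta * t) (Kf * beta * (be - al)).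
  apply: control_time => [p q /oitvE/andP[ap pb] /oitvE/andP[aq qb] pq|t ot e e0].
    rewrite ler_wpM2l//= -mulrDr ler_wpM2l// addrC -lerBlDr; apply: lerB; exact: ltW.
  exists (e / (Kf * beta + 1)); first by rewrite divr_gt0// ltr_wpDl.
  move=> t' _ h; rewrite -mulrBr normrM (ger0_norm kf0).
  apply: (@le_trans _ _ ((Kf * beta + 1) * `|t' - t|)); first by rewrite ler_wpM2r// lerDl.
  by rewrite mulrC -ler_pdivlMr ?ltr_wpDl// ltW.
have cw := control_sum (fun j => control_self (ctl j)); have cv := control_sum (fun j => control_self (ctlv j)).
have cc := control_lin mg0 (control_lin kg0 ct cw) cv.
eexists; apply: (control_dom cc) => P Q oP oQ JP JQ PQ.
have [[lx xD Ex] [lz zD Ez]] := (solx, solz).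
have := rhs_int_diff (i := i) oD Kf0 cf hfLip hg Kg0 hgLip bu bv ctl ctlv lx xD lz zD oP oQ JP JQ PQ M0 b0
  (fun j t s Js h => HM i j (pt_between oP oQ h) Js) (fun t s Js h => Hb t s (pt_between oP oQ h) Js).
rewrite -Ex// -Ez// !sumrB /Defs.coord.
move: (\sum_j w_ j Q.1 Q.2) (\sum_j w_ j P.1 P.2) (\sum_j v_ j Q.1 Q.2) (\sum_j v_ j P.1 P.2) => A1 A2 A3 A4.
move: (x P.1 P.2 i 0) (x Q.1 Q.2 i 0) (z P.1 P.2 i 0) (z Q.1 Q.2 i 0) => X1 X2 X3 X4.
set L := (X in `|X| <= _ -> _); set L' := (X in _ -> `|X| <= _).
have -> : L' = L by rewrite /L /L'; ring.
by move=> h; apply: (le_trans h); rewrite le_eqVlt; apply/orP; left; apply/eqP; ring.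
Qed.

(** The uniform bound of [stability] makes the first two terms of the control of
z - x small, and the third is small with e. *)
Lemma solution_diff_norm : exists2 C : R, 0 <= C & forall v z e, perturbed D f G Kg a b t0 u x v z e ->
  forall i, (sBV_norm a b (fun t s => Defs.coord z i t s - Defs.coord x i t s)%R <= (C * e)%:E)%E.
Proof.
have albe : al < be by move: ot0 => /oitvE/andP[]; exact: lt_trans.
have [C C0 HC] := stability oD Kf0 cf hfLip hg Kg0 hgLip bu ot0 ctl solx M0 HM hshort.
have K0 : 0 <= \sum_j K_ j.
  apply: sumr_ge0 => j _; have [_ _ _ h] := ctl j.
  by have := h (t0, 0) (t0, 0) ot0 ot0 J0 J0 (lexx _); rewrite subrr.
have ba : 0 <= be - al by rewrite subr_ge0 ltW.
(* 2 B + 4 K of [norm_le_control] for B = C e and the mass K of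
   [solution_diff_control], where Kg e <= 1/4 makes M + Kg B at most M + C *)
exists (2 * C + 4 * (Kf * C * (be - al) + Kg * C * \sum_j K_ j + (M + C))).
  move: (be - al) (\sum_j K_ j) ba K0 => p q p0 q0.
  by rewrite !(addr_ge0, mulr_ge0)// ltW.
move=> v z e per i; have HB := HC _ _ _ per.
have [bv solz [v_ [N_ [Ne ctlv]]] Ke _] := per.
have e0 : 0 <= e.
  apply: le_trans Ne; apply: sumr_ge0 => j _; have [_ _ _ h] := ctlv j.
  by have := h (t0, 0) (t0, 0) ot0 ot0 J0 J0 (lexx _); rewrite subrr.
have b0 : 0 <= C * e by rewrite mulr_ge0.
have [w cw] := solution_diff_control i bv solz ctlv b0 HB.
have HBi t s : oitv a b t -> J s -> `|Defs.coord z i t s - Defs.coord x i t s| <= C * e.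
  move=> ot Js; apply: le_trans _ (HB t s ot Js).
  by have := coord_norm_le (z t s - x t s) i 0; rewrite !mxE.
apply: le_trans (norm_le_control albe cw HBi) _; rewrite lee_fin.
have h1 : (M + Kg * (C * e)) * \sum_j N_ j <= (M + C) * e.
  apply: ler_pM => //; first by rewrite addr_ge0// mulr_ge0// ltW.
    apply: sumr_ge0 => j _; have [_ _ _ h] := ctlv j.
    by have := h (t0, 0) (t0, 0) ot0 ot0 J0 J0 (lexx _); rewrite subrr.
  rewrite lerD2l mulrCA -[leRHS]mulr1 ler_wpM2l//; apply: (le_trans Ke).
  by rewrite invf_le1// ler1n.
move: h1; move: (\sum_j N_ j) (\sum_j K_ j) (be - al) => N K p h1.
apply: (@le_trans _ _ (2 * (C * e) + 4 * (Kf * (C * e) * p + Kg * (C * e) * K + (M + C) * e))).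
  by rewrite lerD2l ler_wpM2l// lerD2l.
by rewrite le_eqVlt; apply/orP; left; apply/eqP; ring.
Qed.

Lemma sBV_diff (p q : @dyn R) : sBV a b p -> sBV a b q -> sBV a b (fun t s => p t s - q t s).
Proof.
move=> sp sq; have albe : al < be by move: ot0 => /oitvE/andP[]; exact: lt_trans.
have [w cw] := sBV_control albe sp; have [v cv] := sBV_control albe sq.
exact: (sBV_of_control albe (controlB cw cv)).
Qed.

Lemma mass_ge0 (p : @dyn R) : sBV a b p -> 0 <= contmass al be p + jumpmass al be p.
Proof.
move=> sp; have albe : al < be by move: ot0 => /oitvE/andP[]; exact: lt_trans.
have [w [_ _ _ h]] := sBV_control albe sp.
by have := h (t0, 0) (t0, 0) ot0 ot0 J0 J0 (lexx _); rewrite subrr.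
Qed.

Lemma sBV_norm_ge0 (p : @dyn R) : sBV a b p -> (0 <= sBV_norm a b p)%E.
Proof.
move=> sp; have albe : al < be by move: ot0 => /oitvE/andP[]; exact: lt_trans.
by apply: le_trans (mass_le_norm albe sp); rewrite lee_fin mass_ge0.
Qed.

(** Convergence of u_k in norm gives controls of u_k - u whose masses tend to 0. *)
Lemma solution_cvg (u_ x_ : nat -> R -> R -> 'cV[R]_n) x0 : sBVn a b u -> sBVn a b x -> x t0 (- 2^-1) = x0 ->
  (forall k, sBVn a b (u_ k)) -> sBVn_cvg a b u_ u ->
  (forall k, sBVn a b (x_ k) /\ solution a b t0 x0 D f G (u_ k) (x_ k)) -> sBVn_cvg a b x_ x.
Proof.
move=> su sx xx0 su_ cu sol_ i; have albe : al < be by move: ot0 => /oitvE/andP[]; exact: lt_trans.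
pose d k j : @dyn R := fun t s => Defs.coord (u_ k) j t s - Defs.coord u j t s.
have sd k j : sBV a b (d k j) by apply: sBV_diff; [exact: su_|exact: su].
pose m k j := contmass al be (d k j) + jumpmass al be (d k j).
have m0 k j : 0 <= m k j by exact: mass_ge0.
have small e : 0 < e -> \forall k \near \oo, \sum_j m k j <= e.
  move=> e0; have n0 : 0 < (n.+1)%:R :> R by rewrite ltr0n.
  (* n.+1 and not n, because n may be 0 *)
  have H j : \forall k \near \oo, m k j <= e / n.+1%:R.
    have /cvge0P : sBV_norm a b (d k j) @[k --> \oo] --> 0%E by exact: cu.
    move=> /(_ (fun k => sBV_norm_ge0 (sd k j)) (e / n.+1%:R)); rewrite divr_gt0// => /(_ isT).
    by apply: filterS => k hk; rewrite -lee_fin; apply: le_trans hk; exact: mass_le_norm.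
  apply: filterS (near_forall_ord H) => k hk; apply: (@le_trans _ _ (\sum_(j < n) (e / n.+1%:R))).
    by apply: ler_sum => j _; exact: hk.
  rewrite sumr_const card_ord -[leLHS]mulr_natr -mulrA ger_pMr// mulrC ler_pdivrMr// mul1r ler_nat; exact: leqnSn.
have [C C0 HC] := solution_diff_norm.
have per k : Kg * \sum_j m k j <= 4^-1 -> perturbed D f G Kg a b t0 u x (u_ k) (x_ k) (\sum_j m k j).
  move=> hk; have [sxk solk] := sol_ k.
  have bk : sBVn_loc a b (u_ k) by move=> j; exact: sBV_loc (su_ k j).
  have [isol ini] := solution_integral bk solk.
  split=> //.
    exists (fun j => projT1 (cid (sBV_control albe (sd k j)))), (m k); split=> // j.
    exact: (projT2 (cid (sBV_control albe (sd k j)))).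
  split; last by rewrite ini xx0.
  pose c0 := x_ k t0 0 - x t0 0.
  pose N := \sum_j (contmass al be (fun t s => Defs.coord (x_ k) j t s - Defs.coord x j t s) +
    jumpmass al be (fun t s => Defs.coord (x_ k) j t s - Defs.coord x j t s)).
  have N0 : 0 <= N by apply: sumr_ge0 => j _; exact: mass_ge0 (sBV_diff (sxk j) (sx j)).
  exists (`|c0| + N) => t s ot Js; apply: cV_norm_le => [|j]; first by rewrite addr_ge0.
  have := ctl_bounded (projT2 (cid (sBV_control albe (sBV_diff (sxk j) (sx j))))) ot0 ot Js.
  rewrite /Defs.coord !mxE => h1; have h2 := coord_norm_le c0 j 0; rewrite !mxE in h2.
  have h3 : contmass al be (fun t s => Defs.coord (x_ k) j t s - Defs.coord x j t s) +
    jumpmass al be (fun t s => Defs.coord (x_ k) j t s - Defs.coord x j t s) <= N.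
    rewrite /N (bigD1 j)//= lerDl; apply: sumr_ge0 => l _; exact: mass_ge0 (sBV_diff (sxk l) (sx l)).
  have h4 := le_trans h1 h3.
  rewrite -(subrK (x_ k t0 0 j 0 - x t0 0 j 0) (x_ k t s j 0 - x t s j 0)).
  by rewrite addrC; apply: le_trans (ler_normD _ _) _; apply: lerD.
apply/cvge0P => [k|e e0].
  by apply: sBV_norm_ge0; apply: sBV_diff; [exact: (proj1 (sol_ k))|exact: sx].
have C1 : 0 < C + 1 by rewrite ltr_wpDl.
have h1 : 0 < (4 * Kg)^-1 by rewrite invr_gt0 mulr_gt0.
have h2 : 0 < e / (C + 1) by rewrite divr_gt0.
apply: filterS (filterI (small _ h1) (small _ h2)) => k [k1 k2].
have k3 : Kg * \sum_j m k j <= 4^-1.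
  apply: (@le_trans _ _ (Kg * (4 * Kg)^-1)); first by rewrite ler_pM2l.
  by rewrite invfM mulrCA divff ?mulr1// gt_eqF.
apply: le_trans (HC _ _ _ (per k k3) i) _; rewrite lee_fin.
apply: (@le_trans _ _ ((C + 1) * \sum_j m k j)).
  by rewrite ler_wpM2r ?lerDl//; exact: sumr_ge0.
by rewrite mulrC -ler_pdivlMr.
Qed.

End Wellposedness.

Theorem theorem4 (R : realType) (n : nat) (a b : \bar R)
  (D : set (R * 'cV[R]_n))
  (f : R -> 'cV[R]_n -> 'cV[R]_n)
  (g : R -> 'cV[R]_n -> R -> 'M[R]_n)
  (u : R -> R -> 'cV[R]_n)
  (Kf Kg t0 : R) (x0 : 'cV[R]_n)
  (hab : (a < b)%E)
  (hDopen : open D)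
  (hDI : forall t y, D (t, y) -> oitv a b t)
  (hf : caratheodory D f)
  (hKf : 0 < Kf)
  (hfLip : forall t, Kf.-lipschitz_[set y | D (t, y)] (f t))
  (hg : forall (y : 'cV[R]_n) (i j : 'I_n) (c d : \bar R), (c < d)%E ->
     (forall t, oitv c d t -> D (t, y)) -> sG c d (fun t s => g t y s i j))
  (hKg : 0 < Kg)
  (hgLip : forall t s, J s ->
     Kg.-lipschitz_[set y | D (t, y)] (fun y => g t y s))
  (hu : sBVn_loc a b u)
  (husigma : forall t, Tdiscn a b u t -> sigma u t != 0)
  (ht0 : oitv a b t0)
  (hx0 : D (t0, x0))
  (hjump : Tdiscn a b u t0 -> jump_in_domain t0 x0 D g u) :
  exists h : R,
    let al := (t0 - h)%:E in
    let be := (t0 + h)%:E in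
    [/\ 0 < h, oitv al be `<=` oitv a b, sBVn al be u &
        exists x : R -> R -> 'cV[R]_n,
          [/\ sBVn al be x,
              solution al be t0 x0 D f g u x,
              (forall (c d : \bar R) (y : R -> R -> 'cV[R]_n),
                 (c < d)%E -> oitv c d `<=` oitv a b ->
                 solution c d t0 x0 D f g u y ->
                 forall t s, oitv al be t -> oitv c d t -> J s ->
                   y t s = x t s) &
              (forall (u_ x_ : nat -> R -> R -> 'cV[R]_n),
                 (forall k, sBVn al be (u_ k)) ->
                 sBVn_cvg al be u_ u ->
                 (forall k, sBVn al be (x_ k) /\
                            solution al be t0 x0 D f g (u_ k) (x_ k)) ->
                 sBVn_cvg al be x_ x)]].
Proof.
have [h [w_ [K_ [M [x [[h0 sub] [su ctl] hs [solx xx0] [[w [K cx]] M0 HM]]]]]]] :=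
  local_existence hDopen hKf hf hfLip hg hKg hgLip hu ht0 hx0 hjump.
have albe : t0 - h < t0 + h by rewrite ltrD2l gtrN.
have ot0 : oitv (t0 - h)%:E (t0 + h)%:E t0 by apply/oitvE; rewrite ltrBlDr !ltrDl h0.
have bu : sBVn_loc (t0 - h)%:E (t0 + h)%:E u by move=> i; exact: sBVloc_sub sub (hu i).
have sx : sBVn (t0 - h)%:E (t0 + h)%:E x by move=> i; exact: sBV_of_control albe (cx i).
have bx : sBVn_loc (t0 - h)%:E (t0 + h)%:E x by move=> i; exact: sBV_loc (sx i).
exists h => al be; split; [exact: h0|exact: sub|exact: su|exists x; split; first exact: sx].
- exact: (integral_solution_solution hDopen hKf hf hfLip hg hKg hgLip bu bx ot0 solx xx0).
- move=> c d y cd cdab soly t s ot oct Js.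
  have buc : sBVn_loc c d u by move=> i; exact: sBVloc_sub cdab (hu i).
  have [isol yx0] := solution_integral buc soly; have [oc0 _ _ _ _] := soly.
  apply: (solution_unique hDopen hKf hf hfLip hg hKg hgLip bu ot0 ctl solx M0 HM hs buc oc0 isol _ ot oct Js).
  by rewrite yx0 xx0.
- move=> u_ x_ su_ cu sol_.
  exact: (solution_cvg hDopen hKf hf hfLip hg hKg hgLip bu ot0 ctl solx M0 HM hs su sx xx0 su_ cu sol_).
Qed.
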